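(* Let $Z,Z_1,Z_2,\ldots$ be i.i.d. random vectors in $\mathbb{R}^d$ with $\mathbb{E}(\|Z\|^2)<\infty$, mean $\mu:=\mathbb{E}Z\neq\mathbf{0}$ and covariance matrix $\Sigma:=\mathbb{E}((Z-\mu)(Z-\mu)^\top)$. Let $S_0:=\mathbf{0}$, $S_n:=\sum_{i=1}^nZ_i$ and $\mathcal{H}_n:=\operatorname{hull}\{S_0,\ldots,S_n\}$. (i) If $d\ge2$, then the constant $\lambda_d:=\sup_{f\in U_{d-1}}V_d(H(f))$ satisfies $\lambda_d\in(0,\infty)$, and \[\limsup_{n\to\infty}\frac{V_d(\mathcal{H}_n)}{\sqrt{2^{d-1}n^{d+1}(\log\log n)^{d-1}}}=\lambda_d\cdot\|\mu\|\cdot\sqrt{\det\Sigma_{\mu^\perp}}\quad\text{a.s.}\] Moreover, $\lambda_2=\sqrt3/6$. (ii) For every $d\ge1$, $\limsup_{n\to\infty} V_1(\mathcal{H}_n)/n=\|\mu\|$ a.s.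
   Context: $V_k$ denotes the $k$-th intrinsic volume of a compact convex set (defined via the Steiner formula $V_d(C_\lambda)=\sum_{k=0}^d\lambda^{d-k}\kappa_{d-k}V_k(C)$, $C_\lambda$ the closed $\lambda$-parallel body, $\kappa_j$ the volume of the unit $j$-ball); $V_d$ is volume. $\Sigma_{\mu^\perp}$ is the $(d-1)\times(d-1)$ reduced covariance matrix: writing $\Sigma$ in an orthonormal basis of $\mathbb{R}^d$ containing $\mu/\|\mu\|$, delete the row and column corresponding to $\mu/\|\mu\|$. $U_{d-1}$ is the set of $f=(f_1,\ldots,f_{d-1}):[0,1]\to\mathbb{R}^{d-1}$ with $f(0)=\mathbf{0}$, each $f_i$ absolutely continuous, and $\sum_{i=1}^{d-1}\int_0^1f_i'(s)^2\,ds\le1$. For such $f$, the space–time convex hull is $H(f):=\operatorname{hull}\{(t,f(t)):0\le t\le1\}\subset\mathbb{R}^d$. *)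

(* Defs.v *)
From HB Require Import structures.
From mathcomp Require Import all_boot all_order all_algebra.
From mathcomp Require Import all_classical all_reals all_analysis.
Set Implicit Arguments. Unset Strict Implicit. Unset Printing Implicit Defensive.
Import Order.TTheory GRing.Theory Num.Theory.
Import numFieldNormedType.Exports.
Local Open Scope classical_set_scope.
Local Open Scope ring_scope.

Section Defs.
Variable R : realType.

Definition enorm n (v : 'rV[R]_n) : R := Num.sqrt (\sum_(i < n) v ord0 i ^+ 2).

Definition box n (ab : 'rV[R]_n * 'rV[R]_n) : set 'rV[R]_n :=
  [set x | forall i, ab.1 ord0 i <= x ord0 i <= ab.2 ord0 i].
Definition boxvol n (ab : 'rV[R]_n * 'rV[R]_n) : R :=
  \prod_(i < n) (ab.2 ord0 i - ab.1 ord0 i).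

Definition obox n (B : option ('rV[R]_n * 'rV[R]_n)) : set 'rV[R]_n :=
  if B is Some ab then box ab else set0.
Definition oboxvol n (B : option ('rV[R]_n * 'rV[R]_n)) : R :=
  if B is Some ab then boxvol ab else 0.
Definition obox_ok n (B : option ('rV[R]_n * 'rV[R]_n)) : Prop :=
  if B is Some ab then forall i, ab.1 ord0 i <= ab.2 ord0 i else True.

Definition vol n (A : set 'rV[R]_n) : \bar R :=
  ereal_inf [set s | exists B : nat -> option ('rV[R]_n * 'rV[R]_n),
    [/\ forall k, obox_ok (B k),
        A `<=` \bigcup_k obox (B k) &
        s = (\sum_(0 <= k <oo) (oboxvol (B k))%:E)%E]].

Definition hull n (A : set 'rV[R]_n) : set 'rV[R]_n :=
  [set x | exists m (w : 'I_m -> R) (p : 'I_m -> 'rV[R]_n),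
    [/\ forall i, 0 <= w i, \sum_(i < m) w i = 1,
        forall i, A (p i) & x = \sum_(i < m) w i *: p i]].

Definition parallel n (C : set 'rV[R]_n) (lam : R) : set 'rV[R]_n :=
  [set x | exists2 c, C c & enorm (x - c) <= lam].

Definition kappa j : R := fine (vol [set x : 'rV[R]_j | enorm x <= 1]).

(* Steiner formula: coefficient vector c (c_k = V_k(C), k = 0..n) *)
Definition steiner n (C : set 'rV[R]_n) (c : 'rV[R]_n.+1) : Prop :=
  forall lam : R, 0 <= lam ->
    vol (parallel C lam) =
    (\sum_(k < n.+1) lam ^+ (n - k) * kappa (n - k) * c ord0 k)%:E.

Definition ivol n (k : nat) (C : set 'rV[R]_n) : R :=
  (xget 0 (steiner C)) ord0 (inord k).

Definition abs_cont01 (g : R -> R) : Prop :=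
  forall e : R, 0 < e -> exists2 delta : R, 0 < delta &
    forall (m : nat) (a b : nat -> R),
      (forall k, (k < m)%N -> 0 <= a k <= b k /\ b k <= 1) ->
      (forall k, (k.+1 < m)%N -> b k <= a k.+1) ->
      \sum_(k < m) (b k - a k) < delta ->
      \sum_(k < m) `|g (b k) - g (a k)| < e.

Definition I01 : set R := `[0, 1]%classic.

(* int_0^1 g'(s)^2 ds, derivative taken pointwise (defined a.e. for AC g) *)
Definition energy01 (g : R -> R) : \bar R :=
  \int[lebesgue_measure]_(s in I01) ((derive1 g s) ^+ 2)%:E.

(* U_d (in the paper: U_{d-1}, with paper's d-1 = our d) *)
Definition Uset d : set (R -> 'rV[R]_d) :=
  [set f : R -> 'rV[R]_d | [/\ f 0 = 0,
     forall i : 'I_d, abs_cont01 (fun s => f s ord0 i) &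
     (\sum_(i < d) energy01 (fun u => f u ord0 i) <= 1)%E]].

Definition Hst d (f : R -> 'rV[R]_d) : set 'rV[R]_(1 + d) :=
  hull [set row_mx (const_mx t) (f t) | t in I01].

(* lambda_{d+1} := sup_{f in U_d} V_{d+1}(H(f)) *)
Definition lambdaS (d : nat) : \bar R := ereal_sup [set vol (Hst f) | f in @Uset d].

Definition rv_borel n : set (set 'rV[R]_n) :=
  smallest (sigma_algebra setT) (range (@box n)).

Definition partial_sum n (Z : nat -> 'rV[R]_n) (k : nat) : 'rV[R]_n :=
  \sum_(i < k) Z i.

Definition walk_hull n (Z : nat -> 'rV[R]_n) (k : nat) : set 'rV[R]_n :=
  hull [set x | exists2 j, (j <= k)%N & x = partial_sum Z j].

Definition reduced_cov d (Q Sigma : 'M[R]_d.+1) : 'M[R]_d :=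
  \matrix_(i, j) (Q *m Sigma *m Q^T) (lift ord0 i) (lift ord0 j).

End Defs.

(* Main.v *)
(* A linear map normalizes the drift to the first basis vector and the reduced covariance matrix A to the identity
   (if A is singular the walk stays in a hyperplane, and both sides vanish); it multiplies volumes by
   1 / (|mu| sqrt (det A)).  Cut the normalized walk of n_k = m b_k steps, b_k geometric, into m blocks and divide
   the block sums by sqrt (2 b_k ln k).  Only ln ln n_k ~ ln k matters, so sums over k of exp(- c ln k) decide
   everything.  Truncating each step at a small multiple of sqrt (b_k / ln k), the exponential moment of order
   2 ln k * th of the block sums is exp(ln k (|th|^2 + o(1))); the discarded part is negligible because
   E|Z|^2 < oo.  By Chernoff's bound over a finite net of directions th the vector of block sums is eventually in any
   ball of radius > 1; by exponential tilting and the second Borel-Cantelli lemma (windows ]b_k, m b_k] are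
   independent) it comes infinitely often close to any point of the unit ball whose first row is 0.  Hence the
   walk is eventually close to polylines of energy <= 1, and infinitely often close to each of them, up to errors
   O(m^(-1/2)).  The hull volume is Lipschitz in the Hausdorff distance on bounded polytopes (the volume of
   parallel bodies is a polynomial), and polylines on fine grids exhaust lambda.  In dimension 2 the hull of a
   polyline is bounded through its least concave majorants, and Cauchy-Schwarz gives sqrt 3 / 6.  For (ii), the
   walk is at distance o(n) from the segment [0, n mu], and V_1 is continuous. *)
Require Import Defs.
From HB Require Import structures.
From mathcomp Require Import all_boot all_order all_algebra fingroup perm.
From mathcomp Require Import all_classical all_reals all_analysis.
From mathcomp Require Import measurable_realfun ring lra.
Set Implicit Arguments. Unset Strict Implicit. Unset Printing Implicit Defensive.
Import Order.TTheory GRing.Theory Num.Theory.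
Import numFieldNormedType.Exports.
Local Open Scope classical_set_scope.
Local Open Scope ring_scope.

(** * Lebesgue outer measure and linear maps *)

(** The normalization makes both bounds meet: the squared Euclidean norm of the vector of block sums
    is the [grid_energy] of the polyline through the rescaled walk at the block ends. For fixed [m]
    everything is thus finite-dimensional, and [m] is sent to infinity last. The two bounds use
    different scales. Above, [b k] is about [(1 + eta) ^ k], so that the hull at an intermediate
    time lies in the hull of the next scale, at the price of a factor close to 1. Below,
    [b k = m ^ k], so that all blocks but the first of stage [k] fill exactly the window between
    [b k] and [b k.+1]; this makes stages independent and costs the first block, an error
    O(m^(-1/2)). With second moments only, the truncation level must move with [k]: [tau b k], the
    root of [b k / ln k], is the level at which exponents stay bounded, and its geometric growth
    makes the discarded parts summable against the second moment. Since [vol] is an outer measure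
    given by covers with boxes, measurability, change of variables and the Steiner formula of
    polytopes are derived from that definition. *)

Section VolOuter.
Variable R : realType.
Implicit Types n : nat.

Lemma boxvol_ge0 n (ab : 'rV[R]_n * 'rV[R]_n) :
  (forall i, ab.1 ord0 i <= ab.2 ord0 i) -> 0 <= boxvol ab.
Proof. by move=> h; apply: prodr_ge0 => i _; rewrite subr_ge0. Qed.

Lemma oboxvol_ge0 n (B : option ('rV[R]_n * 'rV[R]_n)) : obox_ok B -> 0 <= oboxvol B.
Proof. by case: B => //= ab; exact: boxvol_ge0. Qed.

Lemma vol_ge0 n (A : set 'rV[R]_n) : (0 <= vol A)%E.
Proof.
apply: le_ereal_inf_tmp => _ [B [Bok _ ->]].
by apply: nneseries_ge0 => k _ _; rewrite lee_fin oboxvol_ge0.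
Qed.

Lemma vol_le_cover n (A : set 'rV[R]_n) (B : nat -> option ('rV[R]_n * 'rV[R]_n)) :
  (forall k, obox_ok (B k)) -> A `<=` \bigcup_k obox (B k) ->
  (vol A <= \sum_(0 <= k <oo) (oboxvol (B k))%:E)%E.
Proof. by move=> h1 h2; apply: ereal_inf_lbound; exists B; split. Qed.

Lemma vol_set0 n : vol (@set0 'rV[R]_n) = 0%E.
Proof.
apply/eqP; rewrite eq_le vol_ge0 andbT.
apply: (le_trans (@vol_le_cover n set0 (fun=> None) _ _)) => //.
by rewrite eseries0.
Qed.

Lemma le_vol n : {homo @vol R n : A B / A `<=` B >-> (A <= B)%E}.
Proof.
move=> A B AB; apply: ereal_inf_le_tmp => _ [C [h1 h2 ->]].
by exists C; split => //; apply: subset_trans AB h2.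
Qed.

(** Each set gets a cover with error [e / 2 ^ k.+1]; a bijection between [nat] and [nat * nat]
    merges these covers into one. *)
Lemma vol_sigma_subadditive n : sigma_subadditive (@vol R n).
Proof.
move=> A; have [[i ioo]|] := pselect (exists i, vol (A i) = +oo%E).
  rewrite (eseries_pinfty _ _ ioo) ?leey// => k _.
  by rewrite -ltNye (lt_le_trans _ (vol_ge0 _)).
rewrite -forallNE => Aoo.
suff add2e (e : {posnum R}) :
    (vol (\bigcup_n A n) <= \sum_(i <oo) vol (A i) + e%:num%:E)%E.
  by apply/lee_addgt0Pr => _/posnumP[].
rewrite (le_trans _ (epsilon_trick _ _ _))//; last by move=> k; exact: vol_ge0.
pose P k (B : nat -> option ('rV[R]_n * 'rV[R]_n)) :=
  [/\ forall j, obox_ok (B j), A k `<=` \bigcup_j obox (B j) &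
  (\sum_(j <oo) (oboxvol (B j))%:E <= vol (A k) + (e%:num / (2 ^ k.+1)%:R)%:E)%E].
have [G PG] : {G : nat -> nat -> option ('rV[R]_n * 'rV[R]_n) & forall k, P k (G k)}.
  apply: (@choice _ _ P) => k.
  have fk : vol (A k) \is a fin_num.
    by rewrite ge0_fin_numE ?vol_ge0// ltey; apply/eqP; exact: Aoo.
  have e0 : (0 < e%:num / (2 ^ k.+1)%:R)%R by [].
  have [_ [B [h1 h2 ->]] h3] := lb_ereal_inf_adherent e0 fk.
  by exists B; split => //; exact: ltW.
pose w (ij : nat * nat) : \bar R := (oboxvol (G ij.1 ij.2))%:E.
have w0 ij : (0 <= w ij)%E by rewrite lee_fin oboxvol_ge0//; case: (PG ij.1).
apply: (@le_trans _ _ (\esum_(i in setT) w i)).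
  have /card_esym/ppcard_eqP[f] := card_nat2.
  have := @vol_le_cover n (\bigcup_n A n) (fun k => G (f k).1 (f k).2) _ _.
  have -> : \esum_(i in setT) w i = (\sum_(0 <= k <oo) (oboxvol (G (f k).1 (f k).2))%:E)%E.
    rewrite [RHS]nneseries_esumT; last by move=> k; exact: (w0 (f k)).
    exact: reindex_esum.
  apply => [k|x [i _]]; first by case: (PG (f k).1).
  move=> xA; case: (PG i) => _ h _; have [j _ xj] := h _ xA.
  by exists (f^-1%FUN (i, j)) => //=; rewrite invK ?inE.
have -> : \esum_(i in setT) w i = \esum_(i in setT) \esum_(j in setT) w (i, j).
  rewrite (esum_esum (a := fun i j => w (i, j)))//=.
  have -> : [set: nat * nat] = [set: nat] `*`` (fun=> setT) by apply/seteqP; split.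
  by apply: eq_esum => -[].
rewrite -nneseries_esumT; last by move=> i; apply: esum_ge0 => j _; exact: (w0 (i, j)).
apply: lee_nneseries => [i _ _|i _]; first by apply: esum_ge0 => j _; exact: (w0 (i, j)).
rewrite -nneseries_esumT; last by move=> j; exact: (w0 (i, j)).
by case: (PG i).
Qed.

(** Gives access to the Carathéodory construction for [vol]. *)
HB.instance Definition _ n := isOuterMeasure.Build R 'rV[R]_n (@vol R n)
  (@vol_set0 n) (@vol_ge0 n) (@le_vol n) (@vol_sigma_subadditive n).

Lemma vol_le_box n (A : set 'rV[R]_n) (ab : 'rV[R]_n * 'rV[R]_n) : (forall i, ab.1 ord0 i <= ab.2 ord0 i) ->
  A `<=` box ab -> (vol A <= (boxvol ab)%:E)%E.
Proof.
move=> ok AB; pose B (k : nat) : option ('rV[R]_n * 'rV[R]_n) := if k is 0%N then Some ab else None.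
have -> : (boxvol ab)%:E = (\sum_(0 <= k <oo) (oboxvol (B k))%:E)%E.
  rewrite nneseries_recl//; last by case=> //= _; rewrite lee_fin boxvol_ge0.
  by rewrite eseries_cond/= eseries0 ?adde0// => -[].
by apply: vol_le_cover => [[]//|x Ax]; exists 0%N => //; exact: AB.
Qed.

End VolOuter.

(** * Volume of boxes and measurability of half-spaces *)

Section BoxVolume.
Variable R : realType.

Lemma integral_scaled_indic (r u v : R) : 0 <= r -> u <= v ->
  (\int[lebesgue_measure]_y (r * \1_(`[u, v]) y)%:E = (r * (v - u))%:E)%E.
Proof.
move=> r0 uv; under eq_integral do rewrite EFinM.
rewrite ge0_integralZl_EFin//; last first.
- by apply/measurable_EFinP.
rewrite integral_indic// setIT.
rewrite EFinM; congr (_ * _)%E; apply: etrans (lebesgue_measure_itv `[u, v]) _.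
by rewrite /= lte_fin; case: ltgtP uv => // -> _; rewrite subrr.
Qed.

(** Fubini by induction on the dimension: the last coordinate is integrated out and its contribution
    moves into the weights [c] and [C]. Points are functions on [nat] so that the dimension can vary
    in the induction. *)
Lemma indicator_cover_le n (c : R) (u v : nat -> R) (C : nat -> R) (U V : nat -> nat -> R) :
  0 <= c -> (forall k, 0 <= C k) -> (forall i, u i <= v i) -> (forall k i, U k i <= V k i) ->
  (forall x : nat -> R, ((c * \prod_(i < n) \1_(`[u i, v i]) (x i))%:E <=
     \sum_(0 <= k <oo) (C k * \prod_(i < n) \1_(`[U k i, V k i]) (x i))%:E)%E) ->
  ((c * \prod_(i < n) (v i - u i))%:E <=
     \sum_(0 <= k <oo) (C k * \prod_(i < n) (V k i - U k i))%:E)%E.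
Proof.
move=> + + uv UV; elim: n c C => [|n IH] c C c0 C0 h.
  have := h (fun=> 0); rewrite !big_ord0 => /le_trans; apply.
  by apply: lee_nneseries => k _; rewrite !big_ord0 ?lee_fin ?mulr1.
rewrite big_ord_recr/=; under eq_eseriesr do rewrite big_ord_recr/= mulrCA mulrC.
rewrite [X in (X%:E <= _)%E]mulrCA mulrC; apply: IH => [||x].
- by rewrite mulr_ge0// subr_ge0.
- by move=> k; rewrite mulr_ge0// subr_ge0.
pose p := \prod_(i < n) (\1_(`[u i, v i]) (x i) : R).
pose q k := \prod_(i < n) (\1_(`[U k i, V k i]) (x i) : R).
have p0 : 0 <= p by apply: prodr_ge0.
have q0 k : 0 <= q k by apply: prodr_ge0.
rewrite -/p; under eq_eseriesr do rewrite -/(q _).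
have -> : (c * (v n - u n) * p)%:E = (\int[lebesgue_measure]_y ((c * p) * \1_(`[u n, v n]) y)%:E)%E.
  by rewrite integral_scaled_indic ?mulr_ge0// mulrAC.
under eq_eseriesr => k _ do rewrite mulrAC -integral_scaled_indic ?mulr_ge0//.
rewrite -integral_nneseries//; last 2 first.
- by move=> k; apply/measurable_EFinP; apply: measurable_funM.
- by move=> k y _; rewrite lee_fin !mulr_ge0.
apply: ge0_le_integral => //.
- by move=> y _; rewrite lee_fin !mulr_ge0.
- by apply/measurable_EFinP; apply: measurable_funM.
- apply: ge0_emeasurable_sum => [k y _ _|k _]; first by rewrite lee_fin !mulr_ge0.
  by apply/measurable_EFinP; apply: measurable_funM.
move=> y _; have := h (fun i => if (i < n)%N then x i else y).
rewrite big_ord_recr/= ltnn -mulrA (eq_bigr (fun i : 'I_n => \1_(`[u i, v i]) (x i))); last first.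
  by move=> i _; rewrite ltn_ord.
move/le_trans; apply; apply: lee_nneseries => k _ ; first by rewrite lee_fin !mulr_ge0// prodr_ge0.
rewrite big_ord_recr/= ltnn mulrA (eq_bigr (fun i : 'I_n => \1_(`[U k i, V k i]) (x i)))// => i _.
by rewrite ltn_ord.
Qed.

Let ext n (a : 'rV[R]_n) (i : nat) : R := if insub i is Some j then a ord0 j else 0.

Let extE n (a : 'rV[R]_n) (i : 'I_n) : ext a i = a ord0 i.
Proof. by rewrite /ext valK. Qed.

Lemma vol_box n (ab : 'rV[R]_n * 'rV[R]_n) :
  (forall i, ab.1 ord0 i <= ab.2 ord0 i) -> vol (box ab) = (boxvol ab)%:E.
Proof.
move=> ok; apply/eqP; rewrite eq_le vol_le_box//=.
apply: le_ereal_inf_tmp => _ [B [Bok BA ->]].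
pose lo k := if B k is Some cd then ext cd.1 else fun=> 0.
pose hi k := if B k is Some cd then ext cd.2 else fun=> 0.
(* The weight 0 discards the [None] entries of the cover, for which [lo] and [hi] are dummies. *)
pose C k : R := if B k is Some _ then 1 else 0.
have C0 k : 0 <= C k by rewrite /C; case: (B k).
have extle (c d : 'rV[R]_n) : (forall i, c ord0 i <= d ord0 i) -> forall i, ext c i <= ext d i.
  by move=> cd i; rewrite /ext; case: insubP.
have := @indicator_cover_le n 1 (ext ab.1) (ext ab.2) C lo hi ler01 C0 (extle _ _ ok) _ _.
have -> : 1 * \prod_(i < n) (ext ab.2 i - ext ab.1 i) = boxvol ab.
  by rewrite mul1r; apply: eq_bigr => i _; rewrite !extE.
rewrite (eq_eseriesr (g := fun k => (oboxvol (B k))%:E)); last first.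
  move=> k _; congr (_%:E); rewrite /C /lo /hi; case: (B k) => [cd|]/=; last by rewrite mul0r.
  by rewrite mul1r; apply: eq_bigr => i _; rewrite !extE.
apply=> [k i|x].
  rewrite /lo /hi; have := Bok k; case: (B k) => //= cd h; exact: extle.
have nn k : (0 <= (C k * \prod_(i < n) \1_(`[lo k i, hi k i]) (x i))%:E)%E.
  by rewrite lee_fin mulr_ge0// prodr_ge0.
pose y : 'rV[R]_n := \row_i x i.
have [yB|yB] := pselect (box ab y); last first.
  have [i /negP hi'] : exists i, ~ (ab.1 ord0 i <= y ord0 i <= ab.2 ord0 i).
    by apply/not_existsP => h; apply: yB => i; apply: contrapT; exact: h.
  rewrite (bigD1 i)//= indicE memNset ?mul0r ?mulr0; first exact: nneseries_ge0.
  by rewrite /= in_itv/= !extE; move: hi'; rewrite mxE => /negP.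
have [k _ yk] := BA _ yB.
apply: (le_trans _ (nneseries_lim_ge (P := xpredT) k.+1 (fun k _ _ => nn k))).
rewrite big_nat_recr//=; apply: (@le_trans _ _ (1%:E)).
  by rewrite lee_fin mul1r; apply: prodr_ile1 => i _; rewrite indicE ler0n lern1; case: (_ \in _).
rewrite -[leLHS]add0e; apply: leeD; first exact: sume_ge0.
rewrite /C /lo /hi; move: yk; case: (B k) => //= cd h.
rewrite mul1r big1// => i _; rewrite indicE mem_set//= in_itv/= !extE.
by have := h i; rewrite mxE.
Qed.

Definition row_set n (a : 'rV[R]_n) (i : 'I_n) (t : R) : 'rV[R]_n :=
  \row_j if j == i then t else a ord0 j.

Lemma boxvol_split n (a b : 'rV[R]_n) i :
  boxvol (a, b) = (b ord0 i - a ord0 i) * \prod_(j < n | j != i) (b ord0 j - a ord0 j).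
Proof. by rewrite /boxvol (bigD1 i). Qed.

Lemma boxvol_row_setl n (a b : 'rV[R]_n) i s :
  boxvol (row_set a i s, b) = (b ord0 i - s) * \prod_(j < n | j != i) (b ord0 j - a ord0 j).
Proof.
rewrite (boxvol_split _ _ i) mxE eqxx; congr (_ * _).
by apply: eq_bigr => j /negPf ji; rewrite mxE ji.
Qed.

Lemma boxvol_row_setr n (a b : 'rV[R]_n) i t :
  boxvol (a, row_set b i t) = (t - a ord0 i) * \prod_(j < n | j != i) (b ord0 j - a ord0 j).
Proof.
rewrite (boxvol_split _ _ i) mxE eqxx; congr (_ * _).
by apply: eq_bigr => j /negPf ji; rewrite mxE ji.
Qed.

(** The hyperplane cuts every box of a cover into two boxes whose volumes add up, so a cover of [X]
    splits into covers of both parts without loss. *)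
Lemma halfspace_caratheodory n (i : 'I_n) (a : R) :
  (@vol R n).-caratheodory [set x | x ord0 i <= a].
Proof.
apply: le_caratheodory_measurable => X.
set H := [set x | _].
apply: le_ereal_inf_tmp => _ [B [Bok BX ->]].
pose B1 k := if B k is Some cd then
  if cd.1 ord0 i <= a then Some (cd.1, row_set cd.2 i (Num.min (cd.2 ord0 i) a)) else None else None.
pose B2 k := if B k is Some cd then
  if a <= cd.2 ord0 i then Some (row_set cd.1 i (Num.max (cd.1 ord0 i) a), cd.2) else None else None.
have B1ok k : obox_ok (B1 k).
  rewrite /B1; have := Bok k; case: (B k) => //= cd h; case: ifP => //= h1 j.
  by rewrite mxE; case: eqP => [->|_]; rewrite ?h// le_min h h1.
have B2ok k : obox_ok (B2 k).
  rewrite /B2; have := Bok k; case: (B k) => //= cd h; case: ifP => //= h1 j.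
  by rewrite mxE; case: eqP => [->|_]; rewrite ?h// ge_max h h1.
rewrite (eq_eseriesr (g := fun k => ((oboxvol (B1 k))%:E + (oboxvol (B2 k))%:E)%E)); last first.
  move=> k _; rewrite -EFinD; congr (_%:E).
  rewrite /B1 /B2; have := Bok k; case: (B k) => //= [[c d]/= ok|_]; last by rewrite addr0.
  have := ok i; rewrite (boxvol_split _ _ i).
  case: (leP (c ord0 i) a) => ca; case: (leP a (d ord0 i)) => ad cd /=.
  - by rewrite boxvol_row_setl boxvol_row_setr -mulrDl; congr (_ * _); ring.
  - by rewrite boxvol_row_setr addr0.
  - by rewrite boxvol_row_setl add0r.
  - by have := lt_trans ad ca; rewrite ltNge cd.
rewrite nneseriesD; last 2 first.
- by move=> k _ _; rewrite lee_fin oboxvol_ge0.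
- by move=> k _ _; rewrite lee_fin oboxvol_ge0.
apply: leeD; apply: vol_le_cover => // x [Xx Hx].
- have [k _ xk] := BX _ Xx; exists k => //.
  rewrite /B1; move: xk; case: (B k) => //= cd h.
  have hi := h i; case: ifP => [|/negP[]]; last by apply: le_trans Hx; case/andP: hi.
  move=> _ j /=; rewrite mxE; case: eqP => [->|_] //=; case/andP: hi => -> h2 /=.
  by rewrite le_min h2.
- have [k _ xk] := BX _ Xx; exists k => //.
  have {}Hx : a <= x ord0 i by rewrite leNgt; apply/negP => /ltW.
  rewrite /B2; move: xk; case: (B k) => //= cd h.
  have hi := h i; case: ifP => [|/negP[]]; last by apply: le_trans Hx _; case/andP: hi.
  move=> _ j /=; rewrite mxE; case: eqP => [->|_] //=; case/andP: hi => h1 -> /=.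
  by rewrite ge_max h1 Hx.
Qed.

End BoxVolume.

(** * Borel sets are Carathéodory measurable for the volume *)

Section BorelCara.
Variable R : realType.

Definition borelT n := g_sigma_algebraType (range (@box R n)).

Lemma rv_borelE n (A : set 'rV[R]_n) : rv_borel A = measurable (A : set (borelT n)).
Proof. by []. Qed.

Lemma box_rv_borel n (ab : 'rV[R]_n * 'rV[R]_n) : rv_borel (box ab).
Proof. by apply: sub_sigma_algebra; exists ab. Qed.

(** An open set is the countable union of the boxes with rational corners that it contains. *)
Lemma open_rv_borel n (U : set 'rV[R]_n) : open U -> rv_borel U.
Proof.
move=> oU.
pose bx (p : 'rV[rat]_n * 'rV[rat]_n) : set 'rV[R]_n :=
  box (map_mx ratr p.1, map_mx ratr p.2).
pose F k : set 'rV[R]_n := if unpickle k is Some p then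
  if `[< bx p `<=` U >] then bx p else set0 else set0.
have -> : U = \bigcup_k F k; last first.
  rewrite rv_borelE; apply: bigcupT_measurable => k; rewrite /F.
  case: (unpickle k) => [p|]; last exact: measurable0.
  by case: asboolP => _; [exact: box_rv_borel|exact: measurable0].
apply/seteqP; split => [x Ux|x [k _]]; last first.
  by rewrite /F; case: (unpickle k) => // p; case: asboolP => // h /h.
have [e /= e0 xU] : nbhs_ball x U by rewrite nbhs_ballE; exact: oU.
have lo i : {q : rat | x ord0 i - e < ratr q < x ord0 i}.
  apply: cid; have /rat_in_itvoo [q] : x ord0 i - e < x ord0 i by rewrite ltrBlDr ltrDl.
  by rewrite in_itv/=; exists q.
have hi i : {q : rat | x ord0 i < ratr q < x ord0 i + e}.
  apply: cid; have /rat_in_itvoo [q] : x ord0 i < x ord0 i + e by rewrite ltrDl.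
  by rewrite in_itv/=; exists q.
pose p : 'rV[rat]_n * 'rV[rat]_n := (\row_i sval (lo i), \row_i sval (hi i)).
exists (pickle p) => //; rewrite /F pickleK.
have pU : bx p `<=` U.
  move=> y yp; apply: xU; split => // i j; rewrite ord1.
  have := yp j; rewrite /= !mxE; case: (lo j) => /= a /andP[a1 a2]; case: (hi j) => /= b /andP[b1 b2].
  move=> /andP[h1 h2]; rewrite /ball/= ltr_norml; apply/andP; split; lra.
case: asboolP => // _ i; rewrite /= !mxE.
by case: (lo i) => /= a /andP[a1 a2]; case: (hi i) => /= b /andP[b1 b2]; rewrite !ltW.
Qed.

Lemma closed_rv_borel n (C : set 'rV[R]_n) : closed C -> rv_borel C.
Proof.
move=> cC; rewrite -(setCK C) rv_borelE; apply: measurableC; apply: open_rv_borel.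
by rewrite openC.
Qed.

Lemma box_caratheodory n (ab : 'rV[R]_n * 'rV[R]_n) : (@vol R n).-caratheodory (box ab).
Proof.
pose M (A : set 'rV[R]_n) := measurable (A : set (caratheodory_type (@vol R n))).
have hs i a : M ([set x | x ord0 i <= a] : set 'rV[R]_n) by exact: halfspace_caratheodory.
have hs' i a : M ([set x | a <= x ord0 i] : set 'rV[R]_n).
  have -> : ([set x | a <= x ord0 i] : set 'rV[R]_n) = ~` \bigcup_k ([set x | x ord0 i <= a - k.+1%:R^-1] : set 'rV[R]_n).
    apply/seteqP; split => [x /= ax [k _ /=]|x /= h].
      by rewrite leNgt => /negP; apply; apply: lt_le_trans ax; rewrite ltrBlDr ltrDl.
    rewrite leNgt; apply/negP => xa; apply: h.
    have d0 : 0 < a - x ord0 i by rewrite subr_gt0.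
    exists (Num.truncn (a - x ord0 i)^-1) => //=; rewrite lerBrDr -lerBrDl.
    rewrite invf_ple ?posrE//; apply: ltW; exact: truncnS_gt.
  by apply: measurableC; apply: bigcupT_measurable => k; exact: hs.
have -> : box ab = \bigcap_(i in [set: 'I_n]) ([set x | ab.1 ord0 i <= x ord0 i] `&` [set x | x ord0 i <= ab.2 ord0 i]).
  apply/seteqP; split => [x h i _|x h i]; first by have /andP[] := h i.
  by have [/= -> ->] := h i I.
change (M (\bigcap_(i in [set: 'I_n]) ([set x | ab.1 ord0 i <= x ord0 i] `&` [set x | x ord0 i <= ab.2 ord0 i]))).
apply: (@fin_bigcap_measurable _ (caratheodory_type (@vol R n))) => [|i _]; first exact: finite_finset.
by apply: measurableI; [exact: hs'|exact: hs].
Qed.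

Lemma rv_borel_caratheodory n (A : set 'rV[R]_n) : rv_borel A -> (@vol R n).-caratheodory A.
Proof.
move=> bA; have := @smallest_sub _ (sigma_algebra setT) (range (@box R n))
  (@measurable _ (caratheodory_type (@vol R n))) _ _ A bA.
apply; first exact: sigma_algebra_measurable.
by move=> _ [ab _ <-]; exact: box_caratheodory.
Qed.

Lemma vol_split n (B A : set 'rV[R]_n) : rv_borel B ->
  vol A = (vol (A `&` B) + vol (A `\` B))%E.
Proof. by move=> /rv_borel_caratheodory/(_ A). Qed.

Lemma volU n (A B : set 'rV[R]_n) : rv_borel A -> A `&` B = set0 ->
  vol (A `|` B) = (vol A + vol B)%E.
Proof.
move=> bA dAB; rewrite (vol_split (A `|` B) bA); congr (_ + _)%E; congr vol.
  by rewrite setIUl setIid setUidl// => x [].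
by rewrite setDUl setDv set0U; apply: setDidl; rewrite setIC.
Qed.

Lemma vol_partition n (I : finType) (f : 'rV[R]_n -> I) (A : set 'rV[R]_n) :
  (forall i, rv_borel (f @^-1` [set i])) ->
  vol A = (\sum_(i : I) vol (A `&` f @^-1` [set i]))%E.
Proof.
move=> bf.
have H (r : seq I) : uniq r -> vol A = (\sum_(i <- r) vol (A `&` f @^-1` [set i]) +
    vol (A `&` [set x | f x \notin r]))%E.
  elim: r => [|i r IH] /= => [_|/andP[ir ur]].
    by rewrite big_nil add0e; congr vol; apply/seteqP; split => [x|x []].
  rewrite (IH ur) big_cons [X in _ = (X + _)%E]addeC -addeA; congr (_ + _)%E.
  rewrite (vol_split (A `&` _) (bf i)); congr (_ + _)%E; congr vol.
    by apply/seteqP; split => x /= [] => [[Ax _] //|Ax ->].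
  apply/seteqP; split => x /=.
    by move=> [[Ax fx] /eqP fi]; rewrite inE negb_or fi fx.
  by rewrite inE negb_or => -[Ax /andP[/eqP fi fx]].
rewrite (H (index_enum I) (index_enum_uniq _)).
rewrite [X in (_ + vol X)%E](_ : _ = set0) ?vol_set0 ?adde0//.
by apply/seteqP; split => x //= -[_]; rewrite mem_index_enum.
Qed.

(** Used to extend the Steiner polynomial to radius 0. *)
Lemma vol_decreasing_cvg n (F : nat -> set 'rV[R]_n) :
  (forall k, rv_borel (F k)) -> (vol (F 0%N) < +oo)%E ->
  (forall i j, (i <= j)%N -> F j `<=` F i) ->
  vol (F k) @[k --> \oo] --> vol (\bigcap_k F k).
Proof.
move=> bF F0 dF.
pose vm : {outer_measure set 'rV[R]_n -> \bar R} := @vol R n.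
pose mu : {measure set (caratheodory_type vm) -> \bar R} := vm.
apply: (@nonincreasing_cvg_mu _ _ _ mu F) => //.
- by move=> k; exact: rv_borel_caratheodory.
- by apply: rv_borel_caratheodory; rewrite rv_borelE; apply: bigcapT_measurable => k; exact: bF.
- by move=> i j ij; apply/subsetPset; exact: dF.
Qed.

End BorelCara.

(** * Volume of linear images *)

Section LinearImage.
Variable R : realType.

Lemma vol_image_le n p (phi : 'rV[R]_n -> 'rV[R]_p) (c : R) : 0 < c ->
  (forall ab : 'rV[R]_n * 'rV[R]_n, (forall i, ab.1 ord0 i <= ab.2 ord0 i) ->
     (vol (phi @` box ab) <= (c * boxvol ab)%:E)%E) ->
  forall A, (vol (phi @` A) <= c%:E * vol A)%E.
Proof.
move=> c0 h A; rewrite -lee_pdivrMl//.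
apply: le_ereal_inf_tmp => _ [B [Bok AB ->]].
rewrite lee_pdivrMl// -nneseriesZl; last by move=> k _; rewrite lee_fin oboxvol_ge0.
apply: (@le_trans _ _ (vol (\bigcup_k (phi @` obox (B k))))).
  by apply: le_vol => _ [x Ax <-]; have [k _ xk] := AB _ Ax; exists k => //; exists x.
apply: le_trans (vol_sigma_subadditive _) _.
apply: lee_nneseries => [k _ _|k _]; first exact: vol_ge0.
have := Bok k; case: (B k) => /= [ab ok|_]; first by rewrite -EFinM; exact: h.
by rewrite image_set0 vol_set0 mule0.
Qed.

Lemma vol_shift_le n (v : 'rV[R]_n) A : (vol [set (x + v)%R | x in A] <= vol A)%E.
Proof.
rewrite -[leRHS]mul1e; apply: vol_image_le => // ab ok.
pose ab' : 'rV[R]_n * 'rV[R]_n := (ab.1 + v, ab.2 + v).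
have -> : 1 * boxvol ab = boxvol ab'.
  by rewrite mul1r; apply: eq_bigr => i _; rewrite !mxE; ring.
apply: vol_le_box => [i|_ [x xab <-] i]; first by rewrite !mxE lerD2r.
by rewrite !mxE !lerD2r.
Qed.

Lemma vol_shift n (v : 'rV[R]_n) A : vol [set x + v | x in A] = vol A.
Proof.
apply/eqP; rewrite eq_le vol_shift_le/=.
apply: le_trans (vol_shift_le (- v) _); apply: le_vol => x Ax.
by exists (x + v); [exists x|rewrite addrK].
Qed.

Definition mximg n (M : 'M[R]_n) (A : set 'rV[R]_n) : set 'rV[R]_n := (fun x => x *m M) @` A.

Lemma mximg_mul n (M N : 'M[R]_n) A : mximg (M *m N) A = mximg N (mximg M A).
Proof.
apply/seteqP; split => [_ [x Ax <-]|_ [_ [x Ax <-] <-]].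
  by exists (x *m M); [exists x|rewrite mulmxA].
by exists x => //; rewrite mulmxA.
Qed.

(** Only an upper bound, so that it can be checked on boxes; equality comes back in [vol_mximg]
    through the inverse matrix. *)
Definition scales n (c : R) (M : 'M[R]_n) :=
  forall A, (vol (mximg M A) <= c%:E * vol A)%E.

Lemma scales_mul n c e (M N : 'M[R]_n) : 0 <= c -> 0 <= e ->
  scales c M -> scales e N -> scales (c * e) (M *m N).
Proof.
move=> c0 e0 hM hN A; rewrite mximg_mul; apply: le_trans (hN _) _.
by rewrite mulrC EFinM -muleA; apply: lee_wpmul2l => //; rewrite lee_fin.
Qed.

Lemma scales_diag n (d : 'rV[R]_n) : (forall i, d ord0 i != 0) ->
  scales `|\prod_i d ord0 i| (diag_mx d).
Proof.
move=> d0; apply: vol_image_le => [|ab ok].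
  by rewrite normr_gt0; apply/prodf_neq0.
pose lo : 'rV[R]_n := \row_i Num.min (ab.1 ord0 i * d ord0 i) (ab.2 ord0 i * d ord0 i).
pose hi : 'rV[R]_n := \row_i Num.max (ab.1 ord0 i * d ord0 i) (ab.2 ord0 i * d ord0 i).
have -> : `|\prod_i d ord0 i| * boxvol ab = boxvol (lo, hi).
  rewrite normr_prod /boxvol -big_split/=; apply: eq_bigr => i _; rewrite !mxE.
  have := ok i; have [dp|dn] := leP 0 (d ord0 i) => h.
    by rewrite min_l ?max_r ?ler_wpM2r// -mulrBl mulrC ger0_norm.
  have h' := ler_wnM2r (ltW dn) h.
  by rewrite min_r// max_l// -mulrBl ltr0_norm//; ring.
apply: vol_le_box => [i|_ [x xab <-] i /=].
  by rewrite /= !mxE le_max ge_min lexx.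
have -> : (x *m diag_mx d) ord0 i = x ord0 i * d ord0 i by rewrite mul_mx_diag mxE.
rewrite !mxE; have /andP[h1 h2] := xab i; rewrite ge_min le_max.
have [dp|/ltW dn] := leP 0 (d ord0 i).
  by rewrite (ler_wpM2r dp h1) (ler_wpM2r dp h2) orbT.
by rewrite (ler_wnM2r dn h1) (ler_wnM2r dn h2) orbT.
Qed.

Lemma scales_perm n (s : {perm 'I_n}) : scales 1 (perm_mx s : 'M[R]_n).
Proof.
apply: vol_image_le => // ab ok.
pose ab' : 'rV[R]_n * 'rV[R]_n := (ab.1 *m perm_mx s, ab.2 *m perm_mx s).
have E (x : 'rV[R]_n) i : (x *m perm_mx s) ord0 i = x ord0 (s^-1%g i).
  by rewrite -{1}(invgK s) -col_permE mxE.
have -> : 1 * boxvol ab = boxvol ab'.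
  rewrite mul1r /boxvol (reindex_inj (@perm_inj _ s^-1%g)).
  by apply: eq_bigr => i _; rewrite !E.
by apply: vol_le_box => [i|_ [x xab <-] i]; rewrite /= !E.
Qed.

Lemma le_of_all_nat (a b c : R) : (forall N : nat, a <= b + c / N.+1%:R) -> a <= b.
Proof.
move=> h; have [//|ab] := leP a b.
have c0 : 0 < c.
  have := h 0%N; rewrite divr1 => h1; lra.
pose N := Num.truncn (c / (a - b)).
have := h N; rewrite leNgt => /negP; case.
rewrite addrC -ltrBrDr ltr_pdivrMr// mulrC -ltr_pdivrMr ?subr_gt0//.
exact: truncnS_gt.
Qed.

(** The box is cut into [N.+1] slabs of thickness [e] along coordinate [j]. On a slab the shear is a
    translation along [i] up to [|t| * e], so the image fits in a box longer by [2 * |t| * e]; the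
    total excess is O(1/N). *)
Lemma scales_transvection n (i j : 'I_n) (t : R) : i != j ->
  scales 1 (1%:M + t *: delta_mx j i).
Proof.
move=> ij; apply: vol_image_le => // ab ok; rewrite mul1r.
set M := 1%:M + _.
have ME (x : 'rV[R]_n) k : (x *m M) ord0 k = x ord0 k + (if k == i then t * x ord0 j else 0).
  rewrite mulmxDr mulmx1 mxE -scalemxAr mxE; congr (_ + _).
  rewrite mxE (bigD1 j)//= big1 ?addr0 => [|l /negPf lj].
    by rewrite mxE eqxx/=; case: eqP => _; rewrite ?mulr1// !mulr0.
  by rewrite mxE lj/= mulr0.
set h := ab.2 ord0 j - ab.1 ord0 j.
have h0 : 0 <= h by rewrite subr_ge0.
pose r := \prod_(k < n | (k != i) && (k != j)) (ab.2 ord0 k - ab.1 ord0 k).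
pose w := ab.2 ord0 i - ab.1 ord0 i.
have bv : boxvol ab = w * (h * r).
  rewrite /boxvol (bigD1 i)//= (bigD1 j) ?(eq_sym j)//=.
suff H (N : nat) : (vol (mximg M (box ab)) <= (boxvol ab + (2 * `|t| * h * h * r) / N.+1%:R)%:E)%E.
  have f : vol (mximg M (box ab)) \is a fin_num.
    by rewrite ge0_fin_numE ?vol_ge0// (le_lt_trans (H 0%N))// ltry.
  by rewrite -(fineK f) lee_fin; apply: le_of_all_nat => N; rewrite -lee_fin fineK.
pose e := h / N.+1%:R.
have N0 : 0 < N.+1%:R :> R by rewrite ltr0n.
have e0 : 0 <= e by rewrite divr_ge0// ltW.
have Ne : N.+1%:R * e = h by rewrite /e mulrC divfK// gt_eqF.
pose s (k : nat) := ab.1 ord0 j + k%:R * e.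
pose lo (k : nat) : 'rV[R]_n :=
  row_set (row_set ab.1 j (s k)) i (ab.1 ord0 i + t * s k - `|t| * e).
pose hi (k : nat) : 'rV[R]_n :=
  row_set (row_set ab.2 j (s k.+1)) i (ab.2 ord0 i + t * s k + `|t| * e).
have cov : mximg M (box ab) `<=` \big[setU/set0]_(k < N.+1) box (lo k, hi k).
  move=> _ [x xab <-]; have /andP[x1 x2] := xab j.
  have [k kN /andP[k1 k2]] : exists2 k, (k < N.+1)%N & s k <= x ord0 j <= s k.+1.
    have : x ord0 j <= s N.+1 by rewrite /s Ne /h addrC subrK.
    elim: N.+1 (ltn0Sn N) => // -[|m] IH _ hm; first by exists 0%N; rewrite ?hm// /s mul0r addr0 x1.
    have [xm|/ltW xm] := leP (x ord0 j) (s m.+1); last by exists m.+1; rewrite ?xm.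
    by have [k km kx] := IH isT xm; exists k => //; exact: leqW.
  rewrite -(bigcup_mkord N.+1 (fun k => box (lo k, hi k))); exists k => // l; rewrite /= !ME !mxE.
  have [->|li] := eqVneq l i; last first.
    by rewrite addr0; case: eqP => [->|_]; [rewrite k1 k2|exact: xab].
  have /andP[y1 y2] := xab i.
  have : `|t * x ord0 j - t * s k| <= `|t| * e.
    rewrite -mulrBr normrM ler_wpM2l// ger0_norm ?subr_ge0//.
    by move: k2; rewrite lerBlDl /s -natr1; lra.
  by rewrite ler_norml => /andP[z1 z2]; apply/andP; split; lra.
apply: (le_trans (le_vol cov)).
apply: (le_trans (outer_measure_subadditive (@vol R n) (fun k => box (lo k, hi k)) N.+1)).
have bvk k : boxvol (lo k, hi k) = (w + 2 * `|t| * e) * (e * r).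
  rewrite /boxvol (bigD1 i)//= (bigD1 j) ?(eq_sym j)//= !mxE !eqxx eq_sym (negPf ij).
  congr (_ * (_ * _)); first by rewrite /w; ring.
    by rewrite /s -natr1; ring.
  by apply: eq_bigr => l /andP[/negPf li /negPf lj]; rewrite !mxE li lj.
apply: (@le_trans _ _ (\sum_(k < N.+1) ((w + 2 * `|t| * e) * (e * r))%:E)%E).
  apply: lee_sum => k _; rewrite -(bvk k); apply: vol_le_box => // l.
  rewrite /= !mxE; case: eqP => [_|_].
    by have := ok i; have : 0 <= `|t| * e by [apply: mulr_ge0]; lra.
  by case: eqP => [_|_]; rewrite ?ok// /s -natr1; lra.
rewrite sumEFin lee_fin sumr_const card_ord -mulr_natl bv.
rewrite le_eqVlt; apply/orP; left; apply/eqP.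
transitivity ((w + 2 * `|t| * e) * (N.+1%:R * e * r)); first by ring.
by rewrite Ne /e; field; rewrite gt_eqF.
Qed.

Definition cylinder n (a b : R) (B : set 'rV[R]_n) : set 'rV[R]_(1 + n) :=
  [set x : 'rV[R]_(1 + n) | a <= x ord0 (lshift n ord0) <= b /\ B (rsubmx x)].

Lemma boxvol_row_mx n (a b : R) (lo hi : 'rV[R]_n) :
  boxvol (row_mx (const_mx a : 'rV_1) lo, row_mx (const_mx b : 'rV_1) hi) =
  (b - a) * boxvol (lo, hi).
Proof.
rewrite /boxvol big_split_ord/= big_ord1 !row_mxEl !mxE; congr (_ * _).
by apply: eq_bigr => i _; rewrite !row_mxEr.
Qed.

Lemma box_row_mx n (a b : R) (lo hi : 'rV[R]_n) :
  box (row_mx (const_mx a : 'rV_1) lo, row_mx (const_mx b : 'rV_1) hi) =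
  cylinder a b (box (lo, hi)).
Proof.
apply/seteqP; split => x /=.
  move=> h; split; first by have := h (lshift n ord0); rewrite /= !row_mxEl !mxE.
  by move=> i; have := h (rshift 1 i); rewrite /= !row_mxEr !mxE.
move=> [h1 h2] i; case: (split_ordP i) => j ->; rewrite /= ?row_mxEl ?row_mxEr ?mxE.
  by rewrite !ord1.
by have := h2 j; rewrite /= mxE.
Qed.

Lemma cylinder_vol_le n (a b : R) (B : set 'rV[R]_n) (c : R) : a <= b ->
  (vol B <= c%:E)%E -> (vol (cylinder a b B) <= ((b - a) * c)%:E)%E.
Proof.
move=> ab Bc.
have fB : vol B \is a fin_num by rewrite ge0_fin_numE ?vol_ge0// (le_lt_trans Bc)// ltry.
suff H (e : R) : 0 < e -> (vol (cylinder a b B) <= ((b - a) * (c + e))%:E)%E.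
  have f : vol (cylinder a b B) \is a fin_num.
    by rewrite ge0_fin_numE ?vol_ge0// (le_lt_trans (H 1 ltr01))// ltry.
  rewrite -(fineK f) lee_fin; apply: (@le_of_all_nat _ _ (b - a)) => N.
  have N0 : 0 < N.+1%:R^-1 :> R by rewrite invr_gt0 ltr0n.
  by rewrite -mulrDr -lee_fin fineK//; exact: H.
move=> e0.
have [_ [C [Cok BC ->]] Ce] := lb_ereal_inf_adherent e0 fB.
pose C' k : option ('rV[R]_(1 + n) * 'rV[R]_(1 + n)) := if C k is Some cd then
  Some (row_mx (const_mx a : 'rV_1) cd.1, row_mx (const_mx b : 'rV_1) cd.2) else None.
apply: (le_trans (@vol_le_cover _ _ _ C' _ _)).
- move=> k; rewrite /C'; have := Cok k; case: (C k) => //= -[lo hi]/= ok i.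
  by case: (split_ordP i) => j ->; rewrite ?row_mxEl ?row_mxEr ?mxE.
- move=> x [xab /BC [k _ xk]]; exists k => //; rewrite /C'; move: xk.
  by case: (C k) => //= -[lo hi] xk; rewrite box_row_mx.
have -> : (\sum_(0 <= k <oo) (oboxvol (C' k))%:E = \sum_(0 <= k <oo) ((b - a)%:E * (oboxvol (C k))%:E))%E.
  apply: eq_eseriesr => k _; rewrite -EFinM /C'; case: (C k) => [[lo hi]|]/=; last by rewrite mulr0.
  by rewrite boxvol_row_mx.
rewrite nneseriesZl => [|k _]; last by rewrite lee_fin oboxvol_ge0.
rewrite EFinM; apply: lee_wpmul2l; first by rewrite lee_fin subr_ge0.
by apply: (le_trans (ltW Ce)); rewrite EFinD leeD2r.
Qed.

Lemma scales_lift n c (S : 'M[R]_n) : 0 < c -> scales c S ->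
  scales c (block_mx 1%:M 0 0 S : 'M[R]_(1 + n)).
Proof.
move=> c0 hS; apply: vol_image_le => // -[a b] ok.
pose a' : 'rV[R]_n := rsubmx (a : 'rV[R]_(1 + n)); pose b' : 'rV[R]_n := rsubmx (b : 'rV[R]_(1 + n)).
pose a0 := a ord0 (lshift n ord0); pose b0 := b ord0 (lshift n ord0).
have aE : a = row_mx (const_mx a0 : 'rV_1) a'.
  by rewrite -[LHS]hsubmxK; congr row_mx; apply/rowP => i; rewrite !mxE !ord1.
have bE : b = row_mx (const_mx b0 : 'rV_1) b'.
  by rewrite -[LHS]hsubmxK; congr row_mx; apply/rowP => i; rewrite !mxE !ord1.
rewrite aE bE boxvol_row_mx box_row_mx mulrCA.
have ok' i : (a', b').1 ord0 i <= (a', b').2 ord0 i by rewrite /= !mxE ok.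
apply: (@le_trans _ _ (vol (cylinder a0 b0 (mximg S (box (a', b')))))).
  apply: le_vol => _ [x [x0 xr] <-].
  have -> : x *m block_mx 1%:M 0 0 S = row_mx (lsubmx x) (rsubmx x *m S).
    by rewrite -[x in LHS]hsubmxK mul_row_block !mulmx1 !mulmx0 addr0 add0r.
  split; first by rewrite row_mxEl mxE.
  by rewrite row_mxKr; exists (rsubmx x).
apply: cylinder_vol_le; first exact: ok.
by apply: (le_trans (hS _)); rewrite vol_box// EFinM.
Qed.

(** When all products [f i *m f j] vanish, the product of the [1 + f i] is [1] plus their sum. *)
Lemma scales_transvections n (I : Type) (r : seq I) (f : I -> 'M[R]_n) :
  (forall i, scales 1 (1%:M + f i)) -> (forall i j, f i *m f j = 0) ->
  scales 1 (1%:M + \sum_(i <- r) f i).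
Proof.
move=> hf ff; elim: r => [|i r IH].
  rewrite big_nil addr0 => A; rewrite mul1e; apply: le_vol => _ [x Ax <-].
  by rewrite mulmx1.
have -> : 1%:M + \sum_(j <- i :: r) f j = (1%:M + f i) *m (1%:M + \sum_(j <- r) f j).
  rewrite big_cons mulmxDl mul1mx mulmxDr mulmx1 mulmx_sumr.
  by rewrite [X in _ = _ + (f i + X)]big1 ?addr0 ?addrA// [RHS]addrAC.
by rewrite -[X in scales X]mulr1; apply: scales_mul.
Qed.

Lemma scales_block_col n (v : 'cV[R]_n) :
  scales 1 (block_mx 1%:M 0 v 1%:M : 'M[R]_(1 + n)).
Proof.
have -> : (block_mx 1%:M 0 v 1%:M : 'M[R]_(1 + n)) =
    1%:M + \sum_(k : 'I_n) v k ord0 *: delta_mx (rshift 1 k) (lshift n ord0).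
  apply/matrixP => i j; rewrite !mxE summxE; under eq_bigr do rewrite !mxE.
  case: (split_ordP i) => i' ->; case: (split_ordP j) => j' ->; rewrite ?eq_shift/=.
  - by rewrite row_mxEl mxE big1 ?addr0// => k _; rewrite ?eq_shift/= mulr0.
  - by rewrite row_mxEr mxE big1 ?addr0// => k _; rewrite ?eq_shift/= mulr0.
  - rewrite row_mxEl (bigD1 i')//= big1 ?addr0 => [|k ki].
      by rewrite !ord1 add0r !eq_shift !eqxx mulr1.
    by rewrite eq_shift eq_sym (negPf ki) mulr0.
  - by rewrite row_mxEr mxE big1 ?addr0// => k _; rewrite ?eq_shift/= ?andbF mulr0.
apply: scales_transvections => [k|k l].
  by apply: scales_transvection; rewrite eq_shift.
by rewrite -scalemxAl -scalemxAr mul_delta_mx_cond eq_shift mulr0n !scaler0.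
Qed.

Lemma scales_block_row n (u : 'rV[R]_n) :
  scales 1 (block_mx 1%:M u 0 1%:M : 'M[R]_(1 + n)).
Proof.
have -> : (block_mx 1%:M u 0 1%:M : 'M[R]_(1 + n)) =
    1%:M + \sum_(k : 'I_n) u ord0 k *: delta_mx (lshift n ord0) (rshift 1 k).
  apply/matrixP => i j; rewrite !mxE summxE; under eq_bigr do rewrite !mxE.
  case: (split_ordP i) => i' ->; case: (split_ordP j) => j' ->; rewrite ?eq_shift/=.
  - by rewrite row_mxEl mxE big1 ?addr0// => k _; rewrite ?eq_shift/= ?andbF mulr0.
  - rewrite row_mxEr (bigD1 j')//= big1 ?addr0 => [|k ki].
      by rewrite !ord1 add0r !eq_shift !eqxx mulr1.
    by rewrite !eq_shift (eq_sym j') (negPf ki) andbF mulr0.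
  - by rewrite row_mxEl mxE big1 ?addr0// => k _; rewrite ?eq_shift/= mulr0.
  - by rewrite row_mxEr mxE big1 ?addr0// => k _; rewrite ?eq_shift/= mulr0.
apply: scales_transvections => [k|k l].
  by apply: scales_transvection; rewrite eq_shift.
by rewrite -scalemxAl -scalemxAr mul_delta_mx_cond eq_shift mulr0n !scaler0.
Qed.

(** Induction on the size by block elimination: a column swap brings a nonzero pivot [a] to the
    corner, then the matrix is lower shears times a diagonal times the lifted Schur complement [S]
    times upper shears, and the determinant is [a * \det S]. *)
Lemma scales_det n (M : 'M[R]_n) : M \in unitmx -> scales `|\det M| M.
Proof.
elim: n M => [|n IH] M uM.
  rewrite det_mx00 normr1 => A; rewrite mul1e; apply: le_vol => _ [x Ax <-].
  by rewrite (_ : x *m M = x)//; apply/rowP => -[].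
have [j Mj] : exists j, M ord0 j != 0.
  apply/existsP; apply: contraT; rewrite negb_exists => /forallP h.
  have : row ord0 M = 0 by apply/rowP => j; rewrite !mxE; apply/eqP; have := h j; rewrite negbK.
  move=> r0; have : delta_mx ord0 ord0 *m M = 0 :> 'rV_n.+1 by rewrite -rowE.
  move/(congr1 (fun A => A *m invmx M)); rewrite mulmxK// mul0mx.
  by move/rowP/(_ ord0); rewrite !mxE !eqxx => /eqP; rewrite oner_eq0.
pose M' : 'M[R]_(1 + n) := M *m tperm_mx ord0 j.
have ME : M = M' *m tperm_mx ord0 j.
  by rewrite -mulmxA -perm_mxM tperm2 perm_mx1 mulmx1.
have M'0 : M' ord0 ord0 != 0.
  rewrite /M' /tperm_mx -[tperm _ _]invgK -col_permE mxE tpermV tpermL.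
  exact: Mj.
have uM' : M' \in unitmx by rewrite unitmx_mul uM unitmx_perm.
have dM : `|\det M| = `|\det M'| * 1.
  rewrite mulr1 /M' det_mulmx normrM det_perm.
  by rewrite normr_sign mulr1.
rewrite dM ME; apply: scales_mul => //; last exact: scales_perm.
clear ME dM Mj uM; move: M' M'0 uM' => N N0 uN {M j}.
pose a := N ord0 ord0.
pose u : 'rV[R]_n := ursubmx N; pose v : 'cV[R]_n := dlsubmx N; pose D : 'M[R]_n := drsubmx N.
have NE : N = block_mx a%:M u v D.
  rewrite -[LHS]submxK; congr block_mx; apply/matrixP => i k.
  by rewrite !ord1 !mxE eqxx mulr1n; congr (N _ _); apply/val_inj.
pose S := D - a^-1 *: (v *m u).
pose L : 'M[R]_(1 + n) := block_mx 1%:M 0 (a^-1 *: v) 1%:M.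
pose Dg : 'M[R]_(1 + n) := block_mx a%:M 0 0 1%:M.
pose Sg : 'M[R]_(1 + n) := block_mx 1%:M 0 0 S.
pose U : 'M[R]_(1 + n) := block_mx 1%:M (a^-1 *: u) 0 1%:M.
have fac : N = L *m (Dg *m (Sg *m U)).
  rewrite NE /L /Dg /Sg /U !mulmx_block !(mulmx0, mul0mx, mulmx1, mul1mx, addr0, add0r).
  have e1 : a%:M *m (a^-1 *: u) = u by rewrite mul_scalar_mx scalerA mulfV// scale1r.
  have e2 : (a^-1 *: v) *m a%:M = v by rewrite mul_mx_scalar scalerA mulfV// scale1r.
  by rewrite e1 e2; congr block_mx; rewrite /S -scalemxAl addrC subrK.
have dN : \det N = a * \det S.
  rewrite fac !det_mulmx /L /Dg /Sg /U !det_lblock det_ublock !det1 !det_scalar1.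
  by rewrite !(mul1r, mulr1).
have uS : S \in unitmx.
  by move: uN; rewrite !unitmxE dN unitrM => /andP[].
have nz : 0 < `|\det S| by rewrite normr_gt0 -unitfE -unitmxE.
rewrite dN normrM -[X in scales X]mul1r fac.
apply: scales_mul => //; first exact: scales_block_col.
apply: scales_mul => //; last first.
  rewrite -[X in scales X]mulr1; apply: scales_mul => //; last exact: scales_block_row.
  by apply: scales_lift => //; exact: IH.
pose d : 'rV[R]_(1 + n) := row_mx (const_mx a) (const_mx 1).
have -> : Dg = diag_mx d.
  rewrite /Dg /d diag_mx_row; congr block_mx; apply/matrixP => i k; rewrite !mxE.
    by rewrite !ord1.
  by case: eqP.
have -> : a = \prod_i d ord0 i.
  rewrite big_split_ord/= big_ord1 row_mxEl mxE big1 ?mulr1// => i _.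
  by rewrite row_mxEr mxE.
apply: (@scales_diag (1 + n)) => i; rewrite /d; case: (split_ordP i) => k ->.
  by rewrite row_mxEl mxE.
by rewrite row_mxEr mxE oner_neq0.
Qed.

Lemma vol_mximg n (M : 'M[R]_n) A : M \in unitmx ->
  vol (mximg M A) = (`|\det M|%:E * vol A)%E.
Proof.
move=> uM; apply/eqP; rewrite eq_le scales_det//=.
have nz : 0 < `|\det M| by rewrite normr_gt0 -unitfE -unitmxE.
rewrite -lee_pdivlMl//.
have uV : invmx M \in unitmx by rewrite unitmx_inv.
have := scales_det uV (mximg M A); rewrite det_inv normfV; apply: le_trans.
apply: le_vol => x Ax; exists (x *m M); [by exists x|by rewrite mulmxK].
Qed.

(** Coordinate [i] of [x *m M] is the inner product of [x] with [v]. So [M] sends the hyperplane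
    into the one where coordinate [i] is 0, which is covered by countably many flat boxes. *)
Lemma vol_hyperplane n (v : 'rV[R]_n) : v != 0 ->
  vol [set x : 'rV[R]_n | x *m v^T = 0] = 0%E.
Proof.
case: n v => [|n] v v0; first by rewrite [v]thinmx0 eqxx in v0.
have [i vi] : exists i, v ord0 i != 0.
  apply/existsP; apply: contraNT v0; rewrite negb_exists => /forallP h.
  by apply/eqP/rowP => i; rewrite mxE; apply/eqP; have := h i; rewrite negbK.
apply/eqP; rewrite eq_le vol_ge0 andbT.
pose w : 'cV[R]_n.+1 := (v - delta_mx ord0 i)^T.
pose e : 'rV[R]_n.+1 := delta_mx ord0 i.
pose M : 'M[R]_n.+1 := 1%:M + w *m e.
have ew : e *m w = (v ord0 i - 1)%:M.
  by apply/matrixP => k l; rewrite !ord1 /e -rowE !mxE !eqxx.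
have uM : M \in unitmx.
  have : M *m (1%:M - (v ord0 i)^-1 *: (w *m e)) = 1%:M.
    rewrite /M mulmxBr mulmx1 -scalemxAr mulmxDl mul1mx -mulmxA (mulmxA e) ew.
    rewrite mul_scalar_mx -scalemxAr -[X in _ *: (X + _)]scale1r -scalerDl scalerA.
    by rewrite subrKC mulVf// scale1r addrK.
  by case/mulmx1_unit.
have M0 : vol (mximg M [set x : 'rV[R]_n.+1 | x *m v^T = 0]) = 0%E.
  apply/eqP; rewrite eq_le vol_ge0 andbT.
  pose ab k : 'rV[R]_n.+1 * 'rV[R]_n.+1 := (row_set (const_mx (- k%:R)) i 0, row_set (const_mx k%:R) i 0).
  apply: (@le_trans _ _ (vol (\bigcup_k box (ab k)))).
    apply: le_vol => _ [x /= xv <-].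
    have yi : (x *m M) ord0 i = 0.
      rewrite /M /w mulmxDr mulmx1 mulmxA linearB/= mulmxBr xv sub0r trmx_delta -colE.
      rewrite !mxE big_ord1 !mxE !eqxx mulr1 subrr//.
    move: (x *m M) yi => y yi.
    pose S := \sum_j `|y ord0 j|.
    exists (Num.truncn S).+1 => // j /=; rewrite !mxE.
    case: eqP => [->|_]; first by rewrite yi lexx.
    rewrite -ler_norml; apply: (@le_trans _ _ S); last by apply/ltW/truncnS_gt.
    by rewrite /S (bigD1 j)//= lerDl; apply: sumr_ge0.
  apply: (le_trans (vol_sigma_subadditive _)).
  rewrite eseries0// => k _ _; rewrite vol_box => [|j].
    by rewrite /boxvol (bigD1 i)//= !mxE eqxx subrr mul0r.
  by rewrite !mxE; case: ifP => // _; rewrite (@le_trans _ _ 0)// oppr_le0.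
have nz : 0 < `|\det M| by rewrite normr_gt0 -unitfE -unitmxE.
have := vol_mximg [set x : 'rV[R]_n.+1 | x *m v^T = 0] uM; rewrite M0.
move/esym/eqP; rewrite mule_eq0 => /orP[/eqP[h]|/eqP->//].
by rewrite h ltxx in nz.
Qed.

End LinearImage.

(** * Polytopes, parallel bodies and the Steiner formula *)

Section Euclid.
Variable R : realType.

Definition dot n (x y : 'rV[R]_n) : R := \sum_i x ord0 i * y ord0 i.

Section DotTheory.
Variable n : nat.
Implicit Types x y z : 'rV[R]_n.

Lemma dotC x y : dot x y = dot y x.
Proof. by apply: eq_bigr => i _; rewrite mulrC. Qed.

Lemma dotDl x y z : dot (x + y) z = dot x z + dot y z.
Proof. by rewrite -big_split; apply: eq_bigr => i _; rewrite mxE mulrDl. Qed.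

Lemma dotZl a x z : dot (a *: x) z = a * dot x z.
Proof. by rewrite mulr_sumr; apply: eq_bigr => i _; rewrite mxE mulrA. Qed.

Lemma dotNl x z : dot (- x) z = - dot x z.
Proof. by rewrite -scaleN1r dotZl mulN1r. Qed.

Lemma dotBl x y z : dot (x - y) z = dot x z - dot y z.
Proof. by rewrite dotDl dotNl. Qed.

Lemma dotDr x y z : dot z (x + y) = dot z x + dot z y.
Proof. by rewrite dotC dotDl !(dotC z). Qed.

Lemma dotZr a x z : dot z (a *: x) = a * dot z x.
Proof. by rewrite dotC dotZl (dotC z). Qed.

Lemma dotNr x z : dot z (- x) = - dot z x.
Proof. by rewrite dotC dotNl (dotC z). Qed.

Lemma dotBr x y z : dot z (x - y) = dot z x - dot z y.
Proof. by rewrite dotDr dotNr. Qed.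

Lemma dot0l z : dot 0 z = 0.
Proof. by rewrite -(scale0r z) dotZl mul0r. Qed.

Lemma dot_suml (I : Type) (r : seq I) (F : I -> 'rV[R]_n) z :
  dot (\sum_(i <- r) F i) z = \sum_(i <- r) dot (F i) z.
Proof. by elim: r => [|i r IH]; rewrite ?big_nil ?dot0l// !big_cons dotDl IH. Qed.

Lemma dot_sumr (I : Type) (r : seq I) (F : I -> 'rV[R]_n) z :
  dot z (\sum_(i <- r) F i) = \sum_(i <- r) dot z (F i).
Proof. by rewrite dotC dot_suml; apply: eq_bigr => i _; rewrite dotC. Qed.

Lemma dot_mx x y : x *m y^T = (dot x y)%:M.
Proof.
apply/matrixP => i j; rewrite !ord1 !mxE eqxx mulr1n.
by apply: eq_bigr => k _; rewrite mxE.
Qed.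

Lemma dotxx_ge0 x : 0 <= dot x x.
Proof. by apply: sumr_ge0 => i _; rewrite -expr2 sqr_ge0. Qed.

Lemma dotxx_eq0 x : dot x x = 0 -> x = 0.
Proof.
move=> h; apply/rowP => i; rewrite mxE; apply/eqP; rewrite -sqrf_eq0 expr2.
move: h => /eqP; rewrite psumr_eq0 => [/allP/(_ i)|j _]; last by rewrite -expr2 sqr_ge0.
by rewrite mem_index_enum => /(_ isT).
Qed.

Lemma enormE x : enorm x = Num.sqrt (dot x x).
Proof. by congr Num.sqrt; apply: eq_bigr => i _; rewrite expr2. Qed.

Lemma enorm_ge0 x : 0 <= enorm x.
Proof. exact: sqrtr_ge0. Qed.

Lemma enorm_sqr x : enorm x ^+ 2 = dot x x.
Proof. by rewrite enormE sqr_sqrtr// dotxx_ge0. Qed.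

Lemma enorm0_eq0 x : enorm x = 0 -> x = 0.
Proof. by move=> h; apply: dotxx_eq0; rewrite -enorm_sqr h expr0n. Qed.

Lemma enorm0 : enorm (0 : 'rV[R]_n) = 0.
Proof. by rewrite enormE dot0l sqrtr0. Qed.

Lemma enormZ a x : enorm (a *: x) = `|a| * enorm x.
Proof. by rewrite !enormE dotZl dotZr mulrA -expr2 sqrtrM ?sqr_ge0// sqrtr_sqr. Qed.

Lemma enormN x : enorm (- x) = enorm x.
Proof. by rewrite -scaleN1r enormZ normrN1 mul1r. Qed.

Lemma enormC x y : enorm (x - y) = enorm (y - x).
Proof. by rewrite -enormN opprB. Qed.

Lemma dot_le_enorm x y : dot x y <= enorm x * enorm y.
Proof.
have [->|x0] := eqVneq x 0; first by rewrite dot0l mulr_ge0// enorm_ge0.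
have nx : 0 < enorm x.
  by rewrite lt0r enorm_ge0 andbT; apply: contraNneq x0 => /enorm0_eq0 ->.
have h := dotxx_ge0 (enorm x ^+ 2 *: y - dot x y *: x).
have : 0 <= enorm x ^+ 2 * (enorm x ^+ 2 * enorm y ^+ 2 - dot x y ^+ 2).
  move: h; rewrite !dotBl !dotBr !dotZl !dotZr -!enorm_sqr (dotC y x); congr (_ <= _); ring.
rewrite pmulr_rge0 ?exprn_gt0// subr_ge0 -exprMn => h2.
apply: le_trans (ler_norm _) _.
by rewrite -(ler_pXn2r (n := 2)) ?nnegrE ?mulr_ge0 ?enorm_ge0// -normrX ger0_norm ?sqr_ge0.
Qed.

Lemma enorm_triangle x y : enorm (x + y) <= enorm x + enorm y.
Proof.
rewrite -(ler_pXn2r (n := 2)) ?nnegrE ?addr_ge0 ?enorm_ge0//.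
rewrite enorm_sqr dotDl !dotDr -!enorm_sqr (dotC y x).
have := dot_le_enorm x y; nra.
Qed.

Lemma enorm_triangleB x y z : enorm (x - z) <= enorm (x - y) + enorm (y - z).
Proof. by have := enorm_triangle (x - y) (y - z); rewrite addrA subrK. Qed.

Lemma coord_le_enorm x i : `|x ord0 i| <= enorm x.
Proof.
rewrite -(ler_pXn2r (n := 2)) ?nnegrE ?enorm_ge0// -normrX ger0_norm ?sqr_ge0//.
by rewrite enorm_sqr /dot (bigD1 i)//= -expr2 lerDl sumr_ge0// => j _; rewrite -expr2 sqr_ge0.
Qed.

Lemma enorm_le_sum x : enorm x <= \sum_i `|x ord0 i|.
Proof.
have -> : x = \sum_i x ord0 i *: delta_mx ord0 i by exact: row_sum_delta.
have H (r : seq 'I_n) : enorm (\sum_(i <- r) x ord0 i *: delta_mx ord0 i : 'rV[R]_n) <= \sum_(i <- r) `|x ord0 i|.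
  elim: r => [|i r IH]; first by rewrite !big_nil enorm0.
  rewrite !big_cons; apply: le_trans (enorm_triangle _ _) _; apply: lerD => //.
  rewrite enormZ -[leRHS]mulr1 ler_wpM2l// enormE /dot (bigD1 i)//= big1 => [|j /negPf ji].
    by rewrite !mxE !eqxx mulr1 addr0 sqrtr1.
  by rewrite !mxE ji andbF mulr0.
by rewrite -row_sum_delta; have := H (index_enum 'I_n); rewrite -row_sum_delta.
Qed.

Lemma enorm_sum (I : Type) (r : seq I) (F : I -> 'rV[R]_n) :
  enorm (\sum_(i <- r) F i) <= \sum_(i <- r) enorm (F i).
Proof.
elim: r => [|i r IH]; first by rewrite !big_nil enorm0.
by rewrite !big_cons; apply: le_trans (enorm_triangle _ _) _; rewrite lerD2l.
Qed.

End DotTheory.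

Lemma continuous_fsum (T : topologicalType) (I : Type) (r : seq I) (f : I -> T -> R) :
  (forall i, continuous (f i)) -> continuous (fun x => \sum_(i <- r) f i x).
Proof.
move=> cf; elim: r => [|i r IH].
  have -> : (fun x => \sum_(i <- [::]) f i x) = fun=> 0 by apply/funext => y; rewrite big_nil.
  by move=> x; exact: cst_continuous.
have -> : (fun x => \sum_(j <- i :: r) f j x) = (fun y => f i y + \sum_(j <- r) f j y).
  by apply/funext => y; rewrite big_cons.
by move=> x; apply: continuousD; [exact: cf|exact: IH].
Qed.

Lemma cvg_fsum (T : Type) (F : set_system T) (FF : Filter F) (I : Type) (r : seq I)
  (f : I -> T -> R) (a : I -> R) : (forall i, f i x @[x --> F] --> a i) ->
  (\sum_(i <- r) f i x) @[x --> F] --> \sum_(i <- r) a i.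
Proof.
move=> cf; elim: r => [|i r IH].
  rewrite big_nil; have -> : (fun x => \sum_(i <- [::]) f i x) = fun=> 0 by apply/funext => y; rewrite big_nil.
  exact: cvg_cst.
have -> : (fun x => \sum_(j <- i :: r) f j x) = (fun y => f i y + \sum_(j <- r) f j y).
  by apply/funext => y; rewrite big_cons.
by rewrite big_cons; apply: cvgD; [exact: cf|exact: IH].
Qed.

Lemma continuous_dot (T : topologicalType) n (f g : T -> 'rV[R]_n) :
  (forall i, continuous (fun x => f x ord0 i)) -> (forall i, continuous (fun x => g x ord0 i)) ->
  continuous (fun x => dot (f x) (g x)).
Proof.
move=> cf cg; apply: continuous_fsum => i x; apply: continuousM; [exact: cf|exact: cg].
Qed.

Lemma continuous_enorm (T : topologicalType) n (f : T -> 'rV[R]_n) :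
  (forall i, continuous (fun x => f x ord0 i)) -> continuous (fun x => enorm (f x)).
Proof.
move=> cf.
have -> : (fun x => enorm (f x)) = Num.sqrt \o (fun y => dot (f y) (f y)).
  by apply/funext => y /=; rewrite enormE.
move=> x; apply: continuous_comp; first exact: continuous_dot.
exact: sqrt_continuous.
Qed.

Lemma continuous_coordB n (v : 'rV[R]_n) i : continuous (fun x : 'rV[R]_n => (x - v) ord0 i).
Proof.
have -> : (fun x : 'rV[R]_n => (x - v) ord0 i) = fun y : 'rV[R]_n => y ord0 i - v ord0 i.
  by apply/funext => y; rewrite !mxE.
by move=> x; apply: continuousB; [exact: coord_continuous|exact: cst_continuous].
Qed.

Lemma lip_continuous n (f : 'rV[R]_n -> R) :
  (forall x y, `|f x - f y| <= enorm (x - y)) -> continuous f.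
Proof.
move=> h x; apply/(@cvgrPdist_le _ _ _ (nbhs x)) => e e0.
have /(_ x) : continuous (fun y : 'rV[R]_n => enorm (y - x)).
  by apply: continuous_enorm => j; exact: continuous_coordB.
rewrite /continuous_at subrr enorm0 => /(@cvgrPdist_le _ _ _ (nbhs x))/(_ e e0); apply: filterS => y.
rewrite sub0r normrN ger0_norm ?enorm_ge0// => hy.
by apply: le_trans (h _ _) _; rewrite enormC.
Qed.

Lemma closed_le_continuous (T : topologicalType) (f : T -> R) a : continuous f -> closed [set x | f x <= a].
Proof.
by move=> cf; apply: (@preimage_closed _ _ f [set y | y <= a]) => //; exact: closed_le.
Qed.

Lemma closed_eq_continuous (T : topologicalType) (f : T -> R) a : continuous f -> closed [set x | f x = a].
Proof.
by move=> cf; apply: (@preimage_closed _ _ f [set y | y = a]) => //; exact: closed_eq.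
Qed.

Lemma eball_vol_lt_pinfty n (A : set 'rV[R]_n) r : A `<=` [set x | enorm x <= r] ->
  (vol A <= (\prod_(i < n) (2 * `|r|))%:E)%E.
Proof.
move=> h; pose ab : 'rV[R]_n * 'rV[R]_n := (const_mx (- `|r|), const_mx `|r|).
have -> : \prod_(i < n) (2 * `|r|) = boxvol ab by apply: eq_bigr => i _; rewrite !mxE; ring.
apply: vol_le_box => [i|x /h /= xr i]; rewrite /= !mxE.
  by rewrite (@le_trans _ _ 0)// oppr_le0.
rewrite -ler_norml; apply: le_trans (coord_le_enorm _ _) _.
by apply: le_trans xr (ler_norm _).
Qed.

Lemma kappa_vol j : vol [set x : 'rV[R]_j | enorm x <= 1] = (kappa R j)%:E.
Proof.
rewrite /kappa fineK// ge0_fin_numE ?vol_ge0//.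
by apply: le_lt_trans (eball_vol_lt_pinfty (r := 1) _) (ltry _).
Qed.

Lemma kappa_gt0 j : 0 < kappa R j.
Proof.
pose a := j.+1%:R^-1 : R.
have a0 : 0 < a by rewrite invr_gt0 ltr0n.
pose ab : 'rV[R]_j * 'rV[R]_j := (const_mx 0, const_mx a).
rewrite -lte_fin -kappa_vol; apply: (@lt_le_trans _ _ (vol (box ab))).
  rewrite vol_box => [|i]; last by rewrite !mxE ltW.
  by rewrite lte_fin; apply: prodr_gt0 => i _; rewrite !mxE subr0.
apply: le_vol => x xab /=; apply: le_trans (enorm_le_sum _) _.
apply: (@le_trans _ _ (\sum_(i < j) a)).
  by apply: ler_sum => i _; have := xab i; rewrite /= !mxE => /andP[h1 h2]; rewrite ger0_norm.
rewrite sumr_const card_ord -mulr_natl /a ler_pdivrMr ?ltr0n// mul1r ler_nat//.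
Qed.

End Euclid.

(** * Nearest points and faces of polytopes *)

Section Polytope.
Variable R : realType.
Variable n : nat.

Definition polytope m (v : 'I_m -> 'rV[R]_n) : set 'rV[R]_n :=
  [set x | exists w : 'I_m -> R, [/\ forall i, 0 <= w i, \sum_i w i = 1 & x = \sum_i w i *: v i]].

Lemma le_hull (A B : set 'rV[R]_n) : A `<=` B -> hull A `<=` hull B.
Proof. by move=> AB x [m [w [p [h1 h2 h3 ->]]]]; exists m, w, p; split => // i; exact: AB. Qed.

Lemma hull_polytope m (v : 'I_m -> 'rV[R]_n) (A : set 'rV[R]_n) :
  A = range v -> hull A = polytope v.
Proof.
move=> ->; apply/seteqP; split => x.
  move=> [k [w [p [w0 w1 pv ->]]]].
  have s i : {j | v j = p i} by apply: cid; have [j _] := pv i; exists j.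
  exists (fun j => \sum_(i | sval (s i) == j) w i); split => [j||].
  - exact: sumr_ge0.
  - by rewrite -w1 [RHS](partition_big (fun i => sval (s i)) xpredT).
  rewrite [LHS](partition_big (fun i => sval (s i)) xpredT)//=; apply: eq_bigr => j _.
  rewrite scaler_suml; apply: eq_bigr => i /eqP <-; congr (_ *: _).
  by case: (s i).
by move=> [w [w0 w1 ->]]; exists m, w, v; split => // i; exists i.
Qed.

Definition convexs (A : set 'rV[R]_n) := forall x y (t : R), A x -> A y -> 0 <= t <= 1 ->
  A ((1 - t) *: x + t *: y).

Lemma polytope_convex m (v : 'I_m -> 'rV[R]_n) : convexs (polytope v).
Proof.
move=> _ _ t [w [w0 w1 ->]] [u [u0 u1 ->]] /andP[t0 t1].
exists (fun i => (1 - t) * w i + t * u i); split => [i||].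
- by rewrite addr_ge0// mulr_ge0// subr_ge0.
- by rewrite big_split/= -!mulr_sumr w1 u1 !mulr1 subrK.
rewrite !scaler_sumr -big_split/=; apply: eq_bigr => i _.
by rewrite !scalerA -scalerDl.
Qed.

Lemma polytope_vertex m (v : 'I_m -> 'rV[R]_n) i : polytope v (v i).
Proof.
exists (fun j => (j == i)%:R); split => [j||] //.
  by rewrite (bigD1 i)//= eqxx big1 ?addr0// => j /negPf ->.
by rewrite (bigD1 i)//= eqxx scale1r big1 ?addr0// => j /negPf ->; rewrite scale0r.
Qed.

Lemma polytope_dot_le m (v : 'I_m -> 'rV[R]_n) u c x : polytope v x ->
  (forall i, dot u (v i) <= c) -> dot u x <= c.
Proof.
move=> [w [w0 w1 ->]] h; rewrite dot_sumr -[c]mul1r -w1 mulr_suml.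
by apply: ler_sum => i _; rewrite dotZr ler_wpM2l.
Qed.

Lemma polytope_enorm_le m (v : 'I_m -> 'rV[R]_n) r x : polytope v x ->
  (forall i, enorm (v i) <= r) -> enorm x <= r.
Proof.
move=> [w [w0 w1 ->]] h; apply: le_trans (enorm_sum _ _) _.
rewrite -[r]mul1r -w1 mulr_suml; apply: ler_sum => i _.
by rewrite enormZ ger0_norm// ler_wpM2l.
Qed.

Lemma simplex_compact m : compact [set w : 'rV[R]_m | (forall i, 0 <= w ord0 i) /\ \sum_i w ord0 i = 1].
Proof.
apply: bounded_closed_compact.
  exists 1; split => // M M1 w [w0 w1] /=; apply: ltW; apply: le_lt_trans M1.
  rewrite [X in X <= _]/Num.norm/= mx_normrE; apply/bigmax_leP; split => //= -[i j] _ /=.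
  by rewrite ord1 ger0_norm// -w1 (bigD1 j)//= lerDl sumr_ge0.
have -> : [set w : 'rV[R]_m | (forall i, 0 <= w ord0 i) /\ \sum_i w ord0 i = 1] =
   (\bigcap_i [set w : 'rV[R]_m | - w ord0 i <= 0]) `&` [set w : 'rV[R]_m | \sum_i w ord0 i = 1].
  apply/seteqP; split => w [h1 h2]; split => //.
    by move=> i _ /=; rewrite oppr_le0.
  by move=> i; have /= := h1 i I; rewrite oppr_le0.
apply: closedI; last first.
  by apply: closed_eq_continuous; apply: continuous_fsum => i; exact: coord_continuous.
apply: closed_bigI => i _; apply: closed_le_continuous.
by move=> w; apply: continuousN; exact: coord_continuous.
Qed.

Section Nearest.
Variables (m : nat) (v : 'I_m.+1 -> 'rV[R]_n).

(** The distance is minimized over the weights, which range over a compact simplex. *)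
Lemma nearest_ex x : exists p, polytope v p /\ forall y, polytope v y -> enorm (x - p) <= enorm (x - y).
Proof.
pose S := [set w : 'rV[R]_m.+1 | (forall i, 0 <= w ord0 i) /\ \sum_i w ord0 i = 1].
pose g (w : 'rV[R]_m.+1) : 'rV[R]_n := \sum_i w ord0 i *: v i.
have cg : continuous (fun w => enorm (x - g w)).
  apply: continuous_enorm => i.
  have -> : (fun w => (x - g w) ord0 i) = fun w : 'rV[R]_m.+1 => x ord0 i - \sum_j w ord0 j * v j ord0 i.
    by apply/funext => w; rewrite !mxE summxE; congr (_ - _); apply: eq_bigr => j _; rewrite mxE.
  move=> w; apply: continuousB; first exact: cst_continuous.
  apply: continuous_fsum => j {}w; apply: continuousM; [exact: coord_continuous|exact: cst_continuous].
have S0 : S !=set0.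
  exists (delta_mx ord0 ord0); split => [i|]; first by rewrite mxE.
  by rewrite (bigD1 ord0)//= mxE !eqxx big1 ?addr0// => i /negPf i0; rewrite mxE i0.
have [w /set_mem [w0 w1] wmin] := @compact_EVT_min _ _ (fun w => enorm (x - g w)) S S0
  (@simplex_compact _) (continuous_subspaceT cg).
exists (g w); split; first by exists (fun i => w ord0 i).
move=> _ [u [u0 u1 ->]].
have -> : \sum_i u i *: v i = g (\row_i u i) by apply: eq_bigr => i _; rewrite mxE.
apply: wmin; apply/mem_set; split => [i|]; first by rewrite mxE.
by rewrite -u1; apply: eq_bigr => i _; rewrite mxE.
Qed.

Definition nearest x := sval (cid (nearest_ex x)).

Lemma nearest_polytope x : polytope v (nearest x).
Proof. by rewrite /nearest; case: (cid _) => p []. Qed.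

Lemma nearest_min x y : polytope v y -> enorm (x - nearest x) <= enorm (x - y).
Proof. by rewrite /nearest; case: (cid _) => p [_ h] /=; exact: h. Qed.

Lemma nearest_dot x y : polytope v y -> dot (x - nearest x) (y - nearest x) <= 0.
Proof.
move=> vy; set p := nearest x; set D := dot _ _.
have H (t : R) : 0 <= t <= 1 -> 0 <= - (2 * t * D) + t ^+ 2 * dot (y - p) (y - p).
  move=> t01; have := nearest_min x (polytope_convex (nearest_polytope x) vy t01).
  rewrite -/p -(ler_pXn2r (n := 2)) ?nnegrE ?enorm_ge0// !enorm_sqr.
  have -> : x - ((1 - t) *: p + t *: y) = (x - p) - t *: (y - p).
    by apply/rowP => i; rewrite !mxE; ring.
  rewrite /D; move: (x - p) (y - p) => a b.
  by rewrite dotBl !dotBr !dotZl !dotZr (dotC b a); lra.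
rewrite leNgt; apply/negP => D0.
set N := dot (y - p) (y - p) in H.
have N0 : 0 <= N by exact: dotxx_ge0.
(* Small enough for the linear term [2 * t * D] to beat the quadratic term [t ^+ 2 * N], a
   contradiction if [D] is positive. *)
pose t := Num.min 1 (D / (N + 1)).
have N1 : 0 < N + 1 by rewrite ltr_wpDl.
have t0 : 0 < t by rewrite lt_min ltr01 divr_gt0.
have t1 : t <= 1 by rewrite ge_min lexx.
have tD : t * (N + 1) <= D by rewrite -ler_pdivlMr// ge_min lexx orbT.
have := H t; rewrite (ltW t0) t1 => /(_ isT); nra.
Qed.

Lemma nearest_uniq x q : polytope v q -> (forall i, dot (x - q) (v i - q) <= 0) -> nearest x = q.
Proof.
move=> vq h; set p := nearest x.
have h1 : dot (x - p) (q - p) <= 0 by exact: nearest_dot.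
have h2 : dot (x - q) (p - q) <= 0.
  rewrite dotBr subr_le0; apply: (polytope_dot_le (nearest_polytope x)) => i.
  by rewrite -subr_le0 -dotBr.
have : dot (p - q) (p - q) <= 0.
  have -> : dot (p - q) (p - q) = dot (x - p) (q - p) + dot (x - q) (p - q).
    by rewrite !dotBl !dotBr; ring.
  by rewrite -[leRHS]addr0 lerD.
move=> h3; apply/eqP; rewrite -subr_eq0; apply/eqP; apply: dotxx_eq0.
by apply/eqP; rewrite eq_le h3 dotxx_ge0.
Qed.

Lemma nearest_lip x y : enorm (nearest x - nearest y) <= enorm (x - y).
Proof.
set p := nearest x; set q := nearest y.
have h1 : dot (x - p) (q - p) <= 0 by exact/nearest_dot/nearest_polytope.
have h2 : dot (y - q) (p - q) <= 0 by exact/nearest_dot/nearest_polytope.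
have h3 : dot (p - q) (p - q) <= dot (x - y) (p - q).
  have -> : dot (x - y) (p - q) = dot (p - q) (p - q) - dot (x - p) (q - p) - dot (y - q) (p - q).
    by rewrite !dotBl !dotBr; ring.
  lra.
have := le_trans h3 (dot_le_enorm _ _); rewrite -enorm_sqr expr2.
have [->|pq] := eqVneq (enorm (p - q)) 0; first by rewrite enorm_ge0.
by rewrite ler_pM2r// lt0r pq enorm_ge0.
Qed.

Lemma continuous_nearest i : continuous (fun x => nearest x ord0 i).
Proof.
apply: lip_continuous => x y.
have -> : nearest x ord0 i - nearest y ord0 i = (nearest x - nearest y) ord0 i by rewrite !mxE.
exact: le_trans (coord_le_enorm _ _) (nearest_lip _ _).
Qed.

Lemma parallel_nearest lam : parallel (polytope v) lam = [set x | enorm (x - nearest x) <= lam].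
Proof.
apply/seteqP; split => x; last by move=> h; exists (nearest x) => //; exact: nearest_polytope.
by move=> [c vc h]; apply: le_trans h; exact: nearest_min.
Qed.

Lemma continuous_subr_nearest i : continuous (fun x : 'rV[R]_n => (x - nearest x) ord0 i).
Proof.
have -> : (fun x : 'rV[R]_n => (x - nearest x) ord0 i) = fun y : 'rV[R]_n => y ord0 i - nearest y ord0 i.
  by apply/funext => y; rewrite !mxE.
by move=> x; apply: continuousB; [exact: coord_continuous|exact: continuous_nearest].
Qed.

Lemma parallel_closed lam : closed (parallel (polytope v) lam).
Proof.
rewrite parallel_nearest; apply: closed_le_continuous; apply: continuous_enorm.
exact: continuous_subr_nearest.
Qed.

Lemma parallel0 : parallel (polytope v) 0 = polytope v.
Proof.
apply/seteqP; split => x; last by move=> h; exists x => //; rewrite subrr enorm0.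
move=> [c vc h]; have /enorm0_eq0/eqP : enorm (x - c) = 0.
  by apply/eqP; rewrite eq_le h enorm_ge0.
by rewrite subr_eq0 => /eqP ->.
Qed.

(** The vertices on the supporting hyperplane at the nearest point with normal [x - nearest x], that
    is, the vertices of the face whose normal cone contains [x - nearest x]. Its finitely many
    values cut space into the pieces of the Steiner formula. *)
Definition active x : {set 'I_m.+1} := [set i | dot (x - nearest x) (v i - nearest x) == 0]%SET.

Lemma active_borel S : rv_borel (active @^-1` [set S]).
Proof.
have c i : continuous (fun x : 'rV[R]_n => dot (x - nearest x) (v i - nearest x)).
  apply: continuous_dot => j; first exact: continuous_subr_nearest.
  have -> : (fun x : 'rV[R]_n => (v i - nearest x) ord0 j) = fun y : 'rV[R]_n => v i ord0 j - nearest y ord0 j.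
    by apply/funext => y; rewrite !mxE.
  by move=> x; apply: continuousB; [exact: cst_continuous|exact: continuous_nearest].
have -> : active @^-1` [set S] = \bigcap_(i in [set: 'I_m.+1])
   (if i \in S then [set x | dot (x - nearest x) (v i - nearest x) = 0] else
    ~` [set x | dot (x - nearest x) (v i - nearest x) = 0]).
  apply/seteqP; split => x /=.
    by move=> <- i _; rewrite inE; case: ifPn => /eqP.
  move=> h; apply/setP => i; rewrite inE; have := h i I; case: (i \in S) => [->|]; first by rewrite eqxx.
  by move/eqP/negPf.
rewrite rv_borelE; apply: fin_bigcap_measurable => [|i _]; first exact: finite_finset.
have b : measurable ([set x | dot (x - nearest x) (v i - nearest x) = 0] : set (borelT R n)).
  by apply: closed_rv_borel; apply: closed_eq_continuous.
by case: ifP => _ //; exact: measurableC.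
Qed.

(** Complementary slackness: the weighted sum of the nonpositive numbers
    [dot (x - nearest x) (v j - nearest x)] is 0, so the weight vanishes wherever the number does
    not. *)
Lemma nearest_face x : exists w : 'I_m.+1 -> R, [/\ forall i, i \notin active x -> w i = 0,
  \sum_i w i = 1 & nearest x = \sum_i w i *: v i].
Proof.
have [w [w0 w1 pE]] := nearest_polytope x; exists w; split => // i.
rewrite inE => di; apply/eqP.
have : \sum_j w j * dot (x - nearest x) (v j - nearest x) = 0.
  transitivity (dot (x - nearest x) (\sum_j w j *: (v j - nearest x))).
    by rewrite dot_sumr; apply: eq_bigr => j _; rewrite dotZr.
  under eq_bigr do rewrite scalerBr.
  by rewrite sumrB -pE -scaler_suml w1 scale1r subrr dotC dot0l.
move/eqP; rewrite -oppr_eq0 -sumrN psumr_eq0 => [/allP/(_ i)|j _].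
  rewrite mem_index_enum => /(_ isT) /=; rewrite oppr_eq0 mulf_eq0 (negPf di) orbF//.
by rewrite -mulrN mulr_ge0// oppr_ge0; apply: nearest_dot; exact: polytope_vertex.
Qed.

Lemma nearest_scale x lam : 0 < lam ->
  nearest (nearest x + lam *: (x - nearest x)) = nearest x.
Proof.
move=> l0; apply: nearest_uniq => [|i]; first exact: nearest_polytope.
rewrite addrC addKr dotZl pmulr_rle0//; apply: nearest_dot; exact: polytope_vertex.
Qed.

Lemma active_scale x lam : 0 < lam ->
  active (nearest x + lam *: (x - nearest x)) = active x.
Proof.
move=> l0; apply/setP => i; rewrite !inE nearest_scale// addrC addKr dotZl.
by rewrite mulf_eq0 gt_eqF.
Qed.

End Nearest.
End Polytope.

(** * The Steiner polynomial of a polytope *)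

Section SteinerPolynomial.
Variable R : realType.

(** The orthogonal projection onto the row space, written with the inverse Gram matrix of a row
    basis. *)
Lemma orth_projection_ex n k (A : 'M[R]_(k, n)) : exists P : 'M[R]_n, P *m P = P /\
  (forall u : 'rV[R]_n, u *m A^T = 0 -> u *m P = 0) /\
  (forall u : 'rV[R]_n, (u <= A)%MS -> u *m P = u).
Proof.
pose B := row_base A; pose G := B *m B^T.
have uG : G \in unitmx.
  rewrite -row_free_unit -kermx_eq0; apply/rowV0P => y /sub_kermxP yG.
  have : dot (y *m B) (y *m B) = 0.
    have : (y *m B) *m (y *m B)^T = 0 by rewrite trmx_mul mulmxA -(mulmxA y) yG mul0mx.
    by rewrite dot_mx => /matrixP/(_ ord0 ord0); rewrite !mxE eqxx.
  move/dotxx_eq0 => yB; apply: (row_free_inj (row_base_free A)).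
  by rewrite mul0mx.
exists (B^T *m invmx G *m B); split.
  have -> : B^T *m invmx G *m B *m (B^T *m invmx G *m B) = B^T *m invmx G *m G *m (invmx G *m B).
    by rewrite !mulmxA.
  by rewrite mulmxKV// mulmxA.
split => u.
  move=> uA; have -> : B = B *m pinvmx A *m A by rewrite mulmxKpV// eq_row_base.
  by rewrite trmx_mul !mulmxA uA !mul0mx.
rewrite -(eq_row_base A) => /submxP[y ->].
have -> : y *m row_base A *m (B^T *m invmx G *m B) = y *m G *m invmx G *m B.
  by rewrite /G !mulmxA.
by rewrite mulmxK.
Qed.

(* [lam] is the dilation factor orthogonally to the face spanned by [P] *)
Definition face_dilation n (P : 'M[R]_n) (lam : R) : 'M[R]_n := P + lam *: (1%:M - P).

Lemma face_dilation_det_poly n (P : 'M[R]_n) : exists q : {poly R},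
  (size q <= n.+1)%N /\ forall lam, q.[lam] = \det (face_dilation P lam).
Proof.
pose M : 'M[{poly R}]_n := \matrix_(i, j) ((P i j)%:P + (((i == j)%:R - P i j) *: 'X)).
exists (\det M); split; last first.
  move=> lam; rewrite -horner_evalE -det_map_mx; congr (\det _).
  apply/matrixP => i j; rewrite !mxE /= horner_evalE hornerD hornerC hornerZ hornerX.
  by rewrite mulrC.
rewrite /determinant; apply: (leq_trans (size_sum _ _ _)); apply/bigmax_leqP => s _.
rewrite size_Msign.
apply: (leq_trans (size_prod_leq _ _)).
have H i : (size (M i (s i)) <= 2)%N.
  rewrite mxE; apply: (leq_trans (size_polyD _ _)); rewrite geq_max.
  rewrite (leq_trans (size_polyC_leq1 _))//=.
  by apply: (leq_trans (size_scale_leq _ _)); rewrite size_polyX.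
rewrite leq_subLR; apply: leq_ltn_trans (leq_sum _ (fun i _ => H i)) _ => //.
rewrite sum_nat_const card_ord muln2 -addnn addnS ltnS leq_add2r.
exact: leqnn.
Qed.

Lemma face_dilation_mul n (P : 'M[R]_n) a b : P *m P = P ->
  face_dilation P a *m face_dilation P b = face_dilation P (a * b).
Proof.
move=> PP; have h : P *m (1%:M - P) = 0 by rewrite mulmxBr mulmx1 PP subrr.
have h' : (1%:M - P) *m P = 0 by rewrite mulmxBl mul1mx PP subrr.
have hh : (1%:M - P) *m (1%:M - P) = 1%:M - P by rewrite mulmxBl mul1mx h subr0.
rewrite /face_dilation mulmxDl !mulmxDr PP -!scalemxAr -!scalemxAl h h' hh !scaler0.
by rewrite addr0 add0r scalerA mulrC.
Qed.

(** Dilations with the same [P] multiply like their factors, so the determinant is the square of the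
    one for [Num.sqrt a], which is nonzero because that dilation is invertible. *)
Lemma face_dilation_det_gt0 n (P : 'M[R]_n) a : P *m P = P -> 0 < a -> 0 < \det (face_dilation P a).
Proof.
move=> PP a0; have {1}-> : a = Num.sqrt a * Num.sqrt a by rewrite -expr2 sqr_sqrtr// ltW.
rewrite -(face_dilation_mul _ _ PP) det_mulmx -expr2 lt0r sqr_ge0 sqrf_eq0 andbT.
have : \det (face_dilation P (Num.sqrt a)) * \det (face_dilation P (Num.sqrt a)^-1) = 1.
  rewrite -det_mulmx (face_dilation_mul _ _ PP) mulfV ?gt_eqF ?sqrtr_gt0//.
  by rewrite /face_dilation scale1r subrKC det1.
by move=> h; apply: contra_eq_neq h => ->; rewrite mul0r eq_sym oner_neq0.
Qed.

Section Parallel.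
Variables (n m : nat) (v : 'I_m.+1 -> 'rV[R]_n).
Let C := polytope v.

Lemma parallel_bounded lam : exists r : R, parallel C lam `<=` [set x | enorm x <= r].
Proof.
exists (\sum_i enorm (v i) + lam) => x [c Cc xc] /=.
have -> : x = c + (x - c) by rewrite addrC subrK.
apply: le_trans (enorm_triangle _ _) _; apply: lerD => //.
apply: (polytope_enorm_le Cc) => i; rewrite (bigD1 i)//= lerDl sumr_ge0// => j _.
exact: enorm_ge0.
Qed.

Lemma vol_parallel_fin lam : (vol (parallel C lam) < +oo)%E.
Proof.
have [r h] := parallel_bounded lam.
by apply: le_lt_trans (eball_vol_lt_pinfty h) (ltry _).
Qed.

(** On the piece with active set [S], multiplying the normal part [x - nearest x] by [lam] is an
    affine map whose linear part fixes the directions of the face and dilates the orthogonal ones.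
    It maps the piece of radius 1 onto the piece of radius [lam], so volumes differ by a determinant
    polynomial in [lam]. *)
Lemma active_part_scale S : exists q : {poly R}, (size q <= n.+1)%N /\
  forall lam, 0 < lam ->
  vol (parallel C lam `&` @active _ _ _ v @^-1` [set S]) = (q.[lam])%:E.
Proof.
pose E := @active _ _ _ v @^-1` [set S].
(* The empty active set does not occur: the weights of the nearest point live on the active vertices
   and sum to 1. *)
have [S0|/set0Pn[i0 i0S]] := eqVneq S finset.set0.
  exists 0; split; first by rewrite size_poly0.
  move=> lam _; rewrite horner0 [X in vol X](_ : _ = set0) ?vol_set0//.
  apply/seteqP; split => x //= -[_ xS].
  have [w [w0 w1 _]] := nearest_face v x.
  move: w1; rewrite big1 => [/eqP|i _]; first by rewrite eq_sym oner_eq0.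
  by apply: w0; rewrite xS S0 inE.
pose A : 'M[R]_(m.+1, n) := \matrix_i (if i \in S then v i - v i0 else 0).
have [P [PP [P0 P1]]] := orth_projection_ex A.
have rA i : row i A = if i \in S then v i - v i0 else 0 by rewrite rowK.
have [q [sq qE]] := face_dilation_det_poly P.
pose c := fine (vol (parallel C 1 `&` E)).
have cE : vol (parallel C 1 `&` E) = c%:E.
  rewrite fineK// ge0_fin_numE ?vol_ge0//; apply: le_lt_trans (vol_parallel_fin 1).
  by apply: le_vol => x [].
exists (c *: q); split; first exact: leq_trans (size_scale_leq _ _) sq.
move=> lam l0.
(* [x - p] is orthogonal to the face and [p - v i0] lies in its direction space, so [P] kills the
   first and fixes the second. *)
have key x : E x -> nearest v x + lam *: (x - nearest v x) = (x - v i0) *m face_dilation P lam + v i0.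
  move=> Ex; set p := nearest v x.
  have h1 : (x - p) *m P = 0.
    apply: P0; apply/rowP => i; rewrite [RHS]mxE.
    have -> : ((x - p) *m A^T) ord0 i = dot (x - p) (row i A).
      by rewrite mxE; apply: eq_bigr => j _; rewrite !mxE.
    rewrite rA; case: ifP => [iS|_]; last by rewrite dotC dot0l.
    have d j : j \in S -> dot (x - p) (v j - p) = 0.
      by rewrite -Ex inE => /eqP.
    have -> : v i - v i0 = (v i - p) - (v i0 - p) by rewrite opprB addrA subrK.
    by rewrite dotBr !d// subr0.
  have h2 : (p - v i0) *m P = p - v i0.
    apply: P1; have [w [w0 w1 pE]] := nearest_face v x.
    have -> : p - v i0 = \sum_i w i *: row i A.
      rewrite -[v i0]scale1r -w1 scaler_suml [p]pE -sumrB; apply: eq_bigr => i _.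
      rewrite -scalerBr rA; case: ifPn => // iS.
      by rewrite w0 ?scale0r// Ex.
    by apply: summx_sub => i _; apply: scalemx_sub; exact: row_sub.
  have -> : x - v i0 = (x - p) + (p - v i0) by rewrite addrA subrK.
  rewrite mulmxDl /face_dilation !mulmxDr h1 h2 -!scalemxAr !mulmxBr !mulmx1 h1 h2 subrr scaler0.
  by rewrite add0r !subr0 addr0 -addrA subrK addrC.
have im : parallel C lam `&` E = [set y + v i0 | y in
     mximg (face_dilation P lam) [set z - v i0 | z in parallel C 1 `&` E]].
  apply/seteqP; split => x.
    rewrite parallel_nearest => -[xl Ex].
    pose y := nearest v x + lam^-1 *: (x - nearest v x).
    have li : 0 < lam^-1 by rewrite invr_gt0.
    have Ey : E y by rewrite /E /= active_scale.
    have ny : nearest v y = nearest v x by exact: nearest_scale.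
    exists ((y - v i0) *m face_dilation P lam).
      exists (y - v i0) => //; exists y => //; split => //.
      rewrite parallel_nearest /= ny /y addrC addKr enormZ gtr0_norm//.
      by rewrite mulrC ler_pdivrMr// mul1r.
    have yE : y - nearest v x = lam^-1 *: (x - nearest v x) by rewrite /y addrC addKr.
    by rewrite -key// ny yE scalerA mulfV ?gt_eqF// scale1r addrC subrK.
  move=> [_ [_ [y [yl Ey] <-] <-] <-]; rewrite -key//; split; last by rewrite /E /= active_scale.
  move: yl; rewrite !parallel_nearest /= nearest_scale// => yl.
  by rewrite addrC addKr enormZ gtr0_norm// ler_piMr// ltW.
have d0 := face_dilation_det_gt0 PP l0.
rewrite -/E im vol_shift vol_mximg ?unitmxE ?unitfE ?gt_eqF//.
by rewrite vol_shift cE gtr0_norm// -EFinM hornerZ qE mulrC.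
Qed.

(** The pieces add up for positive radii. Radius 0 is the limit of the radii [1 / k.+1], by
    continuity of the measure from above and of the polynomial. *)
Lemma steiner_poly_ex : exists q : {poly R}, (size q <= n.+1)%N /\
  forall lam, 0 <= lam -> vol (parallel C lam) = (q.[lam])%:E.
Proof.
have [Q hQ] := choice (fun S => active_part_scale S).
pose q := \sum_S Q S.
have qE lam : 0 < lam -> vol (parallel C lam) = (q.[lam])%:E.
  move=> l0; rewrite (vol_partition _ (active_borel v)) horner_sum -sumEFin.
  by apply: eq_bigr => S _; have [_ ->] := hQ S.
exists q; split.
  by apply: (leq_trans (size_sum _ _ _)); apply/bigmax_leqP => S _; case: (hQ S).
move=> lam; rewrite le_eqVlt => /orP[/eqP<-|]; last exact: qE.
pose F k := parallel C k.+1%:R^-1.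
have F0 : \bigcap_k F k = parallel C 0.
  apply/seteqP; split => x; rewrite /F; last first.
    move=> [c Cc xc] k _; exists c => //; apply: le_trans xc _.
    by rewrite invr_ge0.
  rewrite parallel_nearest => h; rewrite /= leNgt; apply/negP => x0.
  have := h (Num.truncn (enorm (x - nearest v x))^-1) I; rewrite parallel_nearest /= leNgt => /negP; apply.
  by rewrite invf_plt ?posrE//; exact: truncnS_gt.
have c1 : vol (F k) @[k --> \oo] --> vol (parallel C 0).
  rewrite -F0; apply: vol_decreasing_cvg.
  - by move=> k; apply: closed_rv_borel; exact: parallel_closed.
  - exact: vol_parallel_fin.
  - move=> i j ij x [c Cc xc]; exists c => //; apply: le_trans xc _.
    by rewrite lef_pV2 ?posrE ?ltr0n// ler_nat.
have c2 : vol (F k) @[k --> \oo] --> (q.[0])%:E.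
  have -> : (fun k => vol (F k)) = (fun k => (q.[k.+1%:R^-1])%:E).
    by apply/funext => k; rewrite /F qE// invr_gt0 ltr0n.
  apply: cvg_EFin; first exact: nearW.
  rewrite (_ : fine \o _ = horner q \o harmonic)//.
  apply: (cvg_comp _ _ (@cvg_harmonic R)); exact: continuous_horner.
by have := cvg_unique _ c1 c2; apply; exact: ereal_hausdorff.
Qed.

(** Ensures that the [xget] in [ivol] picks genuine Steiner coefficients for polytopes. *)
Lemma steiner_ex : exists c, steiner C c.
Proof.
have [q [sq qE]] := steiner_poly_ex.
exists (\row_k (q`_(n - k) / kappa R (n - k))) => lam l0.
rewrite qE//; congr (_%:E); rewrite (horner_coef_wide _ sq).
rewrite [RHS](reindex_inj rev_ord_inj)/=; apply: eq_bigr => i _.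
rewrite mxE /= subSS subKn; last by rewrite -ltnS.
by rewrite -mulrA [kappa _ _ * _]mulrC divfK ?gt_eqF ?kappa_gt0// mulrC.
Qed.

End Parallel.

(** Interpolation nodes in ]0, 1]: being at most 1, they only involve parallel bodies that stay in a
    fixed ball. *)
Definition node n (j : 'I_n.+1) : R := j.+1%:R / n.+1%:R.

Lemma node_itv n (j : 'I_n.+1) : 0 < node j <= 1.
Proof. by rewrite divr_gt0//= ler_pdivrMr// mul1r ler_nat ltn_ord. Qed.

(** The inverse Vandermonde matrix turns bounds or limits for the values at the nodes into bounds or
    limits for the coefficients. *)
Lemma poly_interpolation n : exists W : 'M[R]_n.+1, forall (q : {poly R}) (k : 'I_n.+1),
  (size q <= n.+1)%N -> q`_k = \sum_j q.[node j] * W j k.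
Proof.
pose a : 'rV[R]_n.+1 := \row_j node j.
pose V := Vandermonde n.+1 a.
have uV : V \in unitmx.
  rewrite unitmxE det_Vandermonde unitfE; apply/prodf_neq0 => i _; apply/prodf_neq0 => j ij.
  rewrite !mxE subr_eq0 gt_eqF// /node ltr_pM2r ?invr_gt0 ?ltr0n// ltr_nat ltnS//.
exists (invmx V) => q k sq.
have -> : \sum_j q.[node j] * invmx V j k = (((\row_i q`_i) *m V) *m invmx V) ord0 k.
  rewrite [RHS]mxE; apply: eq_bigr => j _; congr (_ * _).
  rewrite (horner_coef_wide _ sq) mxE; apply: eq_bigr => i _.
  by rewrite !mxE.
by rewrite mulmxK// mxE.
Qed.

(** The constant does not depend on the number of vertices. The Steiner polynomial is bounded at the
    nodes by the volume of a cube, hence its coefficients are bounded by interpolation; for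
    [eta <= 1] all nonconstant terms are then at most a constant times [eta]. *)
Lemma vol_parallel_lip n (r : R) : exists2 K : R, 0 <= K & forall m (v : 'I_m.+1 -> 'rV[R]_n) (eta : R),
  (forall i, enorm (v i) <= r) -> 0 <= eta <= 1 ->
  (vol (parallel (polytope v) eta) <= vol (polytope v) + (K * eta)%:E)%E.
Proof.
have [W hW] := poly_interpolation n.
pose B := \prod_(i < n) (2 * `|r + 1|).
have B0 : 0 <= B by apply: prodr_ge0.
pose K := \sum_(k < n.+1) \sum_(j < n.+1) B * `|W j k|.
have K0 k : 0 <= \sum_(j < n.+1) B * `|W j k| by apply: sumr_ge0 => j _; rewrite mulr_ge0.
exists K; first by apply: sumr_ge0.
move=> m v eta hv /andP[e0 e1].
have [q [sq qE]] := steiner_poly_ex v.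
have -> : vol (polytope v) = (q.[0])%:E by rewrite -qE// parallel0.
rewrite qE// -EFinD lee_fin.
have qB (j : 'I_n.+1) : `|q.[node j]| <= B.
  have /andP[j0 j1] := node_itv j.
  have q0 : 0 <= q.[node j] by rewrite -lee_fin -qE ?vol_ge0// ltW.
  have j2 := ltW j0; rewrite ger0_norm// -lee_fin -qE// /B; apply: (eball_vol_lt_pinfty (r := r + 1)) => x [c vc xc] /=.
  have -> : x = c + (x - c) by rewrite addrC subrK.
  apply: le_trans (enorm_triangle _ _) _; apply: lerD; last exact: le_trans xc j1.
  exact: polytope_enorm_le vc hv.
rewrite (horner_coef_wide _ sq) (horner_coef_wide _ sq) -lerBlDl -sumrB mulr_suml.
apply: ler_sum => k _; rewrite -mulrBr.
apply: le_trans (ler_norm _) _; rewrite normrM; apply: ler_pM => //.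
  rewrite (hW q k sq); apply: le_trans (ler_norm_sum _ _ _) _; apply: ler_sum => j _.
  by rewrite normrM ler_wpM2r.
case: k => -[|k] /= _; first by rewrite !expr0 subrr normr0.
by rewrite [0 ^+ _]expr0n subr0 ger0_norm ?exprn_ge0// exprS ler_piMr// exprn_ile1.
Qed.

End SteinerPolynomial.

(** * Parallel bodies of segments *)

Section Segment.
Variable R : realType.

(** The lower bound follows from the upper bound of [cylinder_vol_le] for the complement of [B] in a
    box [D], as the volume over [D] is known exactly. *)
Lemma cylinder_vol n (a b : R) (B : set 'rV[R]_n) r : a <= b -> rv_borel B ->
  B `<=` [set x | enorm x <= r] -> vol (cylinder a b B) = ((b - a)%:E * vol B)%E.
Proof.
move=> ab bB Br.
have fv (A : set 'rV[R]_n) : A `<=` B -> vol A \is a fin_num.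
  move=> AB; rewrite ge0_fin_numE ?vol_ge0//.
  by apply: le_lt_trans (eball_vol_lt_pinfty (subset_trans AB Br)) (ltry _).
pose D : 'rV[R]_n * 'rV[R]_n := (const_mx (- `|r|), const_mx `|r|).
have Dok i : D.1 ord0 i <= D.2 ord0 i by rewrite !mxE (@le_trans _ _ 0)// oppr_le0.
have BD : B `<=` box D.
  move=> x /Br /= xr i; rewrite !mxE -ler_norml; apply: le_trans (coord_le_enorm _ _) _.
  exact: le_trans xr (ler_norm _).
have vD := vol_box Dok.
have fDB : vol (box D `\` B) \is a fin_num.
  rewrite ge0_fin_numE ?vol_ge0//; apply: le_lt_trans (ltry (boxvol D)); rewrite -vD.
  by apply: le_vol => x [].
have cD : vol (cylinder a b (box D)) = ((b - a) * boxvol D)%:E.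
  rewrite -box_row_mx vol_box => [|i]; first by rewrite boxvol_row_mx.
  by case: (split_ordP i) => j ->; rewrite /= ?row_mxEl ?row_mxEr !mxE//; have := normr_ge0 r; lra.
have DB : boxvol D = fine (vol B) + fine (vol (box D `\` B)).
  apply: EFin_inj; rewrite EFinD (fineK fDB) (fineK (fv _ (@subset_refl _ B))).
  rewrite -[LHS]vD (vol_split (box D) bB); congr (_ + _)%E; congr vol.
  by apply/seteqP; split => [x []//|x Bx]; split => //; exact: BD.
have up (A : set 'rV[R]_n) : vol A \is a fin_num -> (vol (cylinder a b A) <= ((b - a) * fine (vol A))%:E)%E.
  by move=> fA; apply: cylinder_vol_le => //; rewrite fineK.
have u1 := up B (fv _ (@subset_refl _ B)); have u2 := up _ fDB.
have fc : vol (cylinder a b B) \is a fin_num.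
  by rewrite ge0_fin_numE ?vol_ge0//; apply: le_lt_trans u1 (ltry _).
have fc2 : vol (cylinder a b (box D `\` B)) \is a fin_num.
  by rewrite ge0_fin_numE ?vol_ge0//; apply: le_lt_trans u2 (ltry _).
have sub : (vol (cylinder a b (box D)) <= vol (cylinder a b B) + vol (cylinder a b (box D `\` B)))%E.
  apply: le_trans (outer_measureU2 _ _ _); apply: le_vol => x [x0 xD].
  by have [?|?] := pselect (B (rsubmx x)); [left|right].
rewrite -(fineK (fv _ (@subset_refl _ B))) -EFinM -(fineK fc); congr (_%:E).
move: u1 u2 sub; rewrite cD -(fineK fc) -(fineK fc2) -EFinD !lee_fin DB => u1 u2 sub.
by apply/eqP; rewrite eq_le u1/=; move: sub; rewrite mulrDr; lra.
Qed.

Definition eball n (r : R) : set 'rV[R]_n := [set x | enorm x <= r].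

Lemma eball_borel n r : rv_borel (@eball n r).
Proof.
apply: closed_rv_borel; apply: closed_le_continuous; apply: continuous_enorm => i.
exact: coord_continuous.
Qed.

Lemma vol_scale n (a : R) (A : set 'rV[R]_n) : 0 < a ->
  vol [set (a *: x)%R | x in A] = ((a ^+ n)%:E * vol A)%E.
Proof.
move=> a0; have -> : [set a *: x | x in A] = mximg a%:M A.
  by rewrite /mximg; apply: eq_imagel => x _; rewrite mul_mx_scalar.
rewrite vol_mximg ?det_scalar; last by rewrite unitmxE det_scalar unitfE expf_neq0// gt_eqF.
by rewrite gtr0_norm// exprn_gt0.
Qed.

Lemma vol_eball n r : 0 < r -> vol (@eball n r) = (r ^+ n * kappa R n)%:E.
Proof.
move=> r0; have -> : @eball n r = [set r *: x | x in [set x : 'rV[R]_n | enorm x <= 1]].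
  apply/seteqP; split => [x xr|_ [x x1 <-]]; last first.
    by rewrite /eball /= enormZ gtr0_norm// ler_piMr// ltW.
  exists (r^-1 *: x); last by rewrite scalerA mulfV ?gt_eqF// scale1r.
  by rewrite /= enormZ gtr0_norm ?invr_gt0// mulrC ler_pdivrMr// mul1r.
by rewrite vol_scale// kappa_vol EFinM.
Qed.

Definition segment n (u : 'rV[R]_n) : set 'rV[R]_n := [set t *: u | t in `[0, 1]%classic].

Section Axis.
Variables (n : nat) (l : R).
Hypothesis l0 : 0 < l.
Let e0 : 'rV[R]_(1 + n) := row_mx (const_mx 1) 0.
Let x0 (x : 'rV[R]_(1 + n)) := x ord0 (lshift n ord0).

Let sqE (x : 'rV[R]_(1 + n)) : dot x x = x0 x ^+ 2 + dot (rsubmx x) (rsubmx x).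
Proof.
rewrite /dot big_split_ord/= big_ord1 -expr2; congr (_ + _).
by apply: eq_bigr => i _; rewrite mxE.
Qed.

Let x0B (x : 'rV[R]_(1 + n)) t : x0 (x - (t *: (l *: e0))) = x0 x - t * l.
Proof. by rewrite /x0 /e0 !mxE; case: splitP => // j _; rewrite !mxE mulr1. Qed.

Let rB (x : 'rV[R]_(1 + n)) t : rsubmx (x - (t *: (l *: e0))) = rsubmx x.
Proof. by rewrite linearB/= scalerA linearZ/= row_mxKr scaler0 subr0. Qed.

(** The parallel body is a capsule: cutting at the abscissas 0 and [l] leaves a cylinder and two
    half-balls, which together make a ball because the cutting hyperplane is null. *)
Lemma vol_parallel_axis lam : 0 < lam ->
  vol (parallel (segment (l *: e0)) lam) =
  (lam ^+ n.+1 * kappa R n.+1 + l * (lam ^+ n * kappa R n))%:E.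
Proof.
move=> lam0; set P := parallel _ _.
have lel (x y : 'rV[R]_(1 + n)) : (enorm x <= enorm y) = (dot x x <= dot y y).
  by rewrite -(ler_pXn2r (n := 2)) ?nnegrE ?enorm_ge0// !enorm_sqr.
have leln k (x : 'rV[R]_k) : (enorm x <= lam) = (dot x x <= lam ^+ 2).
  by rewrite -(ler_pXn2r (n := 2)) ?nnegrE ?enorm_ge0 ?(ltW lam0)// enorm_sqr.
have PE (x : 'rV[R]_(1 + n)) : P x <-> exists2 t, 0 <= t <= 1 &
    (x0 x - t * l) ^+ 2 + dot (rsubmx x) (rsubmx x) <= lam ^+ 2.
  split => [[_ [t t01 <-]]|[t t01 h]].
    by rewrite leln sqE x0B rB => h; exists t => //; rewrite in_itv in t01.
  by exists (t *: (l *: e0)); [exists t => //; rewrite /= in_itv|rewrite leln sqE x0B rB].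
have neg : rv_borel [set x : 'rV[R]_(1 + n) | x0 x < 0].
  rewrite rv_borelE -[X in measurable X]setCK; apply: measurableC; apply: closed_rv_borel.
  have -> : ~` [set x : 'rV[R]_(1 + n) | x0 x < 0] = [set x : 'rV[R]_(1 + n) | - x0 x <= 0].
    by apply/seteqP; split => x /=; rewrite oppr_le0 leNgt => /negP.
  by apply: closed_le_continuous => x; apply: continuousN; exact: coord_continuous.
have le_l t : rv_borel [set x : 'rV[R]_(1 + n) | x0 x <= t].
  by apply: closed_rv_borel; apply: closed_le_continuous; exact: coord_continuous.
have ball : vol (@eball (1 + n) lam) = (vol (@eball (1 + n) lam `&` [set x | (x0 x < 0)%R]) +
    vol (@eball (1 + n) lam `&` [set x | (0 < x0 x)%R]))%E.
  rewrite (vol_split _ neg); congr (_ + _)%E.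
  rewrite (vol_split _ (le_l 0)) (_ : vol (_ `&` _) = 0%E) ?add0e.
    congr vol; apply/seteqP; split => x /=.
      by move=> [[h _] /negP]; rewrite -ltNge.
    move=> [h x00]; split; last by apply/negP; rewrite -ltNge.
    by split => //; apply/negP; rewrite -leNgt ltW.
  apply/eqP; rewrite eq_le vol_ge0 andbT.
  rewrite -(@vol_hyperplane R (1 + n) e0).
    apply: le_vol => x /= [[_ /negP]]; rewrite -leNgt => a b.
    have xx : x0 x = 0 by apply/eqP; rewrite eq_le a b.
    rewrite -[x]hsubmxK /e0 tr_row_mx mul_row_col trmx0 mulmx0 addr0.
    apply/matrixP => i j; rewrite !ord1 mxE big_ord1 !mxE mulr1.
    exact: xx.
  apply/eqP => /rowP/(_ (lshift n ord0)); rewrite row_mxEl !mxE => /eqP.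
  by rewrite oner_eq0.
have sh : vol (P `&` [set x | l < x0 x]) = vol (@eball (1 + n) lam `&` [set x | 0 < x0 x]).
  rewrite -[RHS](vol_shift (l *: e0)); congr vol; apply/seteqP; split => x /=.
    move=> [/PE[t /andP[t0 t1] h] lx]; exists (x - l *: e0); last by rewrite subrK.
    have e : x - l *: e0 = x - 1 *: (l *: e0) by rewrite scale1r.
    rewrite /eball /= e x0B mul1r leln sqE x0B rB mul1r subr_gt0; split => //.
    apply: le_trans h; rewrite lerD2r.
    have : t * l <= l by rewrite ler_piMl// ltW.
    nra.
  move=> [y [yl y0] <-].
  have yE : y = (y + l *: e0) - 1 *: (l *: e0) by rewrite scale1r addrK.
  have y1 : x0 (y + l *: e0) - l = x0 y by rewrite {2}yE x0B mul1r.
  split; last by rewrite -subr_gt0 y1.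
  apply/PE; exists 1; first by rewrite ler01 lexx.
  have y2 : rsubmx (y + l *: e0) = rsubmx y by rewrite -(rB (y + l *: e0) 1) scale1r addrK.
  by move: yl; rewrite /eball /= leln sqE mul1r y1 y2.
have lt : P `&` [set x | x0 x < 0] = @eball (1 + n) lam `&` [set x | x0 x < 0].
  apply/seteqP; split => x /= [h xn]; split => //.
    move/PE: h => [t /andP[t0 t1] h]; rewrite /eball /= leln sqE; apply: le_trans h; rewrite lerD2r.
    have : 0 <= t * l by rewrite mulr_ge0// ltW.
    nra.
  apply/PE; exists 0; first by rewrite lexx ler01.
  by move: h; rewrite /eball /= leln sqE mul0r subr0.
have mid : P `&` [set x | 0 <= x0 x <= l] = cylinder 0 l (@eball n lam).
  apply/seteqP; split => x /=.
    move=> [/PE[t _ h] xl]; split => //; rewrite /eball /= leln.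
    by apply: le_trans h; rewrite lerDr sqr_ge0.
  move=> [xl h]; split => //; apply/PE; exists (x0 x / l).
    by case/andP: xl => a b; rewrite (divr_ge0 a (ltW l0))/= ler_pdivrMr// mul1r.
  by rewrite divfK ?gt_eqF// subrr expr0n add0r; move: h; rewrite /eball /= leln.
rewrite (vol_split P neg) (vol_split (P `\` _) (le_l l)) lt.
have -> : (P `\` [set x | x0 x < 0]) `&` [set x | x0 x <= l] = P `&` [set x | 0 <= x0 x <= l].
  apply/seteqP; split => x /=.
    by move=> [[Px /negP]]; rewrite -leNgt => -> ->.
  by move=> [Px /andP[a b]]; split => //; split => //; apply/negP; rewrite -leNgt.
have -> : P `\` [set x | x0 x < 0] `\` [set x | x0 x <= l] = P `&` [set x | l < x0 x].
  apply/seteqP; split => x /=.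
    by move=> [[Px _] /negP]; rewrite -ltNge.
  move=> [Px lx]; split; last by apply/negP; rewrite -ltNge.
  by split => //; apply/negP; rewrite -leNgt (le_trans (ltW l0))// ltW.
rewrite sh mid (cylinder_vol (r := lam)) ?ltW//; last exact: eball_borel.
rewrite vol_eball// subr0 addeC -addeA -EFinM [X in (_ + X)%E]addeC -ball vol_eball//.
by rewrite -EFinD addrC.
Qed.
End Axis.

(** The reflection in the hyperplane orthogonal to [a - b]. *)
Lemma householder n (a b : 'rV[R]_n) : enorm a = enorm b ->
  exists Q : 'M[R]_n, Q *m Q^T = 1%:M /\ a *m Q = b.
Proof.
move=> ab; have [->|nab] := eqVneq a b; first by exists 1%:M; rewrite mulmx1 trmx1 mulmx1.
pose w := a - b.
have ww : dot w w != 0 by apply: contraNneq nab => /dotxx_eq0/eqP; rewrite subr_eq0.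
pose Q : 'M[R]_n := 1%:M - (2 / dot w w) *: (w^T *m w).
have dd : dot a a = dot b b by rewrite -!enorm_sqr ab.
have aw : 2 * dot a w = dot w w.
  by rewrite /w dotBl !dotBr (dotC b a) -dd; ring.
exists Q; split.
  have QT : Q^T = Q by rewrite /Q linearB/= linearZ/= trmx1 trmx_mul trmxK.
  have MM : w^T *m w *m (w^T *m w) = dot w w *: (w^T *m w).
    by rewrite -mulmxA (mulmxA w) dot_mx mul_scalar_mx -scalemxAr.
  rewrite QT /Q mulmxBr mulmx1 -scalemxAr mulmxBl mul1mx -scalemxAl MM scalerBr !scalerA.
  have -> : 2 / dot w w * (2 / dot w w) * dot w w = 2 / dot w w + 2 / dot w w by field.
  by rewrite scalerDl opprB addrK subrK.
rewrite /Q mulmxBr mulmx1 -scalemxAr mulmxA dot_mx mul_scalar_mx scalerA.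
have -> : 2 / dot w w * dot a w = 1 by rewrite mulrAC aw mulfV.
by rewrite scale1r /w subKr.
Qed.

Lemma orth_enorm n (Q : 'M[R]_n) x : Q *m Q^T = 1%:M -> enorm (x *m Q) = enorm x.
Proof.
move=> QQ; rewrite !enormE; congr Num.sqrt.
have : (x *m Q) *m (x *m Q)^T = x *m x^T by rewrite trmx_mul mulmxA -(mulmxA x) QQ mulmx1.
by rewrite !dot_mx => /matrixP/(_ ord0 ord0); rewrite !mxE eqxx.
Qed.

Lemma orth_det n (Q : 'M[R]_n) : Q *m Q^T = 1%:M -> `|\det Q| = 1.
Proof.
move=> /(congr1 (fun M => \det M)); rewrite det_mulmx det_tr det1 -expr2 => h.
by apply/eqP; rewrite -sqrp_eq1// -normrX h normr1.
Qed.

Lemma orth_unit n (Q : 'M[R]_n) : Q *m Q^T = 1%:M -> Q \in unitmx.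
Proof. by case/mulmx1_unit. Qed.

Lemma mximg_parallel n (Q : 'M[R]_n) C lam : Q *m Q^T = 1%:M ->
  mximg Q (parallel C lam) = parallel (mximg Q C) lam.
Proof.
move=> QQ; apply/seteqP; split => [_ [x [c Cc xc] <-]|x [_ [c Cc <-] xc]].
  by exists (c *m Q); [exists c|rewrite -mulmxBl orth_enorm].
have QQ' : Q^T *m Q = 1%:M by exact: mulmx1C.
exists (x *m Q^T); last by rewrite -mulmxA QQ' mulmx1.
exists c => //; rewrite -(orth_enorm _ QQ) mulmxBl -mulmxA QQ' mulmx1.
exact: xc.
Qed.

Lemma vol_parallel_segment n (u : 'rV[R]_n.+1) lam : u != 0 -> 0 < lam ->
  vol (parallel (segment u) lam) =
  (lam ^+ n.+1 * kappa R n.+1 + enorm u * (lam ^+ n * kappa R n))%:E.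
Proof.
move=> u0 lam0; pose e0 : 'rV[R]_(1 + n) := row_mx (const_mx 1) 0.
have nu : 0 < enorm u by rewrite lt0r enorm_ge0 andbT; apply: contraNneq u0 => /enorm0_eq0 ->.
have e1 : enorm e0 = 1.
  rewrite enormE /dot big_split_ord/= big_ord1 row_mxEl mxE mulr1 big1 ?addr0 ?sqrtr1// => i _.
  by rewrite row_mxEr mxE mulr0.
have [Q [QQ uQ]] : exists Q : 'M[R]_(1 + n), Q *m Q^T = 1%:M /\ (enorm u *: e0) *m Q = u.
  by apply: householder; rewrite enormZ e1 mulr1 ger0_norm ?enorm_ge0.
have sE : segment u = mximg Q (segment (enorm u *: e0)).
  apply/seteqP; split => [_ [t t01 <-]|_ [_ [t t01 <-] <-]].
    by exists (t *: (enorm u *: e0)); [exists t|rewrite -scalemxAl uQ].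
  by exists t => //; rewrite -scalemxAl uQ.
rewrite sE -mximg_parallel// vol_mximg ?orth_unit// orth_det// mul1e.
exact: vol_parallel_axis.
Qed.

End Segment.

(** * Convergence of the first intrinsic volume *)

Section FirstIntrinsicVolume.
Variable R : realType.
Variable n : nat.
Notation V := 'rV[R]_n.+1.

Lemma sub_parallel (A B : set V) e l : A `<=` parallel B e -> parallel A l `<=` parallel B (e + l).
Proof.
move=> AB x [a /AB [b Bb ab] xa]; exists b => //.
apply: le_trans (enorm_triangleB _ a _) _; rewrite addrC; exact: lerD.
Qed.

Lemma parallel_scale (a : R) (C : set V) l : 0 < a ->
  parallel [set a *: x | x in C] (a * l) = [set a *: x | x in parallel C l].
Proof.
move=> a0; apply/seteqP; split => [x [_ [c Cc <-] xc]|_ [x [c Cc xc] <-]].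
  exists (a^-1 *: x); last by rewrite scalerA mulfV ?gt_eqF// scale1r.
  exists c => //; move: xc.
  have -> : x - a *: c = a *: (a^-1 *: x - c) by rewrite scalerBr scalerA mulfV ?gt_eqF// scale1r.
  by rewrite enormZ gtr0_norm// ler_pM2l.
exists (a *: c); first by exists c.
by rewrite -scalerBr enormZ gtr0_norm// ler_pM2l.
Qed.

Lemma polytope_scale (a : R) m (v : 'I_m -> V) :
  [set a *: x | x in polytope v] = polytope (fun i => a *: v i).
Proof.
have E (w : 'I_m -> R) : a *: (\sum_i w i *: v i) = \sum_i w i *: (a *: v i).
  by rewrite scaler_sumr; apply: eq_bigr => i _; rewrite !scalerA mulrC.
apply/seteqP; split => [_ [_ [w [w0 w1 ->]] <-]|_ [w [w0 w1 ->]]].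
  by exists w; split.
by exists (\sum_i w i *: v i); [exists w; split|rewrite E].
Qed.

Lemma walk_hull_polytope (Z : nat -> V) k :
  walk_hull Z k = polytope (fun i : 'I_k.+1 => partial_sum Z i).
Proof.
apply: hull_polytope; apply/seteqP; split => [x [j jk ->]|_ [i _ <-]].
  by exists (Ordinal (jk : (j < k.+1)%N)).
by exists i => //; rewrite -ltnS.
Qed.

(** The rescaled hulls [C k] converge to the segment from 0 to [mu], hence so do the volumes of
    their parallel bodies at the nodes. Interpolation carries this to the coefficient that contains
    V_1, and homogeneity of V_1 turns the rescaling into division by [k]. *)
Lemma ivol1_cvg (Z : nat -> V) (mu : V) : mu != 0 ->
  (forall e, 0 < e -> \forall k \near \oo, forall j, (j <= k)%N ->
     enorm (partial_sum Z j - j%:R *: mu) <= e * k%:R) ->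
  ivol 1 (walk_hull Z k) / k%:R @[k --> \oo] --> enorm mu.
Proof.
move=> mu0 hS.
have [W hW] := poly_interpolation R n.+1.
pose l := enorm mu.
(* The Steiner polynomial of the segment from 0 to [mu]; [gp] is the same as a formal polynomial. *)
pose g (x : R) := x ^+ n.+1 * kappa R n.+1 + l * (x ^+ n * kappa R n).
pose gp : {poly R} := kappa R n.+1 *: 'X^(n.+1) + (l * kappa R n) *: 'X^n.
have gpE x : gp.[x] = g x by rewrite hornerD !hornerZ !hornerXn /g; ring.
have sgp : (size gp <= n.+2)%N.
  apply: leq_trans (size_polyD _ _) _; rewrite geq_max.
  by rewrite !(leq_trans (size_scale_leq _ _)) ?size_polyXn.
have ok : (n < n.+2)%N by [].
have gpn : gp`_(Ordinal ok) = l * kappa R n.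
  by rewrite coefD !coefZ !coefXn /= eqxx (ltn_eqF (ltnSn n)) mulr0 add0r mulr1.
pose C k := polytope (fun i : 'I_k.+1 => k%:R^-1 *: partial_sum Z i).
have close e : 0 < e -> \forall k \near \oo, C k `<=` parallel (segment mu) e /\
    segment mu `<=` parallel (C k) e.
  move=> e0; near=> k.
  have k0 : 0 < k%:R :> R by rewrite ltr0n; near: k; exact: nbhs_infty_gt.
  have hk (j : nat) : (j <= k)%N -> enorm (k%:R^-1 *: partial_sum Z j - (j%:R / k%:R) *: mu) <= e.
    move=> jk; have -> : k%:R^-1 *: partial_sum Z j - (j%:R / k%:R) *: mu =
       k%:R^-1 *: (partial_sum Z j - j%:R *: mu) by rewrite scalerBr scalerA mulrC.
    rewrite enormZ gtr0_norm ?invr_gt0// mulrC ler_pdivrMr//.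
    by move: j jk; near: k; exact: hS.
  split => [_ [w [w0 w1 ->]]|_ [t + <-]].
    exists (\sum_i w i *: (((i : nat)%:R / k%:R) *: mu)).
      exists (\sum_i w i * ((i : nat)%:R / k%:R)).
        rewrite /= in_itv/= sumr_ge0 => [|i _]; last by rewrite mulr_ge0// divr_ge0.
        rewrite -[X in _ <= X]w1; apply: ler_sum => i _; rewrite ler_piMr//.
        by rewrite ler_pdivrMr// mul1r ler_nat -ltnS.
      by rewrite scaler_suml; apply: eq_bigr => i _; rewrite scalerA.
    rewrite -sumrB; apply: le_trans (enorm_sum _ _) _.
    rewrite -[X in _ <= X]mul1r -[X in _ <= X * _]w1 mulr_suml; apply: ler_sum => i _.
    by rewrite -scalerBr enormZ ger0_norm// ler_wpM2l// hk// -ltnS.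
  rewrite /= in_itv/= => /andP[t0 t1].
  exists (t *: (k%:R^-1 *: partial_sum Z k)).
    have -> : t *: (k%:R^-1 *: partial_sum Z k) =
       (1 - t) *: (k%:R^-1 *: partial_sum Z (ord0 : 'I_k.+1)) + t *: (k%:R^-1 *: partial_sum Z (ord_max : 'I_k.+1)).
      by rewrite /= {2}/partial_sum big_ord0 !scaler0 add0r.
    apply: polytope_convex; [exact: polytope_vertex|exact: polytope_vertex|by rewrite t0 t1].
  have -> : t *: mu - t *: (k%:R^-1 *: partial_sum Z k) = t *: ((k%:R / k%:R) *: mu - k%:R^-1 *: partial_sum Z k).
    by rewrite mulfV ?gt_eqF// scale1r scalerBr.
  rewrite enormZ ger0_norm// enormC; apply: le_trans (hk k _) => //.
  by rewrite ler_piMl// enorm_ge0.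
have cv x : 0 < x -> fine (vol (parallel (C k) x)) @[k --> \oo] --> g x.
  move=> x0.
  have cg : {for x, continuous g}.
    have -> : g = horner gp by apply/funext => y; rewrite gpE.
    exact: continuous_horner.
  apply/cvgrPdist_le => eta eta0.
  have : \forall y \near x, `|g x - g y| <= eta by move/cvgrPdist_le: cg; apply.
  move/nbhs_ballP => [d /= d0 hd].
  pose e := Num.min (d / 2) (x / 2).
  have e0 : 0 < e by rewrite lt_min !divr_gt0.
  have ed : e < d by rewrite gt_min ltr_pdivrMr// mulr_natr mulr2n ltrDl d0.
  have ex : e < x by rewrite gt_min; apply/orP; right; rewrite ltr_pdivrMr// mulr_natr mulr2n ltrDl.
  near=> k.
  have [h1 h2] : C k `<=` parallel (segment mu) e /\ segment mu `<=` parallel (C k) e.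
    by near: k; exact: close.
  have fC : vol (parallel (C k) x) \is a fin_num by rewrite ge0_fin_numE ?vol_ge0// vol_parallel_fin.
  have up : fine (vol (parallel (C k) x)) <= g (e + x).
    rewrite -lee_fin fineK// /g -vol_parallel_segment ?addr_gt0//.
    by apply: le_vol; exact: sub_parallel.
  have lo : g (x - e) <= fine (vol (parallel (C k) x)).
    rewrite -lee_fin fineK// /g -vol_parallel_segment ?subr_gt0//.
    by apply: le_vol; have := sub_parallel (l := x - e) h2; rewrite subrKC.
  have b1 : `|g x - g (e + x)| <= eta.
    by apply: hd; rewrite /ball/= opprD addrCA subrr addr0 normrN gtr0_norm.
  have b2 : `|g x - g (x - e)| <= eta.
    by apply: hd; rewrite /ball/= opprB addrC subrK gtr0_norm.
  move: b1 b2; rewrite !ler_norml => /andP[b1 _] /andP[_ b2].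
  by apply/andP; split; lra.
pose c k := xget 0 (steiner (walk_hull Z k)).
have cE k : steiner (walk_hull Z k) (c k).
  by apply: xgetPex; rewrite walk_hull_polytope; exact: steiner_ex.
have i1 : (inord 1 : 'I_n.+2) = 1%N :> nat by rewrite inordK.
have main k : (0 < k)%N -> c k ord0 (inord 1) / k%:R * kappa R n =
    \sum_j fine (vol (parallel (C k) (node R j))) * W j (Ordinal ok).
  move=> k0; have k0' : 0 < k%:R :> R by rewrite ltr0n.
  (* The Steiner polynomial of the hull rescaled by [1 / k]: its V_j is divided by [k ^+ j]. The
     coefficient of degree [n] contains V_1 since the dimension is [n.+1]. *)
  pose q : {poly R} := \poly_(i < n.+2) (kappa R i * c k ord0 (inord (n.+1 - i)) / k%:R ^+ (n.+1 - i)).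
  have sq : (size q <= n.+2)%N := size_poly _ _.
  have qn : q`_(Ordinal ok) = c k ord0 (inord 1) / k%:R * kappa R n.
    by rewrite coef_poly ok /= subSnn expr1; ring.
  have qE x : 0 <= x -> q.[x] = fine (vol (parallel (C k) x)).
    move=> x0.
    have -> : C k = [set k%:R^-1 *: y | y in walk_hull Z k].
      by rewrite walk_hull_polytope polytope_scale.
    have -> : x = k%:R^-1 * (k%:R * x) by rewrite mulrA mulVf ?mul1r// gt_eqF.
    rewrite parallel_scale ?invr_gt0// vol_scale ?invr_gt0// (cE k); last by rewrite mulr_ge0// ltW.
    rewrite -EFinM /= mulrA mulVf ?gt_eqF// mul1r horner_poly.
    rewrite (reindex_inj rev_ord_inj)/= mulr_sumr; apply: eq_bigr => i _.
    have ile : (i <= n.+1)%N by rewrite -ltnS.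
    rewrite subSS subKn// exprMn inord_val.
    have -> : k%:R^-1 ^+ n.+1 = k%:R^-1 ^+ i * k%:R^-1 ^+ (n.+1 - i) :> R by rewrite -exprD subnKC.
    have e1 : k%:R^-1 ^+ (n.+1 - i) * k%:R ^+ (n.+1 - i) = 1 :> R by rewrite -exprMn mulVf ?expr1n// gt_eqF.
    rewrite -[(k%:R ^+ i)^-1]exprVn.
    transitivity ((k%:R^-1 ^+ (n.+1 - i) * k%:R ^+ (n.+1 - i)) * (kappa R (n.+1 - i) * c k ord0 i * k%:R^-1 ^+ i * x ^+ (n.+1 - i))).
      by rewrite e1 mul1r.
    by ring.
  rewrite -qn (hW _ _ sq); apply: eq_bigr => j _; rewrite qE//.
  by have /andP[/ltW] := node_itv R j.
have cvm : c k ord0 (inord 1) / k%:R * kappa R n @[k --> \oo] --> l * kappa R n.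
  rewrite -gpn (hW _ _ sgp).
  apply: (@cvg_trans _ ((fun k => \sum_j fine (vol (parallel (C k) (node R j))) * W j (Ordinal ok)) @ \oo)).
    apply: near_eq_cvg; near=> k; rewrite main//; near: k; exact: nbhs_infty_gt.
  apply: cvg_fsum => j; apply: cvgM; last exact: cvg_cst.
  by rewrite gpE; apply: cv; case/andP: (node_itv R j).
have kn0 : kappa R n != 0 by rewrite gt_eqF// kappa_gt0.
have -> : enorm mu = (l * kappa R n) / kappa R n by rewrite mulfK.
have -> : (fun k => ivol 1 (walk_hull Z k) / k%:R) = (fun k => (c k ord0 (inord 1) / k%:R * kappa R n) / kappa R n).
  by apply/funext => k; rewrite mulfK.
by apply: cvgM => //; exact: cvg_cst.
Unshelve. all: by end_near. Qed.

End FirstIntrinsicVolume.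

(** * Absolutely continuous paths and polylines *)

Section AbsolutelyContinuous.
Variable R : realType.
Local Notation TV := (@total_variation R).

Definition ordered_family m (a b : nat -> R) :=
  (forall k, (k < m)%N -> 0 <= a k <= b k /\ b k <= 1) /\
  (forall k, (k.+1 < m)%N -> b k <= a k.+1).

Lemma sum_blocks m p (G : nat -> nat -> R) :
  \sum_(q < m * p) G (q %/ p)%N (q %% p)%N = \sum_(k < m) \sum_(r < p) G k r.
Proof.
case: p => [|p]; first by rewrite muln0 !big_ord0 big1// => k _; rewrite big_ord0.
elim: m => [|m IH]; first by rewrite mul0n !big_ord0.
rewrite [RHS]big_ord_recr/= -IH -!(big_mkord xpredT (fun q => G (q %/ p.+1)%N (q %% p.+1)%N)).
rewrite (big_cat_nat (n := (m * p.+1)%N)) //=; last by rewrite mulSn leq_addl.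
congr (_ + _); rewrite -{1}[(m * p.+1)%N]add0n mulSn big_addn addnK big_mkord.
apply: eq_bigr => r _; rewrite addnC divnMDl// modnMDl.
by rewrite divn_small ?addn0 ?modn_small.
Qed.

Lemma itv_partition_nth_mono (a b : R) s : itv_partition a b s ->
  forall i j, (i <= j)%N -> nth b (a :: s) i <= nth b (a :: s) j.
Proof.
move=> abs; have hb i : nth b (a :: s) i <= b.
  have [h|h] := leqP (size (a :: s)) i; first by rewrite nth_default.
  by apply: itv_partition_nth_le abs; rewrite -ltnS.
have ab := itv_partition_le abs.
suff step i : nth b (a :: s) i <= nth b (a :: s) i.+1.
  move=> i j; elim: j => [|j IH]; first by rewrite leqn0 => /eqP ->.
  rewrite leq_eqVlt => /orP[/eqP -> //|]; rewrite ltnS => /IH h; exact: le_trans h (step _).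
have [h|h] := ltnP i.+1 (size (a :: s)); last by rewrite [X in _ <= X]nth_default.
by case: abs => /(pathP b) /(_ i h)/ltW.
Qed.

(** A bound for all choices of elements bounds the sum of the suprema; [r] carries the elements
    already chosen in the induction. *)
Lemma sum_ereal_sup_le m (A : nat -> set R) (e r : R) :
  (forall k, A k !=set0) -> (forall k x, A k x -> 0 <= x) ->
  (forall x : nat -> R, (forall k, A k (x k)) -> \sum_(k < m) x k + r <= e) ->
  (\sum_(k < m) ereal_sup (EFin @` A k) + r%:E <= e%:E)%E.
Proof.
move=> A0 Age; elim: m r => [|m IH] r h.
  have [x xA] := choice A0; have := h x xA.
  by rewrite !big_ord0 add0e add0r.
rewrite big_ord_recr/=; set S := (\sum_(k < m) _)%E.
have S0 : (0 <= S)%E.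
  apply: sume_ge0 => k _; have [x Ax] := A0 k.
  by apply: (@le_trans _ _ x%:E); [rewrite lee_fin; exact: Age Ax|apply: ereal_sup_ubound; exists x].
have H y : A m y -> (S + (y + r)%:E <= e%:E)%E.
  move=> Ay; apply: IH => x xA.
  have xA' k : A k (if k == m then y else x k) by case: eqP => [->|].
  have := h _ xA'; rewrite big_ord_recr/= eqxx -addrA.
  rewrite (eq_bigr (fun k : 'I_m => x k))// => k _.
  by rewrite (ltn_eqF (ltn_ord k)).
have fS : S \is a fin_num.
  have [y Ay] := A0 m; rewrite ge0_fin_numE//; have := H y Ay.
  by rewrite ltey => hS; apply/eqP => Soo; move: hS; rewrite Soo addye// leye_eq.
have sup_le : (ereal_sup (EFin @` A m) <= (e - (fine S + r))%:E)%E.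
  apply: ge_ereal_sup => _ [y Ay <-].
  have := H y Ay; rewrite -(fineK fS) -!EFinD !lee_fin; lra.
apply: le_trans (leeD2r _ (leeD2l _ sup_le)) _.
by rewrite -(fineK fS) -!EFinD lee_fin; lra.
Qed.

(** A partition of every interval of the family yields another ordered family of the same total
    length, to which [H] applies; then the supremum over the partitions is taken. *)
Lemma abs_cont_TV (f : R -> R) (e delta : R) : 
  (forall m a b, ordered_family m a b -> \sum_(k < m) (b k - a k) < delta ->
      \sum_(k < m) `|f (b k) - f (a k)| <= e) ->
  forall m a b, ordered_family m a b -> (forall k, a k <= b k) -> \sum_(k < m) (b k - a k) < delta ->
    (\sum_(k < m) TV (a k) (b k) f <= e%:E)%E.
Proof.
move=> H m a b [h1 h2] hab hd.
rewrite -[leLHS]adde0; apply: (@sum_ereal_sup_le m (fun k => variations (a k) (b k) f) e 0) => [k|k x|x xv].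
- have := hab k; rewrite le_eqVlt => /orP[/eqP <-|ab]; last exact: variations_neq0.
  by exists 0; rewrite variationsxx.
- by move=> [s _ <-]; exact: variation_ge0.
rewrite addr0.
have [s hs] : {s : nat -> seq R & forall k, itv_partition (a k) (b k) (s k) /\ variation (a k) (b k) f (s k) = x k}.
  apply: (@choice _ _ (fun k s => itv_partition (a k) (b k) s /\ variation (a k) (b k) f s = x k)) => k.
  by have [s ps <-] := xv k; exists s.
(* All partitions are padded to the common length [p] by repeating the right end (the default of
   [nth]), so the refined family is indexed by quotient and remainder modulo [p]. *)
pose p := (\max_(k < m) size (s k)).+1.
pose F k r := nth (b k) (a k :: s k) r.
have F0 k : F k 0%N = a k by [].
have Fp k : (k < m)%N -> F k p = b k.
  move=> km; have [[_ /eqP sb] _] := hs k.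
  rewrite /F /p /=; have := @leq_bigmax _ (fun k : 'I_m => size (s k)) (Ordinal km); rewrite /=.
  by move=> ?; rewrite nth_default.
have Fm k i j : (i <= j)%N -> F k i <= F k j by case: (hs k) => ps _; exact: itv_partition_nth_mono ps _ _.
have Fb k i : (k < m)%N -> (i <= p)%N -> a k <= F k i <= b k.
  by move=> km ip; rewrite -{1}(F0 k) -(Fp k km) !Fm.
have p0 : (0 < p)%N by [].
have sumF : \sum_(q < m * p) (F (q %/ p)%N (q %% p).+1 - F (q %/ p)%N (q %% p)%N) = \sum_(k < m) (b k - a k).
  rewrite (sum_blocks _ _ (fun k r => F k r.+1 - F k r)); apply: eq_bigr => k _.
  by rewrite -(big_mkord xpredT (fun r => F k r.+1 - F k r)) telescope_sumr// F0 Fp.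
have sumV : \sum_(q < m * p) `|f (F (q %/ p)%N (q %% p).+1) - f (F (q %/ p)%N (q %% p)%N)| = \sum_(k < m) x k.
  rewrite (sum_blocks _ _ (fun k r => `|f (F k r.+1) - f (F k r)|)); apply: eq_bigr => k _.
  have [[_ /eqP sb] <-] := hs k; rewrite /variation.
  have sp : (size (s k) <= p)%N.
    by apply: leqW; have := @leq_bigmax _ (fun k : 'I_m => size (s k)) k.
  rewrite -(big_mkord xpredT (fun r => `|f (F k r.+1) - f (F k r)|)) (big_cat_nat (n := size (s k)))//=.
  rewrite [X in _ + X]big_nat_cond [X in _ + X]big1 ?addr0// => i /andP[/andP[h3 h4] _].
  suff -> : F k i.+1 = F k i by rewrite subrr normr0.
  have E j : (size (s k) <= j)%N -> F k j = b k.
    rewrite leq_eqVlt => /orP[/eqP <-|sj]; last by rewrite /F nth_default.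
    by rewrite /F -[RHS]sb (last_nth (b k)).
  by rewrite !E// leqW.
rewrite -sumV; apply: (H (m * p)%N (fun q => F (q %/ p)%N (q %% p)%N)
  (fun q => F (q %/ p)%N (q %% p).+1)); last by rewrite sumF.
split => q hq; last first.
  have q1 : (q < m * p)%N by exact: ltnW.
  have km : (q %/ p < m)%N by rewrite ltn_divLR.
  have [rp|rp] := ltnP (q %% p).+1 p.
    have e1 : (q.+1 %/ p)%N = (q %/ p)%N.
      by rewrite {1}(divn_eq q p) -addnS divnMDl// (divn_small rp) addn0.
    have e2 : (q.+1 %% p)%N = (q %% p).+1.
      by rewrite {1}(divn_eq q p) -addnS modnMDl modn_small.
    by rewrite e1 e2.
  have e0 : (q %% p).+1 = p by apply/eqP; rewrite eqn_leq rp andbT ltn_mod.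
  have e3 : q.+1 = ((q %/ p).+1 * p)%N by rewrite {1}(divn_eq q p) -addnS e0 mulSn addnC.
  have e1 : (q.+1 %/ p)%N = (q %/ p).+1 by rewrite e3 mulnK.
  have e2 : (q.+1 %% p)%N = 0%N by rewrite e3 modnMl.
  have km' : ((q %/ p).+1 < m)%N by rewrite -e1 ltn_divLR.
  by rewrite e1 e2 e0 F0 Fp//; exact: h2.
have km : (q %/ p < m)%N by rewrite ltn_divLR.
have rp : (q %% p < p)%N by rewrite ltn_mod.
have [/andP[a0 ab] b1] := h1 _ km.
have /andP[l1 l2] := Fb _ _ km (ltnW rp); have /andP[l3 l4] := Fb _ _ km rp.
by rewrite (le_trans a0 l1) Fm// (le_trans l4 b1).
Qed.

End AbsolutelyContinuous.

(** * Densities of nondecreasing absolutely continuous functions *)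

Section StieltjesDensity.
Variable R : realType.
Local Notation mu := (@lebesgue_measure R).

Definition nondecr_abs_cont (G : R -> R) :=
  forall e, 0 < e -> exists2 delta : R, 0 < delta & forall m a b, @ordered_family R m a b ->
    \sum_(k < m) (b k - a k) < delta -> \sum_(k < m) (G (b k) - G (a k)) <= e.

Definition dcell (n k : nat) : set R := `](k%:R / (2 ^ n)%:R), (k.+1%:R / (2 ^ n)%:R)]%classic.
Definition dsel (U : set R) n k : set R := if `[< dcell n k `<=` U >] then dcell n k else set0.
(** The dyadic cells of level [n] in ]0, 1] contained in [U]. For open [U] they increase with [n]
    and exhaust its trace on ]0, 1], which reduces open sets to finite interval families. *)
Definition dfill (U : set R) n : set R := \big[setU/set0]_(k < 2 ^ n) dsel U n k.

Lemma dcell_disj n k l x : dcell n k x -> dcell n l x -> k = l.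
Proof.
rewrite /dcell /= !in_itv/= => /andP[a b] /andP[c d].
have p0 : 0 < (2 ^ n)%:R :> R by rewrite ltr0n expn_gt0.
have := lt_le_trans a d; have := lt_le_trans c b.
rewrite !ltr_pM2r ?invr_gt0// !ltr_nat !ltnS => h1 h2.
by apply/eqP; rewrite eqn_leq h1 h2.
Qed.

Lemma dfillP U n x : dfill U n x <-> exists k, [/\ (k < 2 ^ n)%N, dcell n k `<=` U & dcell n k x].
Proof.
rewrite /dfill -(bigcup_mkord _ (dsel U n)) /dsel; split.
  by move=> [k /= kn]; case: asboolP => // kU kx; exists k.
by move=> [k [kn kU kx]]; exists k => //=; case: asboolP.
Qed.

Lemma dfill_mono U n : dfill U n `<=` dfill U n.+1.
Proof.
move=> x /dfillP[k [kn kU kx]]; apply/dfillP.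
have p0 : 0 < (2 ^ n.+1)%:R :> R by rewrite ltr0n expn_gt0.
have half j : (j.*2)%:R / (2 ^ n.+1)%:R = j%:R / (2 ^ n)%:R :> R.
  by rewrite expnS -mul2n !natrM invfM mulrACA mulfV ?mul1r// pnatr_eq0.
move: (kx); rewrite /dcell /= in_itv/= -!half doubleS => /andP[a b].
have sub l : (k.*2 <= l)%N -> (l.+1 <= k.+1.*2)%N -> dcell n.+1 l `<=` dcell n k.
  move=> h1 h2 y; rewrite /dcell /= !in_itv/= -!half => /andP[c d]; apply/andP; split.
    by apply: le_lt_trans c; rewrite ler_pM2r ?invr_gt0// ler_nat.
  by apply: le_trans d _; rewrite ler_pM2r ?invr_gt0// ler_nat.
have k2 : (k.*2.+1 < 2 ^ n.+1)%N by rewrite expnS mul2n ltn_Sdouble.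
have [xm|xm] := leP x (k.*2.+1%:R / (2 ^ n.+1)%:R).
  exists k.*2; split; first exact: ltnW.
    by apply: subset_trans kU; apply: sub => //; rewrite doubleS.
  by rewrite /dcell /= in_itv/= a xm.
exists k.*2.+1; split => //; first by apply: subset_trans kU; apply: sub.
by rewrite /dcell /= in_itv/= xm b.
Qed.

Lemma dfill_cover (U : set R) : open U -> U `&` `]0, 1]%classic `<=` \bigcup_n dfill U n.
Proof.
move=> oU x [Ux]; rewrite /= in_itv/= => /andP[x0 x1].
have [e /= e0 xU] : nbhs_ball x U by rewrite nbhs_ballE; exact: oU.
pose n := Num.truncn (e^-1); exists n => //; apply/dfillP.
have p0 : 0 < (2 ^ n)%:R :> R by rewrite ltr0n expn_gt0.
have pe : (2 ^ n)%:R^-1 < e.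
  rewrite invf_plt ?posrE//; apply: (lt_le_trans (truncnS_gt _)).
  by rewrite ler_nat; exact: ltn_expl.
have y0 : 0 < x * (2 ^ n)%:R by rewrite mulr_gt0.
have [k kP] : exists k : nat, k%:R < x * (2 ^ n)%:R <= k.+1%:R.
  pose t := Num.truncn (x * (2 ^ n)%:R).
  have /andP[t1 t2] : t%:R <= x * (2 ^ n)%:R < t.+1%:R by apply: truncn_itv; exact: ltW.
  move: t1; rewrite le_eqVlt => /orP[/eqP tE|tl]; last by exists t; rewrite tl ltW.
  have t0 : (0 < t)%N by rewrite -(ltr0n R) tE.
  by exists t.-1; rewrite prednK// tE lexx andbT -tE ltr_nat prednK.
case/andP: kP => k1 k2.
exists k; split.
- by rewrite -(ltr_nat R); apply: lt_le_trans k1 _; rewrite ler_piMl// ltW.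
- move=> y; rewrite /dcell /= in_itv/= => /andP[c d]; apply: xU; rewrite /ball/= ltr_norml.
  rewrite ltr_pdivrMr// in c; rewrite ler_pdivlMr// in d.
  have h1 : `|(x - y) * (2 ^ n)%:R| < 1.
    by rewrite mulrBl ltr_norml; move: k2; rewrite -natr1 => k2; move: d; rewrite -natr1 => d; apply/andP; split; lra.
  rewrite -ltr_norml; apply: lt_trans pe.
  by rewrite -[ltRHS]mul1r ltr_pdivlMr// -[X in _ * X](gtr0_norm p0) -normrM.
- by rewrite /dcell /= in_itv/= ltr_pdivrMr// ler_pdivlMr// k1 k2.
Qed.

Section Density.
Variable G : R -> R.
Hypothesis Gnd : {homo G : x y / x <= y}.
Hypothesis Gc : continuous G.
Hypothesis Gac : nondecr_abs_cont G.

(** Radon-Nikodym for the Lebesgue-Stieltjes measure of [G] on ]0, 1]. For domination, a null set is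
    put in an open set of measure below [delta]; absolute continuity bounds the Stieltjes measure of
    every dyadic filling by [e]. *)
Lemma stieltjes_density : exists g : R -> R, mu.-integrable setT (EFin \o g) /\
  forall x, 0 <= x <= 1 -> G x - G 0 = \int[mu]_(t in `]0, x]) g t.
Proof.
pose C : cumulative R R := HB.pack G (isCumulative.Build R _ R G Gnd (right_continuousW Gc)).
have nuE0 a b : a <= b -> lebesgue_stieltjes_measure C `]a, b]%classic = (G b - G a)%:E.
  move=> ab; rewrite /lebesgue_stieltjes_measure /measure_extension measurable_mu_extE/=; last exact: is_ocitv.
  by rewrite wlength_itv_bnd.
pose nu : {measure set (measurableTypeR R) -> \bar R} := lebesgue_stieltjes_measure C.
have nuE a b : a <= b -> nu `]a, b]%classic = (G b - G a)%:E := @nuE0 a b.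
have m01 : measurable (`]0, 1]%classic : set (measurableTypeR R)) by exact: measurable_itv.
have f01 : (nu (`]0%R, 1%R]%classic : set (measurableTypeR R)) < +oo)%E by rewrite nuE// ltry.
pose nu' : {finite_measure set (measurableTypeR R) -> \bar R} := mfrestr m01 f01.
have mdsel U n k : measurable (dsel U n k : set (measurableTypeR R)).
  by rewrite /dsel; case: asboolP => _; [exact: measurable_itv|exact: measurable0].
have dom : nu' `<< mu.
  apply/null_content_dominatesP => A mA A0.
  rewrite /nu' /mfrestr /mrestr/=.
  apply/eqP; rewrite eq_le measure_ge0 andbT; apply/lee_addgt0Pr => e e0; rewrite add0e.
  have [delta d0 hd] := Gac e0.
  have Aoo : (mu A < +oo)%E by rewrite A0 ltry.
  have [U [oU AU UA]] := lebesgue_regularity_outer mA Aoo d0.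
  have mU : measurable U by exact: open_measurable.
  have Ud : (mu U < delta%:E)%E.
    apply: le_lt_trans UA; rewrite -[leRHS]adde0 -A0.
    apply: (le_trans _ (measureU2 _ _ _)) => //; last exact: measurableD.
    apply: le_measure; rewrite ?inE//; first by apply: measurableU => //; exact: measurableD.
    by move=> x Ux; have [?|?] := pselect (A x); [right|left].
  have step n : (nu (dfill U n) <= e%:E)%E.
    pose a k : R := k%:R / (2 ^ n)%:R.
    (* A cell that is not selected gives a degenerate interval, so the family is indexed by all
       [k]. *)
    pose b k : R := if `[< dcell n k `<=` U >] then k.+1%:R / (2 ^ n)%:R else k%:R / (2 ^ n)%:R.
    have p0 : 0 < (2 ^ n)%:R :> R by rewrite ltr0n expn_gt0.
    have aS k : a k <= a k.+1 by rewrite /a ler_pM2r ?invr_gt0// ler_nat.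
    have ab k : a k <= b k by rewrite /b; case: ifP => _ //; exact: aS.
    have bS k : b k <= a k.+1 by rewrite /b; case: ifP => _ //; exact: aS.
    have a1 k : (k < 2 ^ n)%N -> a k.+1 <= 1.
      by move=> kn; rewrite /a ler_pdivrMr// mul1r ler_nat.
    have of_ : ordered_family (2 ^ n) a b.
      split => k kn; last exact: bS.
      by rewrite ab divr_ge0//=; split => //; apply: le_trans (bS k) (a1 _ kn).
    have lenE k : mu (dsel U n k) = (b k - a k)%:E.
      rewrite /dsel /b /a; case: asboolP => _; last by rewrite measure0 subrr.
      apply: etrans (lebesgue_measure_itv _) _.
      by rewrite /= lte_fin ltr_pM2r ?invr_gt0// ltr_nat ltnSn.
    have sum_lt : \sum_(k < 2 ^ n) (b k - a k) < delta.
      rewrite -lte_fin; apply: le_lt_trans Ud.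
      rewrite -sumEFin; under eq_bigr do rewrite -lenE.
      rewrite -measure_bigsetU//; last first.
        apply/trivIsetP => k l _ _ kl; apply/seteqP; split => x //= [].
        rewrite /dsel; case: asboolP => // _ h1; case: asboolP => // _ h2.
        by move: kl; rewrite (dcell_disj h1 h2) eqxx.
      apply: le_measure; rewrite ?inE//; first exact: bigsetU_measurable.
      by move=> x /dfillP[k [_ kU kx]]; exact: kU.
    have nuS k : nu (dsel U n k) = (G (b k) - G (a k))%:E.
      rewrite /dsel /b /a; case: asboolP => _; last by rewrite measure0 subrr.
      by rewrite nuE// ler_pM2r ?invr_gt0// ler_nat.
    have := hd _ _ _ of_ sum_lt; rewrite -lee_fin; apply: le_trans.
    rewrite -sumEFin; under [leRHS]eq_bigr do rewrite -nuS.
    rewrite /dfill -measure_bigsetU//.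
    apply/trivIsetP => k l _ _ kl; apply/seteqP; split => x //= [].
    rewrite /dsel; case: asboolP => // _ h1; case: asboolP => // _ h2.
    by move: kl; rewrite (dcell_disj h1 h2) eqxx.
  have mfill n : measurable (dfill U n : set (measurableTypeR R)).
    by apply: (@bigsetU_measurable _ (measurableTypeR R)) => k _; exact: mdsel.
  have cv : nu (dfill U n) @[n --> \oo] --> nu (\bigcup_n dfill U n).
    apply: nondecreasing_cvg_mu => //; first exact: bigcup_measurable.
    apply/nondecreasing_seqP => n; apply/subsetPset; exact: dfill_mono.
  apply: (@le_trans _ _ (nu (\bigcup_n dfill U n))).
    apply: le_measure; rewrite ?inE; [exact: measurableI|exact: bigcup_measurable|].
    by move=> x [Ax x01]; apply: dfill_cover => //; split => //; exact: AU.
  rewrite -(cvg_lim _ cv)//; apply: lime_le; first by apply/cvg_ex; eexists; exact: cv.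
  exact: nearW.
have [f [f0 ffin fint fE]] := radon_nikodym_sigma_finite dom.
exists (fine \o f); split.
  by apply: eq_integrable fint => // x _ /=; rewrite fineK.
move=> x /andP[x0 x1].
have -> : G x - G 0 = fine (nu' `]0, x]%classic).
  have -> : nu' `]0, x]%classic = nu (`]0, x]%classic `&` `]0, 1]%classic) by [].
  have -> : `]0, x]%classic `&` `]0, 1]%classic = `]0, x]%classic :> set (measurableTypeR R).
    by apply/setIidPl => y /=; rewrite !in_itv/= => /andP[-> yx]; exact: le_trans yx x1.
  by rewrite nuE.
rewrite fE// /Rintegral; congr fine; apply: eq_integral => y _ /=.
by rewrite fineK.
Qed.

End Density.
End StieltjesDensity.

(** * Absolutely continuous functions are primitives *)

Section AbsContPrimitive.
Variable R : realType.
Local Notation mu := (@lebesgue_measure R).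

Definition clamp (x : R) := Num.max 0 (Num.min x 1).

Lemma clamp_itv x : 0 <= clamp x <= 1.
Proof. by rewrite /clamp le_max lexx/= ge_max ler01/= ge_min lexx orbT. Qed.

Lemma clamp_id x : 0 <= x <= 1 -> clamp x = x.
Proof. by move=> /andP[x0 x1]; rewrite /clamp min_l// max_r. Qed.

Lemma clamp_homo x y : x <= y -> clamp x <= clamp y.
Proof.
move=> xy; rewrite /clamp; have [h|h] := leP x 1; have [h'|h'] := leP y 1.
- by rewrite ge_max !le_max lexx/= xy orbT.
- by rewrite ge_max !le_max lexx/= h orbT.
- by have := le_lt_trans (le_trans xy h') h; rewrite ltxx.
- by [].
Qed.

Lemma clamp_lip x y : x <= y -> clamp y - clamp x <= y - x.
Proof.
move=> xy; rewrite /clamp; have [h|h] := leP x 1; have [h'|h'] := leP y 1.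
- by have [?|?] := leP 0 x; have [?|?] := leP 0 y; lra.
- by rewrite [Num.max 0 1]max_r//; have [?|?] := leP 0 x; lra.
- by have := le_lt_trans (le_trans xy h') h; rewrite ltxx.
- by rewrite subrr subr_ge0.
Qed.

(** Composition with [clamp] extends [G] by constants outside [0, 1], which makes it monotone and
    continuous on the whole line. *)
Lemma primitive_of_nondecr (G : R -> R) :
  (forall x y, 0 <= x -> x <= y -> y <= 1 -> G x <= G y) -> nondecr_abs_cont G ->
  exists g : R -> R, mu.-integrable setT (EFin \o g) /\
  forall x, 0 <= x <= 1 -> G x - G 0 = \int[mu]_(t in `]0, x]) g t.
Proof.
move=> Gnd Gac; pose H := G \o clamp.
have Hnd : {homo H : x y / x <= y}.
  move=> x y xy; rewrite /H /=; have /andP[a b] := clamp_itv x; have /andP[c d] := clamp_itv y.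
  by apply: Gnd => //; exact: clamp_homo.
have HE x : 0 <= x <= 1 -> H x = G x by move=> x01; rewrite /H /= clamp_id.
have one e : 0 < e -> exists2 d : R, 0 < d & forall x y, x <= y -> y - x < d -> H y - H x <= e.
  move=> e0; have [d d0 hd] := Gac _ e0; exists d => // x y xy yx.
  have := hd 1%N (fun=> clamp x) (fun=> clamp y); rewrite !big_ord1; apply.
    have /andP[a b] := clamp_itv x; have /andP[c' d'] := clamp_itv y.
    by split => // k _; rewrite a clamp_homo.
  exact: le_lt_trans (clamp_lip xy) yx.
have Hc : continuous H.
  move=> x; apply/cvgrPdist_le => e e0; have [d d0 hd] := one _ e0.
  near=> y; have yx : `|x - y| < d by near: y; exact: cvgr_dist_lt.
  have [xy|/ltW xy] := leP x y.
    rewrite distrC ger0_norm ?subr_ge0 ?Hnd//; apply: hd => //.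
    by move: yx; rewrite distrC ger0_norm ?subr_ge0.
  rewrite ger0_norm ?subr_ge0 ?Hnd//; apply: hd => //.
  by move: yx; rewrite ger0_norm ?subr_ge0.
have Hac : nondecr_abs_cont H.
  move=> e e0; have [d d0 hd] := Gac _ e0; exists d => // m a b ab h.
  have := hd _ _ _ ab h; congr (_ <= _); apply: eq_bigr => k _.
  have [/(_ k (ltn_ord k))[/andP[h1 h2] h3] _] := ab.
  by rewrite !HE// ?h1 ?(le_trans h2 h3)// h3 (le_trans h1 h2).
have [g [ig gE]] := stieltjes_density Hnd Hc Hac.
exists g; split => // x x01; rewrite -gE// !HE// lexx ler01//.
Unshelve. all: by end_near. Qed.

Section Primitive.
Variable f : R -> R.
Hypothesis fac : abs_cont01 f.

Let acf e : 0 < e -> exists2 delta : R, 0 < delta & forall m a b, @ordered_family R m a b ->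
      \sum_(k < m) (b k - a k) < delta -> \sum_(k < m) `|f (b k) - f (a k)| <= e.
Proof.
move=> e0; have [d d0 hd] := fac e0; exists d => // m a b [h1 h2] h.
by apply: ltW; apply: hd.
Qed.

Let acTV e : 0 < e -> exists2 delta : R, 0 < delta & forall m a b, @ordered_family R m a b ->
      \sum_(k < m) (b k - a k) < delta ->
      (\sum_(k < m) total_variation (a k) (b k) f <= e%:E)%E.
Proof.
move=> e0; have [d d0 hd] := acf e0; exists d => // m a b [h1 h2] h.
pose a' k := if (k < m)%N then a k else 0; pose b' k := if (k < m)%N then b k else 0.
have E (F : R -> R -> \bar R) : (\sum_(k < m) F (a k) (b k) = \sum_(k < m) F (a' k) (b' k))%E.
  by apply: eq_bigr => k _; rewrite /a' /b' ltn_ord.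
rewrite (E (fun x y => total_variation x y f)); apply: abs_cont_TV hd _ _ _ _ _ _.
- split => k km; first by rewrite /a' /b' km; exact: h1.
  by rewrite /a' /b' km (ltnW km); exact: h2.
- by move=> k; rewrite /a' /b'; case: ifP => // /h1[/andP[]].
- by rewrite (eq_bigr (fun k : 'I_m => b k - a k))// => k _; rewrite /a' /b' ltn_ord.
Qed.

(** [0, 1] is cut into [N] cells shorter than the [d] attached to [e = 1]; each contributes at most
    1 to the variation. *)
Lemma abs_cont_TV_fin a b : 0 <= a -> a <= b -> b <= 1 -> total_variation a b f \is a fin_num.
Proof.
move=> a0 ab b1; have [d d0 hd] := acTV ltr01.
pose N := (Num.truncn d^-1).+1; have N0 : 0 < N%:R :> R by rewrite ltr0n.
have Nd : N%:R^-1 < d by rewrite invf_plt ?posrE//; exact: truncnS_gt.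
pose t k : R := k%:R / N%:R.
have tS k : t k <= t k.+1 by rewrite /t ler_pM2r ?invr_gt0// ler_nat.
have t0 k : 0 <= t k by rewrite divr_ge0.
have H k : (k <= N)%N -> (total_variation 0 (t k) f <= k%:R%:E)%E.
  elim: k => [|k IH] kN; first by rewrite /t mul0r total_variationxx.
  rewrite (total_variationD f (t0 k) (tS k)) -natr1 EFinD; apply: leeD; first exact/IH/ltnW.
  have := hd 1%N (fun=> t k) (fun=> t k.+1); rewrite !big_ord1; apply.
    by split => // j _; rewrite t0 tS; split => //; rewrite /t ler_pdivrMr// mul1r ler_nat.
  by rewrite /t -mulrBl -natr1 addrC addKr mul1r.
have := H N (leqnn _); rewrite /t mulfV ?gt_eqF// => h.
rewrite ge0_fin_numE ?total_variation_ge0//.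
apply: (@le_lt_trans _ _ (total_variation 0 1 f)); last exact: le_lt_trans h (ltry _).
rewrite (total_variationD f a0 (le_trans ab b1)) (total_variationD f ab b1).
rewrite addeA addeAC leeDr// adde_ge0//; apply: total_variation_ge0 => //.
Qed.

(** Jordan decomposition: the variation [V] and [W = V - f] are nondecreasing and absolutely
    continuous, and [g] is the difference of their densities. The derivative is then identified
    almost everywhere by Lebesgue differentiation. *)
Lemma abs_cont_primitive : exists g : R -> R, [/\ mu.-integrable setT (EFin \o g),
  forall x, 0 <= x <= 1 -> f x - f 0 = \int[mu]_(t in `]0, x]) g t &
  {ae mu, forall x, 0 < x < 1 -> derive1 f x = g x}].
Proof.
pose V x := fine (total_variation 0 x f).
have VB a b : 0 <= a -> a <= b -> b <= 1 -> V b - V a = fine (total_variation a b f).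
  move=> a0 ab b1; rewrite /V (total_variationD f a0 ab) fineD; last 2 first.
  - exact: (abs_cont_TV_fin (lexx 0) a0 (le_trans ab b1)).
  - exact: abs_cont_TV_fin.
  by rewrite addrC addKr.
have fV a b : 0 <= a -> a <= b -> b <= 1 -> `|f b - f a| <= V b - V a.
  move=> a0 ab b1; rewrite VB// -lee_fin fineK ?abs_cont_TV_fin//.
  exact: total_variation_ge.
have Vac : nondecr_abs_cont V.
  move=> e e0; have [d d0 hd] := acTV e0; exists d => // m a b ab h.
  have [h1 _] := ab.
  rewrite -lee_fin; apply: le_trans (hd _ _ _ ab h); rewrite -sumEFin; apply: lee_sum => k _.
  by have [/andP[a0 akb] b1] := h1 _ (ltn_ord k); rewrite VB// fineK// abs_cont_TV_fin.
have Vnd x y : 0 <= x -> x <= y -> y <= 1 -> V x <= V y.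
  by move=> x0 xy y1; rewrite -subr_ge0; apply: le_trans (fV _ _ x0 xy y1).
pose W x := V x - f x.
have Wnd x y : 0 <= x -> x <= y -> y <= 1 -> W x <= W y.
  by move=> x0 xy y1; have := fV _ _ x0 xy y1; have := ler_norm (f y - f x); rewrite /W; lra.
have Wac : nondecr_abs_cont W.
  move=> e e0; have e20 : 0 < e / 2 by rewrite divr_gt0.
  have [d1 d10 hd1] := Vac _ e20; have [d2 d20 hd2] := acf e20.
  exists (Num.min d1 d2); first by rewrite lt_min d10.
  move=> m a b ab; rewrite lt_min => /andP[l1 l2].
  have := hd1 _ _ _ ab l1; have := hd2 _ _ _ ab l2.
  have : \sum_(k < m) (W (b k) - W (a k)) <= \sum_(k < m) (V (b k) - V (a k)) + \sum_(k < m) `|f (b k) - f (a k)|.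
    rewrite -big_split; apply: ler_sum => k _; have := ler_norm (- (f (b k) - f (a k))).
    by rewrite normrN /W /=; lra.
  lra.
have [g1 [ig1 g1E]] := primitive_of_nondecr Vnd Vac.
have [g2 [ig2 g2E]] := primitive_of_nondecr Wnd Wac.
pose g x := g1 x - g2 x.
have ig : mu.-integrable setT (EFin \o g).
  by apply: eq_integrable (integrableB _ ig1 ig2) => // x _.
have sub (h : R -> R) (A : set R) : measurable A -> mu.-integrable setT (EFin \o h) -> mu.-integrable A (EFin \o h).
  by move=> mA; apply: integrableS.
have fE x : 0 <= x <= 1 -> f x - f 0 = \int[mu]_(t in `]0, x]) g t.
  move=> x01; rewrite /g RintegralB//; last 2 first.
  - by apply: sub.
  - by apply: sub.
  by rewrite -g1E// -g2E// /W; ring.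
exists g; split => //.
have := @FTC1 R g (BRight 0) (fun y => sub g _ (measurable_itv _) ig) (open_integrable_locally openT ig).
apply: filterS; first exact: (ae_filter_ringOfSetsType mu).
move=> x h /andP[x0 x1].
have [] := h; first exact: x0.
set F := fun y => _ => dF F'; rewrite -F' !derive1E.
have -> : 'D_1 f x = 'D_1 (fun y => f 0 + F y) x.
  apply: near_eq_derive; near=> y.
  rewrite /F -fE; first by rewrite addrC subrK.
  apply/andP; split; apply: ltW; near: y; [exact: lt_nbhsr|exact: lt_nbhsl].
rewrite (@deriveD _ _ _ (fun=> f 0) F)//.
by rewrite (@derive_cst _ _ _ (f 0)) add0r.
Unshelve. all: by end_near. Qed.

End Primitive.
End AbsContPrimitive.

(** * Energy of a path and of its samples *)

Section Energy.
Variable R : realType.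
Local Notation mu := (@lebesgue_measure R).

(* Unlike [ge0_le_integral], no measurability is needed, as the integral is a supremum over simple functions. *)
Lemma ge0_le_integralT (f1 f2 : measurableTypeR R -> \bar R) :
  (forall x, 0 <= f1 x)%E -> (forall x, f1 x <= f2 x)%E ->
  (\int[mu]_x f1 x <= \int[mu]_x f2 x)%E.
Proof.
move=> f10 f12; rewrite ge0_integralTE// ge0_integralTE; last first.
  by move=> x; apply: le_trans (f10 x) (f12 x).
by apply: le_ereal_sup => _ [h hf <-]; exists h => // x; apply: le_trans (hf x) (f12 x).
Qed.

(** The inequality follows by pointwise comparison on ]0, 1[ minus the null set where [derive1 f]
    and [g] may differ; it asks for the measurability of [g] only. *)
Lemma energy_primitive (f : R -> R) : abs_cont01 f ->
  exists g : R -> R, [/\ mu.-integrable setT (EFin \o g),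
  forall a b, 0 <= a -> a <= b -> b <= 1 -> f b - f a = \int[mu]_(t in `]a, b]) g t &
  (\int[mu]_(t in `]0%R, 1%R]) (g t ^+ 2)%:E <= energy01 f)%E].
Proof.
move=> acf; have [g [ig gE [N [mN N0 hN]]]] := abs_cont_primitive acf.
have sub (A : set (measurableTypeR R)) : measurable A -> mu.-integrable A (EFin \o g).
  by move=> mA; apply: integrableS ig.
have mg : measurable_fun setT (fun x => (g x ^+ 2)%:E).
  apply/measurable_EFinP; apply: measurable_funX; apply/measurable_EFinP; exact: measurable_int ig.
exists g; split => //.
  move=> a b a0 ab b1.
  have h x y : f y - f x = (f y - f 0) - (f x - f 0) by ring.
  rewrite h !gE; try by apply/andP; split; lra.
  have -> : `]0, b]%classic = `]0, a] `|` `]a, b] :> set (measurableTypeR R).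
    by rewrite -itv_bndbnd_setU// bnd_simp.
  rewrite Rintegral_setU//; first by ring.
  - by apply: sub; apply: measurableU.
  - rewrite disj_set2E; apply/eqP; rewrite -subset0 => x [] /=; rewrite !in_itv/= => /andP[_ p] /andP[q _].
    by have := lt_le_trans q p; rewrite ltxx.
pose D : set (measurableTypeR R) := `]0%R, 1%R[ `\` N.
have mD : measurable D by apply: measurableD => //; exact: measurable_itv.
rewrite -integral_itv_bndo_bndc; last by apply: measurable_funTS.
have -> : (\int[mu]_(t in `]0%R, 1%R[) (g t ^+ 2)%:E = \int[mu]_(t in D) (g t ^+ 2)%:E)%E.
  rewrite (integral_mkcond D) (integral_mkcond (`]0%R,1%R[%classic : set (measurableTypeR R))).
  apply: ae_eq_integral => //.
  - by apply/(measurable_restrictT _ _).1; [exact: measurable_itv|apply: measurable_funTS].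
  - by apply/(measurable_restrictT _ _).1; [exact: mD|apply: measurable_funTS].
  exists N; split => // x /= h; apply: contrapT => Nx; apply: h => _.
  by rewrite /patch /D in_setD (memNset Nx) andbT.
rewrite /energy01 (integral_mkcond D) [X in (_ <= X)%E]integral_mkcond; apply: ge0_le_integralT => x.
  by rewrite /patch; case: ifP => // _; rewrite lee_fin sqr_ge0.
rewrite /patch; case: ifPn => [|_]; last by case: ifP => // _; rewrite lee_fin sqr_ge0.
rewrite inE => -[/=]; rewrite in_itv/= => x01 Nx.
have -> : x \in @I01 R by rewrite inE /I01 /= in_itv/=; case/andP: x01 => ? ?; rewrite !ltW.
suff -> : derive1 f x = g x by [].
by apply: contrapT => h; apply: Nx; apply: hN => /(_ x01).
Qed.

(** Cauchy-Schwarz, obtained by integrating [2 * c * g - c ^+ 2 <= g ^+ 2] with [c] the mean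
    slope. *)
Lemma energy_cell (g : R -> R) a b : mu.-integrable setT (EFin \o g) -> a < b ->
  (((\int[mu]_(t in `]a, b]) g t) ^+ 2 / (b - a))%:E <= \int[mu]_(t in `]a, b]) (g t ^+ 2)%:E)%E.
Proof.
move=> ig ab; set D := (`]a, b]%classic : set (measurableTypeR R)); set J := \int[mu]_(t in D) g t.
have mD : measurable D by exact: measurable_itv.
have igD : mu.-integrable D (EFin \o g) by apply: integrableS ig.
have muD : mu D = (b - a)%:E by apply: etrans (lebesgue_measure_itv _) _; rewrite /= lte_fin ab.
have mg : measurable_fun D (fun x => (g x ^+ 2)%:E).
  apply/measurable_EFinP; apply: measurable_funX; apply/measurable_EFinP; exact: measurable_int igD.
have [inf|/lt_eqF fin] := leP +oo%E (\int[mu]_(t in D) (g t ^+ 2)%:E)%E.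
  by apply: le_trans inf; rewrite leey.
have ig2 : mu.-integrable D (EFin \o (fun x => g x ^+ 2)).
  apply/integrableP; split => //; under eq_integral do rewrite /= ger0_norm ?sqr_ge0//.
  by rewrite ltey fin.
have ic (c : R) : mu.-integrable D (EFin \o cst c).
  apply/integrableP; split; first by apply/measurable_EFinP.
  apply: le_lt_trans (_ : (`|c|%:E * mu D < +oo)%E); first by rewrite -(integral_cst mu mD).
  by rewrite muD -EFinM ltey.
pose c := J / (b - a).
have icg : mu.-integrable D (EFin \o (fun x => 2 * c * g x)) by exact: integrableZl igD.
rewrite -[X in (_ <= X)%E]fineK; last first.
  rewrite ge0_fin_numE ?ltey ?fin//; apply: integral_ge0 => x _; by rewrite lee_fin sqr_ge0.
rewrite lee_fin -[X in _ <= X]/(\int[mu]_(t in D) (g t ^+ 2)).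
have -> : J ^+ 2 / (b - a) = \int[mu]_(t in D) (2 * c * g t - c ^+ 2).
  have -> : \int[mu]_(t in D) (2 * c * g t - c ^+ 2) = 2 * c * J - c ^+ 2 * (b - a).
    rewrite (RintegralB mD icg (ic (c ^+ 2))) (RintegralZl (2 * c) mD igD); congr (_ - _).
    exact: (etrans (Rintegral_cst mu mD (c ^+ 2)) (congr1 (fun z => c ^+ 2 * fine z) muD)).
  have ba : b - a != 0 by rewrite subr_eq0 gt_eqF.
  rewrite /c.
  by field.
apply: le_Rintegral => //.
  exact: (integrableB mD icg (ic (c ^+ 2))).
by move=> x _; have := sqr_ge0 (g x - c); rewrite sqrrB; lra.
Qed.

Lemma energy_chain (f : R -> R) m (t : nat -> R) : abs_cont01 f ->
  0 <= t 0%N -> (forall i, (i < m)%N -> t i < t i.+1) -> t m <= 1 ->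
  ((\sum_(i < m) ((f (t i.+1) - f (t i)) ^+ 2 / (t i.+1 - t i)))%:E <= energy01 f)%E.
Proof.
move=> acf t0 tlt tm; have [g [ig gE gen]] := energy_primitive acf; apply: le_trans gen.
have mg : measurable_fun setT (fun x => (g x ^+ 2)%:E).
  apply/measurable_EFinP; apply: measurable_funX; apply/measurable_EFinP; exact: measurable_int ig.
have tle i j : (i <= j)%N -> (j <= m)%N -> t i <= t j.
  elim: j => [|j IH]; first by rewrite leqn0 => /eqP ->.
  rewrite leq_eqVlt => /predU1P[->//|]; rewrite ltnS => ij jm.
  by apply: le_trans (IH ij (ltnW jm)) (ltW (tlt _ jm)).
suff H k : (k <= m)%N -> ((\sum_(i < k) ((f (t i.+1) - f (t i)) ^+ 2 / (t i.+1 - t i)))%:E <=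
    \int[mu]_(x in `]0%R, t k]) (g x ^+ 2)%:E)%E.
  apply: le_trans (H m (leqnn m)) _; apply: ge0_subset_integral => //.
  - exact: measurable_funTS.
  - by move=> x _; rewrite lee_fin sqr_ge0.
  - by apply: subset_itvl; rewrite bnd_simp.
elim: k => [_|k IH km].
  by rewrite big_ord0; apply: integral_ge0 => x _; rewrite lee_fin sqr_ge0.
have tk0 : 0 <= t k by apply: le_trans t0 (tle _ _ _ (ltnW km)).
have -> : `]0, t k.+1]%classic = `]0, t k] `|` `]t k, t k.+1] :> set (measurableTypeR R).
  by rewrite -itv_bndbnd_setU// bnd_simp// (ltW (tlt _ km)).
rewrite ge0_integral_setU//; last 3 first.
- exact: measurable_funTS.
- by move=> x _; rewrite lee_fin sqr_ge0.
- rewrite disj_set2E; apply/eqP; rewrite -subset0 => x [] /=; rewrite !in_itv/= => /andP[_ p] /andP[q _].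
  by have := lt_le_trans q p; rewrite ltxx.
rewrite big_ord_recr /= EFinD; apply: leeD; first exact: IH (ltnW km).
rewrite gE//; last by apply: le_trans tm; apply: tle.
  exact: energy_cell (tlt _ km).
exact: ltW (tlt _ km).
Qed.

Lemma Uset_chain d (f : R -> 'rV[R]_d) m (t : nat -> R) : Uset f ->
  0 <= t 0%N -> (forall i, (i < m)%N -> t i < t i.+1) -> t m <= 1 ->
  \sum_(i < m) (enorm (f (t i.+1) - f (t i)) ^+ 2 / (t i.+1 - t i)) <= 1.
Proof.
move=> [_ acf ef] t0 tlt tm; rewrite -lee_fin; apply: le_trans ef.
have -> : \sum_(i < m) (enorm (f (t i.+1) - f (t i)) ^+ 2 / (t i.+1 - t i)) =
   \sum_(j < d) \sum_(i < m) ((f (t i.+1) ord0 j - f (t i) ord0 j) ^+ 2 / (t i.+1 - t i)).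
  rewrite exchange_big; apply: eq_bigr => i _; rewrite enorm_sqr mulr_suml.
  by apply: eq_bigr => j _; rewrite !mxE.
by rewrite -sumEFin; apply: lee_sum => j _; exact: energy_chain (fun s => f s ord0 j) _ _ (acf j) t0 tlt tm.
Qed.

Lemma Uset_holder d (f : R -> 'rV[R]_d) s t : Uset f -> 0 <= s -> s <= t -> t <= 1 ->
  enorm (f t - f s) ^+ 2 <= t - s.
Proof.
move=> Uf s0; rewrite le_eqVlt => /predU1P[->|st] t1; first by rewrite !subrr enorm0 expr0n.
have := @Uset_chain d f 1 (fun i => if i is 0%N then s else t) Uf s0 _ t1.
rewrite big_ord1 /= ler_pdivrMr ?subr_gt0// mul1r; apply.
by case.
Qed.

End Energy.

(** * Piecewise linear paths and their energy *)

Section PiecewiseLinear.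
Variable R : realType.
Local Notation mu := (@lebesgue_measure R).

Lemma clamp0 (x : R) : x <= 0 -> clamp x = 0.
Proof. by move=> x0; rewrite /clamp max_l// ge_min x0. Qed.

Lemma clamp1 (x : R) : 1 <= x -> clamp x = 1.
Proof. by move=> x1; rewrite /clamp min_r// max_r. Qed.

Lemma clamp_dist (x y : R) : `|clamp y - clamp x| <= `|y - x|.
Proof.
wlog xy : x y / x <= y => [H|].
  by have [/H//|/ltW/H] := leP x y; rewrite distrC [X in _ <= X]distrC.
by rewrite !ger0_norm ?subr_ge0// ?clamp_homo// clamp_lip.
Qed.

Lemma lipschitz_abs_cont (f : R -> R) L : (forall s t, `|f t - f s| <= L * `|t - s|) -> abs_cont01 f.
Proof.
move=> fL; have L1 : 0 < `|L| + 1 by rewrite ltr_wpDl.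
move=> e e0; exists (e / (`|L| + 1)); first by rewrite divr_gt0.
move=> m a b ab _; rewrite ltr_pdivlMr// => h; apply: le_lt_trans h.
rewrite mulr_suml; apply: ler_sum => i _; apply: le_trans (fL _ _) _.
have [/andP[_ h] _] := ab _ (ltn_ord i).
rewrite ger0_norm ?subr_ge0// mulrC; apply: ler_wpM2l; rewrite ?subr_ge0//.
by have := ler_norm L; lra.
Qed.

Variable m : nat.
Hypothesis m0 : (0 < m)%N.
Let mR : 0 < m%:R :> R. Proof. by rewrite ltr0n. Qed.

(** A sum of ramps, the [i]-th one rising from 0 to 1 on the cell [i]: the linear interpolation of
    [y - y 0] at the nodes [i / m]. *)
Definition plin (y : nat -> R) (t : R) := \sum_(i < m) clamp (m%:R * t - i%:R) * (y i.+1 - y i).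

Lemma plin_cell (y : nat -> R) j t : (j < m)%N -> j%:R <= m%:R * t <= j.+1%:R ->
  plin y t = y j - y 0%N + (m%:R * t - j%:R) * (y j.+1 - y j).
Proof.
move=> jm /andP[jt tj].
rewrite /plin -(big_mkord xpredT (fun i => clamp (m%:R * t - i%:R) * (y i.+1 - y i))).
rewrite (big_cat_nat (n := j))//=; last exact: ltnW.
rewrite [X in _ + X](big_cat_nat (n := j.+1))//= big_nat1.
rewrite (eq_big_nat _ _ (F2 := fun i => y i.+1 - y i)); last first.
  move=> i /andP[_ ij]; rewrite clamp1 ?mul1r//.
  have : i.+1%:R <= j%:R :> R by rewrite ler_nat.
  by rewrite -natr1; lra.
rewrite telescope_sumr// clamp_id; last by move: tj; rewrite -natr1; lra.
rewrite [X in _ + (_ + X)]big_nat_cond [X in _ + (_ + X)]big1 ?addr0// => i /andP[/andP[ji _] _].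
rewrite clamp0 ?mul0r//; have : j.+1%:R <= i%:R :> R by rewrite ler_nat.
by move: tj; lra.
Qed.

Lemma plin_node (y : nat -> R) j : (j <= m)%N -> plin y (j%:R / m%:R) = y j - y 0%N.
Proof.
have mj k : m%:R * (k%:R / m%:R) = k%:R :> R by rewrite mulrC divfK// gt_eqF.
case: j => [_|j jm].
  rewrite (@plin_cell y 0)// mj; first by ring.
  by rewrite lexx ler0n.
rewrite (@plin_cell y j)// mj -natr1; first by ring.
by rewrite lexx andbT; lra.
Qed.

Lemma plin_abs_cont (y : nat -> R) : abs_cont01 (plin y).
Proof.
apply: (@lipschitz_abs_cont _ (\sum_(i < m) m%:R * `|y i.+1 - y i|)) => s t.
rewrite /plin -sumrB mulr_suml; apply: le_trans (ler_norm_sum _ _ _) _.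
apply: ler_sum => i _; rewrite -mulrBl normrM mulrAC; apply: ler_wpM2r => //.
apply: le_trans (clamp_dist _ _) _.
by rewrite opprD opprK addrACA addNr addr0 -mulrBr normrM ger0_norm.
Qed.

Lemma derive1_plin (y : nat -> R) j t : (j < m)%N -> j%:R < m%:R * t < j.+1%:R ->
  derive1 (plin y) t = m%:R * (y j.+1 - y j).
Proof.
move=> jm /andP[jt tj]; rewrite /derive1; apply: cvg_lim => //.
apply: cvg_near_cst; near=> h.
have h0 : h != 0 by near: h; exact: nbhs_dnbhs_neq.
have /andP[h1 h2] : - (m%:R * t - j%:R) < m%:R * h < j.+1%:R - m%:R * t.
  have : `|m%:R * h| < Num.min (m%:R * t - j%:R) (j.+1%:R - m%:R * t).
    rewrite normrM gtr0_norm// mulrC -ltr_pdivlMr//; near: h; apply: dnbhs0_lt.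
    by rewrite divr_gt0// lt_min !subr_gt0 jt.
  by rewrite lt_min ![`|_| < _]ltr_norml => /andP[/andP[a _] /andP[_ ->]]; rewrite a.
rewrite (@plin_cell y j)// ?(@plin_cell y j)//; last 2 first.
- by apply/andP; split; lra.
- by apply/andP; split; rewrite mulrDr; lra.
rewrite mulrDr /GRing.scale /=; field.
Unshelve. all: by end_near. Qed.

(** The squared derivative lies below a step function [G]. *)
Lemma energy_plin (y : nat -> R) :
  (energy01 (plin y) <= (m%:R * \sum_(i < m) (y i.+1 - y i) ^+ 2)%:E)%E.
Proof.
pose C j : set (measurableTypeR R) := `]j%:R / m%:R, j.+1%:R / m%:R[%classic.
pose N : set (measurableTypeR R) := range (fun j : nat => j%:R / m%:R).
pose c j := (m%:R * (y j.+1 - y j)) ^+ 2.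
have mC j : measurable (C j) by exact: measurable_itv.
have N0 : mu N = 0 by apply: countable_lebesgue_measure0; apply: card_le_trans (card_image_le _ _) _; exact: countableP.
have mN : measurable N by apply: countable_measurable => [t|]; [exact: measurable_set1|]; apply: card_le_trans (card_image_le _ _) _; exact: countableP.
(* The value [+oo] on the null set [N] of nodes absorbs whatever [derive1] returns at the
   corners. *)
pose G x := (\sum_(j < m) ((cst (c j)%:E) \_ (C j)) x + ((cst +oo%E) \_ N) x)%E.
have G0 x j : (0 <= ((cst (c j)%:E) \_ (C j)) x)%E.
  by rewrite /patch; case: ifP => // _; rewrite lee_fin sqr_ge0.
have iG : (\int[mu]_x G x = (m%:R * \sum_(i < m) (y i.+1 - y i) ^+ 2)%:E)%E.
  rewrite /G ge0_integralD//=; last 4 first.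
  - by move=> x _; apply: sume_ge0 => j _.
  - apply: emeasurable_sum => j; apply/(measurable_restrictT _ _).1 => //; exact: measurable_cst.
  - by move=> x _; rewrite /patch; case: ifP => // _; rewrite leey.
  - by apply/(measurable_restrictT _ _).1 => //; exact: measurable_cst.
  have -> : (\int[mu]_x ((cst +oo) \_ N) x = 0)%E.
    apply: etrans (esym (integral_mkcond N _)) (etrans (integral_cst mu mN +oo%E) _).
    exact: etrans (congr1 (mule +oo%E) N0) (mule0 _).
  rewrite adde0.
  rewrite ge0_integral_sum//; last first.
    by move=> j; apply/(measurable_restrictT _ _).1 => //; exact: measurable_cst.
  rewrite mulr_sumr -sumEFin; apply: eq_bigr => j _.
  have muC : mu (C j) = (m%:R^-1)%:E.
    apply: etrans (lebesgue_measure_itv _) _; rewrite /= lte_fin ltr_pM2r ?invr_gt0// ltr_nat ltnSn.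
    by rewrite -EFinD -mulrBl -natrB// subSnn mul1r.
  apply: etrans (esym (integral_mkcond (C j) _)) (etrans (integral_cst mu (mC j) _) _).
  apply: etrans (congr1 (mule (c j)%:E) muC) _.
  by rewrite -EFinM /c; congr EFin; field; rewrite gt_eqF.
rewrite -iG /energy01 [X in (X <= _)%E]integral_mkcond; apply: ge0_le_integralT => x.
  by rewrite /patch; case: ifP => // _; rewrite lee_fin sqr_ge0.
rewrite [X in (X <= _)%E]/patch; case: ifPn => [|_]; last first.
  apply: adde_ge0; first exact: sume_ge0.
  by rewrite /patch; case: ifP => // _; rewrite leey.
rewrite inE /I01 /= in_itv/= => /andP[x0 x1].
have [Nx|Nx] := pselect (N x).
  rewrite /G [X in (_ + X)%E]/patch (mem_set Nx) /= addey ?leey//.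
  by rewrite gt_eqF// (lt_le_trans (ltNyr 0))// sume_ge0.
have mx0 : 0 <= m%:R * x by rewrite mulr_ge0// ltW.
pose j := Num.trunc (m%:R * x).
have /andP[j1 j2] : j%:R <= m%:R * x < j.+1%:R by rewrite truncn_itv.
have j1' : j%:R < m%:R * x.
  rewrite lt_neqAle j1 andbT; apply/eqP => e; apply: Nx; exists j => //.
  by rewrite e mulrC mulKf// gt_eqF.
have jm : (j < m)%N.
  rewrite -(ltr_nat R); apply: lt_le_trans j1' _; by rewrite -[X in _ <= X]mulr1 ler_pM2l.
rewrite (derive1_plin _ jm) ?j1'//.
rewrite /G (bigD1 (Ordinal jm))//= [X in (X + _ + _)%E]/patch mem_set/=; last first.
  by rewrite /C /= in_itv/= ltr_pdivrMr// ltr_pdivlMr// ![x * _]mulrC j1'.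
rewrite -addeA leeDl//; apply: adde_ge0; first exact: sume_ge0.
by rewrite /patch; case: ifP => // _; rewrite leey.
Qed.

End PiecewiseLinear.

(** * Approximation of the supremum by polylines *)

Section Polylines.
Variables (R : realType) (d : nat).

Definition polyline m (y : nat -> 'rV[R]_d) : 'I_m.+1 -> 'rV[R]_(1 + d) :=
  fun i => row_mx (const_mx (i%:R / m%:R)) (y i).

Arguments polyline : clear implicits.

Lemma polytope_comb n k m (v : 'I_m -> 'rV[R]_n) (w : 'I_k -> R) (c : 'I_k -> 'rV[R]_n) :
  (forall i, 0 <= w i) -> \sum_i w i = 1 -> (forall i, polytope v (c i)) ->
  polytope v (\sum_i w i *: c i).
Proof.
move=> w0 w1 /choice[u hu]; exists (fun j => \sum_i w i * u i j); split => [j||].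
- by apply: sumr_ge0 => i _; rewrite mulr_ge0//; case: (hu i).
- rewrite exchange_big -[RHS]w1; apply: eq_bigr => i _; rewrite -mulr_sumr.
  by case: (hu i) => _ -> _; rewrite mulr1.
under [RHS]eq_bigr do rewrite scaler_suml.
rewrite exchange_big; apply: eq_bigr => i _; have [_ _ ->] := hu i.
by rewrite scaler_sumr; apply: eq_bigr => j _; rewrite scalerA.
Qed.

(** The energy of the piecewise linear path through [y i] at times [i / m]: squared increments
    divided by the step [1 / m]. *)
Definition grid_energy m (y : nat -> 'rV[R]_d) : R :=
  m%:R * \sum_(i < m) enorm (y i.+1 - y i) ^+ 2.

Lemma polyline_sub m (y : nat -> 'rV[R]_d) (f : R -> 'rV[R]_d) : (0 < m)%N ->
  (forall i, (i <= m)%N -> f (i%:R / m%:R) = y i) -> polytope (polyline m y) `<=` Hst f.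
Proof.
move=> m0 fy; rewrite -(@hull_polytope _ _ _ (polyline m y) (range (polyline m y)))//.
apply: le_hull => _ [i _ <-]; have im : (i <= m)%N by rewrite -ltnS.
exists (i%:R / m%:R); last by rewrite fy.
by rewrite /I01 /= in_itv/= divr_ge0//= ler_pdivrMr ?ltr0n// mul1r ler_nat.
Qed.

Lemma vol_polyline_le m (y : nat -> 'rV[R]_d) : (0 < m)%N -> y 0%N = 0 ->
  grid_energy m y <= 1 -> (vol (polytope (polyline m y)) <= lambdaS R d)%E.
Proof.
move=> m0 y0 ge; pose f t : 'rV[R]_d := \row_k plin m (fun i => y i ord0 k) t.
have fy i : (i <= m)%N -> f (i%:R / m%:R) = y i.
  by move=> im; apply/rowP => k; rewrite mxE plin_node// y0 mxE subr0.
apply: le_trans (le_vol (polyline_sub m0 fy)) _.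
apply: ereal_sup_ubound; exists f => //; split.
- by have := fy 0%N isT; rewrite mul0r y0.
- move=> k; have -> : (fun s => f s ord0 k) = plin m (fun i => y i ord0 k).
    by apply/funext => s; rewrite mxE.
  exact: plin_abs_cont.
apply: le_trans (_ : (grid_energy m y)%:E <= _)%E; last by rewrite lee_fin.
have -> : grid_energy m y = \sum_(k < d) m%:R * \sum_(i < m) (y i.+1 ord0 k - y i ord0 k) ^+ 2.
  rewrite -mulr_sumr /grid_energy exchange_big; congr (_ * _); apply: eq_bigr => i _.
  by rewrite enorm_sqr; apply: eq_bigr => k _; rewrite !mxE.
rewrite -sumEFin; apply: lee_sum => k _.
have -> : (fun s => f s ord0 k) = plin m (fun i => y i ord0 k).
  by apply/funext => s; rewrite mxE.
exact: energy_plin.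
Qed.

Lemma enorm_row_mx a (x : 'rV[R]_d) : enorm (row_mx (const_mx a : 'rV_1) x) ^+ 2 = a ^+ 2 + enorm x ^+ 2.
Proof.
rewrite !enorm_sqr /dot big_split_ord big_ord1 /= row_mxEl mxE; congr (_ + _).
by apply: eq_bigr => i _; rewrite row_mxEr.
Qed.

Lemma sample_energy m (f : R -> 'rV[R]_d) : (0 < m)%N -> Uset f ->
  grid_energy m (fun i => f (i%:R / m%:R)) <= 1.
Proof.
move=> m0 Uf; have mR : 0 < m%:R :> R by rewrite ltr0n.
have tS i : i.+1%:R / m%:R - i%:R / m%:R = m%:R^-1 :> R by rewrite -mulrBl -natr1 [_ - _]addrAC subrr add0r mul1r.
have := @Uset_chain R d f m (fun i => i%:R / m%:R) Uf _ _ _.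
rewrite /grid_energy mulr_sumr; under eq_bigr do rewrite tS invrK mulrC.
apply; first by rewrite mul0r.
- by move=> i _; rewrite -subr_gt0 tS invr_gt0.
- by rewrite divff// gt_eqF.
Qed.

(** A point of the graph is compared with the preceding node: the time gap is at most [1 / m], and
    by the Hölder bound so is the squared space gap. *)
Lemma Hst_sub m (f : R -> 'rV[R]_d) : (0 < m)%N -> Uset f ->
  Hst f `<=` parallel (polytope (polyline m (fun i => f (i%:R / m%:R)))) (Num.sqrt (2 / m%:R)).
Proof.
move=> m0 Uf; have mR : 0 < m%:R :> R by rewrite ltr0n.
set C := polytope _.
have near t : I01 t -> exists2 c, C c & enorm (row_mx (const_mx t : 'rV_1) (f t) - c) <= Num.sqrt (2 / m%:R).
  rewrite /I01 /= in_itv/= => /andP[t0 t1].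
  have mt0 : 0 <= m%:R * t by rewrite mulr_ge0// ltW.
  pose j := Num.trunc (m%:R * t).
  have /andP[j1 j2] : j%:R <= m%:R * t < j.+1%:R by rewrite truncn_itv.
  have jm : (j < m.+1)%N.
    by rewrite ltnS -(ler_nat R); apply: le_trans j1 _; rewrite -[X in _ <= X]mulr1 ler_pM2l.
  exists (polyline m (fun i => f (i%:R / m%:R)) (Ordinal jm)); first exact: polytope_vertex.
  have s1 : j%:R / m%:R <= t by rewrite ler_pdivrMr// mulrC.
  have s2 : t - j%:R / m%:R <= m%:R^-1.
    by rewrite -(ler_pM2l mR) mulrBr mulrCA divff ?gt_eqF// mulr1 -natr1 in j2 *; lra.
  have s0 : 0 <= j%:R / m%:R :> R by rewrite divr_ge0.
  rewrite -(ler_pXn2r (n := 2))// ?nnegrE ?enorm_ge0 ?sqrtr_ge0// [X in _ <= X]sqr_sqrtr ?divr_ge0//.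
  rewrite /polyline /= opp_row_mx add_row_mx.
  have -> : const_mx t - const_mx (j%:R / m%:R) = const_mx (t - j%:R / m%:R) :> 'rV[R]_1.
    by apply/rowP => i; rewrite !mxE.
  rewrite enorm_row_mx; have := Uset_holder Uf s0 s1 t1.
  have : (t - j%:R / m%:R) ^+ 2 <= t - j%:R / m%:R.
    by rewrite expr2 -[X in _ <= X]mul1r; apply: ler_wpM2r; lra.
  by lra.
move=> _ [k [w [p [w0 w1 pA ->]]]].
have /choice[c hc] : forall i, exists c, C c /\ enorm (p i - c) <= Num.sqrt (2 / m%:R).
  by move=> i; have [t t01 <-] := pA i; have [c] := near t t01; exists c.
exists (\sum_i w i *: c i).
  by apply: polytope_comb => // i; case: (hc i).
rewrite -sumrB; under eq_bigr do rewrite -scalerBr.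
apply: le_trans (enorm_sum _ _) _; rewrite -[X in _ <= X]mul1r -[X in _ <= X * _]w1 mulr_suml.
by apply: ler_sum => i _; rewrite enormZ ger0_norm//; apply: ler_wpM2l => //; case: (hc i).
Qed.

Lemma polyline_enorm m y i : (0 < m)%N -> (forall i, (i <= m)%N -> enorm (y i) <= 1) ->
  enorm (polyline m y i) <= 2.
Proof.
move=> m0 h; rewrite -(ler_pXn2r (n := 2))// ?nnegrE ?enorm_ge0// enorm_row_mx.
have a : enorm (y i) ^+ 2 <= 1 by rewrite exprn_ile1 ?enorm_ge0 ?h// -ltnS.
suff : (i%:R / m%:R) ^+ 2 <= 1 :> R by lra.
by rewrite exprn_ile1// ?divr_ge0// ler_pdivrMr ?ltr0n// mul1r ler_nat -ltnS.
Qed.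

Lemma Uset_enorm (f : R -> 'rV[R]_d) t : Uset f -> 0 <= t <= 1 -> enorm (f t) <= 1.
Proof.
move=> Uf /andP[t0 t1]; have := Uset_holder Uf (lexx 0) t0 t1.
have [-> _ _] := Uf; rewrite !subr0 => h.
by rewrite -(ler_pXn2r (n := 2))// ?nnegrE ?enorm_ge0// expr1n; apply: le_trans h t1.
Qed.

Lemma vol_Hst_le (f : R -> 'rV[R]_d) : Uset f -> exists2 K, 0 <= K & forall m, (2 <= m)%N ->
  (vol (Hst f) <= vol (polytope (polyline m (fun i => f (i%:R / m%:R)%R))) + (K * Num.sqrt (2 / m%:R))%:E)%E.
Proof.
move=> Uf; have [K K0 hK] := @vol_parallel_lip R (1 + d) 2.
exists K => // m m2; have m0 : (0 < m)%N by apply: leq_trans m2.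
apply: le_trans (le_vol (Hst_sub m0 Uf)) _; apply: hK.
  move=> i; apply: polyline_enorm => // j jm; apply: Uset_enorm => //.
  by rewrite divr_ge0//= ler_pdivrMr ?ltr0n// mul1r ler_nat.
rewrite sqrtr_ge0/= -(ler_pXn2r (n := 2))// ?nnegrE ?sqrtr_ge0// expr1n sqr_sqrtr ?divr_ge0//.
by rewrite ler_pdivrMr ?ltr0n// mul1r ler_nat.
Qed.

Lemma sqrt_div_cvg0 (c K e : R) : 0 <= c -> 0 <= K -> 0 < e -> exists M : nat, forall m, (M <= m)%N ->
  K * Num.sqrt (c / m%:R) <= e.
Proof.
move=> c0 K0 e0; pose z := c * K ^+ 2 / e ^+ 2.
have z0 : 0 <= z by rewrite divr_ge0 ?sqr_ge0// mulr_ge0 ?sqr_ge0.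
exists (Num.trunc z).+1 => m hm; have /andP[_ z1] : (Num.trunc z)%:R <= z < (Num.trunc z).+1%:R by rewrite truncn_itv.
have mR : z < m%:R by apply: lt_le_trans z1 _; rewrite ler_nat.
have m0 : 0 < m%:R :> R by apply: le_lt_trans mR.
rewrite -(ler_pXn2r (n := 2))// ?nnegrE ?mulr_ge0 ?sqrtr_ge0//; last exact: ltW.
rewrite exprMn sqr_sqrtr; last by rewrite divr_ge0// ltW.
rewrite mulrA ler_pdivrMr// [K ^+ 2 * c]mulrC [e ^+ 2 * _]mulrC.
by move: mR; rewrite /z ltr_pdivrMr ?exprn_gt0// => /ltW.
Qed.

(* The polylines on a fixed fine grid already nearly exhaust the supremum. *)
Lemma lambda_grid (c : \bar R) : (c < lambdaS R d)%E -> exists M : nat, forall m, (M <= m)%N ->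
  exists y : nat -> 'rV[R]_d, [/\ y 0%N = 0, grid_energy m y <= 1 & (c < vol (polytope (polyline m y)))%E].
Proof.
move=> /ereal_sup_gt[_ [f Uf <-] cf]; have [K K0 hK] := vol_Hst_le Uf.
have [e e0 he] : exists2 e : R, 0 < e & forall x, (vol (Hst f) <= x + e%:E)%E -> (c < x)%E.
  case: c cf => [c cf| |_].
  - case E : (vol (Hst f)) cf => [v| |] cf.
    + exists ((v - c) / 2); first by rewrite divr_gt0// subr_gt0.
      move=> [x| |]//; rewrite -?EFinD ?lee_fin ?lte_fin ?ltry//.
      by move: cf; rewrite lte_fin; lra.
    + by exists 1 => // -[x| |]//; rewrite ?ltry.
    + by [].
  - by rewrite ltNge leey.
  - exists 1 => // x h; rewrite ltNye; apply/eqP => xE.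
    by move: h; rewrite xE /= leeNy_eq gt_eqF// (lt_le_trans _ (vol_ge0 _)).
have [M hM] := sqrt_div_cvg0 (ler0n R 2) K0 e0.
exists (maxn M 2) => m; rewrite geq_max => /andP[Mm m2].
have m0 : (0 < m)%N by apply: leq_trans m2.
exists (fun i => f (i%:R / m%:R)); split.
- by rewrite mul0r; case: Uf.
- exact: sample_energy.
apply: he; apply: le_trans (hK m m2) _; apply: leeD => //; rewrite lee_fin; exact: hM.
Qed.

Lemma lambda_le (c : \bar R) : (forall m y, (0 < m)%N -> y 0%N = 0 -> grid_energy m y <= 1 ->
  (vol (polytope (polyline m y)) <= c)%E) -> (lambdaS R d <= c)%E.
Proof.
move=> h; rewrite leNgt; apply/negP => /lambda_grid[M hM].
have [y [y0 ye]] := hM (maxn M 1) (leq_maxl _ _).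
by rewrite ltNge h// leq_maxr.
Qed.

Lemma grid_energy_enorm m y i : (0 < m)%N -> y 0%N = 0 -> grid_energy m y <= 1 -> (i <= m)%N ->
  enorm (y i) <= 1.
Proof.
move=> m0 y0 ye im; have -> : y i = \sum_(j < i) (y j.+1 - y j).
  by rewrite -(big_mkord xpredT (fun j => y j.+1 - y j)) telescope_sumr// y0 subr0.
apply: le_trans (enorm_sum _ _) _.
apply: le_trans (_ : \sum_(j < m) enorm (y j.+1 - y j) <= _).
  rewrite -!(big_mkord xpredT (fun j => enorm (y j.+1 - y j))) [X in _ <= X](big_cat_nat (n := i))//= lerDl.
  by apply: sumr_ge0 => j _; exact: enorm_ge0.
have mR : 0 < m%:R :> R by rewrite ltr0n.
(* AM-GM: x <= (m x^2 + 1/m)/2 *)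
apply: le_trans (_ : \sum_(j < m) (m%:R * enorm (y j.+1 - y j) ^+ 2 / 2 + m%:R^-1 / 2) <= _).
  apply: ler_sum => j _; set x := enorm _.
  have : 0 <= m%:R * (x - m%:R^-1) ^+ 2 by rewrite mulr_ge0 ?sqr_ge0// ltW.
  have mi : m%:R * m%:R^-1 = 1 :> R by rewrite divff// gt_eqF.
  have -> : m%:R * (x - m%:R^-1) ^+ 2 = m%:R * x ^+ 2 - 2 * (m%:R * m%:R^-1) * x + m%:R^-1 * (m%:R * m%:R^-1).
    by field; rewrite gt_eqF.
  rewrite mi; lra.
rewrite big_split /= sumr_const card_ord -mulr_suml -mulr_sumr.
have -> : (m%:R^-1 / 2) *+ m = 1 / 2 :> R by rewrite -mulr_natr; field; rewrite gt_eqF.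
by move: ye; rewrite /grid_energy; lra.
Qed.

Lemma lambda_lty : (lambdaS R d < +oo)%E.
Proof.
apply: le_lt_trans (ltry (\prod_(i < 1 + d) (2 * `|2|))); apply: lambda_le => m y m0 y0 ye.
apply: eball_vol_lt_pinfty => x Px; apply: (polytope_enorm_le Px) => i; apply: polyline_enorm => // j jm.
exact: grid_energy_enorm ye _.
Qed.

(** The polytope contains the image by [A] of a small cube: coordinates at most [n.+1^-1] have sum
    at most 1 and serve as weights, 0 taking the rest. *)
Lemma polytope_simplex_vol n (A : 'M[R]_n.+1) m (v : 'I_m -> 'rV[R]_n.+1) : A \in unitmx ->
  polytope v 0 -> (forall i, polytope v (row i A)) -> (0 < vol (polytope v))%E.
Proof.
move=> uA v0 vA; pose B := box ((0 : 'rV[R]_n.+1), const_mx (n.+1%:R^-1)).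
have sub : mximg A B `<=` polytope v.
  move=> _ [x Bx <-].
  have x0 i : 0 <= x ord0 i by have /andP[+ _] := Bx i; rewrite mxE.
  have x1 : \sum_i x ord0 i <= 1.
    apply: le_trans (_ : \sum_(i < n.+1) n.+1%:R^-1 <= _).
      by apply: ler_sum => i _; have /andP[_] := Bx i; rewrite mxE.
    by rewrite sumr_const card_ord -[_ *+ _]mulr_natr mulVf.
  pose w (i : 'I_n.+2) := if unlift ord0 i is Some j then x ord0 j else 1 - \sum_j x ord0 j.
  pose c (i : 'I_n.+2) := if unlift ord0 i is Some j then row j A else 0.
  have wS j : w (lift ord0 j) = x ord0 j by rewrite /w liftK.
  have cS j : c (lift ord0 j) = row j A by rewrite /c liftK.
  have -> : x *m A = \sum_i w i *: c i.
    rewrite big_ord_recl (_ : c ord0 = 0) ?scaler0 ?add0r ?mulmx_sum_row ?[LHS]/c ?unlift_none//.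
    by apply: eq_bigr => j _; rewrite wS cS.
  apply: polytope_comb => [i||i].
  - by rewrite /w; case: unliftP => [j|] _ //; rewrite subr_ge0.
  - by rewrite big_ord_recl (eq_bigr _ (fun j _ => wS j)) /w unlift_none subrK.
  - by rewrite /c; case: unliftP => [j|] _.
apply: lt_le_trans (le_vol sub); rewrite vol_mximg// vol_box.
  rewrite -EFinM lte_fin mulr_gt0// ?normr_gt0 -?unitfE -?unitmxE//.
  by apply: prodr_gt0 => i _; rewrite /= !mxE subr0 invr_gt0.
by move=> i; rewrite /= !mxE invr_ge0.
Qed.

Lemma lambda_gt0 : (0 < lambdaS R d)%E.
Proof.
pose m := d.+1; pose c : R := (m%:R * m%:R)^-1.
have c0 : 0 < c by rewrite invr_gt0 mulr_gt0.
(* The path moves by [c] along each axis in turn and rests during the last step; [c = 1 / m ^ 2]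
   keeps the energy below 1. *)
pose y i : 'rV[R]_d := \row_k (if (k < i)%N then c else 0).
have y0 : y 0%N = 0 by apply/rowP => k; rewrite !mxE.
have ye : grid_energy m y <= 1.
  apply: le_trans (_ : m%:R * \sum_(i < m) \sum_(k < d) c ^+ 2 <= _).
    apply: ler_wpM2l => //; apply: ler_sum => i _; rewrite enorm_sqr; apply: ler_sum => k _.
    rewrite !mxE -expr2; case: ltnP => h1; case: ltnP => h2; rewrite ?subrr ?subr0 ?sub0r ?expr0n ?sqrrN//=; rewrite ?sqr_ge0//.
  have -> : \sum_(i < m) \sum_(k < d) c ^+ 2 = m%:R * (d%:R * c ^+ 2).
    by rewrite !sumr_const !card_ord [RHS]mulr_natl mulr_natl.
  have dm : d%:R <= m%:R * m%:R :> R by rewrite -natrM ler_nat /m mulSn addSn ltnW// ltnS leq_addr.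
  have cm : c * (m%:R * m%:R) = 1 by rewrite /c mulVf// mulf_neq0// pnatr_eq0.
  have -> : m%:R * (m%:R * (d%:R * c ^+ 2)) = (c * (m%:R * m%:R)) * (c * d%:R) by ring.
  by rewrite cm mul1r -[X in _ <= X]cm; apply: ler_wpM2l dm; exact: ltW.
apply: lt_le_trans (vol_polyline_le (ltn0Sn d) y0 ye).
pose A : 'M[R]_(1 + d) := \matrix_i polyline m y (lift ord0 i).
apply: (@polytope_simplex_vol d A).
- rewrite -unitmx_tr -row_free_unit; apply: inj_row_free => w hw.
  have Al i : A i (lshift d (ord0 : 'I_1)) = i.+1%:R / m%:R by rewrite /A mxE /polyline row_mxEl mxE.
  have Ar i k : A i (rshift 1 k) = if (k < i.+1)%N then c else 0 by rewrite /A mxE /polyline row_mxEr mxE.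
  (* A linear relation [w] evaluated at the vertices. It vanishes at all of them, so do its
     increments: the last step isolates the time coefficient, the step [k] the coefficient of axis
     [k]. *)
  pose g i := w ord0 (lshift d (ord0 : 'I_1)) * (i%:R / m%:R) + \sum_(k < d) w ord0 (rshift 1 k) * (if (k < i)%N then c else 0).
  have g0 i : (i <= m)%N -> g i = 0.
    case: i => [_|i im]; first by rewrite /g mul0r mulr0 big1 ?addr0// => k _; rewrite mulr0.
    have : \sum_(j < 1 + d) w ord0 j * A (Ordinal im) j = 0.
      have /rowP/(_ (Ordinal im)) := hw; rewrite mxE [RHS]mxE => h; apply: etrans h.
      by apply: eq_bigr => j _; rewrite [A^T j _]mxE.
    rewrite big_split_ord big_ord1 /= => <-; rewrite /g Al; congr (_ + _).
    by apply: eq_bigr => k _; rewrite Ar.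
  have gS i : g i.+1 - g i = w ord0 (lshift d (ord0 : 'I_1)) / m%:R + \sum_(k < d) w ord0 (rshift 1 k) * (if k == i :> nat then c else 0).
    rewrite /g opprD addrACA -mulrBr -mulrBl -natr1 [_ - _]addrAC subrr add0r -sumrB; congr (_ * _ + _).
      by rewrite mul1r.
    apply: eq_bigr => k _; rewrite -mulrBr ltnS leq_eqVlt; congr (_ * _).
    by have [->|h] := eqVneq (k : nat) i; rewrite ?ltnn ?subr0// orFb subrr.
  have w0 : w ord0 (lshift d (ord0 : 'I_1)) = 0.
    have := gS d; rewrite !g0// subrr big1 ?addr0 => [/esym/eqP|k _]; last by rewrite ltn_eqF// mulr0.
    by rewrite mulf_eq0 invr_eq0 pnatr_eq0 orbF => /eqP.
  have wk (k : 'I_d) : w ord0 (rshift 1 k) = 0.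
    have := gS k; rewrite !g0 ?(leq_trans (ltn_ord k))// ?(leq_trans (ltnW (ltn_ord k)))//.
    rewrite subrr w0 mul0r add0r (bigD1 k)//= eqxx big1 ?addr0 => [/esym/eqP|i ik]; last first.
      by rewrite (_ : (i == k :> nat) = false) ?mulr0//; exact: negbTE.
    by rewrite mulf_eq0 (gt_eqF c0) orbF => /eqP.
  apply/rowP => i; rewrite mxE; case: (@splitP 1 d i) => k ik.
    by have -> : i = lshift d (ord0 : 'I_1) by apply/val_inj; apply: etrans ik _; rewrite ord1.
  by have -> : i = rshift 1 k by apply/val_inj.
- have <- : polyline m y ord0 = 0 by rewrite /polyline /= y0 mul0r; exact: row_mx0.
  exact: polytope_vertex.
move=> i; rewrite rowK; exact: polytope_vertex.
Qed.

End Polylines.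
Arguments polyline {R d} m y _.

(** * The planar constant *)

Section PlanarConstant.
Variable R : realType.

(* The slopes [a] of the least concave majorant are the projection of the slopes [D] onto the cone of
   nonincreasing sequences. *)
Lemma majorant_slopes m (D : nat -> R) : exists a : nat -> R, [/\
  forall i j, (i <= j)%N -> (j < m)%N -> a j <= a i,
  \sum_(i < m) a i = \sum_(i < m) D i,
  forall k, (k <= m)%N -> \sum_(i < k) D i <= \sum_(i < k) a i &
  \sum_(i < m) a i ^+ 2 <= \sum_(i < m) a i * D i].
Proof.
pose v : 'rV[R]_m := \row_i D i.
pose K := [set a : 'rV[R]_m | forall i j : 'I_m, (i <= j)%N -> a ord0 j <= a ord0 i].
(* As 0 is in [K], the projection is sought in a ball around [v], which gives compactness. *)
pose S := K `&` [set a | enorm (v - a) <= enorm v].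
have cS : continuous (fun a : 'rV[R]_m => enorm (v - a)).
  apply: continuous_enorm => i.
  have -> : (fun a : 'rV[R]_m => (v - a) ord0 i) = fun a => v ord0 i - a ord0 i.
    by apply/funext => a; rewrite !mxE.
  by move=> a; apply: continuousB; [exact: cst_continuous|exact: coord_continuous].
have compS : compact S.
  apply: bounded_closed_compact.
    exists (2 * enorm v); split => [|M hM a [_ ha] /=]; first exact: num_real.
    apply: ltW; apply: le_lt_trans hM.
    rewrite [X in X <= _]/Num.norm/= mx_normrE; apply/bigmax_leP; split => [|[i j] _ /=].
      by rewrite mulr_ge0// enorm_ge0.
    rewrite ord1; apply: le_trans (coord_le_enorm _ _) _.
    by have := enorm_triangleB a v 0; rewrite !subr0 enormC; move: ha => /=; lra.
  apply: closedI; last exact: closed_le_continuous.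
  have -> : K = \bigcap_(i : 'I_m) \bigcap_(j : 'I_m) [set a : 'rV[R]_m | (i <= j)%N -> a ord0 j <= a ord0 i].
    apply/seteqP; split => [a h i _ j _|a h i j]; [exact: h|exact: h i I j I].
  apply: closed_bigI => i _; apply: closed_bigI => j _.
  have [ij|ij] := boolP (i <= j)%N; last by rewrite [X in closed X](_ : _ = setT)//; apply/seteqP; split.
  rewrite [X in closed X](_ : _ = [set a : 'rV[R]_m | a ord0 j - a ord0 i <= 0]); last first.
    by apply/seteqP; split => a /=; rewrite subr_le0; [exact|move=> h _].
  by apply: closed_le_continuous => a; apply: continuousB; exact: coord_continuous.
have S0 : S !=set0 by exists 0; split => [i j _|/=]; rewrite ?mxE// subr0.
have [a /set_mem [aK aS] amin] := @compact_EVT_min _ _ _ S S0 compS (continuous_subspaceT cS).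
have proj b : K b -> enorm (v - a) <= enorm (v - b).
  move=> Kb; have [h|/ltW h] := leP (enorm (v - b)) (enorm v); last exact: le_trans h.
  by apply: amin; apply/mem_set.
have var c t : 0 < t -> K (a + t *: c) -> 2 * dot (v - a) c <= t * dot c c.
  move=> t0 /proj; rewrite -(ler_pXn2r (n := 2))// ?nnegrE ?enorm_ge0// !enorm_sqr => h.
  rewrite -(ler_pM2l t0); move: h; rewrite opprD addrA; move: (v - a) => z.
  have -> : dot (z - t *: c) (z - t *: c) = dot z z - 2 * t * dot z c + t * t * dot c c.
    by rewrite dotBl !dotBr !dotZl !dotZr (dotC c z); ring.
  lra.
have Kadd c t : 0 < t -> K c -> K (a + t *: c).
  by move=> t0 Kc i j ij; rewrite !mxE; apply: lerD; [exact: aK|apply: ler_wpM2l; [exact: ltW|exact: Kc]].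
have half (x z : R) : 0 <= z -> 2 * x <= z -> x <= z by lra.
(* First-order condition: the residual [v - a] lies in the polar of the cone [K]. *)
have cone c : K c -> dot (v - a) c <= 0.
  move=> Kc; apply: (@le_of_all_nat _ _ _ (dot c c)) => N; rewrite add0r.
  have N0 : 0 < N.+1%:R^-1 :> R by rewrite invr_gt0.
  by rewrite mulrC; apply: half (var c _ N0 (Kadd _ _ N0 Kc)); rewrite mulr_ge0 ?dotxx_ge0 ?ltW.
(* Shrinking [a] slightly stays in the cone, which gives the opposite sign in the direction of [a]
   itself. *)
have self : dot (v - a) a >= 0.
  rewrite -oppr_le0 -dotNr; apply: (@le_of_all_nat _ _ _ (dot a a)) => N; rewrite add0r.
  have N0 : 0 < N.+1%:R^-1 :> R by rewrite invr_gt0.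
  rewrite mulrC; apply: (half); first by rewrite mulr_ge0 ?dotxx_ge0 ?ltW.
  have := var (- a) _ N0 _; rewrite [dot (- a) _]dotNr dotNl opprK; apply.
  have aE k : (a + N.+1%:R^-1 *: - a) ord0 k = (1 - N.+1%:R^-1) * a ord0 k by rewrite !mxE mulrBl mul1r mulrN.
  move=> i j ij; rewrite !aE; apply: ler_wpM2l; last exact: aK.
  by rewrite subr_ge0 invf_le1// ler1n.
pose a' i := if insub i is Some j then a ord0 j else 0.
have a'E (i : 'I_m) : a' i = a ord0 i by rewrite /a' valK.
(* Nonincreasing test sequences: the constants 1 and -1 give equal totals, the indicators of initial
   segments compare the partial sums. *)
have test (c : nat -> R) : (forall i j, (i <= j)%N -> c j <= c i) -> \sum_(i < m) D i * c i <= \sum_(i < m) a' i * c i.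
  move=> hc; have /cone : K (\row_i c i) by move=> i j ij; rewrite !mxE hc.
  rewrite dotBl subr_le0; congr (_ <= _); apply: eq_bigr => i _; rewrite !mxE ?a'E//.
exists a'; split.
- by move=> i j ij jm; rewrite (a'E (Ordinal jm)) (a'E (Ordinal (leq_ltn_trans ij jm))) aK.
- apply/eqP; rewrite eq_le; apply/andP; split.
    have := test (fun=> -1) (fun _ _ _ => lexx _); rewrite -!mulr_suml; lra.
  by have := test (fun=> 1) (fun _ _ _ => lexx _); rewrite -!mulr_suml !mulr1.
- move=> k km.
  have trunc (F : nat -> R) : \sum_(i < m) F i * (if (i < k)%N then 1 else 0) = \sum_(i < k) F i.
    rewrite (big_ord_widen m F km) [RHS]big_mkcond /=; apply: eq_bigr => i _.
    by case: ifP; rewrite ?mulr1 ?mulr0.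
  rewrite -(trunc D) -(trunc a'); apply: (test (fun i => if (i < k)%N then 1 else 0)) => i j ij.
  by case: ifP => [jk|_]; [rewrite (leq_ltn_trans ij jk)|case: ifP].
move: self; rewrite dotBl subr_ge0 => h.
have -> : \sum_(i < m) a' i ^+ 2 = dot a a by apply: eq_bigr => i _; rewrite a'E.
by apply: le_trans h _; rewrite le_eqVlt; apply/orP; left; apply/eqP; apply: eq_bigr => i _; rewrite mxE a'E mulrC.
Qed.

Lemma sum_partial_sums (e : nat -> R) m :
  \sum_(i < m) \sum_(j < i) e j = \sum_(j < m) (m%:R - 1 - j%:R) * e j.
Proof.
elim: m => [|m IH]; first by rewrite !big_ord0.
rewrite big_ord_recr /= IH -big_split [RHS]big_ord_recr /= -natr1.
have -> : m%:R + 1 - 1 - m%:R = 0 :> R by ring.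
by rewrite mul0r addr0; apply: eq_bigr => j _; ring.
Qed.

Lemma sum_centered_sq m : \sum_(j < m) ((m%:R - 1) / 2 - j%:R) ^+ 2 <= m%:R ^+ 3 / 12 :> R.
Proof.
have H (c : R) k : \sum_(j < k) (c - j%:R) ^+ 2 =
    k%:R * c ^+ 2 - c * k%:R * (k%:R - 1) + k%:R * (k%:R - 1) * (2 * k%:R - 1) / 6.
  elim: k => [|k IH]; first by rewrite big_ord0; ring.
  by rewrite big_ord_recr /= IH -natr1; field.
rewrite H; have : 0 <= m%:R :> R by []; set x := m%:R => x0.
have -> : x * ((x - 1) / 2) ^+ 2 - (x - 1) / 2 * x * (x - 1) + x * (x - 1) * (2 * x - 1) / 6
  = x ^+ 3 / 12 - x / 12 by field.
by lra.
Qed.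

(** Here [a] and [b] are the slopes of the upper and lower boundaries. Expanding the square of
    [D - a - b] with the projection inequalities bounds the sum of squares of [e = a - b] by that of
    [D], hence by [1 / m]. Summation by parts writes the area as a weighted sum of [e]; the weights
    may be centred as [e] has sum 0, and then their squares sum to at most [m ^ 3 / 12].
    Cauchy-Schwarz gives [m / sqrt 12], which is [m] times [sqrt 3 / 6]. *)
Lemma slope_gap_bound m (D a b : nat -> R) : (0 < m)%N ->
  \sum_(i < m) a i = \sum_(i < m) b i ->
  \sum_(i < m) a i ^+ 2 <= \sum_(i < m) a i * D i ->
  \sum_(i < m) b i ^+ 2 <= \sum_(i < m) b i * D i ->
  m%:R * \sum_(i < m) D i ^+ 2 <= 1 ->
  \sum_(i < m) (\sum_(j < i) a j - \sum_(j < i) b j) <= m%:R * (Num.sqrt 3 / 6).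
Proof.
move=> m0 ab aD bD D1; have mR : 0 < m%:R :> R by rewrite ltr0n.
pose e i := a i - b i.
have e2 : \sum_(i < m) e i ^+ 2 <= \sum_(i < m) D i ^+ 2.
  have : 0 <= \sum_(i < m) (D i - a i - b i) ^+ 2 by apply: sumr_ge0 => i _; rewrite sqr_ge0.
  have -> : \sum_(i < m) (D i - a i - b i) ^+ 2 = \sum_(i < m) D i ^+ 2 - \sum_(i < m) e i ^+ 2
      + 2 * (\sum_(i < m) a i ^+ 2 - \sum_(i < m) a i * D i) + 2 * (\sum_(i < m) b i ^+ 2 - \sum_(i < m) b i * D i).
    rewrite -!sumrB !mulr_sumr -!big_split; apply: eq_bigr => i _; rewrite /e /=; ring.
  lra.
have e0 : \sum_(i < m) e i = 0 by rewrite sumrB ab subrr.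
under eq_bigr do rewrite -sumrB.
rewrite (sum_partial_sums e).
have -> : \sum_(j < m) (m%:R - 1 - j%:R) * e j = \sum_(j < m) ((m%:R - 1) / 2 - j%:R) * e j.
  apply/eqP; rewrite -subr_eq0 -sumrB; apply/eqP.
  rewrite (eq_bigr (fun i : 'I_m => (m%:R - 1) / 2 * e i)) ?(big_distrr _ _ e0)//=; last first.
    by move=> i _; rewrite -mulrBl; congr (_ * _); field.
  by rewrite -mulr_sumr e0 mulr0.
pose r := Num.sqrt 3 : R; have r0 : 0 < r by rewrite sqrtr_gt0.
have r2 : r ^+ 2 = 3 by rewrite sqr_sqrtr.
(* The ratio that makes the weighted AM-GM inequality an equality between the two bounds:
   [s ^ 2 = 12 / m ^ 4]. *)
pose s := 2 * r / m%:R ^+ 2; have s0 : 0 < s by rewrite divr_gt0 ?mulr_gt0 ?exprn_gt0.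
apply: le_trans (_ : \sum_(j < m) (s / 2 * ((m%:R - 1) / 2 - j%:R) ^+ 2 + e j ^+ 2 / (2 * s)) <= _).
  apply: ler_sum => j _; set x := (_ - j%:R); set y := e j.
  rewrite -subr_ge0; have -> : s / 2 * x ^+ 2 + y ^+ 2 / (2 * s) - x * y = (s * x - y) ^+ 2 / (2 * s).
    by field; rewrite gt_eqF.
  by rewrite divr_ge0 ?sqr_ge0// mulr_ge0// ltW.
rewrite big_split /= -mulr_sumr -mulr_suml.
have E1 := sum_centered_sq m.
have E2 : \sum_(i < m) e i ^+ 2 <= m%:R^-1.
  by apply: le_trans e2 _; rewrite -(ler_pM2l mR) divff ?gt_eqF.
apply: le_trans (_ : s / 2 * (m%:R ^+ 3 / 12) + m%:R^-1 / (2 * s) <= _).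
  apply: lerD; first by apply: ler_wpM2l; rewrite // divr_ge0// ltW.
  by apply: ler_wpM2r E2; rewrite invr_ge0 mulr_ge0// ltW.
rewrite le_eqVlt; apply/orP; left; apply/eqP; rewrite -/r /s.
have -> : m%:R^-1 / (2 * (2 * r / m%:R ^+ 2)) = r * m%:R / (4 * r ^+ 2) :> R.
  by field; rewrite !gt_eqF.
rewrite r2; field; by rewrite gt_eqF.
Qed.

Lemma vol_le_boxes n m (A : set 'rV[R]_n) (B : nat -> 'rV[R]_n * 'rV[R]_n) :
  (forall k i, (k < m)%N -> (B k).1 ord0 i <= (B k).2 ord0 i) ->
  A `<=` [set x | exists2 k, (k < m)%N & box (B k) x] -> (vol A <= (\sum_(k < m) boxvol (B k))%:E)%E.
Proof.
move=> ok AB; apply: le_trans (le_vol AB) _ => {A AB}.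
elim: m ok => [|m IH] ok.
  rewrite big_ord0 [X in vol X](_ : _ = set0) ?vol_set0//.
  by apply/seteqP; split => x // [].
rewrite big_ord_recr /= EFinD.
apply: le_trans (_ : vol ([set x | exists2 k, (k < m)%N & box (B k) x] `|` box (B m)) <= _)%E.
  by apply: le_vol => x [k]; rewrite ltnS leq_eqVlt => /predU1P[->|km] Bx; [right|left; exists k].
apply: le_trans (outer_measureU2 _ _ _) _; apply: leeD.
  by apply: IH => k i km; apply: ok; exact: ltnW.
by apply: vol_le_box => // i; exact: ok.
Qed.

Lemma vol_ge_boxes n m (A : set 'rV[R]_n) (B : nat -> 'rV[R]_n * 'rV[R]_n) :
  (forall k i, (k < m)%N -> (B k).1 ord0 i <= (B k).2 ord0 i) ->
  (forall k, (k < m)%N -> box (B k) `<=` A) ->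
  (forall j k x, (j < k)%N -> (k < m)%N -> box (B j) x -> ~ box (B k) x) ->
  ((\sum_(k < m) boxvol (B k))%:E <= vol A)%E.
Proof.
move=> ok BA dis; apply: le_trans (le_vol (_ : [set x | exists2 k, (k < m)%N & box (B k) x] `<=` A)); last first.
  by move=> x [k km]; exact: BA.
elim: m ok BA dis => [|m IH] ok BA dis; first by rewrite big_ord0 vol_ge0.
rewrite big_ord_recr /= EFinD.
apply: le_trans (le_vol (_ : box (B m) `|` [set x | exists2 k, (k < m)%N & box (B k) x] `<=` _)); last first.
  by move=> x [Bx|[k km Bx]]; [exists m|exists k => //; exact: ltnW].
rewrite volU; [|exact: box_rv_borel|]; last first.
  by apply/seteqP; split => // x [Bx [k km /dis]]; apply: (_ : _ -> _) => h; exact: h km (ltnSn m) Bx.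
rewrite addeC vol_box => [|i]; last exact: ok.
by apply: leeD => //; apply: IH => [k i km|k km|j k x jk km]; [exact: ok (ltnW km)|exact: BA (ltnW km)|exact: dis (ltnW km)].
Qed.

Definition planar_box (s t l u : R) : 'rV[R]_(1 + 1) * 'rV[R]_(1 + 1) :=
  (row_mx (const_mx s) (const_mx l), row_mx (const_mx t) (const_mx u)).

Lemma planar_boxE s t l u x : box (planar_box s t l u) x <->
  s <= x ord0 (lshift 1 (ord0 : 'I_1)) <= t /\ l <= x ord0 (rshift 1 (ord0 : 'I_1)) <= u.
Proof.
split => [h|[h1 h2] i].
  by have := h (lshift 1 (ord0 : 'I_1)); have := h (rshift 1 (ord0 : 'I_1)); rewrite /= !row_mxEl !row_mxEr !mxE.
by case: (@split_ordP 1 1 i) => j ->; rewrite (ord1 j) /= ?row_mxEl ?row_mxEr !mxE.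
Qed.

Lemma planar_box_vol s t l u : boxvol (planar_box s t l u) = (t - s) * (u - l).
Proof.
by rewrite /boxvol big_split_ord !big_ord1 /= !row_mxEl !row_mxEr !mxE.
Qed.

Lemma planar_box_ok s t l u i : s <= t -> l <= u ->
  (planar_box s t l u).1 ord0 i <= (planar_box s t l u).2 ord0 i.
Proof. by move=> st lu; case: (@split_ordP 1 1 i) => j ->; rewrite /= ?row_mxEl ?row_mxEr !mxE. Qed.

End PlanarConstant.

(** * Upper and lower bounds for the planar supremum *)

Section PlanarLambda.
Variable R : realType.
Local Notation o := (ord0 : 'I_1).

Lemma polyline_coords m (y : nat -> 'rV[R]_1) (w : 'I_m.+1 -> R) :
  (\sum_i w i *: polyline m y i) ord0 (lshift 1 o) = \sum_i w i * (i%:R / m%:R) /\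
  (\sum_i w i *: polyline m y i) ord0 (rshift 1 o) = \sum_i w i * y i ord0 o.
Proof.
by split; rewrite summxE; apply: eq_bigr => i _; rewrite mxE /polyline ?row_mxEl ?row_mxEr ?mxE.
Qed.

(* The supporting line of the majorant at abscissa [i] has slope [a i]. *)
Lemma majorant_support (m : nat) (a : nat -> R) i j :
  (forall i j, (i <= j)%N -> (j < m)%N -> a j <= a i) -> (i < m)%N -> (j <= m)%N ->
  \sum_(k < j) a k <= \sum_(k < i) a k + a i * (j%:R - i%:R).
Proof.
move=> nd im jm; rewrite -!(big_mkord xpredT a).
have [ij|/ltnW ji] := leqP i j.
  rewrite (big_cat_nat (n := i))//= lerD2l -natrB// mulr_natr -[(j - i)%N]subn0.
  apply: le_trans (_ : \sum_(i <= k < j) a i <= _); last by rewrite sumr_const_nat subn0.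
  by apply: ler_sum_nat => k /andP[ik kj]; apply: nd => //; exact: leq_trans kj jm.
rewrite [X in _ <= X + _](big_cat_nat (n := j))//= -addrA lerDl.
rewrite -opprB -natrB// mulrN mulr_natr subr_ge0.
apply: le_trans (_ : \sum_(j <= k < i) a i <= _); first by rewrite sumr_const_nat.
by apply: ler_sum_nat => k /andP[ik kj]; apply: nd => //; exact: ltnW.
Qed.

(** Over the cell [i] the hull lies below the supporting line of slope [a i], which exceeds its
    value at the left node by at most [|a i|]. *)
Lemma polyline_below_majorant m (f a : nat -> R) (w : 'I_m.+1 -> R) i t :
  (forall i j, (i <= j)%N -> (j < m)%N -> a j <= a i) -> (i < m)%N ->
  (forall k, (k <= m)%N -> f k <= \sum_(j < k) a j) ->
  (forall j, 0 <= w j) -> \sum_j w j = 1 -> \sum_j w j * (j%:R / m%:R) = t ->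
  0 <= m%:R * t - i%:R <= 1 ->
  \sum_j w j * f j <= \sum_(k < i) a k + `|a i|.
Proof.
move=> nd im fa w0 w1 wt /andP[s0 s1].
have mn0 : m%:R != 0 :> R by rewrite pnatr_eq0; case: (m) im.
apply: le_trans (_ : \sum_j w j * (\sum_(k < i) a k + a i * (j%:R - i%:R)) <= _).
  apply: ler_sum => j _; apply: ler_wpM2l => //.
  apply: le_trans (fa j _) _; first by rewrite -ltnS.
  by apply: (majorant_support nd) => //; rewrite -ltnS.
have -> : \sum_j w j * (\sum_(k < i) a k + a i * (j%:R - i%:R)) =
    (\sum_j w j) * (\sum_(k < i) a k) + a i * (m%:R * (\sum_j w j * (j%:R / m%:R)) - (\sum_j w j) * i%:R).
  rewrite mulr_sumr !mulr_suml -sumrB mulr_sumr -big_split; apply: eq_bigr => j _ /=.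
  by field.
rewrite w1 wt !mul1r lerD2l; apply: le_trans (ler_norm _) _.
by rewrite normrM -[X in _ <= X]mulr1; apply: ler_wpM2l => //; rewrite ger0_norm.
Qed.

(** The hull is covered by one column per cell, from the minorant minus [h] to the majorant plus
    [h]. All slopes are at most [h = sqrt (1 / m)], since their squares sum to at most [1 / m]; the
    enlargement costs [2 * h]. *)
Lemma planar_polyline_le m (y : nat -> 'rV[R]_1) : (0 < m)%N -> y 0%N = 0 -> grid_energy m y <= 1 ->
  (vol (polytope (polyline m y)) <= (Num.sqrt 3 / 6 + 2 * Num.sqrt (1 / m%:R))%:E)%E.
Proof.
move=> m0 y0 ye; have mR : 0 < m%:R :> R by rewrite ltr0n.
pose f i := y i ord0 o; pose D i := f i.+1 - f i.
have f0 : f 0%N = 0 by rewrite /f y0 mxE.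
have fD k : \sum_(i < k) D i = f k.
  by rewrite -(big_mkord xpredT D) /D telescope_sumr// f0 subr0.
have D1 : m%:R * \sum_(i < m) D i ^+ 2 <= 1.
  apply: le_trans ye; rewrite /grid_energy le_eqVlt; apply/orP; left; apply/eqP; congr (_ * _).
  by apply: eq_bigr => i _; rewrite enorm_sqr /dot big_ord1 !mxE -expr2.
have [a [and_ aS aD a2]] := majorant_slopes m D.
have [b' [bnd bS bD b2]] := majorant_slopes m (fun i => - D i).
have small (c E : nat -> R) : \sum_(i < m) E i ^+ 2 = \sum_(i < m) D i ^+ 2 ->
    \sum_(i < m) c i ^+ 2 <= \sum_(i < m) c i * E i -> forall i, (i < m)%N -> `|c i| <= Num.sqrt (1 / m%:R).
  move=> ED cE i im; rewrite -(ler_pXn2r (n := 2))// ?nnegrE ?sqrtr_ge0// sqr_sqrtr ?divr_ge0// real_normK ?num_real//.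
  have : 0 <= \sum_(i < m) (c i - E i) ^+ 2 by apply: sumr_ge0 => j _; rewrite sqr_ge0.
  have -> : \sum_(i < m) (c i - E i) ^+ 2 = \sum_(i < m) c i ^+ 2 - 2 * (\sum_(i < m) c i * E i) + \sum_(i < m) E i ^+ 2.
    by rewrite mulr_sumr -sumrB -big_split; apply: eq_bigr => j _ /=; ring.
  have : c i ^+ 2 <= \sum_(i < m) c i ^+ 2.
    by rewrite (bigD1 (Ordinal im))//= lerDl sumr_ge0// => j _; rewrite sqr_ge0.
  have : \sum_(i < m) D i ^+ 2 <= 1 / m%:R by rewrite ler_pdivlMr// mulrC.
  rewrite ED; lra.
have ha := small a D erefl a2.
have hb : forall i, (i < m)%N -> `|b' i| <= Num.sqrt (1 / m%:R).
  by apply: (small b' (fun i => - D i) _ b2); apply: eq_bigr => i _; rewrite sqrrN.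
set h := Num.sqrt (1 / m%:R) in ha hb *.
pose u i := \sum_(j < i) a j; pose l i := - \sum_(j < i) b' j.
have fu k : (k <= m)%N -> f k <= u k by rewrite -fD; exact: aD.
have lf k : (k <= m)%N -> l k <= f k.
  by move=> km; rewrite -fD /l lerNl -sumrN; exact: bD.
have h0 : 0 <= h by rewrite sqrtr_ge0.
pose B i := planar_box (i%:R / m%:R) (i.+1%:R / m%:R) (l i - h) (u i + h).
have Bs i : i.+1%:R / m%:R - i%:R / m%:R = m%:R^-1 :> R by rewrite -mulrBl -natr1 [_ - _]addrAC subrr add0r mul1r.
apply: le_trans (@vol_le_boxes _ _ m _ B _ _) _.
- move=> k i km; apply: planar_box_ok; first by rewrite -subr_ge0 Bs invr_ge0 ltW.
  by have := fu _ (ltnW km); have := lf _ (ltnW km); lra.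
- move=> x [w [w0 w1 ->]]; have [] := polyline_coords y w.
  set t := \sum_i w i * (i%:R / m%:R) => xt xz.
  have t0 : 0 <= t by apply: sumr_ge0 => i _; rewrite mulr_ge0// divr_ge0.
  have t1 : t <= 1.
    rewrite -w1; apply: ler_sum => i _; rewrite -[X in _ <= X]mulr1; apply: ler_wpM2l => //.
    by rewrite ler_pdivrMr// mul1r ler_nat -ltnS.
  have [i im /andP[it ti]] : exists2 i, (i < m)%N & 0 <= m%:R * t - i%:R <= 1.
    have mt0 : 0 <= m%:R * t by rewrite mulr_ge0// ltW.
    have /andP[j1 j2] : (Num.trunc (m%:R * t))%:R <= m%:R * t < (Num.trunc (m%:R * t)).+1%:R by rewrite truncn_itv.
    have [jm|mj] := ltnP (Num.trunc (m%:R * t)) m.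
      by exists (Num.trunc (m%:R * t)) => //; move: j2; rewrite -natr1; lra.
    exists m.-1; first by rewrite prednK.
    have : (m.-1)%:R + 1 = m%:R :> R by rewrite natr1 prednK.
    have : m%:R <= m%:R * t by apply: le_trans j1; rewrite ler_nat.
    have : m%:R * t <= m%:R by rewrite -[X in _ <= X]mulr1 ler_pM2l.
    lra.
  exists i => //; apply/planar_boxE; rewrite xt xz; split.
    rewrite ler_pdivrMr// ler_pdivlMr// [t * _]mulrC; move: it ti; rewrite -natr1; lra.
  have := @polyline_below_majorant m f a w i t and_ im fu w0 w1 erefl.
  have := @polyline_below_majorant m (fun i => - f i) b' w i t bnd im _ w0 w1 erefl.
  rewrite it ti => /(_ _ isT) H /(_ isT) H'.
  have {}H : \sum_j w j * - f j <= \sum_(k < i) b' k + `|b' i|.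
    by apply: H => k km; have := bD k km; rewrite sumrN fD.
  move: H H'; under eq_bigr do rewrite mulrN; rewrite sumrN.
  have := ha i im; have := hb i im; rewrite /u /l -/(f _); lra.
rewrite lee_fin.
have -> : \sum_(k < m) boxvol (B k) = m%:R^-1 * \sum_(k < m) (u k - l k) + 2 * h.
  under eq_bigr do rewrite planar_box_vol Bs.
  rewrite -mulr_sumr.
  have -> : \sum_(i < m) (u i + h - (l i - h)) = \sum_(i < m) (u i - l i) + m%:R * (2 * h).
    have -> : m%:R * (2 * h) = \sum_(i < m) (2 * h) by rewrite sumr_const card_ord mulr_natl.
    by rewrite -big_split; apply: eq_bigr => i _ /=; ring.
  by rewrite mulrDr mulKf// gt_eqF.
rewrite lerD2r ler_pdivrMl//.
apply: le_trans (_ : \sum_(i < m) (\sum_(j < i) a j - \sum_(j < i) - b' j) <= _).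
  by apply: ler_sum => i _; rewrite /u /l sumrN.
apply: (@slope_gap_bound _ m D a (fun j => - b' j)) => //.
- by rewrite aS sumrN bS sumrN opprK.
- apply: le_trans (_ : \sum_(i < m) b' i ^+ 2 <= _).
    by apply: ler_sum => i _; rewrite sqrrN.
  by apply: le_trans b2 _; apply: ler_sum => i _; rewrite mulrN mulNr.
Qed.

(** The extremal path is the parabola [sqrt 3 * s * (1 - s)]: energy 1, and area [sqrt 3 / 6] above
    its chord. Its samples are bounded below by boxes under the arch. *)
Lemma planar_polyline_ge m : (2 <= m)%N -> exists y : nat -> 'rV[R]_1, [/\ y 0%N = 0, grid_energy m y <= 1 &
  ((Num.sqrt 3 / 6 - 4 / m%:R)%:E <= vol (polytope (polyline m y)))%E].
Proof.
move=> m2; have m0 : (0 < m)%N by apply: leq_trans m2.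
have mR : 0 < m%:R :> R by rewrite ltr0n.
pose x := m%:R^-1 : R; have x0 : 0 < x by rewrite invr_gt0.
have mx : m%:R * x = 1 by rewrite divff// gt_eqF.
have x1 : x <= 1 / 2 by rewrite /x div1r lef_pV2 ?posrE// ler_nat.
pose r := Num.sqrt 3 : R; have r0 : 0 < r by rewrite sqrtr_gt0.
have r2 : r ^+ 2 = 3 by rewrite sqr_sqrtr.
have rlt2 : r < 2 by rewrite -(ltr_pXn2r (n := 2))// ?nnegrE ?sqrtr_ge0// r2; lra.
pose g (i : nat) := r * (i%:R * x) * (1 - i%:R * x).
pose y i : 'rV[R]_1 := const_mx (g i).
have gS i : g i.+1 - g i = r * x * (1 - x - 2 * i%:R * x) by rewrite /g -natr1; ring.
have ix1 i : (i <= m)%N -> i%:R * x <= 1 by move=> im; rewrite -[X in _ <= X]mx; apply: ler_wpM2r; [exact: ltW|rewrite ler_nat].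
have g0 i : (i <= m)%N -> 0 <= g i.
  by move=> im; rewrite /g !mulr_ge0// ?subr_ge0 ?ix1// ltW.
exists y; split.
- by apply/rowP => k; rewrite !mxE /g mul0r mulr0 mul0r.
- apply: le_trans (_ : m%:R * \sum_(i < m) (12 * x ^+ 4 * ((m%:R - 1) / 2 - i%:R) ^+ 2) <= _).
    rewrite /grid_energy le_eqVlt; apply/orP; left; apply/eqP; congr (_ * _); apply: eq_bigr => i _.
    rewrite enorm_sqr /dot big_ord1 !mxE -expr2 gS.
    have -> : r * x * (1 - x - 2 * i%:R * x) = r * (2 * x ^+ 2 * ((m%:R - 1) / 2 - i%:R)).
      rewrite (_ : 2 * x ^+ 2 * ((m%:R - 1) / 2 - i%:R) = x * (m%:R * x - x - 2 * i%:R * x)); last by field.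
      by rewrite mx mulrA.
    by rewrite exprMn r2; ring.
  rewrite -mulr_sumr; apply: le_trans (_ : m%:R * (12 * x ^+ 4 * (m%:R ^+ 3 / 12)) <= _).
    by apply: ler_wpM2l => //; apply: ler_wpM2l (sum_centered_sq _ m); rewrite mulr_ge0// exprn_ge0// ltW.
  have -> : m%:R * (12 * x ^+ 4 * (m%:R ^+ 3 / 12)) = (m%:R * x) ^+ 4 by field.
  by rewrite mx expr1n.
pose h k := Num.min (g k) (g k.+1).
have h0 k : (k < m)%N -> 0 <= h k by move=> km; rewrite le_min !g0// ltnW.
(* The column starts at [(k + x) * x] instead of [k * x], so that consecutive closed boxes are
   disjoint. *)
pose B k := planar_box ((k%:R + x) * x) (k.+1%:R * x) 0 (h k).
set C := polytope _.
have Cv k : (k <= m)%N -> C (row_mx (const_mx (k%:R * x)) (const_mx (g k))).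
  by move=> km; have := polytope_vertex (polyline m y) (Ordinal (km : (k < m.+1)%N)).
apply: le_trans (@vol_ge_boxes _ _ m C B _ _ _); last 3 first.
- move=> k i km; apply: planar_box_ok (h0 k km); rewrite -natr1 ler_wpM2r// ?lerD2l ?ltW//; lra.
- move=> k km p /planar_boxE[/andP[s1 s2] /andP[z1 z2]].
  set s := p _ _ in s1 s2; set z := p _ _ in z1 z2.
  have kx0 : 0 <= k%:R * x by rewrite mulr_ge0// ltW.
  have xx : 0 <= x * x by rewrite mulr_ge0 ?ltW.
  have sk1 := ix1 _ km.
  pose th := m%:R * s - k%:R.
  have ks : k%:R * x <= s by move: s1; lra.
  have th01 : 0 <= th <= 1.
    have E : x * th = s - k%:R * x by rewrite /th mulrBr mulrA [x * _]mulrC mx mul1r [x * _]mulrC.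
    rewrite -(pmulr_rge0 _ x0) -(ler_pM2l x0 th 1) E mulr1; move: s2; rewrite -natr1; lra.
  have T : C (row_mx (const_mx s) (const_mx ((1 - th) * g k + th * g k.+1))).
    have := polytope_convex (Cv k (ltnW km)) (Cv k.+1 km) th01; congr C.
    rewrite !scale_row_mx add_row_mx; congr row_mx; apply/rowP => i; rewrite !mxE//.
    have -> : (1 - th) * (k%:R * x) + th * (k.+1%:R * x) = m%:R * x * s by rewrite /th -natr1; ring.
    by rewrite mx mul1r.
  have Bo : C (row_mx (const_mx s) (const_mx 0)).
    have s01 : 0 <= s <= 1 by apply/andP; split; lra.
    have := polytope_convex (Cv 0%N isT) (Cv m (leqnn m)) s01; congr C.
    rewrite !scale_row_mx add_row_mx; congr row_mx; apply/rowP => i; rewrite !mxE ?mx /g ?mx mul0r; ring.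
  set G := (1 - th) * g k + th * g k.+1 in T.
  have hG : h k <= G.
    have [a b] : h k <= g k /\ h k <= g k.+1 by rewrite /h !ge_min !lexx orbT.
    by case/andP: th01 => t0 t1; rewrite /G; nra.
  have [u u01 uG] : exists2 u, 0 <= u <= 1 & u * G = z.
    have [G0|G0] := eqVneq G 0.
      by exists 0; [rewrite lexx ler01|rewrite mul0r; lra].
    have Gp : 0 < G by rewrite lt_neqAle eq_sym G0 (le_trans _ hG)// (le_trans z1).
    exists (z / G); last by rewrite divfK.
    by rewrite divr_ge0 ?(ltW Gp)//= ler_pdivrMr// mul1r (le_trans z2).
  have := polytope_convex Bo T u01; congr C.
  apply/rowP => i; case: (@split_ordP 1 1 i) => l ->; rewrite (ord1 l) [LHS]mxE [X in X + _]mxE [X in _ + X]mxE ?row_mxEl ?row_mxEr ?[const_mx _ _ _]mxE.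
    by rewrite -[RHS]/s; ring.
  by rewrite mulr0 add0r uG.
- move=> j k p jk km /planar_boxE[/andP[_ p1] _] /planar_boxE[/andP[p2 _] _].
  have : j.+1%:R * x <= k%:R * x by rewrite ler_wpM2r ?ler_nat// ltW.
  have : 0 < x * x by rewrite mulr_gt0.
  by move: (le_trans p2 p1); lra.
rewrite lee_fin.
apply: le_trans (_ : \sum_(k < m) (x - x * x) * (g k - r * x) <= _); last first.
  apply: ler_sum => k _; rewrite planar_box_vol subr0.
  have -> : k.+1%:R * x - (k%:R + x) * x = x - x * x by rewrite -natr1; ring.
  apply: ler_wpM2l; first by nra.
  rewrite le_min; have := gS k; have := ix1 k (ltnW (ltn_ord k)); have : 0 <= k%:R * x by rewrite mulr_ge0// ltW.
  have : 0 < r * x by rewrite mulr_gt0.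
  move=> a b c e; apply/andP; split; first by lra.
  have : 0 <= 2 - x - 2 * k%:R * x by have := ix1 _ (ltn_ord k); rewrite -natr1; lra.
  by move=> /(mulr_ge0 (ltW a)); lra.
rewrite -mulr_sumr sumrB sumr_const card_ord -[(r * x) *+ m]mulr_natl.
have S n : \sum_(k < n) g k = r * (x * n%:R * (n%:R - 1) / 2 - x ^+ 2 * n%:R * (n%:R - 1) * (2 * n%:R - 1) / 6).
  elim: n => [|n IH]; first by rewrite big_ord0; ring.
  by rewrite big_ord_recr /= IH /g -natr1; field.
have -> : (x - x * x) * (\sum_(k < m) g k - m%:R * (r * x)) = (1 - x) * r * ((1 - x ^+ 2) / 6 - x).
  rewrite S; have -> : m%:R = x^-1 :> R by rewrite invrK.
  by field; rewrite gt_eqF.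
rewrite -/r -[4 / _]/(4 * x).
have h1 : 0 <= x * (4 - 7 / 6 * r) by rewrite mulr_ge0 ?(ltW x0)//; lra.
have h2 : 0 <= r * x * (5 / 6 * x + x ^+ 2 / 6).
  by rewrite !mulr_ge0 ?(ltW x0) ?(ltW r0)// addr_ge0 ?mulr_ge0 ?sqr_ge0 ?(ltW x0)// ?invr_ge0.
have -> : (1 - x) * r * ((1 - x ^+ 2) / 6 - x) = r / 6 - 4 * x + x * (4 - 7 / 6 * r) + r * x * (5 / 6 * x + x ^+ 2 / 6).
  by field.
by lra.
Qed.

Lemma lambdaS1 : lambdaS R 1 = (Num.sqrt 3 / 6)%:E.
Proof.
apply/eqP; rewrite eq_le; apply/andP; split.
  rewrite leNgt; apply/negP => lt.
  have [c c1 c2] : exists2 c : R, Num.sqrt 3 / 6 < c & (c%:E < lambdaS R 1)%E.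
    move: lt (lambda_lty R 1); case: (lambdaS R 1) => // z; rewrite lte_fin => lt _.
    by exists ((Num.sqrt 3 / 6 + z) / 2); rewrite ?lte_fin; lra.
  have [M hM] := lambda_grid c2.
  have e0 : 0 < c - Num.sqrt 3 / 6 by rewrite subr_gt0.
  have [M' hM'] := sqrt_div_cvg0 ler01 (ler0n R 2) e0.
  pose m := maxn 1 (maxn M M').
  have [y [y0 ye]] := hM m (leq_trans (leq_maxl M M') (leq_maxr _ _)).
  have := planar_polyline_le (leq_maxl 1 (maxn M M')) y0 ye; rewrite -/m => h1 /lt_le_trans/(_ h1).
  rewrite lte_fin; have := hM' m (leq_trans (leq_maxr M M') (leq_maxr _ _)); lra.
have := lambda_lty R 1; have := lambda_gt0 R 1; case E : (lambdaS R 1) => [z| |]// _ _.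
rewrite lee_fin; apply: (@le_of_all_nat _ _ _ 4) => N.
have [y [y0 ye hy]] := @planar_polyline_ge N.+2 isT.
have := le_trans hy (vol_polyline_le (ltn0Sn N.+1) y0 ye); rewrite E lee_fin => h.
have : N.+2%:R^-1 <= N.+1%:R^-1 :> R by rewrite lef_pV2 ?posrE// ler_nat.
by move: (N.+2%:R^-1) (N.+1%:R^-1) h => p q; lra.
Qed.

End PlanarLambda.

(** * Independent blocks and exponential moments *)

Section IndependentExpectation.
Variables (R : realType) (d : measure_display) (T : measurableType d) (P : probability T R).

(** The joint law is the product of the marginals, as they agree on rectangles; then Tonelli. *)
Lemma expectation_prod (X Y : T -> R) : measurable_fun setT X -> measurable_fun setT Y ->
  (forall t, 0 <= X t) -> (forall t, 0 <= Y t) ->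
  (forall A B : set R, measurable A -> measurable B ->
    P (X @^-1` A `&` Y @^-1` B) = P (X @^-1` A) * P (Y @^-1` B))%E ->
  (\int[P]_t (X t * Y t)%:E = \int[P]_t (X t)%:E * \int[P]_t (Y t)%:E)%E.
Proof.
move=> mX mY X0 Y0 ind.
pose Xm : {mfun T >-> R} := HB.pack X (isMeasurableFun.Build _ _ _ _ _ mX).
pose Ym : {mfun T >-> R} := HB.pack Y (isMeasurableFun.Build _ _ _ _ _ mY).
have mXY : measurable_fun setT (fun t => (X t, Y t) : R * R).
  exact: measurable_fun_pair.
pose XY : {mfun T >-> (R * R)%type} :=
  HB.pack (fun t => (X t, Y t) : R * R) (isMeasurableFun.Build _ _ _ _ _ mXY).
(* The positive parts make the integrand nonnegative on the whole plane without changing it on the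
   range of [X] and [Y]. *)
pose f (z : R * R) : \bar R := (Num.max 0 z.1 * Num.max 0 z.2)%:E.
have m1 : measurable_fun setT (fun z : R * R => Num.max 0 z.1 : R).
  by apply: measurable_maxr => //; exact: measurable_fst.
have m2 : measurable_fun setT (fun z : R * R => Num.max 0 z.2 : R).
  by apply: measurable_maxr => //; exact: measurable_snd.
have mf : measurable_fun setT f by apply/measurable_EFinP; exact: measurable_funM.
have mpos : measurable_fun setT (fun y : R => (Num.max 0 y)%:E).
  by apply/measurable_EFinP; apply: measurable_maxr.
have pos0 (y : R) : (0 <= (Num.max 0 y)%:E)%E by rewrite lee_fin le_max lexx.
have f0 z : (0 <= f z)%E by rewrite lee_fin mulr_ge0// le_max lexx.
transitivity (\int[distribution P XY]_z f z)%E.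
  rewrite ge0_integral_distribution//; apply: eq_integral => t _.
  by rewrite /f /= !max_r.
transitivity (\int[distribution P Xm \x distribution P Ym]_z f z)%E.
  apply/esym/eq_measure_integral => A mA _; apply: (product_measure_unique (m' := distribution P XY)) => // B C mB mC.
rewrite fubini_tonelli1//.
transitivity (\int[distribution P Xm]_x ((\int[distribution P Ym]_y (Num.max 0 y)%:E) * (Num.max 0 x)%:E))%E.
  apply: eq_integral => x _; rewrite /fubini_F /f /= muleC -ge0_integralZl//.
rewrite ge0_integralZl//; last by apply: integral_ge0.
rewrite muleC !ge0_integral_distribution//; congr (_ * _)%E; apply: eq_integral => t _ /=; by rewrite max_r.
Qed.

End IndependentExpectation.

(** * Independence of disjoint windows of steps *)

Section Windows.
Variables (R : realType) (dT : measure_display) (T : measurableType dT) (P : probability T R).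
Variables (n : nat) (Z : nat -> T -> 'rV[R]_n).
Hypothesis mZ : forall i B, rv_borel B -> measurable (Z i @^-1` B).
Hypothesis indZ : forall (F : seq nat) (B : nat -> set 'rV[R]_n), uniq F -> (forall i, rv_borel (B i)) ->
  P (\bigcap_(i in [set` F]) (Z i @^-1` B i)) = \big[*%E/1%E]_(i <- F) P (Z i @^-1` B i).

Definition cyl a b (B : nat -> set 'rV[R]_n) : set T :=
  [set t | forall i, (a <= i < b)%N -> B i (Z i t)].
Definition cyls a b : set (set T) := [set cyl a b B | B in [set B | forall i, rv_borel (B i)]].

(** The sigma-algebra generated by the steps [Z i] with [a <= i < b]. *)
Definition windowT a b := g_sigma_algebraType (cyls a b).

Lemma rv_borelT : rv_borel (setT : set 'rV[R]_n).
Proof. by rewrite rv_borelE; exact: measurableT. Qed.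

Lemma rv_borelI (A B : set 'rV[R]_n) : rv_borel A -> rv_borel B -> rv_borel (A `&` B).
Proof. by rewrite !rv_borelE; exact: measurableI. Qed.

Lemma cylE a b B : cyl a b B = \bigcap_(i in [set` index_iota a b]) (Z i @^-1` B i).
Proof.
by apply/seteqP; split => t h i /=; [rewrite mem_index_iota => /h|move=> hi; apply: h; rewrite /= mem_index_iota].
Qed.

Lemma measurable_cyl a b B : (forall i, rv_borel (B i)) -> measurable (cyl a b B).
Proof.
move=> mB; have -> : cyl a b B = \bigcap_i (if (a <= i < b)%N then Z i @^-1` B i else setT).
  apply/seteqP; split => t h i; first by move=> _; case: ifP => // /h.
  by move=> hi; have := h i I; rewrite hi.
by apply: bigcapT_measurable => i; case: ifP => // _; exact: mZ.
Qed.

Lemma P_cyl a b B : (forall i, rv_borel (B i)) ->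
  P (cyl a b B) = (\big[*%E/1%E]_(a <= i < b) P (Z i @^-1` B i))%E.
Proof. by move=> mB; rewrite cylE indZ// iota_uniq. Qed.

Lemma cyls_setI a b : setI_closed (cyls a b).
Proof.
move=> _ _ [B mB <-] [C mC <-]; exists (fun i => B i `&` C i) => [i|]; first exact: rv_borelI.
by apply/seteqP; split => [t h|t [h1 h2] i hi]; [split => i /h []|split; [exact: h1|exact: h2]].
Qed.

Lemma cyls_setT a b : cyls a b setT.
Proof. by exists (fun=> setT) => [i|]; [exact: rv_borelT|apply/seteqP; split]. Qed.

Lemma window_measurable a b (A : set T) : measurable (A : set (windowT a b)) -> measurable A.
Proof.
apply: smallest_sub => [|_ [B mB <-]]; last exact: measurable_cyl.
by split; [exact: measurable0|move=> C mC; rewrite setTD; exact: measurableC|exact: bigcupT_measurable].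
Qed.

Lemma cyl_indep a b c B C : (a <= b)%N -> (b <= c)%N -> (forall i, rv_borel (B i)) -> (forall i, rv_borel (C i)) ->
  P (cyl a b B `&` cyl b c C) = (P (cyl a b B) * P (cyl b c C))%E.
Proof.
move=> ab bc mB mC; pose D i := if (i < b)%N then B i else C i.
have -> : cyl a b B `&` cyl b c C = cyl a c D.
  apply/seteqP; split => [t [h1 h2] i /andP[ai ic]|t h].
    rewrite /D; case: ltnP => ib; [apply: h1|apply: h2]; by rewrite ?ai ?ib ?ic.
  split => i /andP[h1 h2].
    by have := h i; rewrite /D h2 h1 (leq_trans h2 bc); exact.
  by have := h i; rewrite /D (leq_trans ab h1) h2 [(i < b)%N]ltnNge h1; exact.
have mD i : rv_borel (D i) by rewrite /D; case: ifP.
rewrite !P_cyl// (big_cat_nat (n := b))//=; congr (_ * _)%E; apply: eq_big_nat => i /andP[h1 h2].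
  by rewrite /D h2.
by rewrite /D ltnNge h1.
Qed.

(** Two monotone class arguments, one for each factor: on either side the products agree on
    cylinders, which are stable under intersection. *)
Lemma window_indep a b c (A B : set T) : (a <= b)%N -> (b <= c)%N ->
  measurable (A : set (windowT a b)) -> measurable (B : set (windowT b c)) ->
  P (A `&` B) = (P A * P B)%E.
Proof.
move=> ab bc mA mB.
have pr C : measurable C -> P C \is a fin_num by move=> mC; exact: fin_num_measure.
have H (F : set (set T)) C : setI_closed F -> F setT -> F `<=` measurable -> measurable C ->
    (forall D, F D -> P (C `&` D) = P C * P D)%E -> forall D, <<s F >> D -> P (C `&` D) = (P C * P D)%E.
  move=> IF FT Fm mC FD D sD.
  have c0 : 0 <= fine (P C) by rewrite fine_ge0.
  have sE E : mscale (NngNum c0) P E = (P C * P E)%E by rewrite /mscale -[in RHS](fineK (pr C mC)).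
  suff : mrestr P mC D = mscale (NngNum c0) P D by rewrite sE /mrestr setIC.
  apply: (@g_sigma_algebra_measure_unique _ R T F Fm (fun=> setT)) => //.
  - by rewrite bigcup_const.
  - by move=> E FE; apply: etrans _ (esym (sE E)); rewrite -FD// setIC.
  - by move=> _; rewrite -[X in (X < _)%E]/(P (setT `&` C)) setTI -ge0_fin_numE ?pr.
have cA : measurable A := window_measurable mA; have cB : measurable B := window_measurable mB.
apply: (H (cyls b c)) => //; [exact: cyls_setI|exact: cyls_setT| |].
  by move=> _ [D mD <-]; exact: measurable_cyl.
move=> _ [D mD <-]; rewrite setIC muleC; have mcD := @measurable_cyl b c D mD.
apply: (H (cyls a b)) => //; [exact: cyls_setI|exact: cyls_setT| |].
  by move=> _ [E mE <-]; exact: measurable_cyl.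
by move=> _ [E mE <-]; rewrite setIC muleC; exact: cyl_indep.
Qed.

Lemma window_fun a b d' (U : measurableType d') (X : T -> U) :
  measurable_fun (setT : set (windowT a b)) X -> measurable_fun setT X.
Proof.
move=> mX _ B mB; rewrite setTI; apply: (@window_measurable a b).
by have := mX measurableT B mB; rewrite setTI.
Qed.

Lemma window_expectation a b c (X Y : T -> R) : (a <= b)%N -> (b <= c)%N ->
  measurable_fun (setT : set (windowT a b)) X -> measurable_fun (setT : set (windowT b c)) Y ->
  (forall t, 0 <= X t) -> (forall t, 0 <= Y t) ->
  (\int[P]_t (X t * Y t)%:E = \int[P]_t (X t)%:E * \int[P]_t (Y t)%:E)%E.
Proof.
move=> ab bc mX mY X0 Y0; apply: expectation_prod => //.
- exact: (@window_fun a b).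
- exact: (@window_fun b c).
move=> A B mA mB; apply: (@window_indep a b c) => //.
  by have := mX measurableT A mA; rewrite setTI.
by have := mY measurableT B mB; rewrite setTI.
Qed.

Lemma window_Z a b i : (a <= i < b)%N ->
  measurable_fun (setT : set (windowT a b)) (Z i : _ -> borelT R n).
Proof.
move=> iab _ B mB; rewrite setTI; apply: sub_sigma_algebra.
exists (fun j => if j == i then B else setT) => [j|].
  by case: ifP => // _; exact: rv_borelT.
apply/seteqP; split => [t h|t h j _]; first by have := h i iab; rewrite eqxx.
by case: eqVneq => [->|].
Qed.

Lemma measurable_Z i : measurable_fun setT (Z i : T -> borelT R n).
Proof. by move=> _ B mB; rewrite setTI; exact: mZ. Qed.

Hypothesis idZ : forall i B, rv_borel B -> P (Z i @^-1` B) = P (Z 0%N @^-1` B).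

Lemma law_eq i (f : borelT R n -> \bar R) : measurable_fun setT f -> (forall x, 0 <= f x)%E ->
  (\int[P]_t f (Z i t) = \int[P]_t f (Z 0%N t))%E.
Proof.
move=> mf f0.
have H j : (\int[P]_t f (Z j t) = \int[distribution P (HB.pack (Z j : T -> borelT R n)
    (isMeasurableFun.Build _ _ _ _ _ (measurable_Z j)) : {mfun T >-> borelT R n})]_x f x)%E.
  by rewrite ge0_integral_distribution.
rewrite !H; apply: eq_measure_integral => A mA _.
by rewrite /distribution /pushforward /=; exact: idZ.
Qed.

End Windows.

(** * Elementary bounds for the exponential *)

Section ExponentialExpansion.
Variable R : realType.

Lemma fact_ge_exp2 k : (2 ^ k.+1 <= (k.+3)`!)%N.
Proof.
elim: k => [|k IH]; first by [].
by rewrite expnS factS; apply: leq_mul.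
Qed.

(** The remainder of the series is dominated by [|x| ^ 3] times a geometric series, since [(k + 3)!]
    is at least [2 ^ k.+1]. *)
Lemma expR_taylor2 (x : R) : `|x| <= 1 -> `|expR x - (1 + x + x ^+ 2 / 2)| <= `|x| ^+ 3.
Proof.
move=> x1; set q := 1 + x + x ^+ 2 / 2.
have S k : `|series (exp_coeff x) (k + 3)%N - q| <= `|x| ^+ 3 * (1 - (2 ^+ k)^-1).
  elim: k => [|k IH].
    rewrite add0n /series /= !big_nat_recr//= big_geq// /exp_coeff /=.
    have -> : 0 + x ^+ 0 / 0`!%:R + x ^+ 1 / 1`!%:R + x ^+ 2 / 2`!%:R = q.
      by rewrite add0r /q; congr (_ + _ + _); rewrite divr1.
    by rewrite subrr normr0 expr0 invr1 subrr mulr0.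
  rewrite addSn seriesSr addrAC; apply: le_trans (ler_normD _ _) _.
  apply: le_trans (lerD IH (lexx _)) _.
  have : `|exp_coeff x (k + 3)| <= `|x| ^+ 3 * (2 ^+ k.+1)^-1.
    rewrite /exp_coeff /= normrM normrX [X in _ * X]ger0_norm ?invr_ge0//.
    apply: ler_pM; rewrite ?exprn_ge0 ?invr_ge0//.
      rewrite -[(k + 3)%R]/(k + 3)%N exprD -[X in _ <= X]mul1r; apply: ler_wpM2r; rewrite ?exprn_ge0//.
      by rewrite exprn_ile1.
    by rewrite lef_pV2 ?posrE ?exprn_gt0 ?ltr0n ?fact_gt0// -natrX ler_nat -[(k + 3)%R]/(k + 3)%N addn3 fact_ge_exp2.
  have -> : 1 - (2 ^+ k.+1)^-1 = 1 - (2 ^+ k)^-1 + (2 ^+ k.+1)^-1 :> R.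
    by rewrite exprS; field; rewrite expf_neq0.
  by rewrite [X in _ -> _ <= X]mulrDr; lra.
have S' n : (3 <= n)%N -> `|series (exp_coeff x) n - q| <= `|x| ^+ 3.
  move=> n3; rewrite -(subnK n3); apply: le_trans (S _) _; rewrite -[X in _ <= X]mulr1.
  by apply: ler_wpM2l; rewrite ?exprn_ge0// lerBlDr lerDl invr_ge0 exprn_ge0.
have c := is_cvg_series_exp_coeff x.
rewrite ler_norml; apply/andP; split.
  rewrite lerBrDr; apply: limr_ge => //; near=> n.
  have : `|series (exp_coeff x) n - q| <= `|x| ^+ 3 by apply: S'; near: n; exists 3%N.
  by rewrite ler_norml => /andP[+ _]; rewrite lerBrDr.
rewrite lerBlDr; apply: limr_le => //; near=> n.
have : `|series (exp_coeff x) n - q| <= `|x| ^+ 3 by apply: S'; near: n; exists 3%N.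
by rewrite ler_norml => /andP[_]; rewrite lerBlDr.
Unshelve. all: by end_near. Qed.

(** With [y = a * u], the bound [1 - z <= expR (- z)] at [z = y / (1 + y)] gives
    [expR (y / (1 + y)) <= 1 + y]; the loss [e * u] covers the difference between [y] and
    [y / (1 + y)]. *)
Lemma expR_le_1Dx (a e : R) : 0 < e -> exists2 u0, 0 < u0 & forall u, 0 < u -> u <= u0 ->
  expR ((a - e) * u) <= 1 + a * u.
Proof.
move=> e0; exists (Num.min ((2 * (`|a| + 1))^-1) (e / (2 * (a ^+ 2 + 1)))).
  by rewrite lt_min invr_gt0 mulr_gt0 ?ltr_wpDl//= divr_gt0// mulr_gt0// ltr_wpDl ?sqr_ge0.
move=> u u0; rewrite le_min => /andP[u1 u2]; set y := a * u.
have y2 : `|y| <= 1 / 2.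
  rewrite /y normrM (gtr0_norm u0); apply: le_trans (_ : (`|a| + 1) * u <= _).
    by apply: ler_wpM2r; [exact: ltW|lra].
  have p : 0 < `|a| + 1 by rewrite ltr_wpDl.
  apply: le_trans (ler_wpM2l (ltW p) u1) _.
  by rewrite invfM mulrCA divff ?gt_eqF// mulr1 div1r.
have [ya yb] : - (1 / 2) <= y /\ y <= 1 / 2 by move: y2; rewrite ler_norml => /andP[].
have p : 0 < 1 + y by lra.
have h : (a - e) * u <= y / (1 + y).
  rewrite ler_pdivlMr// /y.
  have : u * (2 * (a ^+ 2 + 1)) <= e by rewrite -ler_pdivlMr// mulr_gt0// ltr_wpDl ?sqr_ge0.
  move=> h; suff : a ^+ 2 * u <= e * (1 + y) by move: u0; rewrite /y; nra.
  have : e / 2 <= e * (1 + y) by apply: ler_wpM2l; [exact: ltW|lra].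
  by have := sqr_ge0 a; nra.
apply: le_trans (_ : expR (y / (1 + y)) <= _); first by rewrite ler_expR.
rewrite -[y / (1 + y)]opprK expRN -[X in _ <= X]invrK lef_pV2 ?posrE ?expR_gt0 ?invr_gt0//.
apply: le_trans (expR_ge1Dx _); rewrite le_eqVlt; apply/orP; left; apply/eqP.
by field; rewrite gt_eqF.
Qed.

End ExponentialExpansion.

(** * Exponential moment of a truncated step *)

Section TruncatedMgf.
Variables (R : realType) (dT : measure_display) (T : measurableType dT) (P : probability T R).
Local Notation I f := (P.-integrable setT (EFin \o f)).
Local Notation "'Ex' f" := (\int[P]_t f t) (at level 10, f at next level).

Lemma integrable_le (f g : T -> R) : measurable_fun setT f -> (forall t, `|f t| <= g t) -> I g -> I f.
Proof.
move=> mf fg ig; apply: (le_integrable measurableT _ _ ig); first exact/measurable_EFinP.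
by move=> t _ /=; rewrite lee_fin; apply: le_trans (fg t) (ler_norm _).
Qed.

Lemma integrable_cstR (c : R) : I (fun=> c).
Proof. exact: finite_measure_integrable_cst. Qed.

Lemma Ex_cst (c : R) : Ex (fun=> c) = c.
Proof. by rewrite /= Rintegral_cst//= probability_setT mulr1. Qed.

Definition tail_ind (h : T -> R) (s : R) : T -> R := \1_[set t | s < h t].

Variable h : T -> R.
Hypotheses (mh : measurable_fun setT h) (h0 : forall t, 0 <= h t).
Hypothesis ih2 : I (fun t => h t ^+ 2).

Lemma measurable_tail s : measurable_fun setT (tail_ind h s).
Proof.
apply: measurable_indic; have -> : [set t | s < h t] = h @^-1` `]s, +oo[%classic.
  by apply/seteqP; split => t /=; rewrite in_itv/= andbT.
by rewrite -[X in measurable X]setTI; apply: mh => //; exact: measurable_itv.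
Qed.

Lemma tail_ind01 s t : 0 <= tail_ind h s t <= 1.
Proof. by rewrite /tail_ind indicE; case: (_ \in _) => /=; rewrite ?lexx ler01. Qed.

Lemma integrable_tail s : I (fun t => h t ^+ 2 * tail_ind h s t).
Proof.
apply: (integrable_le _ _ ih2).
  by apply: measurable_funM; [exact: measurable_funX|exact: measurable_tail].
move=> t; have /andP[a b] := tail_ind01 s t.
by rewrite normrM !ger0_norm ?sqr_ge0//; have := sqr_ge0 (h t); nra.
Qed.

Lemma tail_second_moment e : 0 < e -> exists s0, forall s, s0 <= s ->
  Ex (fun t => h t ^+ 2 * tail_ind h s t) <= e.
Proof.
move=> e0; pose f (N : nat) t := (h t ^+ 2 * tail_ind h N%:R t)%:E.
have f0 : {ae P, forall t, setT t -> f N t @[N --> \oo] --> cst 0%E t}.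
  apply/nearW => t _; apply: cvg_near_cst; near=> N; rewrite /f /tail_ind indicE memNset ?mulr0//=.
  apply/negP; rewrite -leNgt; near: N.
  exists (Num.trunc (h t)).+1 => // N /= hN; apply: ltW.
  apply: lt_le_trans (_ : (Num.trunc (h t)).+1%:R <= _); last by rewrite ler_nat.
  by have /andP[] := truncn_itv (h0 t).
have fg : {ae P, forall t, forall N, setT t -> (`|f N t| <= (h t ^+ 2)%:E)%E}.
  apply/nearW => t N _; have /andP[a b] := tail_ind01 N%:R t.
  by rewrite /f lee_fin normrM !ger0_norm ?sqr_ge0//; have := sqr_ge0 (h t); nra.
have [_ _] := dominated_convergence measurableT (fun N => measurable_int _ (integrable_tail N%:R))
  (measurable_cst _) f0 ih2 fg.
rewrite integral_cst// mul0e => /fine_cvgP[_ /cvgrPdist_le /(_ _ e0)[N _ hN]].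
exists N%:R => s Ns; apply: le_trans (_ : Ex (fun t => h t ^+ 2 * tail_ind h N%:R t) <= _).
  apply: le_Rintegral => //; [exact: integrable_tail|exact: integrable_tail|].
  move=> t _; apply: ler_wpM2l; first exact: sqr_ge0.
  rewrite /tail_ind !indicE ler_nat; case: (boolP (t \in [set t | s < h t])) => //; rewrite inE /= => st.
  by rewrite mem_set//=; apply: le_lt_trans st.
have := hN N (leqnn N); rewrite sub0r normrN; apply: le_trans; exact: ler_norm.
Unshelve. all: by end_near. Qed.

(** With the factor [sqrt 2 / tau] the second-order term of the exponential is [q / tau ^ 2].
    Truncation at [eps * tau] keeps the exponent in [-1, 1]; the cubic remainder is at most a
    multiple of [eps] times the second moment, and the truncated part is controlled by the tail of
    the second moment of [h]. Since [eps0] depends on [C] and [e] but not on [xi], one truncation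
    level serves all test directions. *)
Lemma truncated_mgf (C e : R) : 0 < C -> 0 < e -> exists2 eps0, 0 < eps0 & forall eps, 0 < eps -> eps <= eps0 ->
  forall xi : T -> R, measurable_fun setT xi -> (forall t, `|xi t| <= C * h t) -> Ex xi = 0 ->
  exists2 tau0, 0 < tau0 & forall tau, tau0 <= tau ->
  let q := Ex (fun t => xi t ^+ 2) in
  let phi := Ex (fun t => expR (Num.sqrt 2 / tau * (xi t * (1 - tail_ind h (eps * tau) t)))) in
  expR ((q - e) / tau ^+ 2) <= phi <= expR ((q + e) / tau ^+ 2).
Proof.
move=> C0 e0; pose M := Ex (fun t => h t ^+ 2).
have M0 : 0 <= M by apply: Rintegral_ge0 => t _; rewrite sqr_ge0.
pose r := Num.sqrt 2 : R; have r0 : 0 < r by rewrite sqrtr_gt0.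
have r2 : r ^+ 2 = 2 by rewrite sqr_sqrtr.
have rlt2 : r < 2 by rewrite -(ltr_pXn2r (n := 2))// ?nnegrE ?sqrtr_ge0// r2; lra.
(* The first bound keeps the exponent in [-1, 1], the second brings the cubic remainder below
   [e / 4] after multiplication by [tau ^ 2]. *)
exists (Num.min ((2 * C)^-1) (e / (16 * (C ^+ 3 * M + 1)))).
  rewrite lt_min invr_gt0 mulr_gt0//= divr_gt0// mulr_gt0// ltr_wpDl// mulr_ge0// exprn_ge0//; exact: ltW.
move=> eps eps0; rewrite le_min => /andP[eps1 eps2] xi mxi xiC Exi.
have ixi2 : I (fun t => xi t ^+ 2).
  apply: (@integrable_le _ (fun t => C ^+ 2 * h t ^+ 2)); first exact: measurable_funX.
    move=> t; rewrite normrX -exprMn lerXn2r ?nnegrE// mulr_ge0// ltW//.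
  exact: (integrableZl measurableT _ ih2).
have ixi : I xi.
  apply: (@integrable_le _ (fun t => 1 + xi t ^+ 2)) => //.
    by move=> t; rewrite -(real_normK (num_real (xi t))); have := sqr_ge0 (`|xi t| - 1); nra.
  exact: (integrableD measurableT (integrable_cstR 1) ixi2).
set q := Ex (fun t => xi t ^+ 2).
have q0 : 0 <= q by apply: Rintegral_ge0 => t _; rewrite sqr_ge0.
have qM : q <= C ^+ 2 * M.
  rewrite /M -RintegralZl//; apply: le_Rintegral => //; first exact: (integrableZl measurableT _ ih2).
  by move=> t _; rewrite -exprMn -(real_normK (num_real (xi t))) lerXn2r ?nnegrE// mulr_ge0// ltW.
have e20 : 0 < e / 2 by rewrite divr_gt0.
pose K := 2 * C / eps + C ^+ 2; have K0 : 0 < K.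
  by rewrite addr_gt0 ?exprn_gt0// divr_gt0// mulr_gt0.
have eK : 0 < e / (4 * K) by rewrite divr_gt0// mulr_gt0.
have [s0 hs0] := tail_second_moment eK.
have [u0 u00 hu0] := expR_le_1Dx (q - e / 2) e20.
exists (Num.max 1 (Num.max (s0 / eps) (Num.max 1 u0^-1))).
  by rewrite lt_max ltr01.
move=> tau; rewrite !ge_max => /and3P[tau1 tau2 /andP[_ tau3]] /=.
have tau0 : 0 < tau by apply: lt_le_trans tau1.
have r00 := ltW r0; have C00 := ltW C0; have eps00 := ltW eps0.
set A := tail_ind h (eps * tau); set x := fun t => r / tau * (xi t * (1 - A t)).
pose phi := Ex (fun t => expR (x t)); change (expR ((q - e) / tau ^+ 2) <= phi <= expR ((q + e) / tau ^+ 2)).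
pose D := Ex (fun t => h t ^+ 2 * A t).
have D1 : D <= e / (4 * K).
  by apply: hs0; rewrite mulrC -ler_pdivrMr.
have A01 t : A t = 0 /\ h t <= eps * tau \/ A t = 1 /\ eps * tau < h t.
  have [H|H] := leP (h t) (eps * tau); [left|right]; split => //; rewrite /A /tail_ind indicE.
    by rewrite memNset//= ltNge H.
  by rewrite mem_set.
have Ce : C * eps <= 1 / 2.
  by have := ler_wpM2l (ltW C0) eps1; rewrite invfM mulrCA divff ?gt_eqF// mulr1 div1r.
have x1 t : `|x t| <= 1.
  rewrite /x !normrM (ger0_norm (ltW r0)) normfV (gtr0_norm tau0).
  have [[-> ht]|[-> _]] := A01 t; last by rewrite subrr normr0 !mulr0.
  rewrite subr0 normr1 mulr1 mulrAC ler_pdivrMr// mul1r.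
  by have := xiC t; have := normr_ge0 (xi t); nra.
have mA : measurable_fun setT A by exact: measurable_tail.
have mx : measurable_fun setT x.
  by apply: measurable_funM => //; apply: measurable_funM => //; exact: measurable_funB.
have ix : I (fun t => expR (x t)).
  apply: (@integrable_le _ (fun=> expR 1)).
  - exact: measurableT_comp.
  - by move=> t; rewrite ger0_norm ?expR_ge0// ler_expR; have := x1 t; rewrite ler_norml => /andP[].
  - exact: integrable_cstR.
pose s := r / tau; have s0' : 0 < s by rewrite divr_gt0.
have s2 : s ^+ 2 = 2 / tau ^+ 2 by rewrite expr_div_n r2.
(* Below the level, Taylor's formula applies. Above it the truncated exponent is 0, and
   [h t > eps * tau] lets the linear term be bounded by [h t ^+ 2]. *)
have pt t : `|expR (x t) - (1 + s * xi t + s ^+ 2 / 2 * xi t ^+ 2)| <=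
    r * C * eps * s ^+ 2 * xi t ^+ 2 + (s * C / (eps * tau) + s ^+ 2 / 2 * C ^+ 2) * (h t ^+ 2 * A t).
  rewrite /x -/s; have [[-> ht]|[-> ht]] := A01 t.
    rewrite subr0 !mulr1 mulr0 mulr0 addr0.
    have sx1 : `|s * xi t| <= 1.
      rewrite normrM (gtr0_norm s0') /s mulrAC ler_pdivrMr// mul1r.
      by have := xiC t; have := normr_ge0 (xi t); nra.
    have := expR_taylor2 sx1.
    have -> : 1 + s * xi t + (s * xi t) ^+ 2 / 2 = 1 + s * xi t + s ^+ 2 / 2 * xi t ^+ 2 by rewrite exprMn; ring.
    move=> h1; apply: le_trans h1 _.
    rewrite normrM (gtr0_norm s0') exprSr exprMn (real_normK (num_real (xi t))).
    have -> : r * C * eps * s ^+ 2 * xi t ^+ 2 = s ^+ 2 * xi t ^+ 2 * (s * (C * (eps * tau))).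
      by rewrite /s; field; rewrite gt_eqF.
    apply: ler_wpM2l; first by rewrite mulr_ge0// sqr_ge0.
    apply: ler_wpM2l; first exact: ltW.
    by apply: le_trans (xiC t) _; apply: ler_wpM2l => //; exact: ltW.
  rewrite subrr !mulr0 mulr1 expR0.
  have -> : 1 - (1 + s * xi t + s ^+ 2 / 2 * xi t ^+ 2) = - (s * xi t + s ^+ 2 / 2 * xi t ^+ 2) by ring.
  rewrite normrN; apply: le_trans (ler_normD _ _) _.
  have et0 : 0 < eps * tau by rewrite mulr_gt0.
  have s20 : 0 <= s ^+ 2 / 2 by rewrite divr_ge0 ?sqr_ge0.
  rewrite [X in _ + X]ger0_norm; last by rewrite mulr_ge0// sqr_ge0.
  rewrite (normrM s) (gtr0_norm s0').
  have b1 : s * `|xi t| <= s * C / (eps * tau) * h t ^+ 2.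
    have -> : s * C / (eps * tau) * h t ^+ 2 = s * (C * h t * (h t / (eps * tau))) by field; rewrite !gt_eqF.
    apply: ler_wpM2l; first exact: ltW.
    apply: le_trans (xiC t) _; rewrite -[X in X <= _]mulr1; apply: ler_wpM2l.
      by rewrite mulr_ge0// ltW.
    by rewrite ler_pdivlMr// mul1r ltW.
  have b2 : s ^+ 2 / 2 * xi t ^+ 2 <= s ^+ 2 / 2 * C ^+ 2 * h t ^+ 2.
    rewrite -[X in _ <= X]mulrA; apply: ler_wpM2l => //; rewrite -exprMn -(real_normK (num_real (xi t))).
    by rewrite lerXn2r ?nnegrE// mulr_ge0// ltW.
  have b3 : 0 <= r * C * eps * s ^+ 2 * xi t ^+ 2 by apply: mulr_ge0 (sqr_ge0 _); apply: mulr_ge0 (sqr_ge0 _); rewrite !mulr_ge0.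
  by rewrite mulrDl; lra.
have iA : I (fun t => h t ^+ 2 * A t) := integrable_tail _.
have i1 : I (fun t => 1 + s * xi t + s ^+ 2 / 2 * xi t ^+ 2).
  exact: (integrableD measurableT (integrableD measurableT (integrable_cstR 1)
    (integrableZl measurableT s ixi)) (integrableZl measurableT (s ^+ 2 / 2) ixi2)).
have i2 : I (fun t => expR (x t) - (1 + s * xi t + s ^+ 2 / 2 * xi t ^+ 2)).
  exact: (integrableB measurableT ix i1).
have E1 : Ex (fun t => 1 + s * xi t + s ^+ 2 / 2 * xi t ^+ 2) = 1 + q / tau ^+ 2.
  rewrite /= RintegralD//=; last 2 first.
  - exact: (integrableD measurableT (integrable_cstR 1) (integrableZl measurableT s ixi)).
  - exact: (integrableZl measurableT (s ^+ 2 / 2) ixi2).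
  rewrite RintegralD//=; last 2 first.
  - exact: integrable_cstR.
  - exact: (integrableZl measurableT s ixi).
  rewrite !RintegralZl// -[\int[P]_x 1]/(Ex (fun=> 1)) Ex_cst -[\int[P]_x xi x]/(Ex xi) Exi mulr0 addr0.
  by rewrite s2 -[\int[P]_x _]/q; congr (_ + _); field; rewrite gt_eqF.
have main : `|phi - (1 + q / tau ^+ 2)| <= e / 2 / tau ^+ 2.
  rewrite -E1 /phi -RintegralB//; apply: le_trans (le_normr_Rintegral measurableT i2) _.
  have i3 : I (fun t => r * C * eps * s ^+ 2 * xi t ^+ 2) by exact: (integrableZl measurableT _ ixi2).
  have i4 : I (fun t => (s * C / (eps * tau) + s ^+ 2 / 2 * C ^+ 2) * (h t ^+ 2 * A t)).
    exact: (integrableZl measurableT _ iA).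
  apply: le_trans (le_Rintegral measurableT _ (integrableD measurableT i3 i4) (fun t _ => pt t)) _.
    exact: integrable_norm.
  rewrite RintegralD// !RintegralZl//= -[\int[P]_x (xi x ^+ 2)]/q -/D s2.
  have -> : s * C / (eps * tau) + 2 / tau ^+ 2 / 2 * C ^+ 2 = (r * C / eps + C ^+ 2) / tau ^+ 2.
    by rewrite /s; field; rewrite !gt_eqF.
  have -> : r * C * eps * (2 / tau ^+ 2) * q + (r * C / eps + C ^+ 2) / tau ^+ 2 * D =
    (2 * r * C * eps * q + (r * C / eps + C ^+ 2) * D) / tau ^+ 2 by field; rewrite !gt_eqF.
  apply: ler_wpM2r; first by rewrite invr_ge0 exprn_ge0// ltW.
  have D0 : 0 <= D by apply: Rintegral_ge0 => t _; rewrite mulr_ge0 ?sqr_ge0//; case/andP: (tail_ind01 (eps * tau) t).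
  have b1 : (r * C / eps + C ^+ 2) * D <= e / 4.
    apply: le_trans (_ : K * D <= _).
      apply: ler_wpM2r => //; rewrite lerD2r; apply: ler_wpM2r; first by rewrite invr_ge0 ltW.
      by apply: ler_wpM2r; exact: ltW.
    apply: le_trans (ler_wpM2l (ltW K0) D1) _; rewrite le_eqVlt; apply/orP; left; apply/eqP.
    by field; rewrite gt_eqF.
  have b2 : 2 * r * C * eps * q <= e / 4.
    apply: le_trans (_ : 4 * (C ^+ 3 * M + 1) * eps <= _).
      have : r * (C * eps * q) <= 2 * (C * eps * (C ^+ 2 * M)).
        apply: ler_pM; [exact: r00|by rewrite !mulr_ge0|exact: ltW|].
        by apply: ler_wpM2l => //; rewrite mulr_ge0.
      lra.
    have p : 0 < C ^+ 3 * M + 1 by rewrite ltr_wpDl// mulr_ge0// exprn_ge0// ltW.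
    by move: eps2; rewrite ler_pdivlMr ?mulr_gt0//; lra.
  by lra.
move: main; rewrite ler_norml => /andP[lo up]; apply/andP; split.
  apply: le_trans (_ : 1 + (q - e / 2) / tau ^+ 2 <= _).
    have := hu0 (tau ^+ 2)^-1; rewrite invr_gt0 exprn_gt0// => /(_ isT).
    have -> : q - e / 2 - e / 2 = q - e by field.
    apply; rewrite -[u0]invrK lef_pV2 ?posrE ?invr_gt0 ?exprn_gt0//; apply: le_trans tau3 _.
    by rewrite expr2 -[X in X <= _]mulr1; apply: ler_wpM2l => //; exact: ltW.
  by move: lo; rewrite [(q - _) / _]mulrBl; lra.
apply: le_trans (expR_ge1Dx _); rewrite mulrDl.
have : 0 <= e / tau ^+ 2 by rewrite divr_ge0// ?exprn_ge0// ltW.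
by move: up; rewrite [e / 2 / _]mulrAC; lra.
Qed.

End TruncatedMgf.

(** * Sums over windows and their maxima *)

Section WindowSums.
Variables (R : realType) (dT : measure_display) (T : measurableType dT) (P : probability T R).
Variables (n : nat) (Z : nat -> T -> 'rV[R]_n).
Hypothesis mZ : forall i B, rv_borel B -> measurable (Z i @^-1` B).
Hypothesis indZ : forall (F : seq nat) (B : nat -> set 'rV[R]_n), uniq F -> (forall i, rv_borel (B i)) ->
  P (\bigcap_(i in [set` F]) (Z i @^-1` B i)) = \big[*%E/1%E]_(i <- F) P (Z i @^-1` B i).
Hypothesis idZ : forall i B, rv_borel B -> P (Z i @^-1` B) = P (Z 0%N @^-1` B).

Local Notation mB g := (measurable_fun (setT : set (borelT R n)) g).

Lemma window_sum a b c d (g : nat -> 'rV[R]_n -> R) : (forall i, mB (g i)) ->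
  (forall i, c <= i < d -> a <= i < b)%N ->
  measurable_fun (setT : set (windowT Z a b)) (fun t => \sum_(c <= i < d) g i (Z i t)).
Proof.
move=> mg cdab; have -> : (fun t => \sum_(c <= i < d) g i (Z i t)) =
    (fun t => \sum_(i <- index_iota c d) (if (c <= i < d)%N then g i (Z i t) else 0)).
  by apply/funext => t; apply: eq_big_nat => i ->.
apply: measurable_sum => i; case: (boolP (c <= i < d)%N) => [icd|_]; last exact: measurable_cst.
have zi : measurable_fun (setT : set (windowT Z a b)) (Z i : _ -> borelT R n) := window_Z (cdab i icd).
exact: (measurableT_comp (mg i) zi).
Qed.

Lemma measurable_gZ i (g : 'rV[R]_n -> R) : mB g -> measurable_fun setT (fun t => g (Z i t)).
Proof. by move=> mg; exact: measurableT_comp mg (measurable_Z mZ i). Qed.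

Lemma mgf_sum a b (g : nat -> 'rV[R]_n -> R) : (a <= b)%N -> (forall i, mB (g i)) ->
  (\int[P]_t (expR (\sum_(a <= i < b) g i (Z i t)))%:E =
   \big[*%E/1%E]_(a <= i < b) \int[P]_t (expR (g i (Z 0%N t)))%:E)%E.
Proof.
move=> ab mg; rewrite -(subnKC ab); elim: (b - a)%N => [|k IH].
  rewrite addn0 !big_geq//; under eq_integral do rewrite big_geq// expR0.
  by rewrite integral_cst//= mul1e; exact: probability_setT.
have ak : (a <= a + k)%N by exact: leq_addr.
rewrite addnS big_nat_recr//= -IH.
under eq_integral do rewrite big_nat_recr//= expRD.
apply: etrans (@window_expectation _ _ _ P _ _ mZ indZ a (a + k) (a + k).+1
  (fun t => expR (\sum_(a <= i < a + k) g i (Z i t))) (fun t => expR (g (a + k)%N (Z (a + k)%N t))) ak (leqnSn _) _ _ _ _) _.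
- by apply: measurableT_comp => //; exact: window_sum.
- apply: measurableT_comp => //; apply: measurableT_comp (mg _) _.
  by apply: window_Z; rewrite leqnn ltnSn.
- by move=> t; rewrite expR_ge0.
- by move=> t; rewrite expR_ge0.
congr (_ * _)%E; apply: (@law_eq _ _ _ _ _ _ mZ idZ _ (fun z => (expR (g (a + k)%N z))%:E)).
  by apply/measurable_EFinP; exact: measurableT_comp.
by move=> z; rewrite lee_fin expR_ge0.
Qed.

Lemma windowS a b c d A : (a <= b)%N -> (c <= d)%N -> measurable (A : set (windowT Z b c)) ->
  measurable (A : set (windowT Z a d)).
Proof.
move=> ab cd; apply: sub_smallest2r => [|_ [B mB <-]]; first exact: smallest_sigma_algebra.
exists (fun i => if (b <= i < c)%N then B i else setT) => [i|].
  by case: ifP => // _; exact: rv_borelT.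
apply/seteqP; split => t h i hi; last first.
  by case: ifP => // hi'; exact: h.
have := h i; rewrite hi; apply.
by case/andP: hi => h1 h2; rewrite (leq_trans ab h1) (leq_trans h2 cd).
Qed.

(* Exponential Doob inequality, by splitting according to the first passage time. *)
Lemma max_window_sum a b (g : 'rV[R]_n -> R) (Phi x : R) : mB g -> 1 <= Phi ->
  (\int[P]_t (expR (g (Z 0%N t)))%:E <= Phi%:E)%E ->
  (P [set t | exists2 j, (j <= b)%N & (x <= \sum_(a <= i < a + j) g (Z i t))%R] <=
   (Phi ^+ b * expR (- x))%:E)%E.
Proof.
move=> mg Phi1 gPhi; have Phi0 : 0 <= Phi by apply: le_trans Phi1.
pose S j t := \sum_(a <= i < a + j) g (Z i t).
pose N k := [set t | forall j, (j <= k)%N -> S j t < x].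
have mN k : measurable (N k : set (windowT Z a (a + k))).
  have -> : N k = \bigcap_j (if (j <= k)%N then [set t | S j t < x] else setT).
    apply/seteqP; split => t h j; first by move=> _; case: ifP => // /h.
    by move=> jk; have := h j I; rewrite jk.
  apply: bigcapT_measurable => j; case: ifP => // jk.
  have -> : [set t | S j t < x] = S j @^-1` `]-oo, x[%classic.
    by apply/seteqP; split => t /=; rewrite in_itv.
  have mS : measurable_fun (setT : set (windowT Z a (a + k))) (S j).
    by apply: (@window_sum a (a + k) a (a + j) (fun=> g)) => // i /andP[h1 h2]; rewrite h1 (leq_trans h2)// leq_add2l.
  by rewrite -[X in measurable X]setTI; apply: mS => //; exact: measurable_itv.
(* [U] carries the exponential of the sum while the level [x] has not been reached; [V] is frozen at
   [expR x] afterwards. As [Phi >= 1], one more step multiplies the expectation of [U + V] by at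
   most [Phi]. *)
pose U k t := \1_(N k) t * expR (S k t).
pose V k t := \1_(~` N k) t * expR x.
have U0 k t : 0 <= U k t by rewrite mulr_ge0 ?expR_ge0// indicE.
have V0 k t : 0 <= V k t by rewrite mulr_ge0 ?expR_ge0// indicE.
have mU k : measurable_fun (setT : set (windowT Z a (a + k))) (U k).
  apply: measurable_funM; first exact: measurable_indic.
  by apply: measurableT_comp => //; exact: (@window_sum a (a + k) a (a + k) (fun=> g)).
have mN' k : measurable (N k : set T) := window_measurable mZ (mN k).
have mU' k : measurable_fun setT (U k) := window_fun mZ (mU k).
have mV k : measurable_fun setT (V k).
  by apply: measurable_funM => //; apply: measurable_indic; exact: measurableC.
have main k : (\int[P]_t (U k t + V k t)%:E <= (Phi ^+ k)%:E)%E.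
  elim: k => [|k IH].
    apply: le_trans (_ : \int[P]_t (cst 1%E t) <= _)%E; last first.
      by rewrite integral_cst//= mul1e expr0 probability_le1.
    apply: ge0_le_integral => //.
    - by move=> t _; rewrite lee_fin addr_ge0.
    - by apply/measurable_EFinP; exact: measurable_funD.
    move=> t _; rewrite lee_fin /U /V /S addn0 big_geq// expR0 mulr1 !indicE in_setC.
    case: (boolP (t \in N 0%N)) => [|h]; first by rewrite mul0r addr0.
    rewrite add0r mul1r -expR0 ler_expR leNgt; apply: contra h => x0; apply/mem_set => j.
    by rewrite leqn0 => /eqP ->; rewrite /S addn0 big_geq.
  have step t : U k.+1 t + V k.+1 t <= V k t + U k t * expR (g (Z (a + k)%N t)).
    have SS : S k.+1 t = S k t + g (Z (a + k)%N t) by rewrite /S addnS big_nat_recr//= leq_addr.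
    rewrite /U /V !indicE !in_setC -mulrA -expRD -SS.
    case: (boolP (t \in N k.+1)) => [/set_mem h|/negP h].
      rewrite mem_set; last by move=> j jk; apply: h; exact: ltnW.
      by rewrite mul0r add0r addr0.
    rewrite mul0r add0r mul1r; case: (boolP (t \in N k)) => [/set_mem h'|_]; last by rewrite mul0r addr0 mul1r.
    rewrite mul0r add0r mul1r ler_expR leNgt; apply/negP => Sx; apply: h; apply/mem_set => j.
    by rewrite leq_eqVlt => /predU1P[->//|]; rewrite ltnS; exact: h'.
  have ak : (a <= a + k)%N by exact: leq_addr.
  have mg' : measurable_fun (setT : set (windowT Z (a + k) (a + k).+1)) (fun t => expR (g (Z (a + k)%N t))).
    apply: measurableT_comp => //; apply: measurableT_comp mg _.
    by apply: window_Z; rewrite leqnn ltnSn.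
  have mUg : measurable_fun setT (fun t => U k t * expR (g (Z (a + k)%N t))).
    by apply: measurable_funM; [exact: mU'|exact: (window_fun mZ mg')].
  have iUg : (\int[P]_t (U k t * expR (g (Z (a + k)%N t)))%:E <= (\int[P]_t (U k t)%:E) * Phi%:E)%E.
    rewrite (@window_expectation _ _ _ P _ _ mZ indZ a (a + k) (a + k).+1 (U k)
      (fun t => expR (g (Z (a + k)%N t))) ak (leqnSn _) (mU k) mg' (U0 k)); last by move=> t; rewrite expR_ge0.
    apply: lee_wpmul2l; first by apply: integral_ge0 => t _; rewrite lee_fin.
    rewrite (@law_eq _ _ _ _ _ _ mZ idZ _ (fun z => (expR (g z))%:E))//.
    by apply/measurable_EFinP; exact: measurableT_comp.
  apply: le_trans (_ : \int[P]_t ((V k t)%:E + (U k t * expR (g (Z (a + k)%N t)))%:E) <= _)%E.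
    apply: ge0_le_integral => //.
    - by move=> t _; rewrite lee_fin addr_ge0.
    - by apply/measurable_EFinP; exact: measurable_funD.
    - by apply: emeasurable_funD; exact/measurable_EFinP.
    - by move=> t _; rewrite -EFinD lee_fin.
  rewrite ge0_integralD//; last 4 first.
  - by move=> t _; rewrite lee_fin.
  - exact/measurable_EFinP.
  - by move=> t _; rewrite lee_fin mulr_ge0// expR_ge0.
  - exact/measurable_EFinP.
  apply: le_trans (_ : (\int[P]_t (U k t)%:E + \int[P]_t (V k t)%:E) * Phi%:E <= _)%E.
    rewrite ge0_muleDl; last 2 first.
    - by apply: integral_ge0 => t _; rewrite lee_fin.
    - by apply: integral_ge0 => t _; rewrite lee_fin.
    rewrite addeC; apply: leeD => //; rewrite -[X in (X <= _)%E]mule1.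
    by apply: lee_wpmul2l; [apply: integral_ge0 => t _; rewrite lee_fin|rewrite lee_fin].
  rewrite -ge0_integralD//; last 4 first.
  - by move=> t _; rewrite lee_fin.
  - exact/measurable_EFinP.
  - by move=> t _; rewrite lee_fin.
  - exact/measurable_EFinP.
  rewrite exprSr EFinM; apply: lee_wpmul2r; first by rewrite lee_fin.
  exact: IH.
have -> : [set t | exists2 j, (j <= b)%N & (x <= \sum_(a <= i < a + j) g (Z i t))%R] = ~` N b.
  apply/seteqP; split => t; first by move=> [j jb xj] /(_ j jb); rewrite ltNge xj.
  move=> h; apply: contrapT => h'; apply: h => j jb; rewrite ltNge; apply/negP => xj.
  by apply: h'; exists j.
rewrite expRN EFinM -lee_pdivrMr ?invr_gt0 ?expR_gt0//.
apply: le_trans (main b); rewrite invrK.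
have -> : (P (~` N b) * (expR x)%:E = \int[P]_t (V b t)%:E)%E.
  rewrite /V; under eq_integral do rewrite EFinM.
  have mI : measurable_fun setT (fun t => (\1_(~` N b) t)%:E : \bar R).
    by apply/measurable_EFinP; apply: measurable_indic; exact: measurableC.
  rewrite ge0_integralZr ?lee_fin ?expR_ge0//.
  by rewrite integral_indic ?setIT//; exact: measurableC.
apply: ge0_le_integral => //.
- by move=> t _; rewrite lee_fin.
- exact/measurable_EFinP.
- by apply/measurable_EFinP; exact: measurable_funD.
- by move=> t _; rewrite lee_fin lerDr.
Qed.

End WindowSums.

(** * Borel-Cantelli along geometric scales *)

Section LogScale.
Variable R : realType.

(** Stands for ln ln of the number of steps at stage [k]; the shift by 2 keeps it positive from
    [k = 0] on. *)
Definition logk (k : nat) : R := ln k.+2%:R.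

Lemma logk_gt0 k : 0 < logk k.
Proof. by rewrite /logk ln_gt0// ltr1n. Qed.

Lemma logkS k : logk k.+1 <= logk k + k.+2%:R^-1.
Proof.
have k0 : 0 < k.+2%:R :> R by [].
have -> : k.+2%:R^-1 = ln (expR k.+2%:R^-1) :> R by rewrite expRK.
rewrite /logk -lnM ?posrE ?expR_gt0// ler_ln ?posrE ?mulr_gt0 ?expR_gt0//.
apply: le_trans (_ : k.+2%:R * (1 + k.+2%:R^-1) <= _); last by rewrite ler_pM2l// expR_ge1Dx.
by rewrite mulrDr mulr1 divff ?gt_eqF// natr1.
Qed.

Lemma logk_large (M : R) : \forall k \near \oo, M <= logk k.
Proof.
near=> k; rewrite -[M]expRK /logk ler_ln ?posrE ?expR_gt0//.
have : (Num.trunc (expR M) < k)%N by near: k; exists (Num.trunc (expR M)).+1.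
move=> h; have /andP[_ /ltW h2] := truncn_itv (expR_ge0 M).
by apply: le_trans h2 _; rewrite ler_nat (leq_trans h)// -addn2 leq_addr.
Unshelve. all: by end_near. Qed.

(** Comparison with the telescoping sum of the increments of [- expR (- c * ln k)], the discrete
    form of the integral of [x ^ (- 1 - c)]. *)
Lemma sum_logk_pow (c : R) N : 0 < c -> \sum_(k < N) expR (- (1 + c) * logk k) <= c^-1.
Proof.
move=> c0; suff H : \sum_(k < N) expR (- (1 + c) * logk k) <= c^-1 * (1 - expR (- c * ln N.+1%:R)).
  apply: le_trans H _; rewrite -[X in _ <= X]mulr1; apply: ler_wpM2l; first by rewrite invr_ge0 ltW.
  by rewrite lerBlDr lerDl expR_ge0.
elim: N => [|N IH]; first by rewrite big_ord0 ln1 mulr0 expR0 subrr mulr0.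
rewrite big_ord_recr /=; apply: le_trans (lerD IH (lexx _)) _; rewrite /logk.
set x := ln N.+1%:R; set y := ln N.+2%:R.
have xy : y - x >= N.+2%:R^-1.
  have N0 : 0 < N.+2%:R :> R by [].
  rewrite lerBrDl -[N.+2%:R^-1]expRK -lnM ?posrE ?expR_gt0// ler_ln ?posrE ?mulr_gt0 ?expR_gt0//.
  rewrite -ler_pdivlMr ?expR_gt0// -expRN.
  apply: le_trans (_ : N.+2%:R * (1 - N.+2%:R^-1) <= _); last by rewrite ler_pM2l// expR_ge1Dx.
  by rewrite mulrBr mulr1 divff ?gt_eqF// -[N.+2%:R]natr1 addrK.
have ey : expR y = N.+2%:R by rewrite /y lnK// posrE.
have -> : expR (- (1 + c) * y) = expR (- c * y) * N.+2%:R^-1.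
  by rewrite -ey -expRN -expRD; congr expR; ring.
have e1 : expR (- c * y) * (1 + c * N.+2%:R^-1) <= expR (- c * x).
  have -> : - c * x = - c * y + c * (y - x) by ring.
  rewrite expRD ler_pM2l ?expR_gt0//; apply: le_trans (expR_ge1Dx _).
  by rewrite lerD2l ler_pM2l.
have -> : c^-1 * (1 - expR (- c * x)) + expR (- c * y) / N.+2%:R =
  c^-1 * (1 - (expR (- c * x) - expR (- c * y) * (c * N.+2%:R^-1))).
  by move: (N.+2%:R^-1) => z; field; rewrite gt_eqF.
apply: ler_wpM2l; first by rewrite invr_ge0 ltW.
rewrite lerD2l lerN2; move: e1; rewrite mulrDr mulr1.
by move: (expR _ * (c / _)) => z; lra.
Qed.

Definition tau (b : nat -> nat) (k : nat) : R := Num.sqrt ((b k)%:R / logk k).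

Lemma tau_sqr b k : tau b k ^+ 2 = (b k)%:R / logk k.
Proof. by rewrite sqr_sqrtr// divr_ge0// ltW ?logk_gt0. Qed.

(** The second condition asks that [tau] grow at least geometrically from some rank on; both
    families of scales satisfy it. *)
Definition growing (b : nat -> nat) := [/\ forall k, (0 < b k)%N &
  exists r K, 1 < r /\ forall k, (K <= k)%N -> r * tau b k <= tau b k.+1].

Lemma tau_gt0 b k : growing b -> 0 < tau b k.
Proof. by move=> [b0 _]; rewrite sqrtr_gt0 divr_gt0 ?logk_gt0 ?ltr0n. Qed.

Lemma tau_logk b k : logk k * tau b k = Num.sqrt ((b k)%:R * logk k).
Proof.
have l0 := logk_gt0 k; apply/eqP; rewrite -(eqrXn2 (n := 2))// ?mulr_ge0 ?sqrtr_ge0 ?(ltW l0)//.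
rewrite exprMn tau_sqr sqr_sqrtr; last by rewrite mulr_ge0// ltW.
by apply/eqP; field; rewrite gt_eqF.
Qed.

Lemma tau_large b (M : R) : growing b -> \forall k \near \oo, M <= tau b k.
Proof.
move=> gb; have [b0 [r [K [r1 hr]]]] := gb.
have H j : tau b K * (1 + j%:R * (r - 1)) <= tau b (K + j).
  elim: j => [|j IH]; first by rewrite addn0 mul0r addr0 mulr1.
  rewrite addnS; apply: le_trans (hr _ (leq_addr _ _)).
  apply: le_trans (_ : r * (tau b K * (1 + j%:R * (r - 1))) <= _); last by rewrite ler_pM2l// (lt_trans ltr01).
  rewrite mulrCA ler_pM2l ?tau_gt0// -natr1.
  have : 0 <= j%:R * (r - 1) * (r - 1) by rewrite !mulr_ge0// subr_ge0 ltW.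
  lra.
have t0 := tau_gt0 K gb; have r10 : 0 < r - 1 by rewrite subr_gt0.
pose x := `|M| / (tau b K * (r - 1)); have x0 : 0 <= x by rewrite divr_ge0// mulr_ge0// ltW.
near=> k.
have kK : (K + (Num.trunc x).+1 <= k)%N by near: k; exists (K + (Num.trunc x).+1)%N.
have /andP[_ x1] := truncn_itv x0.
rewrite -(subnKC (leq_trans (leq_addr _ _) kK)); apply: le_trans (H _).
have xk : x <= (k - K)%:R.
  by apply: le_trans (ltW x1) _; rewrite ler_nat leq_subRL// (leq_trans (leq_addr _ _) kK).
apply: le_trans (ler_norm _) _.
have -> : `|M| = tau b K * (x * (r - 1)) by rewrite /x; field; rewrite !gt_eqF.
apply: ler_wpM2l; first exact: ltW.
have : x * (r - 1) <= (k - K)%:R * (r - 1) by apply: ler_wpM2r => //; exact: ltW.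
lra.
Unshelve. all: by end_near. Qed.

(** Geometric growth: the sum of the terms below [y] is at most a constant times the largest of
    them. *)
Lemma sum_tau_below b : growing b -> exists K c, 0 <= c /\ forall y N, 0 <= y ->
  \sum_(k < N) (if tau b (K + k) < y then tau b (K + k)%N else 0) <= c * y.
Proof.
move=> gb; have [b0 [r [K [r1 hr]]]] := gb.
have r10 : 0 < r - 1 by rewrite subr_gt0.
exists K, (r / (r - 1)); split => [|y N y0]; first by rewrite divr_ge0 ?ltW// (lt_trans ltr01).
set c := r / (r - 1).
have c1 : c = 1 + (r - 1)^-1 by rewrite /c; field; rewrite gt_eqF.
have ci : 0 < (r - 1)^-1 by rewrite invr_gt0.
have cr z : 0 <= z -> c * z = (r - 1)^-1 * (r * z) by rewrite /c => _; ring.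
set u := fun k => tau b (K + k).
have u0 k : 0 < u k by exact: tau_gt0.
have uS k : r * u k <= u k.+1 by rewrite /u addnS hr// leq_addr.
case: N => [|N]; first by rewrite big_ord0 mulr_ge0// c1; lra.
suff [] : (u N < y -> \sum_(k < N.+1) (if u k < y then u k else 0) <= c * u N) /\
   \sum_(k < N.+1) (if u k < y then u k else 0) <= c * y by [].
elim: N => [|N [IH1 IH2]].
  rewrite big_ord1; have := u0 0%N; case: ifP => [h|_] p; rewrite c1; split => //; nra.
rewrite big_ord_recr /=; case: ifP => [h|h]; last by rewrite addr0; split.
have uN : u N < y by apply: le_lt_trans h; apply: le_trans (uS N); have := u0 N; nra.
have := IH1 uN; have := uS N; have p := u0 N => h1 h2.
have H : \sum_(i < N.+1) (if u i < y then u i else 0) + u N.+1 <= c * u N.+1.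
  rewrite c1 mulrDl mul1r addrC lerD2l; apply: le_trans h2 _; rewrite cr ?(ltW p)//.
  by apply: ler_wpM2l => //; exact: ltW.
split => // ; apply: le_trans H _; apply: ler_wpM2l; [by rewrite c1; lra|exact: ltW].
Qed.

Definition geom (rho : R) (k : nat) : nat := Num.trunc (rho ^+ k).

Lemma geom_bounds rho k : 1 < rho -> (geom rho k)%:R <= rho ^+ k < (geom rho k)%:R + 1.
Proof.
move=> r1; rewrite natr1; apply: truncn_itv; rewrite exprn_ge0//; lra.
Qed.

Lemma geom_gt0 rho k : 1 < rho -> (0 < geom rho k)%N.
Proof.
move=> r1; rewrite -(ltr_nat R); have /andP[_] := geom_bounds k r1.
have : 1 <= rho ^+ k by rewrite exprn_ege1// ltW.
by rewrite ltr0n lt0n => h1 h2; apply/eqP => h; move: h2; rewrite h add0r ltNge h1.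
Qed.

Lemma pow_large (r M : R) : 1 < r -> \forall k \near \oo, M <= r ^+ k.
Proof.
move=> r1; have H k : 1 + k%:R * (r - 1) <= r ^+ k.
  elim: k => [|k IH]; first by rewrite mul0r addr0 expr0.
  rewrite exprS -natr1; have : 0 <= k%:R * (r - 1) * (r - 1) by rewrite !mulr_ge0// subr_ge0 ltW.
  have : r * (1 + k%:R * (r - 1)) <= r * r ^+ k by rewrite ler_pM2l//; lra.
  lra.
have r10 : 0 < r - 1 by rewrite subr_gt0.
pose x := `|M| / (r - 1); have x0 : 0 <= x by rewrite divr_ge0// ltW.
have /andP[_ x1] := truncn_itv x0.
near=> k; apply: le_trans (H k).
have xk : x <= k%:R.
  apply: le_trans (ltW x1) _; rewrite ler_nat; near: k; by exists (Num.trunc x).+1.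
have : x * (r - 1) <= k%:R * (r - 1) by apply: ler_wpM2r => //; exact: ltW.
rewrite /x divfK ?gt_eqF//; have := ler_norm M; lra.
Unshelve. all: by end_near. Qed.

Lemma geom_growing rho : 1 < rho -> growing (geom rho).
Proof.
move=> r1; split => [k|]; first exact: geom_gt0.
pose s := (1 + rho) / 2; have s1 : 1 < s by rewrite /s; lra.
(* The target ratio for [tau ^ 2] is [s], halfway between 1 and [rho]. The gap [rho - s] equals
   [2 * e]: one [e] absorbs the rounding in [geom], the other the growth of [logk]. *)
exists (Num.sqrt s); pose e := (rho - 1) / 4; have e0 : 0 < e by rewrite /e; lra.
have n1 := pow_large e^-1 r1.
have n2 := logk_large ((s / e)).
have [K _ hK] : \forall k \near \oo, e^-1 <= rho ^+ k /\ s / e <= logk k by apply: filterI.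
exists K; split; first by rewrite -[X in X < _]sqrtr1 ltr_sqrt//; lra.
move=> k /hK [h1 h2]; rewrite /tau -sqrtrM; last by lra.
apply: ler_wsqrtr; have l0 := logk_gt0 k; have l1 := logk_gt0 k.+1.
rewrite ler_pdivlMr// mulrA mulrAC ler_pdivrMr//.
have /andP[a1 _] := geom_bounds k r1; have /andP[_ a2] := geom_bounds k.+1 r1.
have b1 : (rho - e) * rho ^+ k <= (geom rho k.+1)%:R.
  have : 1 <= e * rho ^+ k by rewrite -ler_pdivrMl// mulr1.
  by move: a2; rewrite exprS; lra.
have b2 : s * logk k.+1 <= (rho - e) * logk k.
  have : k.+2%:R^-1 <= 1 :> R by rewrite invf_le1// ler1n.
  have := logkS k => c1 c2; have : s * logk k.+1 <= s * (logk k + 1) by apply: ler_wpM2l; [rewrite /s; lra|apply: le_trans c1 _; rewrite lerD2l].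
  have : s <= e * logk k by move: h2; rewrite ler_pdivrMr// mulrC.
  by rewrite /s /e; lra.
have g0 : 0 <= (geom rho k)%:R :> R by [].
have p0 : 0 < rho ^+ k by rewrite exprn_gt0//; lra.
apply: le_trans (_ : (rho - e) * logk k * rho ^+ k <= _).
  rewrite [X in X <= _]mulrAC; apply: le_trans (_ : (rho - e) * logk k * (geom rho k)%:R <= _).
    by apply: ler_wpM2r.
  by apply: ler_wpM2l => //; rewrite mulr_ge0 ?(ltW l0)// /e; lra.
by rewrite mulrAC; apply: ler_wpM2r => //; exact: ltW.
Qed.

End LogScale.

Section BorelCantelli.
Variables (R : realType) (dT : measure_display) (T : measurableType dT) (P : probability T R).

Lemma ae_and (A B C : T -> Prop) : {ae P, forall t, A t} -> {ae P, forall t, B t} ->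
  (forall t, A t -> B t -> C t) -> {ae P, forall t, C t}.
Proof.
move=> hA hB h; have [U [mU U0 AU]] := hA; have [W [mW W0 BW]] := hB.
exists (U `|` W); split; [exact: measurableU|by rewrite measureU0|].
move=> t nC; have [At|nA] := pselect (A t); last by left; apply: AU.
by right; apply: BW => Bt; apply: nC; exact: h.
Qed.

Lemma borel_cantelli_logk (A : nat -> set T) (c M : R) : (forall k, measurable (A k)) -> 0 < c -> 0 <= M ->
  (\forall k \near \oo, (P (A k) <= (M * expR (- (1 + c) * logk R k))%:E)%E) ->
  {ae P, forall t, \forall k \near \oo, ~ A k t}.
Proof.
move=> mA c0 M0 [K _ hK]; pose B k := if (K <= k)%N then A k else set0.
have mB k : measurable (B k) by rewrite /B; case: ifP.
have PB k : (P (B k) <= (M * expR (- (1 + c) * logk R k))%:E)%E.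
  rewrite /B; case: ifP => [kK|_]; first exact: hK.
  by rewrite measure0 lee_fin mulr_ge0// expR_ge0.
have B0 : P (lim_sup_set B) = 0%E.
  apply: lim_sup_set_cvg0 => //; apply: le_lt_trans (ltry (M * c^-1)).
  apply: lime_le; first by apply: is_cvg_nneseries.
  apply/nearW => N /=; rewrite big_mkord; apply: le_trans (_ : (\sum_(k < N) (M * expR (- (1 + c) * logk R k)))%:E <= _)%E.
    by rewrite -sumEFin; apply: lee_sum.
  by rewrite lee_fin -mulr_sumr; apply: ler_wpM2l => //; exact: sum_logk_pow.
exists (lim_sup_set B); split => //.
  by apply: bigcap_measurableType => //; move=> n _; exact: bigcup_measurable.
move=> t /= h n _ /=; apply: contrapT => h'; apply: h; exists (maxn n K) => // k /=.
rewrite geq_max => /andP[nk kK] At; apply: h'; exists k => //; by rewrite /B kK.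
Qed.

End BorelCantelli.

(** * Truncation remainders and maxima inside blocks *)

Section BlockMaxima.
Variables (R : realType) (dT : measure_display) (T : measurableType dT) (P : probability T R).
Variables (n : nat) (Z : nat -> T -> 'rV[R]_n).
Hypothesis mZ : forall i B, rv_borel B -> measurable (Z i @^-1` B).
Hypothesis indZ : forall (F : seq nat) (B : nat -> set 'rV[R]_n), uniq F -> (forall i, rv_borel (B i)) ->
  P (\bigcap_(i in [set` F]) (Z i @^-1` B i)) = \big[*%E/1%E]_(i <- F) P (Z i @^-1` B i).
Hypothesis idZ : forall i B, rv_borel B -> P (Z i @^-1` B) = P (Z 0%N @^-1` B).
Local Notation mB g := (measurable_fun (setT : set (borelT R n)) g).
Local Notation "'Ex' f" := (\int[P]_t f t) (at level 10, f at next level).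

Variable h : 'rV[R]_n -> R.
Hypotheses (mh : mB h) (h0 : forall z, 0 <= h z).
Hypothesis ih2 : P.-integrable setT (EFin \o (fun t => h (Z 0%N t) ^+ 2)).
Variable b : nat -> nat.
Hypothesis gb : growing R b.

Definition above (s : R) (z : 'rV[R]_n) : R := \1_[set z | s < h z] z.

Lemma above01 s z : 0 <= above s z <= 1.
Proof. by rewrite /above indicE; case: (_ \in _) => /=; rewrite ?lexx ler01. Qed.

Lemma aboveE s z : above s z = if s < h z then 1 else 0.
Proof. by rewrite /above indicE; case: ifPn => H; [rewrite mem_set|rewrite memNset//; apply/negP]. Qed.

Lemma above_tail s t : above s (Z 0%N t) = tail_ind (h \o Z 0%N) s t.
Proof. by rewrite aboveE /tail_ind indicE; case: ifPn => H; [rewrite mem_set|rewrite memNset//; apply/negP]. Qed.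

Lemma measurable_above s : mB (above s).
Proof.
apply: measurable_indic; have -> : [set z | s < h z] = h @^-1` `]s, +oo[%classic.
  by apply/seteqP; split => t /=; rewrite in_itv/= andbT.
by rewrite -[X in measurable X]setTI; apply: mh => //; exact: measurable_itv.
Qed.

(** Equals [b k / tau] and [logk k * tau]; block sums are divided by [sqrt 2] times this, that is,
    by the root of [2 * b k * logk k]. *)
Definition scale k : R := Num.sqrt ((b k)%:R * logk R k).

Lemma scale_gt0 k : 0 < scale k.
Proof. by rewrite sqrtr_gt0 mulr_gt0 ?logk_gt0// ltr0n; case: gb. Qed.

Lemma scale_tau k : (b k)%:R / scale k = tau R b k.
Proof.
have l0 := logk_gt0 R k; have b0 : 0 < (b k)%:R :> R by rewrite ltr0n; case: gb.
apply/eqP; rewrite -(eqrXn2 (n := 2))// ?divr_ge0 ?sqrtr_ge0//.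
rewrite expr_div_n tau_sqr /scale sqr_sqrtr; last by rewrite mulr_ge0// ltW.
by apply/eqP; field; rewrite !gt_eqF.
Qed.

(** The sum over [k] of the remainders divided by [scale] has finite expectation, so almost surely
    its terms tend to 0. *)
Lemma remainder_negligible (m : nat) (e : R) : 0 < e ->
  {ae P, forall t, forall dl, 0 < dl -> \forall k \near \oo,
    \sum_(0 <= i < m * b k) h (Z i t) * above (e * tau R b k) (Z i t) <= dl * scale k}.
Proof.
move=> e0; have [K [c [c0 hc]]] := sum_tau_below gb.
pose u k (z : 'rV[R]_n) := h z * above (e * tau R b (K + k)) z.
have u0 k z : 0 <= u k z by rewrite mulr_ge0//; case/andP: (above01 (e * tau R b (K + k)) z).
have mu_ k : mB (u k) by apply: measurable_funM => //; exact: measurable_above.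
pose f k t := ((scale (K + k))^-1 * \sum_(0 <= i < m * b (K + k)) u k (Z i t))%:E.
have f0 k t : (0 <= f k t)%E.
  by rewrite lee_fin mulr_ge0 ?invr_ge0 ?(ltW (scale_gt0 _))// sumr_ge0.
have muZ k i : measurable_fun setT (fun t => u k (Z i t)) by exact: (measurable_gZ mZ _ (mu_ k)).
have mf k : measurable_fun setT (f k).
  by apply/measurable_EFinP; apply: measurable_funM => //; apply: measurable_sum.
have mhZ : measurable_fun setT (fun t => h (Z 0%N t)) by exact: (measurable_gZ mZ _ mh).
have If k : (\int[P]_t f k t = \int[P]_t (m%:R * tau R b (K + k) * u k (Z 0%N t))%:E)%E.
  rewrite /f; under eq_integral do rewrite EFinM -sumEFin.
  rewrite ge0_integralZl//; last 3 first.
  - by apply: emeasurable_sum => i; exact/measurable_EFinP.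
  - by move=> t _; apply: sume_ge0 => i _; rewrite lee_fin.
  - by rewrite lee_fin invr_ge0 ltW// scale_gt0.
  rewrite ge0_integral_sum//; last 2 first.
  - by move=> i; exact/measurable_EFinP.
  - by move=> i t _; rewrite lee_fin.
  have law i : (\int[P]_t (u k (Z i t))%:E = \int[P]_t (u k (Z 0%N t))%:E)%E.
    by apply: (@law_eq _ _ _ _ _ _ mZ idZ i (fun z => (u k z)%:E)) => [|z]; [exact/measurable_EFinP|rewrite lee_fin].
  rewrite (eq_bigr _ (fun i _ => law i)) -ge0_integral_sum//; last 2 first.
  - by move=> i; exact/measurable_EFinP.
  - by move=> i t _; rewrite lee_fin.
  rewrite -ge0_integralZl//; last 3 first.
  - by apply: emeasurable_sum => i; exact/measurable_EFinP.
  - by move=> t _; apply: sume_ge0 => i _; rewrite lee_fin.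
  - by rewrite lee_fin invr_ge0 ltW// scale_gt0.
  apply: eq_integral => t _; rewrite sumEFin -EFinM sumr_const_nat subn0 -scale_tau.
  rewrite -[_ *+ (m * _)]mulr_natl natrM; congr EFin; ring.
(* Sum and expectation are exchanged: for a step of size [x], the sum of the [tau] below [x / e] is
   at most [c * x / e], which leaves a multiple of the second moment. *)
have Ifin N : (\sum_(0 <= k < N) \int[P]_t f k t <= \int[P]_t (m%:R * c / e * h (Z 0%N t) ^+ 2)%:E)%E.
  rewrite (eq_bigr _ (fun k _ => If k)) -ge0_integral_sum//; last 2 first.
  - by move=> k; apply/measurable_EFinP; exact: measurable_funM.
  - by move=> k t _; rewrite lee_fin !mulr_ge0// ltW// tau_gt0.
  apply: ge0_le_integral => //.
  - by move=> t _; apply: sume_ge0 => k _; rewrite lee_fin !mulr_ge0// ltW// tau_gt0.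
  - by apply: emeasurable_sum => k; apply/measurable_EFinP; exact: measurable_funM.
  - by apply/measurable_EFinP; apply: measurable_funM => //; exact: measurable_funX.
  move=> t _; rewrite sumEFin lee_fin; set x := h (Z 0%N t); have x0 : 0 <= x by exact: h0.
  have -> : \sum_(0 <= k < N) m%:R * tau R b (K + k) * u k (Z 0%N t) =
     m%:R * x * \sum_(k < N) (if tau R b (K + k) < x / e then tau R b (K + k) else 0).
    rewrite mulr_sumr big_mkord; apply: eq_bigr => k _; rewrite /u aboveE -/x mulrC [e * _]mulrC -ltr_pdivlMr//.
    by case: ifP => _; ring.
  apply: le_trans (ler_wpM2l _ (hc (x / e) N _)) _.
  - by rewrite mulr_ge0.
  - by rewrite divr_ge0// ltW.
  by rewrite le_eqVlt; apply/orP; left; apply/eqP; ring.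
have fin : (\int[P]_t (\sum_(0 <= k <oo) f k t) < +oo)%E.
  rewrite integral_nneseries//; apply: le_lt_trans (_ : \int[P]_t (m%:R * c / e * h (Z 0%N t) ^+ 2)%:E < _)%E.
    apply: lime_le; last exact/nearW.
    by apply: is_cvg_nneseries => k _ _; apply: integral_ge0.
  have /integrableP[_] := integrableZl measurableT (m%:R * c / e) ih2.
  under eq_integral => t _.
    rewrite /= ger0_norm; last by rewrite mulr_ge0 ?sqr_ge0// divr_ge0 ?mulr_ge0// ltW.
    over.
  by [].
have iF : P.-integrable setT (fun t => \sum_(0 <= k <oo) f k t)%E.
  apply/integrableP; split; first exact: ge0_emeasurable_sum.
  by under eq_integral do rewrite gee0_abs ?nneseries_ge0//.
have := integrable_ae measurableT iF; apply: filterS => t /(_ I) ft dl dl0.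
have := @nneseries_tail_cvg _ (fun k => f k t) xpredT _ (fun k _ => f0 k t).
rewrite ltey_eq ft => /(_ isT) /fine_cvgP[fn /cvgrPdist_lt /(_ _ dl0) cv].
have : \forall k \near \oo, (fine (f k t) < dl).
  near=> k.
  have A : ((\sum_(k <= j <oo) f j t)%E \is a fin_num) by near: k.
  have : `|0 - fine (\sum_(k <= j <oo) f j t)%E| < dl by near: k.
  rewrite sub0r normrN => /(le_lt_trans (ler_norm _)); apply: le_lt_trans.
  apply: fine_le => //.
  have -> : (\sum_(k <= j <oo) f j t = f k t + \sum_(k.+1 <= j <oo) f j t)%E.
    by rewrite (nneseries_split k 1)// addn1 big_nat1.
  by rewrite leeDl// nneseries_ge0.
move=> [K' _ hK']; exists (K + K')%N => // k /= kK.
have Kk : (K <= k)%N by apply: leq_trans (leq_addr _ _) kK.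
have /= := hK' (k - K)%N; rewrite leq_subRL// => /(_ kK); rewrite /f /= subnKC// => h1.
have E : \sum_(0 <= i < m * b k) u (k - K)%N (Z i t) =
  \sum_(0 <= i < m * b k) h (Z i t) * above (e * tau R b k) (Z i t).
  by apply: eq_bigr => i _; rewrite /u subnKC.
by rewrite -E mulrC; apply: ltW; rewrite -ltr_pdivrMl ?scale_gt0.
Unshelve. all: by end_near. Qed.

Lemma Rintegral_bounded (f : T -> R) (M : R) : measurable_fun setT f -> (forall t, 0 <= f t <= M) ->
  (\int[P]_t (f t)%:E = (Ex f)%:E)%E.
Proof.
move=> mf fM; rewrite /Rintegral fineK// ge0_fin_numE; last first.
  by apply: integral_ge0 => t _; rewrite lee_fin; case/andP: (fM t).
apply: le_lt_trans (ltry M); apply: le_trans (_ : \int[P]_t (cst M%:E t) <= _)%E.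
  apply: ge0_le_integral => //.
  - by move=> t _; rewrite lee_fin; case/andP: (fM t).
  - exact/measurable_EFinP.
  - by move=> t _; rewrite lee_fin; case/andP: (fM t).
rewrite integral_cst//= -[X in (_ <= X)%E]mule1; have -> : P setT = 1%E by exact: probability_setT.
exact: lexx.
Qed.

(* The weight of [Z l] in the exponential moments of the [k]-th block sums, truncated at level [e * tau k]. *)
Definition tilt (e : R) k (xi : 'rV[R]_n -> R) (z : 'rV[R]_n) : R :=
  Num.sqrt 2 / tau R b k * (xi z * (1 - above (e * tau R b k) z)).

Lemma measurable_tilt e k xi : mB xi -> mB (tilt e k xi).
Proof.
move=> mxi; apply: measurable_funM => //; apply: measurable_funM => //.
by apply: measurable_funB => //; exact: measurable_above.
Qed.

Lemma tilt_mgf (C e : R) : 0 < C -> 0 < e -> exists2 eps0, 0 < eps0 & forall eps, 0 < eps -> eps <= eps0 ->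
  forall xi : 'rV[R]_n -> R, mB xi -> (forall z, `|xi z| <= C * h z) -> Ex (fun t => xi (Z 0%N t)) = 0 ->
  let q := Ex (fun t => xi (Z 0%N t) ^+ 2) in
  \forall k \near \oo, exists2 phi, (\int[P]_t (expR (tilt eps k xi (Z 0%N t)))%:E = phi%:E)%E &
    expR ((q - e) / tau R b k ^+ 2) <= phi <= expR ((q + e) / tau R b k ^+ 2).
Proof.
move=> C0 e0; have mhZ := measurable_gZ mZ 0%N mh.
have [eps0 eps00 H] := truncated_mgf (P := P) mhZ (fun t => h0 (Z 0%N t)) ih2 C0 e0.
exists eps0 => // eps ep epl xi mxi xiC Exi q.
have [t0 t00 H'] := H eps ep epl (fun t => xi (Z 0%N t)) (measurable_gZ mZ 0%N mxi) (fun t => xiC _) Exi.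
have := tau_large t0 gb; apply: filterS => k /H' /= Hk.
have tk := tau_gt0 k gb.
have mg : measurable_fun setT (fun t => expR (tilt eps k xi (Z 0%N t))).
  by apply: measurableT_comp => //; exact: (measurable_gZ mZ 0%N (measurable_tilt eps k mxi)).
exists (Ex (fun t => expR (tilt eps k xi (Z 0%N t)))).
  apply: (Rintegral_bounded (M := expR (Num.sqrt 2 / tau R b k * (C * (eps * tau R b k))))) => // t.
  rewrite expR_ge0 ler_expR /tilt; apply: ler_wpM2l; first by rewrite divr_ge0 ?sqrtr_ge0// ltW.
  rewrite aboveE; case: ltP => [_|hl]; first by rewrite subrr mulr0 !mulr_ge0// ltW.
  rewrite subr0 mulr1; apply: le_trans (ler_norm _) _; apply: le_trans (xiC _) _.
  by apply: ler_wpM2l => //; exact: ltW.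
suff -> : Ex (fun t => expR (tilt eps k xi (Z 0%N t))) =
  Ex (fun t => expR (Num.sqrt 2 / tau R b k * (xi (Z 0%N t) * (1 - tail_ind (h \o Z 0%N) (eps * tau R b k) t)))) by [].
by apply: eq_Rintegral => t _; rewrite /tilt above_tail.
Qed.

(** Doob's inequality at level [(q + 4) * logk] against a moment at most [expR ((q + 1) * logk)]
    leaves [expR (- 3 * logk)], which is summable, for each of the [m] blocks. The last unit of
    [q + 5] pays for the truncation remainder. *)
Lemma block_max (m : nat) (C : R) (xi : 'rV[R]_n -> R) : 0 < C -> mB xi -> (forall z, `|xi z| <= C * h z) ->
  Ex (fun t => xi (Z 0%N t)) = 0 ->
  {ae P, forall t, \forall k \near \oo, forall i j, (i < m)%N -> (j <= b k)%N ->
    \sum_(i * b k <= l < i * b k + j) xi (Z l t) <= (Ex (fun t => xi (Z 0%N t) ^+ 2) + 5) * scale k}.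
Proof.
move=> C0 mxi xiC Exi; set q := Ex _.
have q0 : 0 <= q by apply: Rintegral_ge0 => t _; rewrite sqr_ge0.
have [eps eps0 /(_ _ eps0 (lexx _) _ mxi xiC Exi)] := tilt_mgf C0 ltr01.
rewrite -/q /= => H.
pose S k a j t := \sum_(a <= l < a + j) tilt eps k xi (Z l t).
pose A k := \bigcup_(i in [set i | (i < m)%N])
  [set t | exists2 j, (j <= b k)%N & (q + 4) * logk R k <= S k (i * b k)%N j t].
have mAi k i : measurable [set t | exists2 j, (j <= b k)%N & (q + 4) * logk R k <= S k (i * b k)%N j t].
  have -> : [set t | exists2 j, (j <= b k)%N & (q + 4) * logk R k <= S k (i * b k)%N j t] =
     \bigcup_(j in [set j | (j <= b k)%N]) (S k (i * b k)%N j @^-1` `[(q + 4) * logk R k, +oo[%classic).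
    by apply/seteqP; split => t [j jb /=]; rewrite ?in_itv/= ?andbT => jt; exists j => //=; rewrite in_itv/= andbT.
  apply: bigcup_measurable => j _; rewrite -[X in measurable X]setTI.
  have mS : measurable_fun setT (S k (i * b k)%N j).
    by apply: measurable_sum => l; exact: (measurable_gZ mZ l (measurable_tilt eps k mxi)).
  by apply: mS => //; exact: measurable_itv.
have mA k : measurable (A k) by apply: bigcup_measurable.
have PA : \forall k \near \oo, (P (A k) <= (m%:R * expR (- (1 + 2) * logk R k))%:E)%E.
  near=> k; have [phi phiE /andP[_ phi2]] : exists2 phi, (\int[P]_t (expR (tilt eps k xi (Z 0%N t)))%:E = phi%:E)%E &
    expR ((q - 1) / tau R b k ^+ 2) <= phi <= expR ((q + 1) / tau R b k ^+ 2) by near: k.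
  have t2 : 0 < tau R b k ^+ 2 by rewrite exprn_gt0// tau_gt0.
  have Phi1 : 1 <= expR ((q + 1) / tau R b k ^+ 2).
    by rewrite -[X in X <= _]expR0 ler_expR divr_ge0 ?(ltW t2)// addr_ge0.
  rewrite /A bigcup_mkord; apply: le_trans (@Boole_inequality _ _ _ P (fun i =>
    [set t | exists2 j, (j <= b k)%N & (q + 4) * logk R k <= S k (i * b k)%N j t]) m _) _ => //.
  apply: le_trans (_ : \sum_(i < m) (expR (- (1 + 2) * logk R k))%:E <= _)%E; last first.
    by rewrite sumEFin sumr_const card_ord mulr_natl.
  apply: lee_sum => i _.
  apply: le_trans (max_window_sum mZ indZ idZ (i * b k) (b k) ((q + 4) * logk R k) (measurable_tilt eps k mxi) Phi1 _) _.
    by rewrite phiE lee_fin.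
  rewrite lee_fin -expRM_natl -expRD ler_expR tau_sqr.
  have bk : 0 < (b k)%:R :> R by rewrite ltr0n; case: gb.
  have -> : (b k)%:R * ((q + 1) / ((b k)%:R / logk R k)) = (q + 1) * logk R k.
    by field; rewrite !gt_eqF// logk_gt0.
  by lra.
have ae1 := borel_cantelli_logk mA (ltr0n R 2) (ler0n R m) PA.
have ae2 := remainder_negligible m eps0.
apply: (ae_and ae1 ae2) => t ht1 /(_ C^-1); rewrite invr_gt0 => /(_ C0) ht2.
apply: filterS2 ht1 ht2 => k Ak rk i j im jb.
have tk := tau_gt0 k gb.
have S1 : S k (i * b k)%N j t < (q + 4) * logk R k.
  by rewrite ltNge; apply/negP => h1; apply: Ak; exists i => //; exists j.
pose s := Num.sqrt 2 / tau R b k.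
have s0 : 0 < s by rewrite divr_gt0// sqrtr_gt0.
have r1 : 1 <= Num.sqrt 2 :> R by rewrite -[X in X <= _]sqrtr1 ler_sqrt//; lra.
have E1 : \sum_(i * b k <= l < i * b k + j) xi (Z l t) <= s^-1 * S k (i * b k)%N j t + C * (C^-1 * scale k).
  apply: le_trans (_ : _ <= s^-1 * S k (i * b k)%N j t + C * \sum_(0 <= l < m * b k) h (Z l t) * above (eps * tau R b k) (Z l t)) _; last first.
    by rewrite lerD2l; apply: ler_wpM2l => //; exact: ltW.
  have ij : (i * b k + j <= m * b k)%N.
    by apply: leq_trans (_ : i.+1 * b k <= _)%N; [rewrite mulSn addnC leq_add2r|rewrite leq_mul2r im orbT].
  have i0 : (i * b k <= i * b k + j)%N by exact: leq_addr.
  have ha0 l : 0 <= h (Z l t) * above (eps * tau R b k) (Z l t) by rewrite mulr_ge0//; case/andP: (above01 (eps * tau R b k) (Z l t)).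
  apply: le_trans (_ : _ <= s^-1 * S k (i * b k)%N j t + C * \sum_(i * b k <= l < i * b k + j) h (Z l t) * above (eps * tau R b k) (Z l t)) _.
    rewrite /S !mulr_sumr -big_split; apply: ler_sum => l _ /=; rewrite /tilt -/s mulKf ?gt_eqF//.
    have /andP[a0 a1] := above01 (eps * tau R b k) (Z l t).
    have := xiC (Z l t); rewrite ler_norml => /andP[_]; nra.
  rewrite lerD2l; apply: ler_wpM2l; first exact: ltW.
  rewrite (big_cat_nat (n := (i * b k)%N) (p := (m * b k)%N))//=; last exact: leq_trans ij.
  rewrite (big_cat_nat (m := (i * b k)%N) (n := (i * b k + j)%N) (p := (m * b k)%N))//=.
  by rewrite addrCA lerDl addr_ge0// sumr_ge0.
apply: le_trans E1 _; rewrite mulrA divff ?gt_eqF// mul1r.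
have E2 : s^-1 * S k (i * b k)%N j t <= (q + 4) * scale k.
  apply: le_trans (_ : s^-1 * ((q + 4) * logk R k) <= _).
    by apply: ler_wpM2l; [rewrite invr_ge0 ltW|exact: ltW].
  rewrite /s invf_div /scale -tau_logk.
  have -> : tau R b k / Num.sqrt 2 * ((q + 4) * logk R k) = (q + 4) * (logk R k * tau R b k) / Num.sqrt 2 by ring.
  rewrite ler_pdivrMr ?sqrtr_gt0// ler_peMr// mulr_ge0 ?mulr_ge0 ?(ltW (logk_gt0 _ _)) ?(ltW tk)//; lra.
lra.
Unshelve. all: by end_near. Qed.

End BlockMaxima.

(** * Upper and lower deviations of block sums *)

Section FiniteNet.
Variable R : realType.

(** Rounding toward 0 keeps the rounded vector inside the unit ball; the index [j] encodes the grid
    point [(j - N) / N]. *)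
Lemma round_to_zero (v : R) (N : nat) : (0 < N)%N -> `|v| <= 1 -> exists j : 'I_(N.*2.+1),
  let th := (j%:R - N%:R) / N%:R in th ^+ 2 <= v ^+ 2 /\ v ^+ 2 - `|v| / N%:R <= th * v.
Proof.
move=> N0 v1; have NR : 0 < N%:R :> R by rewrite ltr0n.
have vN0 : 0 <= `|v| * N%:R by rewrite mulr_ge0.
pose q := Num.trunc (`|v| * N%:R); have /andP[q1 q2] := truncn_itv vN0; rewrite -/q in q1 q2.
have qN : (q <= N)%N by rewrite -(ler_nat R) (le_trans q1)// ler_piMl.
pose x : R := q%:R / N%:R.
have x0 : 0 <= x by rewrite divr_ge0.
have xv : x <= `|v| by rewrite ler_pdivrMr.
have vx : `|v| - N%:R^-1 <= x.
  by rewrite lerBlDr -[N%:R^-1]mul1r -mulrDl ler_pdivlMr// natr1 ltW.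
have [v0|v0] := leP 0 v.
  have jN : (N + q < N.*2.+1)%N by rewrite ltnS -addnn leq_add2l.
  exists (Ordinal jN) => /=; rewrite natrD addrAC subrr add0r -/x.
  rewrite ger0_norm// in xv vx *; split; first by rewrite lerXn2r.
  have : (v - N%:R^-1) * v <= x * v by apply: ler_wpM2r.
  by rewrite mulrBl -expr2 mulrC; lra.
have jN : (N - q < N.*2.+1)%N by rewrite ltnS (leq_trans (leq_subr _ _))// -addnn leq_addr.
exists (Ordinal jN) => /=; rewrite natrB// addrAC subrr add0r mulNr -/x.
rewrite ltr0_norm// in xv vx *; rewrite sqrrN; split.
  by rewrite -[X in _ <= X]sqrrN lerXn2r// nnegrE// oppr_ge0 ltW.
have : (- v - N%:R^-1) * (- v) <= x * (- v) by apply: ler_wpM2r => //; rewrite oppr_ge0 ltW.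
by rewrite mulrBl mulrNN -expr2 !mulrN mulNr [N%:R^-1 * v]mulrC mulNr; lra.
Qed.

Definition netpt (I : finType) N (f : {ffun I -> 'I_(N.*2.+1)}) (p : I) : R := ((f p)%:R - N%:R) / N%:R.

(** The unit vector in the direction of [u] is rounded coordinatewise; each coordinate loses at most
    [1 / N] in the pairing. *)
Lemma net_detects (I : finType) (u : I -> R) (r : R) N : (0 < N)%N -> 0 < r -> #|I|%:R <= N%:R :> R ->
  r ^+ 2 < \sum_p u p ^+ 2 -> exists f : {ffun I -> 'I_(N.*2.+1)}, \sum_p netpt f p ^+ 2 <= 1 /\
  r * (1 - #|I|%:R / N%:R) <= \sum_p netpt f p * u p.
Proof.
move=> N0 r0 IN ru; have NR : 0 < N%:R :> R by rewrite ltr0n.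
pose w := Num.sqrt (\sum_p u p ^+ 2).
have w2 : w ^+ 2 = \sum_p u p ^+ 2 by rewrite sqr_sqrtr// sumr_ge0// => p _; rewrite sqr_ge0.
have rw : r < w by rewrite -(ltr_pXn2r (n := 2))// ?nnegrE ?sqrtr_ge0 ?(ltW r0)// w2.
have w0 : 0 < w by apply: lt_trans rw.
pose v p := u p / w.
have v2 : \sum_p v p ^+ 2 = 1.
  have -> : \sum_p v p ^+ 2 = (\sum_p u p ^+ 2) / w ^+ 2.
    by rewrite mulr_suml; apply: eq_bigr => p _; rewrite expr_div_n.
  by rewrite -w2 divff// expf_neq0// gt_eqF.
have v1 p : `|v p| <= 1.
  rewrite -(ler_pXn2r (n := 2))// ?nnegrE// expr1n real_normK ?num_real// -[X in _ <= X]v2 (bigD1 p)//= lerDl.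
  by apply: sumr_ge0 => q _; rewrite sqr_ge0.
have [f hf] := choice (fun p => round_to_zero N0 (v1 p)).
exists [ffun p => f p]; rewrite /netpt; split.
  by rewrite -[X in _ <= X]v2; apply: ler_sum => p _; rewrite ffunE; case: (hf p).
apply: le_trans (_ : w * (1 - #|I|%:R / N%:R) <= _).
  by apply: ler_wpM2r; [rewrite subr_ge0 ler_pdivrMr// mul1r|exact: ltW].
apply: le_trans (_ : w * \sum_p (v p ^+ 2 - `|v p| / N%:R) <= _).
  apply: ler_wpM2l; first exact: ltW.
  rewrite sumrB v2 lerD2l lerN2 -mulr_suml; apply: ler_wpM2r; first by rewrite invr_ge0 ltW.
  by rewrite -sum1_card natr_sum; apply: ler_sum => p _.
rewrite mulr_sumr; apply: ler_sum => p _; rewrite ffunE; have [_ h] := hf p.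
have -> : u p = w * v p by rewrite /v mulrCA divff ?mulr1// gt_eqF.
by rewrite mulrCA; apply: ler_wpM2l => //; exact: ltW.
Qed.

End FiniteNet.

Lemma big_div_blocks (S : Type) (idx : S) (op : Monoid.law idx) m b (G : nat -> nat -> S) : (0 < b)%N ->
  \big[op/idx]_(0 <= l < m * b) G (l %/ b)%N l =
  \big[op/idx]_(i < m) \big[op/idx]_(i * b <= l < i.+1 * b) G i l.
Proof.
move=> b0; elim: m => [|m IH]; first by rewrite mul0n big_geq// big_ord0.
rewrite [RHS]big_ord_recr /= -IH (big_cat_nat (n := (m * b)%N))//=; last by rewrite leq_mul2r leqnSn orbT.
congr (op _ _); apply: eq_big_nat => l /andP[h1 h2].
suff -> : (l %/ b)%N = m by [].
by apply/eqP; rewrite eqn_leq leq_divRL// h1 andbT -ltnS ltn_divLR.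
Qed.

Lemma sum_pairs (V : nmodType) (I J : finType) (F : I * J -> V) : \sum_p F p = \sum_i \sum_j F (i, j).
Proof. by rewrite pair_bigA; apply: eq_bigr => -[]. Qed.

(** * Exponential moments of the vector of block sums and its upper bound *)

Section BlockFluctuations.
Variables (R : realType) (dT : measure_display) (T : measurableType dT) (P : probability T R).
Variables (n : nat) (Z : nat -> T -> 'rV[R]_n).
Hypothesis mZ : forall i B, rv_borel B -> measurable (Z i @^-1` B).
Hypothesis indZ : forall (F : seq nat) (B : nat -> set 'rV[R]_n), uniq F -> (forall i, rv_borel (B i)) ->
  P (\bigcap_(i in [set` F]) (Z i @^-1` B i)) = \big[*%E/1%E]_(i <- F) P (Z i @^-1` B i).
Hypothesis idZ : forall i B, rv_borel B -> P (Z i @^-1` B) = P (Z 0%N @^-1` B).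
Local Notation mB g := (measurable_fun (setT : set (borelT R n)) g).
Local Notation "'Ex' f" := (\int[P]_t f t) (at level 10, f at next level).

Variable h : 'rV[R]_n -> R.
Hypotheses (mh : mB h) (h0 : forall z, 0 <= h z).
Hypothesis ih2 : P.-integrable setT (EFin \o (fun t => h (Z 0%N t) ^+ 2)).
Variable b : nat -> nat.
Hypothesis gb : growing R b.

Variables (d : nat) (V : 'I_d -> 'rV[R]_n -> R).
Hypotheses (mV : forall c, mB (V c)) (Vh : forall c z, `|V c z| <= h z).
Hypothesis EV : forall c, Ex (fun t => V c (Z 0%N t)) = 0.
Hypothesis EVV : forall w : 'I_d -> R, Ex (fun t => (\sum_c w c * V c (Z 0%N t)) ^+ 2) = \sum_c w c ^+ 2.

Variable m : nat.
Hypothesis m0 : (0 < m)%N.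

Definition blockY k t (p : 'I_m * 'I_d) : R :=
  (\sum_(p.1 * b k <= l < p.1.+1 * b k) V p.2 (Z l t)) / (Num.sqrt 2 * scale R b k).

Definition blockYt (e : R) k t (p : 'I_m * 'I_d) : R :=
  (\sum_(p.1 * b k <= l < p.1.+1 * b k) V p.2 (Z l t) * (1 - above h (e * tau R b k) (Z l t))) /
  (Num.sqrt 2 * scale R b k).

(** The linear form applied to a step of block [i] when the block sums are paired with the direction
    [th]; it is 0 for indices outside the [m] blocks. *)
Definition rowsum (th : 'I_m * 'I_d -> R) (i : nat) (z : 'rV[R]_n) : R :=
  if insub i is Some i' then \sum_c th (i', c) * V c z else 0.

Lemma rowsumE th (i : 'I_m) z : rowsum th i z = \sum_c th (i, c) * V c z.
Proof. by rewrite /rowsum valK. Qed.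

Lemma measurable_rowsum th i : mB (rowsum th i).
Proof.
rewrite /rowsum; case: insubP => [i' _ _|_]; last exact: measurable_cst.
by apply: measurable_sum => c; exact: measurable_funM.
Qed.

Lemma rowsum_le th i C z : (forall i, \sum_c `|th (i, c)| <= C) -> 0 <= C -> `|rowsum th i z| <= C * h z.
Proof.
move=> thC C0; rewrite /rowsum; case: insubP => [i' _ _|_]; last by rewrite normr0 mulr_ge0.
apply: le_trans (ler_norm_sum _ _ _) _; apply: le_trans (_ : (\sum_c `|th (i', c)|) * h z <= _).
  by rewrite mulr_suml; apply: ler_sum => c _; rewrite normrM ler_wpM2l.
exact: ler_wpM2r.
Qed.

Lemma integrable_VZ c : P.-integrable setT (EFin \o (fun t => V c (Z 0%N t))).
Proof.
apply: (@integrable_le _ _ _ _ _ (fun t => 1 + h (Z 0%N t) ^+ 2)).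
- exact: (measurable_gZ mZ 0%N (mV c)).
- move=> t; apply: le_trans (Vh _ _) _; have := sqr_ge0 (h (Z 0%N t) - 1); have := h0 (Z 0%N t); nra.
- exact: (integrableD measurableT (integrable_cstR P 1) ih2).
Qed.

Lemma Ex_rowsum th i : Ex (fun t => rowsum th i (Z 0%N t)) = 0.
Proof.
rewrite /rowsum; case: insubP => [i' _ _|_]; last by rewrite Ex_cst.
suff H (r : seq 'I_d) : Ex (fun t => \sum_(c <- r) th (i', c) * V c (Z 0%N t)) = 0 /\
    P.-integrable setT (EFin \o (fun t => \sum_(c <- r) th (i', c) * V c (Z 0%N t))).
  by case: (H (index_enum 'I_d)).
elim: r => [|c r [IH1 IH2]].
  under eq_Rintegral do rewrite big_nil.
  split; first exact: Ex_cst.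
  have -> : (fun t : T => \sum_(c <- [::]) th (i', c) * V c (Z 0%N t)) = fun=> 0 by apply/funext => t; rewrite big_nil.
  exact: integrable_cstR.
have e : (fun t => \sum_(j <- c :: r) th (i', j) * V j (Z 0%N t)) =
   (fun t => th (i', c) * V c (Z 0%N t) + \sum_(j <- r) th (i', j) * V j (Z 0%N t)).
  by apply/funext => t; rewrite big_cons.
have i1 : P.-integrable setT (EFin \o (fun t => th (i', c) * V c (Z 0%N t))).
  exact: (integrableZl measurableT _ (integrable_VZ c)).
rewrite e; split; last exact: (integrableD measurableT i1 IH2).
rewrite RintegralD//; rewrite RintegralZl//; last exact: integrable_VZ.
by rewrite IH1 EV mulr0 addr0.
Qed.

Lemma Ex_rowsum2 th (i : 'I_m) : Ex (fun t => rowsum th i (Z 0%N t) ^+ 2) = \sum_c th (i, c) ^+ 2.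
Proof. by under eq_Rintegral do rewrite rowsumE; exact: EVV. Qed.

(** Writes the exponent as a sum over single steps, because [2 * logk / (sqrt 2 * scale)] is
    [sqrt 2 / tau]; independence then factors the exponential moment. *)
Lemma block_pairing e k t (th : 'I_m * 'I_d -> R) :
  2 * logk R k * (\sum_p th p * blockYt e k t p) =
  \sum_(0 <= l < m * b k) tilt h b e k (rowsum th (l %/ b k)%N) (Z l t).
Proof.
have l0 := logk_gt0 R k; have t0 := tau_gt0 k gb; have s0 := scale_gt0 gb k.
have r2 : Num.sqrt 2 ^+ 2 = 2 :> R by rewrite sqr_sqrtr.
have r0 : 0 < Num.sqrt 2 :> R by rewrite sqrtr_gt0.
have bk : (0 < b k)%N by case: gb.
have cE : 2 * logk R k / (Num.sqrt 2 * scale R b k) = Num.sqrt 2 / tau R b k.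
  rewrite /scale -tau_logk -[X in X * logk _ _]r2; field; rewrite !gt_eqF//.
rewrite (@big_div_blocks _ _ _ m (b k) (fun i l => tilt h b e k (rowsum th i) (Z l t)))//.
rewrite sum_pairs mulr_sumr; apply: eq_bigr => i _.
rewrite mulr_sumr (eq_bigr (fun c => \sum_(i * b k <= l < i.+1 * b k)
   Num.sqrt 2 / tau R b k * (th (i, c) * V c (Z l t) * (1 - above h (e * tau R b k) (Z l t))))); last first.
  move=> c _; rewrite /blockYt /= -cE.
  have -> : forall x, 2 * logk R k * (th (i, c) * (x / (Num.sqrt 2 * scale R b k))) =
    2 * logk R k / (Num.sqrt 2 * scale R b k) * th (i, c) * x by move=> x; ring.
  by rewrite mulr_sumr; apply: eq_bigr => l _; ring.
rewrite exchange_big; apply: eq_bigr => l _; rewrite /tilt rowsumE mulr_suml mulr_sumr.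
by apply: eq_bigr.
Qed.

(** Each of the [b k] steps of block [i] contributes the squared norm of row [i] divided by
    [tau ^ 2], and [b k / tau ^ 2] is [logk k]. The error is split as [e / m] per block. *)
Lemma mgf_blocks (C e : R) : 0 < C -> 0 < e -> exists2 eps0, 0 < eps0 & forall eps, 0 < eps -> eps <= eps0 ->
  forall th : 'I_m * 'I_d -> R, (forall i, \sum_c `|th (i, c)| <= C) ->
  let q := \sum_p th p ^+ 2 in
  \forall k \near \oo, exists2 phi,
    (\int[P]_t (expR (2 * logk R k * \sum_p th p * blockYt eps k t p))%:E = phi%:E)%E &
    expR (logk R k * (q - e)) <= phi <= expR (logk R k * (q + e)).
Proof.
move=> C0 e0; have mR : 0 < m%:R :> R by rewrite ltr0n.
have em : 0 < e / m%:R by rewrite divr_gt0.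
have [eps0 eps00 H] := tilt_mgf mZ mh h0 ih2 gb C0 em.
exists eps0 => // eps ep epl th thC q.
have {}H : forall i : 'I_m, \forall k \near \oo, exists2 phi : R,
    (\int[P]_t (expR (tilt h b eps k (rowsum th i) (Z 0%N t)))%:E = phi%:E)%E &
    expR ((\int[P]_t (fun t => rowsum th i (Z 0%N t) ^+ 2) t - e / m%:R) / tau R b k ^+ 2) <= phi <=
    expR ((\int[P]_t (fun t => rowsum th i (Z 0%N t) ^+ 2) t + e / m%:R) / tau R b k ^+ 2).
  by move=> i; exact: (H eps ep epl (rowsum th i) (measurable_rowsum th i)
    (fun z => rowsum_le i z thC (ltW C0)) (Ex_rowsum th i)).
have HH := filter_forall eventually_filter H; apply: filterS HH => k Hk.
have /choice[phi hphi] : forall i : 'I_m, exists x,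
    (\int[P]_t (expR (tilt h b eps k (rowsum th i) (Z 0%N t)))%:E = x%:E)%E /\
    expR ((\sum_c th (i, c) ^+ 2 - e / m%:R) / tau R b k ^+ 2) <= x <=
    expR ((\sum_c th (i, c) ^+ 2 + e / m%:R) / tau R b k ^+ 2).
  by move=> i; have [x h1 h2] := Hk i; exists x; rewrite -Ex_rowsum2.
have bk : (0 < b k)%N by case: gb.
have bR : 0 < (b k)%:R :> R by rewrite ltr0n.
have l0 := logk_gt0 R k.
exists (\prod_(i < m) phi i ^+ b k).
  under eq_integral do rewrite block_pairing.
  rewrite (@mgf_sum _ _ _ P _ _ mZ indZ idZ 0 (m * b k)
    (fun l => tilt h b eps k (rowsum th (l %/ b k)%N)))//; last first.
    by move=> l; apply: measurable_tilt => //; exact: measurable_rowsum.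
  pose psi i := if insub i is Some i' then phi i' else 0.
  rewrite (eq_big_nat _ _ (F2 := fun l => (psi (l %/ b k)%N)%:E)); last first.
    move=> l /andP[_ lm]; have lk : (l %/ b k < m)%N by rewrite ltn_divLR.
    by rewrite /psi insubT/=; case: (hphi (Ordinal lk)).
  rewrite prodEFin (@big_div_blocks _ _ _ m (b k) (fun i l => psi i))//; congr EFin; apply: eq_bigr => i _.
  by rewrite prodr_const_nat -mulnBl subSnn mul1n /psi valK.
have bt : (b k)%:R / tau R b k ^+ 2 = logk R k by rewrite tau_sqr; field; rewrite !gt_eqF.
have qE : q = \sum_i \sum_c th (i, c) ^+ 2 := sum_pairs _.
have phi0 i : 0 <= phi i by have [_ /andP[+ _]] := hphi i; apply: le_trans; exact: expR_ge0.
have sumE (s : R) : expR (logk R k * (q + s)) = \prod_(i < m) expR ((\sum_c th (i, c) ^+ 2 + s / m%:R) / tau R b k ^+ 2) ^+ b k.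
  under eq_bigr do rewrite -expRM_natl.
  rewrite -expR_sum; congr expR; rewrite -mulr_sumr -mulr_suml big_split /= -qE sumr_const card_ord.
  have -> : (s / m%:R) *+ m = s by rewrite -[_ *+ m]mulr_natr divfK// gt_eqF.
  by rewrite [RHS]mulrCA bt mulrC.
apply/andP; split.
  rewrite sumE; apply: ler_prod => i _; rewrite exprn_ge0 ?expR_ge0//=.
  by have [_ /andP[h1 _]] := hphi i; rewrite lerXn2r ?nnegrE ?expR_ge0// mulNr.
rewrite sumE; apply: ler_prod => i _; rewrite exprn_ge0//=.
by have [_ /andP[_ h1]] := hphi i; rewrite lerXn2r ?nnegrE ?expR_ge0.
Qed.

Lemma blockYt_near (e dl : R) : 0 < e -> 0 < dl ->
  {ae P, forall t, \forall k \near \oo, forall p, `|blockY k t p - blockYt e k t p| <= dl}.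
Proof.
move=> e0 dl0; have := remainder_negligible mZ idZ mh h0 ih2 gb m e0.
apply: filterS => t /(_ _ dl0); apply: filterS => k rk [i c]; rewrite /blockY /blockYt /=.
have s0 := scale_gt0 gb k; have r1 : 1 <= Num.sqrt 2 :> R by rewrite -[X in X <= _]sqrtr1 ler_sqrt//; lra.
rewrite -mulrBl normrM [X in _ * X]ger0_norm ?invr_ge0 ?mulr_ge0 ?(ltW s0)// ler_pdivrMr; last first.
  by rewrite mulr_gt0//; lra.
have a01 l := above01 h (e * tau R b k) (Z l t).
have ha0 l : 0 <= h (Z l t) * above h (e * tau R b k) (Z l t) by rewrite mulr_ge0//; case/andP: (a01 l).
apply: le_trans (_ : \sum_(i * b k <= l < i.+1 * b k) h (Z l t) * above h (e * tau R b k) (Z l t) <= _).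
  rewrite -sumrB; apply: le_trans (ler_norm_sum _ _ _) _; apply: ler_sum => l _.
  have -> : V c (Z l t) - V c (Z l t) * (1 - above h (e * tau R b k) (Z l t)) = V c (Z l t) * above h (e * tau R b k) (Z l t) by ring.
  have /andP[a0 a1] := a01 l; rewrite normrM [X in _ * X]ger0_norm//; exact: ler_wpM2r.
apply: le_trans (_ : \sum_(0 <= l < m * b k) h (Z l t) * above h (e * tau R b k) (Z l t) <= _).
  have i1 : (i * b k <= i.+1 * b k)%N by rewrite leq_mul2r leqnSn orbT.
  have i2 : (i.+1 * b k <= m * b k)%N by rewrite leq_mul2r ltn_ord orbT.
  rewrite (big_cat_nat (n := (i * b k)%N) (p := (m * b k)%N))//=; last exact: leq_trans i2.
  rewrite (big_cat_nat (m := (i * b k)%N) (n := (i.+1 * b k)%N) (p := (m * b k)%N))//=.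
  by rewrite addrCA lerDl addr_ge0// sumr_ge0.
apply: le_trans rk _; apply: ler_wpM2l; first exact: ltW.
by rewrite ler_peMl// ltW.
Qed.

Lemma measurable_blockYt e k p : measurable_fun setT (fun t => blockYt e k t p).
Proof.
apply: measurable_funM => //; apply: measurable_sum => l.
apply: measurable_funM; first exact: (measurable_gZ mZ l (mV p.2)).
apply: measurable_funB => //; exact: (measurable_gZ mZ l (measurable_above mh _)).
Qed.

Lemma chernoff k (e s phi : R) (th : 'I_m * 'I_d -> R) :
  (\int[P]_t (expR (2 * logk R k * \sum_p th p * blockYt e k t p))%:E = phi%:E)%E ->
  (P [set t | (s <= \sum_p th p * blockYt e k t p)%R] <= (phi * expR (- (2 * logk R k * s)))%:E)%E.
Proof.
move=> phiE; set A := [set t | _].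
have mX : measurable_fun setT (fun t => \sum_p th p * blockYt e k t p).
  by apply: measurable_sum => p; apply: measurable_funM => //; exact: measurable_blockYt.
have mA : measurable A.
  have -> : A = (fun t => \sum_p th p * blockYt e k t p) @^-1` `[s, +oo[%classic.
    by apply/seteqP; split => t /=; rewrite in_itv/= andbT.
  by rewrite -[X in measurable X]setTI; apply: mX => //; exact: measurable_itv.
rewrite expRN EFinM -phiE -lee_pdivrMr ?invr_gt0 ?expR_gt0// invrK.
have -> : (P A * (expR (2 * logk R k * s))%:E = \int[P]_t ((\1_A t)%:E * (expR (2 * logk R k * s))%:E))%E.
  rewrite ge0_integralZr ?lee_fin ?expR_ge0//; last by apply/measurable_EFinP; exact: measurable_indic.
  by rewrite integral_indic ?setIT.
apply: ge0_le_integral => //.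
- by apply/measurable_EFinP; apply: measurable_funM => //; exact: measurable_indic.
- by apply/measurable_EFinP; apply: measurableT_comp => //; exact: measurable_funM.
move=> t _; rewrite -EFinM lee_fin indicE; case: (boolP (t \in A)) => [/set_mem At|_]; last by rewrite mul0r expR_ge0.
by rewrite mul1r ler_expR ler_pM2l// mulr_gt0// logk_gt0.
Qed.

(** For a direction of the net, Chernoff at level [1 + a / 2] gives the exponent [(1 + a / 4) - 2 *
    (1 + a / 2) = - (1 + a * (3 / 4))], which is summable. A truncated vector outside the ball of
    radius [1 + a] would exceed this level in some direction of the net. *)
Lemma block_energy_upper (dl : R) : 0 < dl -> dl <= 1 ->
  {ae P, forall t, \forall k \near \oo, \sum_p blockY k t p ^+ 2 <= 1 + dl}.
Proof.
move=> dl0 dl1; pose a := dl / 8; have a0 : 0 < a by rewrite divr_gt0.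
have al : a <= 8^-1 by rewrite /a; lra.
set D := #|{: 'I_m * 'I_d}|.
pose N := (Num.trunc (2 * (1 + a) * D%:R / a)).+1.
have NR : 0 < N%:R :> R by rewrite ltr0n.
have DN : (1 + a) * (D%:R / N%:R) <= a / 2.
  have x0 : 0 <= 2 * (1 + a) * D%:R / a by rewrite divr_ge0 ?(ltW a0)// !mulr_ge0// addr_ge0// ltW.
  have /andP[_ /ltW] := truncn_itv x0; rewrite -/N ler_pdivrMr// => hN; rewrite [X in X <= _]mulrA ler_pdivrMr//; lra.
have DN1 : D%:R <= N%:R :> R.
  have q0 : 0 <= D%:R / N%:R :> R by rewrite divr_ge0.
  have : D%:R / N%:R <= 1 :> R by move: q0 DN; move: (D%:R / N%:R) => q; nra.
  by rewrite ler_pdivrMr// mul1r.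
pose s := 1 + a / 2.
have e0 : 0 < a / 4 by rewrite divr_gt0.
pose C : R := D%:R + 1; have C0 : 0 < C by rewrite ltr_wpDl.
have [eps eps0 /(_ eps eps0 (lexx _)) mgf] := mgf_blocks C0 e0.
have mX (f : {ffun 'I_m * 'I_d -> 'I_(N.*2.+1)}) k :
    measurable_fun setT (fun t => \sum_p netpt R f p * blockYt eps k t p).
  by apply: measurable_sum => p; apply: measurable_funM => //; exact: measurable_blockYt.
have aeN : {ae P, forall t, forall f : {ffun 'I_m * 'I_d -> 'I_(N.*2.+1)}, \sum_p netpt R f p ^+ 2 <= 1 ->
    \forall k \near \oo, \sum_p netpt R f p * blockYt eps k t p < s}.
  apply: filter_forall => f; have [f1|f1] := boolP (\sum_p netpt R f p ^+ 2 <= 1); last first.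
    by apply/nearW.
  pose A k := [set t | (s <= \sum_p netpt R f p * blockYt eps k t p)%R].
  have mA k : measurable (A k).
    have -> : A k = (fun t => \sum_p netpt R f p * blockYt eps k t p) @^-1` `[s, +oo[%classic.
      by apply/seteqP; split => t /=; rewrite in_itv/= andbT.
    by rewrite -[X in measurable X]setTI; apply: mX => //; exact: measurable_itv.
  have fC i : \sum_c `|netpt R f (i, c)| <= C.
    apply: le_trans (_ : \sum_p `|netpt R f p| <= _).
      by rewrite sum_pairs (bigD1 i)//= lerDl !sumr_ge0// => j _; rewrite sumr_ge0.
    apply: le_trans (_ : \sum_(p : 'I_m * 'I_d) 1 <= _); last by rewrite sumr_const /C lerDl.
    apply: ler_sum => p _; rewrite -(ler_pXn2r (n := 2))// ?nnegrE// expr1n real_normK ?num_real//.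
    by apply: le_trans f1; rewrite (bigD1 p)//= lerDl sumr_ge0// => j _; rewrite sqr_ge0.
  have a40 : 0 < a * (3 / 4) by lra.
  have Ab : \forall k \near \oo, (P (A k) <= (1 * expR (- (1 + a * (3 / 4)) * logk R k))%:E)%E.
    have := mgf _ fC; apply: filterS => k [phi ephi /andP[_ phi1]].
    apply: le_trans (chernoff s ephi) _; rewrite lee_fin mul1r.
    apply: le_trans (ler_wpM2r (expR_ge0 _) phi1) _; rewrite -expRD ler_expR.
    have := logk_gt0 R k; move: (logk R k) => L L0; rewrite /s mulNr.
    have : L * (\sum_p netpt R f p ^+ 2 + a / 4) <= L * (1 + a / 4) by apply: ler_wpM2l; [exact: ltW|lra].
    lra.
  have := borel_cantelli_logk mA a40 ler01 Ab; apply: filterS => t H _; apply: filterS H => k /negP.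
  by rewrite -ltNge.
pose dl2 := a / (D%:R + 1); have dl20 : 0 < dl2 by rewrite divr_gt0// ltr_wpDl.
apply: (ae_and aeN (blockYt_near eps0 dl20)) => t ht1 ht2.
have : \forall k \near \oo, forall f : {ffun 'I_m * 'I_d -> 'I_(N.*2.+1)}, \sum_p netpt R f p ^+ 2 <= 1 ->
    \sum_p netpt R f p * blockYt eps k t p < s.
  apply: filter_forall => f; have [f1|f1] := boolP (\sum_p netpt R f p ^+ 2 <= 1); last by apply: nearW.
  by apply: filterS (ht1 f f1).
apply: filterS2 ht2 => k near12 small.
have Yt1 : \sum_p blockYt eps k t p ^+ 2 <= (1 + a) ^+ 2.
  rewrite leNgt; apply/negP => big; have a10 : 0 < 1 + a by lra.
  have N0 : (0 < N)%N by [].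
  have [f [f1 f2]] := net_detects N0 a10 DN1 big.
  have := small f f1; rewrite ltNge => /negP; apply; apply: le_trans f2.
  by rewrite /s mulrBr mulr1; move: DN; rewrite -/D; lra.
(* Young's inequality for the passage from truncated to actual block sums; [dl2] is small enough for
   the factor [1 + a^-1] to be harmless. *)
have sqb (y z : R) : `|y - z| <= dl2 -> y ^+ 2 <= (1 + a) * z ^+ 2 + (1 + a^-1) * dl2 ^+ 2.
  move=> yz; have := sqr_ge0 (a * z - (y - z)).
  have yz2 : (y - z) ^+ 2 <= dl2 ^+ 2 by rewrite -real_normK ?num_real// lerXn2r// nnegrE ltW.
  have : (1 + a^-1) * (y - z) ^+ 2 <= (1 + a^-1) * dl2 ^+ 2.
    by apply: ler_wpM2l => //; rewrite addr_ge0// invr_ge0 ltW.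
  move=> h1 h2; apply: le_trans (_ : (1 + a) * z ^+ 2 + (1 + a^-1) * (y - z) ^+ 2 <= _); last by lra.
  have : 0 <= a^-1 * (a * z - (y - z)) ^+ 2 by apply: mulr_ge0 (sqr_ge0 _); rewrite invr_ge0 ltW.
  have -> : a^-1 * (a * z - (y - z)) ^+ 2 = a * z ^+ 2 - 2 * z * (y - z) + a^-1 * (y - z) ^+ 2.
    by field; rewrite gt_eqF.
  by move: (a^-1) => a'; nra.
apply: le_trans (_ : \sum_p ((1 + a) * blockYt eps k t p ^+ 2 + (1 + a^-1) * dl2 ^+ 2) <= _).
  by apply: ler_sum => p _; exact: sqb.
rewrite big_split /= -mulr_sumr sumr_const -/D -[_ *+ D]mulr_natl.
have b1 : (1 + a) * \sum_p blockYt eps k t p ^+ 2 <= (1 + a) * (1 + a) ^+ 2 by apply: ler_wpM2l => //; lra.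
have b2 : D%:R * ((1 + a^-1) * dl2 ^+ 2) <= (1 + a) * a.
  have -> : D%:R * ((1 + a^-1) * dl2 ^+ 2) = (1 + a) * a * (D%:R / (D%:R + 1) ^+ 2).
    rewrite /dl2; field; rewrite gt_eqF//= gt_eqF//; exact: C0.
  rewrite -[X in _ <= X]mulr1; apply: ler_wpM2l; first by rewrite mulr_ge0//; lra.
  rewrite ler_pdivrMr ?mul1r ?exprn_gt0//.
  have : 0 <= D%:R :> R by []. 
  by move: (D%:R) => x; nra.
apply: le_trans (lerD b1 b2) _; have : dl = 8 * a by rewrite /a; lra.
by move=> ->; nra.
Qed.

End BlockFluctuations.

(** * Lower bound: prescribed block sums recur infinitely often *)

Section BlockHits.
Variables (R : realType) (dT : measure_display) (T : measurableType dT) (P : probability T R).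
Variables (n : nat) (Z : nat -> T -> 'rV[R]_n).
Hypothesis mZ : forall i B, rv_borel B -> measurable (Z i @^-1` B).
Hypothesis indZ : forall (F : seq nat) (B : nat -> set 'rV[R]_n), uniq F -> (forall i, rv_borel (B i)) ->
  P (\bigcap_(i in [set` F]) (Z i @^-1` B i)) = \big[*%E/1%E]_(i <- F) P (Z i @^-1` B i).
Hypothesis idZ : forall i B, rv_borel B -> P (Z i @^-1` B) = P (Z 0%N @^-1` B).
Local Notation mB g := (measurable_fun (setT : set (borelT R n)) g).
Local Notation "'Ex' f" := (\int[P]_t f t) (at level 10, f at next level).

(** By independence, the probability of missing all events from [K] to [K + N] is at most the
    exponential of [- c] times a piece of the harmonic series, bounded through the increments of
    [logk]. *)
Lemma borel_cantelli_windows (b : nat -> nat) (E : nat -> set T) (c : R) : {homo b : j k / (j <= k)%N} ->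
  (forall k, measurable (E k : set (windowT Z (b k) (b k.+1)))) -> 0 < c ->
  (\forall k \near \oo, ((c / k.+2%:R)%:E <= P (E k))%E) ->
  {ae P, forall t, forall K, exists2 k, (K <= k)%N & E k t}.
Proof.
move=> bnd mE c0 [K0 _ hK0]; apply/ae_foralln => K1; pose K := maxn K0 K1.
pose F N := [set t | forall j, (j < N)%N -> ~ E (K + j)%N t].
have mF N : measurable (F N : set (windowT Z 0 (b (K + N)%N))).
  have -> : F N = \bigcap_(j in [set j | (j < N)%N]) ~` E (K + j)%N by [].
  apply: bigcap_measurableType => j /= jN; apply: measurableC.
  by apply: windowS (mE (K + j)%N); rewrite // bnd// -addnS leq_add2l.
have PF N : (P (F N) <= (expR (- (c * (logk R (K + N) - logk R K))))%:E)%E.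
  elim: N => [|N IH]; first by rewrite addn0 subrr mulr0 oppr0 expR0; exact: probability_le1 (window_measurable mZ (mF 0%N)).
  have -> : F N.+1 = F N `&` ~` E (K + N)%N.
    apply/seteqP; split => [t h|t [h1 h2] j].
      by split => [j jN|]; apply: h => //; exact: ltnW.
    by rewrite ltnS leq_eqVlt => /predU1P[->//|]; exact: h1.
  have mEN : measurable (E (K + N)%N) := window_measurable mZ (mE _).
  have mCE : measurable ((~` E (K + N)%N) : set (windowT Z (b (K + N)%N) (b (K + N).+1))) by exact: measurableC.
  rewrite (window_indep mZ indZ (leq0n _) (bnd _ _ (leqnSn _)) (mF N) mCE) probability_setC//.
  have PEf : P (E (K + N)%N) \is a fin_num by exact: fin_num_measure.
  have PE1 : (1 - P (E (K + N)%N) <= (expR (- (c / (K + N).+2%:R)))%:E)%E.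
    have := hK0 (K + N)%N (leq_trans (leq_maxl _ _) (leq_addr _ _)).
    rewrite -(fineK PEf) -EFinB !lee_fin => h1; apply: le_trans (expR_ge1Dx _); by rewrite lerD2l lerN2.
  have PE0 : (0 <= 1 - P (E (K + N)%N))%E by rewrite -(fineK PEf) -EFinB lee_fin subr_ge0 -lee_fin fineK//; exact: probability_le1.
  apply: le_trans (lee_pmul _ PE0 IH PE1) _; first exact: measure_ge0.
  rewrite -EFinM lee_fin -expRD ler_expR addnS.
  have : c * logk R (K + N).+1 <= c * (logk R (K + N) + (K + N).+2%:R^-1).
    by apply: ler_wpM2l; [exact: ltW|exact: logkS].
  move: ((K + N).+2%:R^-1) (logk R (K + N)) (logk R (K + N).+1) (logk R K) => q x y z; lra.
have mFN N : measurable (F N) := window_measurable mZ (mF N).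
have mI : measurable (\bigcap_N F N) by exact: bigcapT_measurable.
apply: (@negligibleS _ _ _ P (\bigcap_N F N)).
  move=> t /= ht N _ j _ EKj; apply: ht; exists (K + j)%N => //.
  by rewrite (leq_trans (leq_maxr K0 K1))// leq_addr.
exists (\bigcap_N F N); split => //; apply/eqP; rewrite eq_le measure_ge0 andbT.
apply/lee_addgt0Pr => e e0; rewrite add0e.
have [N0 _ hN0] := logk_large ((- ln e) / c + logk R K).
have FI : \bigcap_N F N `<=` F N0 by apply: bigcap_inf.
have PI : (P (\bigcap_N F N) <= P (F N0))%E by apply: le_measure; rewrite ?inE.
apply: le_trans PI _.
apply: le_trans (PF N0) _; rewrite lee_fin -[X in _ <= X]lnK ?posrE// ler_expR.
have := hN0 (K + N0)%N (leq_addl _ _); rewrite -lerBrDr ler_pdivrMr// => h; lra.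
Qed.

Variable h : 'rV[R]_n -> R.
Hypotheses (mh : mB h) (h0 : forall z, 0 <= h z).
Hypothesis ih2 : P.-integrable setT (EFin \o (fun t => h (Z 0%N t) ^+ 2)).
Variable b : nat -> nat.
Hypothesis gb : growing R b.
Variables (d : nat) (V : 'I_d -> 'rV[R]_n -> R).
Hypotheses (mV : forall c, mB (V c)) (Vh : forall c z, `|V c z| <= h z).
Hypothesis EV : forall c, Ex (fun t => V c (Z 0%N t)) = 0.
Hypothesis EVV : forall w : 'I_d -> R, Ex (fun t => (\sum_c w c * V c (Z 0%N t)) ^+ 2) = \sum_c w c ^+ 2.
Variable m : nat.
Hypothesis m0 : (0 < m)%N.
Hypothesis bS : forall k, b k.+1 = (m * b k)%N.

(** Block 0 consists of the steps before [b k], which belong to earlier windows; hence the condition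
    on the row. *)
Lemma window_blockYt e k (p : 'I_m * 'I_d) : (0 < p.1)%N ->
  measurable_fun (setT : set (windowT Z (b k) (b k.+1))) (fun t => blockYt Z h b V e k t p).
Proof.
move=> p0; apply: measurable_funM => //.
apply: (window_sum (g := fun _ z => V p.2 z * (1 - above h (e * tau R b k) z))).
  by move=> _; apply: measurable_funM => //; apply: measurable_funB => //; exact: measurable_above.
move=> l /andP[l1 l2]; rewrite bS (leq_trans _ l1)/= ?leq_pmull//; apply: leq_trans l2 _.
by rewrite leq_mul2r ltn_ord orbT.
Qed.

(** Exponential tilting without a change of measure: the moment in direction [th] is split over the
    event [E k] and its complement. With [s] the squared norm of [th], it has rate [s], the
    complement only [s - e' ^ 2], and on [E k] the integrand is at most [c1]; so the probability of
    [E k] is at least [expR (- logk k) / 2], that is, [1 / 2] over [k.+2]. *)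
Lemma block_hits (th : 'I_m * 'I_d -> R) (e : R) : (forall p : 'I_m * 'I_d, (p.1 : nat) = 0%N -> th p = 0) ->
  \sum_p th p ^+ 2 < 1 -> 0 < e ->
  {ae P, forall t, forall K, exists2 k, (K <= k)%N &
     forall p : 'I_m * 'I_d, (0 < p.1)%N -> `|blockY Z b V k t p - th p| < e}.
Proof.
move=> th0 th1 e0; pose s := \sum_p th p ^+ 2; pose S := \sum_p `|th p|; pose g := 1 - s.
have g0 : 0 < g by rewrite /g subr_gt0.
have S0 : 0 <= S by apply: sumr_ge0.
pose e' := Num.min (e / 2) (g / (4 * (S + 1))).
have e'0 : 0 < e' by rewrite lt_min !divr_gt0// mulr_gt0//; lra.
have e'e : e' <= e / 2 by rewrite ge_min lexx.
have e'S : e' * S <= g / 4.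
  apply: le_trans (_ : g / (4 * (S + 1)) * S <= _); first by apply: ler_wpM2r => //; rewrite ge_min lexx orbT.
  rewrite -mulrA ler_pM2l// mulrC ler_pdivrMr ?mulr_gt0//; lra.
(* The first bound makes the tails lose against the main term, the second leaves room below
   [g = 1 - s] for the exponent of the final probability. *)
pose eta := Num.min (e' ^+ 2 / 4) (g / 4).
have eta0 : 0 < eta by rewrite lt_min !divr_gt0 ?exprn_gt0.
have eta1 : eta <= e' ^+ 2 / 4 by rewrite ge_min lexx.
have eta2 : eta <= g / 4 by rewrite ge_min lexx orbT.
have C0 : 0 < S + e' by rewrite ltr_wpDl.
have [eps eps0 /(_ eps eps0 (lexx _)) mgf] := mgf_blocks mZ indZ idZ mh h0 ih2 gb mV Vh EV EVV m0 C0 eta0.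
pose sg (x : bool) : R := (-1) ^+ x.
have sgsg x : sg x * sg x = 1 by rewrite /sg -expr2 sqrr_sign.
(* [th] shifted by [e'] or [- e'] in a single coordinate: such a shift detects a deviation in that
   coordinate with that sign. *)
pose thn (w : ('I_m * 'I_d) * bool) p := th p + (if p == w.1 then sg w.2 * e' else 0).
have row_le (f : 'I_m * 'I_d -> R) (i : 'I_m) : \sum_c `|f (i, c)| <= \sum_p `|f p|.
  by rewrite sum_pairs (bigD1 i)//= lerDl !sumr_ge0// => j _; rewrite sumr_ge0.
have thC i : \sum_c `|th (i, c)| <= S + e' by apply: le_trans (row_le th i) _; rewrite lerDl ltW.
have thnC w i : \sum_c `|thn w (i, c)| <= S + e'.
  apply: le_trans (row_le (thn w) i) _.
  apply: le_trans (_ : \sum_p (`|th p| + (if p == w.1 then e' else 0)) <= _).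
    apply: ler_sum => p _; apply: le_trans (ler_normD _ _) _; rewrite lerD2l.
    by case: eqP => _; rewrite ?normr0// normrM normr_sign mul1r gtr0_norm.
  by rewrite big_split /= -big_mkcond /= big_pred1_eq.
have thn2 w : \sum_p thn w p ^+ 2 = s + 2 * sg w.2 * e' * th w.1 + e' ^+ 2.
  have -> : \sum_p thn w p ^+ 2 =
     \sum_p (th p ^+ 2 + (if p == w.1 then 2 * sg w.2 * e' * th w.1 + e' ^+ 2 else 0)).
    apply: eq_bigr => p _; rewrite /thn; case: eqP => [->|_]; last by rewrite !addr0.
    have -> : (th w.1 + sg w.2 * e') ^+ 2 = th w.1 ^+ 2 + (2 * sg w.2 * e' * th w.1 + (sg w.2 * sg w.2) * e' ^+ 2) by ring.
    by rewrite sgsg mul1r.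
  by rewrite big_split /= -big_mkcond /= big_pred1_eq addrA.
pose E k := [set t | forall p : 'I_m * 'I_d, (0 < p.1)%N -> `|blockYt Z h b V eps k t p - th p| < e'].
have mE k : measurable (E k : set (windowT Z (b k) (b k.+1))).
  have -> : E k = \bigcap_(p in [set p : 'I_m * 'I_d | (0 < p.1)%N]) [set t | `|blockYt Z h b V eps k t p - th p| < e'] by [].
  apply: fin_bigcap_measurable; first exact: finite_finset.
  move=> p p0; have mf : measurable_fun (setT : set (windowT Z (b k) (b k.+1))) (fun t => `|blockYt Z h b V eps k t p - th p|).
    by apply: measurableT_comp => //; apply: measurable_funB => //; exact: window_blockYt.
  have -> : [set t | `|blockYt Z h b V eps k t p - th p| < e'] = (fun t => `|blockYt Z h b V eps k t p - th p|) @^-1` `]-oo, e'[%classic.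
    by apply/seteqP; split => t /=; rewrite in_itv.
  by rewrite -[X in measurable X]setTI; apply: mf => //; exact: measurable_itv.
have bnd : {homo b : j k / (j <= k)%N}.
  by apply: homo_leq => [//|? ? ?|k]; [exact: leq_trans|rewrite bS leq_pmull].
pose D := #|{: ('I_m * 'I_d) * bool}|.
have big_e : \forall k \near \oo, 2 * D%:R * expR (- (logk R k * (e' ^+ 2 / 2))) <= 1 :> R.
  have := logk_large (ln (2 * D%:R + 1) * (2 / e' ^+ 2)); apply: filterS => k hk.
  have D1 : 0 < 2 * D%:R + 1 :> R by rewrite ltr_wpDl// mulr_ge0.
  have : ln (2 * D%:R + 1) <= logk R k * (e' ^+ 2 / 2).
    have -> : ln (2 * D%:R + 1) = ln (2 * D%:R + 1) * (2 / e' ^+ 2) * (e' ^+ 2 / 2).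
      by field; rewrite gt_eqF.
    by apply: ler_wpM2r => //; rewrite divr_ge0// sqr_ge0.
  rewrite -ler_expR lnK ?posrE// expRN => h1; have h2 := expR_gt0 (logk R k * (e' ^+ 2 / 2)).
  rewrite ler_pdivrMr// mul1r; apply: le_trans h1; lra.
have lowE : \forall k \near \oo, (((2^-1) / k.+2%:R)%:E <= P (E k))%E.
  have hw : \forall k \near \oo, forall w, exists2 phi,
    (\int[P]_t (expR (2 * logk R k * \sum_p thn w p * blockYt Z h b V eps k t p))%:E = phi%:E)%E &
    expR (logk R k * (\sum_p thn w p ^+ 2 - eta)) <= phi <= expR (logk R k * (\sum_p thn w p ^+ 2 + eta)).
    by apply: filter_forall => w; exact: mgf (thnC w).
  have hth := mgf th thC.
  apply: filterS3 hth hw big_e => k [phi ephi /andP[phi1 _]] hw' be.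
  pose L := logk R k; have L0 : 0 < L := logk_gt0 R k.
  pose X (t : T) (p : 'I_m * 'I_d) := blockYt Z h b V eps k t p.
  have /choice[psi hpsi] : forall w, exists x : R,
    (\int[P]_t (expR (2 * L * \sum_p thn w p * X t p))%:E = x%:E)%E /\
    x <= expR (L * (\sum_p thn w p ^+ 2 + eta)).
    by move=> w; have [x h1 /andP[_ h2]] := hw' w; exists x.
  pose cw (w : ('I_m * 'I_d) * bool) := expR (- (2 * L * (sg w.2 * e' * th w.1 + e' ^+ 2))).
  pose c1 := expR (2 * L * (s + e' * S)).
  (* Off [E k] some coordinate deviates by at least [e'], and the term of the matching shift alone
     dominates. On [E k] the pairing is within [e' * S] of [s]. *)
  have pw t : expR (2 * L * \sum_p th p * X t p) <=
      c1 * \1_(E k) t + \sum_w cw w * expR (2 * L * \sum_p thn w p * X t p).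
    have sum0 : 0 <= \sum_w cw w * expR (2 * L * \sum_p thn w p * X t p).
      by apply: sumr_ge0 => w _; rewrite mulr_ge0 ?expR_ge0.
    have [Ek|nE] := pselect (E k t).
      rewrite indicE mem_set// mulr1; apply: ler_wpDr => //.
      rewrite ler_expR ler_pM2l ?mulr_gt0// mulr_sumr -big_split /=; apply: ler_sum => p _.
      have [p0|p0] := posnP p.1; first by rewrite th0// normr0 mul0r expr0n mulr0 addr0.
      have -> : th p * X t p = th p ^+ 2 + th p * (X t p - th p) by ring.
      rewrite lerD2l; apply: le_trans (ler_norm _) _; rewrite normrM mulrC.
      by apply: ler_wpM2r => //; exact: ltW (Ek p p0).
    have [p] : exists p : 'I_m * 'I_d, e' <= `|X t p - th p|.
      apply: contrapT => hn; apply: nE => p _; rewrite ltNge; apply/negP => hp; apply: hn; by exists p.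
    move=> pe; pose w := (p, X t p - th p < 0).
    have wE : sg w.2 * (X t p - th p) = `|X t p - th p| by rewrite /sg normrEsign.
    rewrite addrC; apply: ler_wpDr; first by rewrite mulr_ge0 ?expR_ge0.
    rewrite (bigD1 w)//=; apply: ler_wpDr; first by apply: sumr_ge0 => ? _; rewrite mulr_ge0 ?expR_ge0.
    have -> : \sum_q thn w q * X t q = (\sum_q th q * X t q) + sg w.2 * e' * X t p.
      have -> : \sum_q thn w q * X t q = \sum_q (th q * X t q + (if q == p then sg w.2 * e' * X t p else 0)).
        by apply: eq_bigr => q _; rewrite /thn mulrDl; case: eqP => [->//|_]; rewrite mul0r.
      by rewrite big_split /= -big_mkcond /= big_pred1_eq.
    rewrite -expRD ler_expR.
    have -> : - (2 * L * (sg w.2 * e' * th w.1 + e' ^+ 2)) + 2 * L * (\sum_q th q * X t q + sg w.2 * e' * X t p) =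
      2 * L * (\sum_q th q * X t q) + 2 * L * (e' * (sg w.2 * (X t p - th p) - e')) by rewrite /=; ring.
    have L2 : 0 < 2 * L by rewrite mulr_gt0.
    by rewrite lerDl wE; apply: mulr_ge0; [exact: ltW|apply: mulr_ge0; [exact: ltW|rewrite subr_ge0]].
  have mEk : measurable (E k) := window_measurable mZ (mE k).
  have mX f : measurable_fun setT (fun t => expR (2 * L * \sum_p f p * X t p)).
    apply: measurableT_comp => //; apply: measurable_funM => //; apply: measurable_sum => p.
    by apply: measurable_funM => //; exact: measurable_blockYt.
  have ineq : (phi%:E <= c1%:E * P (E k) + \sum_w (cw w * psi w)%:E)%E.
    rewrite -ephi; apply: le_trans (_ : (\int[P]_t (c1%:E * (\1_(E k) t)%:E +
        \sum_w (cw w)%:E * (expR (2 * L * \sum_p thn w p * X t p))%:E)) <= _)%E.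
      apply: ge0_le_integral => //.
      - by apply/measurable_EFinP; exact: mX.
      - apply: emeasurable_funD; first by apply: emeasurable_funM => //; apply/measurable_EFinP; exact: measurable_indic.
        apply: emeasurable_sum => w; apply: emeasurable_funM => //; apply/measurable_EFinP; exact: mX.
      move=> t _; rewrite (eq_bigr (fun w => (cw w * expR (2 * L * \sum_p thn w p * X t p))%:E)); last by move=> w _; rewrite EFinM.
      by rewrite sumEFin -EFinM -EFinD lee_fin; exact: pw.
    rewrite ge0_integralD//; last 4 first.
    - by move=> t _; rewrite -EFinM lee_fin mulr_ge0 ?expR_ge0// indicE.
    - by apply: emeasurable_funM => //; apply/measurable_EFinP; exact: measurable_indic.
    - by move=> t _; apply: sume_ge0 => w _; rewrite -EFinM lee_fin mulr_ge0 ?expR_ge0.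
    - by apply: emeasurable_sum => w; apply: emeasurable_funM => //; apply/measurable_EFinP; exact: mX.
    apply: leeD.
      rewrite ge0_integralZl ?lee_fin ?expR_ge0//; last by apply/measurable_EFinP; exact: measurable_indic.
      by rewrite integral_indic ?setIT.
    rewrite ge0_integral_sum//; last 2 first.
    - by move=> w; apply: emeasurable_funM => //; apply/measurable_EFinP; exact: mX.
    - by move=> w t _; rewrite -EFinM lee_fin mulr_ge0 ?expR_ge0.
    apply: lee_sum => w _; rewrite ge0_integralZl ?lee_fin ?expR_ge0//; last by apply/measurable_EFinP; exact: mX.
    by have [-> _] := hpsi w; rewrite EFinM.
  have PEf : P (E k) \is a fin_num by exact: fin_num_measure.
  rewrite -(fineK PEf) in ineq *; move: (fine _) ineq => pE.
  rewrite sumEFin -EFinM -EFinD !lee_fin => ineq.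
  have tails : \sum_w cw w * psi w <= D%:R * expR (L * (s - e' ^+ 2 + eta)).
    apply: le_trans (_ : \sum_(w : ('I_m * 'I_d) * bool) expR (L * (s - e' ^+ 2 + eta)) <= _); last first.
      by rewrite sumr_const mulr_natl.
    apply: ler_sum => w _; have [_ h2] := hpsi w.
    apply: le_trans (ler_wpM2l (expR_ge0 _) h2) _; rewrite -expRD ler_expR thn2 /=.
    by rewrite le_eqVlt; apply/orP; left; apply/eqP; ring.
  have half : D%:R * expR (L * (s - e' ^+ 2 + eta)) <= 2^-1 * expR (L * (s - eta)).
    have : D%:R * expR (L * (s - e' ^+ 2 + eta)) <= D%:R * (expR (L * (s - eta)) * expR (- (L * (e' ^+ 2 / 2)))).
      apply: ler_wpM2l => //; rewrite -expRD ler_expR.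
      apply: le_trans (_ : L * (s - eta - e' ^+ 2 / 2) <= _); last by rewrite [X in X <= _]mulrBr.
      by rewrite ler_pM2l//; lra.
    have : expR (L * (s - eta)) * (2 * D%:R * expR (- (L * (e' ^+ 2 / 2)))) <= expR (L * (s - eta)) * 1.
      by apply: ler_wpM2l => //; exact: expR_ge0.
    lra.
  have cpE : 2^-1 * expR (L * (s - eta)) <= c1 * pE.
    apply: le_trans (_ : phi - 2^-1 * expR (L * (s - eta)) <= _); last by lra.
    by move: phi1; rewrite -/s -/L; lra.
  have c10 : 0 < c1 by exact: expR_gt0.
  have -> : k.+2%:R^-1 = expR (- L) by rewrite expRN /L /logk lnK ?posrE.
  rewrite -(ler_pM2l c10); apply: le_trans cpE; rewrite mulrCA; apply: ler_wpM2l => //.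
  rewrite -expRD ler_expR.
  have -> : 2 * L * (s + e' * S) - L = L * (2 * (s + e' * S) - 1) by ring.
  by rewrite ler_pM2l//; move: g0; rewrite /g in e'S eta2 *; lra.
have c20 : 0 < 2^-1 :> R by [].
apply: (ae_and (borel_cantelli_windows bnd mE c20 lowE)
  (blockYt_near mZ idZ mh h0 ih2 gb Vh m eps0 (divr_gt0 e'0 (ltr0n _ 2)))) => t hit [K0 _ near12] K.
have [k kK Ek] := hit (maxn K K0); exists k; first by rewrite (leq_trans (leq_maxl _ _) kK).
move=> p p0; have h1 := Ek p p0; have := near12 k (leq_trans (leq_maxr _ _) kK) p => h2.
rewrite -[X in X - th p](subrK (blockYt Z h b V eps k t p)) -addrA.
apply: le_lt_trans (ler_normD _ _) _; lra.
Qed.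

End BlockHits.

(** * Assembly *)

Section Limsup.
Variable R : realType.

Lemma limn_esup_eq (u : nat -> \bar R) (l : R) :
  (forall e, 0 < e -> \forall k \near \oo, (u k <= (l + e)%:E)%E) ->
  (forall e, 0 < e -> forall K, exists2 k, (K <= k)%N & ((l - e)%:E <= u k)%E) -> limn_esup u = l%:E.
Proof.
move=> hu hl; rewrite limn_esup_lim (cvg_lim _ (@cvg_esups_inf _ u))//; apply/eqP; rewrite eq_le; apply/andP; split.
  apply/lee_addgt0Pr => e e0; have [K _ hK] := hu e e0.
  apply: (@le_trans _ _ (esups u K)); first by apply: ereal_inf_lbound; exists K.
  by apply: ge_ereal_sup => _ [k kK <-]; rewrite -EFinD; exact: hK.
apply: le_ereal_inf_tmp => _ [K _ <-]; apply/lee_subgt0Pr => e e0; have [k kK lk] := hl e e0 K.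
by apply: le_trans lk _; apply: ereal_sup_ubound; exists k.
Qed.

Lemma pow_near1 p (l e : R) : 0 <= l -> 0 < e -> exists2 eta, 0 < eta <= 1 & (1 + eta) ^+ p * (l + eta) <= l + e.
Proof.
move=> l0 e0; pose c : R := 3 ^+ p; have c0 : 0 < c by rewrite exprn_gt0.
have B x : 0 < x <= 1 -> (1 + x) ^+ p <= 1 + c * x.
  move=> /andP[x0 x1]; rewrite /c; elim: p {c c0} => [|p IH]; first by rewrite !expr0; lra.
  have q0 : 0 < 3 ^+ p :> R by rewrite exprn_gt0.
  have q1 : 1 <= 3 ^+ p :> R by rewrite exprn_ege1//; lra.
  rewrite !exprS; move: IH q0 q1; move: ((1 + x) ^+ p) (3 ^+ p) => y q IH q0 q1.
  apply: le_trans (ler_wpM2l _ IH) _; first by lra.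
  have : q * (x * x) <= q * x by rewrite ler_pM2l// -[X in _ <= X]mulr1 ler_pM2l.
  have : x <= q * x by rewrite ler_peMl// ltW.
  lra.
pose eta := Num.min 1 (e / (1 + c * (l + 1))).
have D0 : 0 < 1 + c * (l + 1) by rewrite addr_gt0// mulr_gt0//; lra.
have t0 : 0 < eta by rewrite lt_min ltr01 divr_gt0.
have t1 : eta <= 1 by rewrite ge_min lexx.
have t2 : eta * (1 + c * (l + 1)) <= e by rewrite -ler_pdivlMr// ge_min lexx orbT.
exists eta; first by rewrite t0.
apply: le_trans (_ : (1 + c * eta) * (l + eta) <= _).
  by apply: ler_wpM2r; [lra|apply: B; rewrite t0].
have : eta * (c * eta) <= eta * (c * 1) by rewrite ler_pM2l// ler_pM2l.
lra.
Qed.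

Lemma ln_mul_le (c r x : R) : 0 < c -> 1 < r -> ln c / (r - 1) <= ln x -> 0 < x -> ln (c * x) <= r * ln x.
Proof.
move=> c0 r1 h x0; rewrite lnM ?posrE//; move: h; rewrite ler_pdivrMr ?subr_gt0// => h; lra.
Qed.

(** With [c] half of [ln rho], [ln (geom rho k)] is eventually at least [c * k]; the constant factor
    inside the outer logarithm disappears in the ratio [r]. *)
Lemma logk_le_lnln (rho r : R) : 1 < rho -> 1 < r ->
  \forall k \near \oo, 0 < ln ((geom rho k)%:R : R) /\ logk R k.+1 <= r * ln (ln (geom rho k)%:R).
Proof.
move=> rho1 r1; pose c := ln rho / 2; have c0 : 0 < c by rewrite divr_gt0// ln_gt0.
have n1 := pow_large 2 rho1.
have n2 := @logk_large R (ln (4 / c) / (r - 1) + ln (2 / c)).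
have n3 : \forall k \near \oo, ln 2 <= c * k%:R.
  exists (Num.trunc (ln 2 / c)).+1 => // k /= hk; rewrite mulrC -ler_pdivrMr//.
  have x0 : 0 <= ln 2 / c :> R by rewrite divr_ge0 ?ln_ge0 ?(ltW c0)//; lra.
  have /andP[_ /ltW h] := truncn_itv x0; apply: le_trans h _; by rewrite ler_nat.
have n4 : \forall k \near \oo, (2 <= k)%N by exists 2%N.
have n12 : \forall k \near \oo, 2 <= rho ^+ k /\ ln (4 / c) / (r - 1) + ln (2 / c) <= logk R k by exact: filterI.
have n34 : \forall k \near \oo, ln 2 <= c * k%:R /\ (2 <= k)%N by exact: filterI.
apply: filterS2 n12 n34 => k [h1 h2] [h3 h4].
have g0 : 0 < (geom rho k)%:R :> R by rewrite ltr0n geom_gt0.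
have lg : c * k%:R <= ln (geom rho k)%:R.
  have /andP[_ hg] := geom_bounds k rho1.
  have : ln (rho ^+ k / 2) <= ln (geom rho k)%:R by rewrite ler_ln ?posrE//; lra.
  apply: le_trans; rewrite lnM ?posrE ?lnV ?posrE ?lnXn ?posrE//; try lra.
  rewrite -[ln rho *+ k]mulr_natr /c in h3 *; lra.
have k0 : 0 < k%:R :> R by rewrite ltr0n (leq_trans _ h4).
have ck : 0 < c * k%:R by rewrite mulr_gt0.
split; first exact: lt_le_trans lg.
apply: le_trans (_ : r * ln (c * k%:R) <= _); last first.
  by rewrite ler_pM2l ?ler_ln ?posrE//; [exact: lt_le_trans lg|lra].
apply: le_trans (_ : ln (4 / c * (c * k%:R)) <= _).
  rewrite mulrA divfK ?gt_eqF// /logk ler_ln ?posrE ?mulr_gt0// -natrM ler_nat.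
  by rewrite -(addn3 k) mulSn leq_add2l leq_pmulr// ltnW.
apply: ln_mul_le => //; first by rewrite divr_gt0.
have : logk R k <= ln (2 / c * (c * k%:R)).
  by rewrite mulrA divfK ?gt_eqF// /logk ler_ln ?posrE ?mulr_gt0// -natrM ler_nat -addn2 mul2n -addnn leq_add2l.
have c2 : 0 < 2 / c by rewrite divr_gt0.
rewrite [in X in X -> _]lnM ?posrE// => h5; lra.
Qed.

Lemma lnln_le_logk m (r : R) : (1 < m)%N -> 1 < r ->
  \forall k \near \oo, ln (ln (m ^ k.+1)%:R) <= r * logk R k.
Proof.
move=> m1 r1; have lm : 0 < ln m%:R :> R by rewrite ln_gt0// ltr1n.
have n1 := @logk_large R (ln (1 + ln m%:R) / (r - 1)); apply: filterS n1 => k h1.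
have m0 : 0 < m%:R :> R by rewrite ltr0n ltnW.
apply: le_trans (_ : ln ((1 + ln m%:R) * k.+2%:R) <= _); last by apply: ln_mul_le => //; lra.
rewrite natrX lnXn// -[ln _ *+ _]mulr_natr ler_ln; [|by rewrite posrE mulr_gt0|by rewrite posrE mulr_gt0//; lra].
have : k.+1%:R <= k.+2%:R :> R by rewrite ler_nat.
move=> h2; apply: ler_pM => //; [exact: ltW|lra].
Qed.

End Limsup.

(** * Whitening of a positive definite matrix *)

Section Whitening.
Variable R : realType.

(** Symmetric block elimination: [E] clears the first row and column, the Schur complement [S] is
    again positive definite, and the pivot is normalized by its square root. *)
Lemma whitening d (A : 'M[R]_d) : A^T = A -> (forall w : 'rV_d, w != 0 -> 0 < (w *m A *m w^T) 0 0) ->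
  exists W : 'M[R]_d, W *m A *m W^T = 1%:M.
Proof.
elim: d A => [|d IH] A sA pA; first by exists 1%:M; apply/matrixP => -[].
pose A1 : 'M[R]_(1 + d) := A; pose a := A 0 0; pose c : 'M[R]_(d, 1) := dlsubmx A1.
have a0 : 0 < a.
  have e0 : delta_mx 0 0 != 0 :> 'rV[R]_d.+1.
    by apply/eqP => /matrixP /(_ 0 0); rewrite !mxE !eqxx /= => /eqP; rewrite oner_eq0.
  by have := pA _ e0; rewrite -rowE mxE (bigD1 0)//= big1 ?addr0 => [|j /negPf j0]; rewrite !mxE ?j0 ?eqxx ?mulr1 ?mulr0.
have AE : A1 = block_mx a%:M c^T c (drsubmx A1).
  rewrite -[LHS]submxK; congr block_mx; last by rewrite trmx_dlsub; congr ursubmx.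
  by rewrite [LHS]mx11_scalar !mxE; congr (A _ _)%:M; apply: val_inj.
pose E : 'M[R]_(1 + d) := block_mx 1%:M 0 (- a^-1 *: c) 1%:M.
pose S := drsubmx A1 - a^-1 *: (c *m c^T).
have EAE : E *m A1 *m E^T = block_mx a%:M 0 0 S.
  rewrite AE /E tr_block_mx !mulmx_block !trmx1 trmx0 !mul1mx !mul0mx !mulmx1 !mulmx0 !addr0.
  have -> : (- a^-1 *: c)^T = - a^-1 *: c^T by rewrite linearZ.
  have aN : a * - a^-1 = -1 by rewrite mulrN mulfV ?gt_eqF.
  rewrite mul_scalar_mx mul_mx_scalar !scalerA aN !scaleN1r !addNr mul0mx add0r.
  by rewrite -scalemxAl scaleNr addrC.
have sS : S^T = S.
  have sA1 : A1^T = A1 by [].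
  have sD : (drsubmx A1)^T = drsubmx A1 by rewrite trmx_drsub sA1.
  by rewrite /S linearB linearZ /= trmx_mul trmxK sD.
have pS (w : 'rV_d) : w != 0 -> 0 < (w *m S *m w^T) 0 0.
  move=> w0; pose v : 'rV[R]_(1 + d) := row_mx 0 w *m E.
  have v0 : v != 0.
    apply: contraNneq w0 => v0; have := congr1 rsubmx v0.
    by rewrite /v /E mul_row_block row_mxKr mul0mx mulmx1 add0r linear0 => ->.
  have := pA _ v0; rewrite -/A1.
  have -> : v *m A1 *m v^T = w *m S *m w^T.
    rewrite /v trmx_mul !mulmxA -(mulmxA _ E) -(mulmxA _ (E *m A1)) EAE.
    rewrite mul_row_block tr_row_mx mul_row_col !mul0mx !mulmx0 !add0r trmx0 mulmx0 add0r.
    by [].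
  by [].
have [W hW] := IH S sS pS.
pose F : 'M[R]_(1 + d) := block_mx (Num.sqrt a)^-1%:M 0 0 W.
have FT : F^T = block_mx (Num.sqrt a)^-1%:M 0 0 W^T by rewrite /F tr_block_mx !trmx0 tr_scalar_mx.
have FF : F *m block_mx a%:M 0 0 S *m F^T = 1%:M.
  rewrite FT /F !mulmx_block ?(mul0mx, mulmx0, addr0, add0r) hW -!scalar_mxM.
  have -> : (Num.sqrt a)^-1 * a * (Num.sqrt a)^-1 = 1.
    rewrite -[X in _ * X * _]sqr_sqrtr ?(ltW a0)//; field; by rewrite gt_eqF// sqrtr_gt0.
  by rewrite -scalar_mx_block.
exists (F *m E); rewrite trmx_mul !mulmxA -(mulmxA _ E) -(mulmxA _ (E *m A1)) EAE.
exact: FF.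
Qed.

(** With [u = w *m A], the form at [u + s *: w] is affine in [s] with slope twice the squared norm
    of [u]; it stays nonnegative for all [s], so [u] is 0. *)
Lemma psd_isotropic d (A : 'M[R]_d) (w : 'rV_d) : A^T = A -> (forall u : 'rV_d, 0 <= (u *m A *m u^T) 0 0) ->
  (w *m A *m w^T) 0 0 = 0 -> w *m A = 0.
Proof.
move=> sA pA wA; pose u := w *m A; pose r := (u *m u^T) 0 0; pose q := (u *m A *m u^T) 0 0.
have H s : 0 <= q + 2 * s * r.
  have := pA (u + s *: w); congr (0 <= _).
  have uw : (u *m A *m w^T) 0 0 = r by rewrite /r {3}/u trmx_mul sA !mulmxA.
  have wu : (w *m A *m u^T) 0 0 = r by [].
  rewrite mulmxDl [(_ + _)^T]linearD /= mulmxDr !mulmxDl [(s *: w)^T]linearZ /= -!scalemxAl -!scalemxAr.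
  have E4 (X Y U V : 'M[R]_1) : (X + s *: Y + (s *: U + s *: (s *: V))) 0 0 =
      X 0 0 + s * Y 0 0 + (s * U 0 0 + s * (s * V 0 0)) by rewrite !mxE.
  by rewrite E4 uw wu wA -/q; ring.
have r0 : r = 0.
  apply/eqP; apply/negPn/negP => rn; have := H (- (q + 1) / (2 * r)).
  have -> : q + 2 * (- (q + 1) / (2 * r)) * r = -1 by field.
  lra.
apply/rowP => i; rewrite -/u [RHS]mxE; apply/eqP; rewrite -sqrf_eq0.
have : \sum_j u 0 j ^+ 2 = 0.
  have tE j : u^T j 0 = u 0 j by rewrite mxE.
  by rewrite -[RHS]r0 /r [RHS]mxE; apply: eq_bigr => j _; rewrite tE expr2.
move=> /eqP; rewrite psumr_eq0 => [|j _]; last exact: sqr_ge0.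
by move=> /allP /(_ i); rewrite mem_index_enum => /(_ isT).
Qed.

End Whitening.

(** * Comparison of the rescaled walk with polylines *)

Section WalkPaths.
Variables (R : realType).

Lemma polytope_perturb n (r : R) : exists2 K : R, 0 <= K &
  forall a b (p : 'I_a.+1 -> 'rV[R]_n) (q : 'I_b.+1 -> 'rV[R]_n) (eta : R),
  (forall j, enorm (q j) <= r) -> 0 <= eta <= 1 -> (forall i, exists j, enorm (p i - q j) <= eta) ->
  (vol (polytope p) <= vol (polytope q) + (K * eta)%:E)%E.
Proof.
have [K K0 hK] := vol_parallel_lip n r; exists K => // a b p q eta qr eta01 /choice[f hf].
apply: le_trans (hK _ _ _ qr eta01); apply: le_vol => x [w [w0 w1 ->]].
exists (\sum_i w i *: q (f i)); first by apply: polytope_comb => // i; exact: polytope_vertex.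
have -> : \sum_i w i *: p i - \sum_i w i *: q (f i) = \sum_i w i *: (p i - q (f i)).
  by rewrite -sumrB; apply: eq_bigr => i _; rewrite scalerBr.
apply: le_trans (enorm_sum _ _) _; rewrite -[X in _ <= X]mul1r -w1 mulr_suml; apply: ler_sum => i _.
by rewrite enormZ ger0_norm// ler_wpM2l.
Qed.

Lemma polytope_subfamily n a b (p : 'I_a -> 'rV[R]_n) (q : 'I_b -> 'rV[R]_n) :
  (forall i, exists j, p i = q j) -> polytope p `<=` polytope q.
Proof.
move=> pq x [w [w0 w1 ->]]; apply: polytope_comb => // i; have [j ->] := pq i; exact: polytope_vertex.
Qed.

Lemma enorm_row_mx_le d a (x : 'rV[R]_d) : enorm (row_mx (const_mx a : 'rV_1) x) <= `|a| + enorm x.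
Proof.
rewrite -(ler_pXn2r (n := 2))// ?nnegrE ?addr_ge0 ?enorm_ge0// enorm_row_mx -[a ^+ 2]real_normK ?num_real//.
have : 0 <= `|a| * enorm x by rewrite mulr_ge0 ?enorm_ge0.
lra.
Qed.

Lemma row_mx_constB d a c (x y : 'rV[R]_d) :
  row_mx (const_mx a : 'rV_1) x - row_mx (const_mx c) y = row_mx (const_mx (a - c)) (x - y).
Proof. by rewrite opp_row_mx add_row_mx; congr row_mx; apply/rowP => i; rewrite !mxE. Qed.

Variable d : nat.
Variables (x : nat -> R) (v : nat -> 'rV[R]_d) (m b : nat) (s : R).
Hypotheses (m0 : (0 < m)%N) (b0 : (0 < b)%N).

(** The standardized walk after [l] steps, with time divided by [m * b] and space by [s]. The drift
    coordinate is [l] plus the fluctuation given by [x]; [v] holds the transversal steps. *)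
Definition walkpt (l : nat) : 'rV[R]_(1 + d) :=
  row_mx (const_mx ((l%:R + \sum_(0 <= i < l) x i) / (m * b)%:R)) (s^-1 *: \sum_(0 <= i < l) v i).

Lemma time_dev (e2 : R) i j : (i < m)%N -> (j <= b)%N ->
  (forall i j, (i < m)%N -> (j <= b)%N -> `|\sum_(i * b <= l < i * b + j) x l| <= e2 * (m * b)%:R) ->
  `|((i * b + j)%:R + \sum_(0 <= l < i * b + j) x l) / (m * b)%:R - (i * b + j)%:R / (m * b)%:R| <= m%:R * e2.
Proof.
move=> im jb hx; have mR : 0 < m%:R :> R by rewrite ltr0n.
have bR : 0 < b%:R :> R by rewrite ltr0n.
have NR : 0 < (m * b)%:R :> R by rewrite ltr0n muln_gt0 m0.
rewrite -mulrBl addrAC subrr add0r; rewrite normrM [X in _ * X]ger0_norm ?invr_ge0 ?(ltW NR)// ler_pdivrMr// -mulrA.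
have e2N : 0 <= e2 * (m * b)%:R by apply: le_trans (hx 0%N 0%N m0 (leq0n _)).
have H k : (k <= m)%N -> `|\sum_(0 <= l < k * b) x l| <= k%:R * (e2 * (m * b)%:R).
  elim: k => [|k IH] km; first by rewrite mul0n big_geq// normr0 mul0r.
  rewrite (big_cat_nat (n := (k * b)%N))//= ?leq_mul2r ?leqnSn ?orbT//.
  apply: le_trans (ler_normD _ _) _; rewrite -natr1 mulrDl mul1r; apply: lerD; first by apply: IH; exact: ltnW.
  by rewrite mulSn addnC; exact: hx.
rewrite (big_cat_nat (n := (i * b)%N))//= ?leq_addr//.
apply: le_trans (ler_normD _ _) _; apply: le_trans (_ : i.+1%:R * (e2 * (m * b)%:R) <= _).
  by rewrite -natr1 mulrDl mul1r; apply: lerD; [apply: H; exact: ltnW|exact: hx].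
by apply: ler_wpM2r => //; rewrite ler_nat.
Qed.

Let y i := s^-1 *: \sum_(0 <= l < i * b) v l.

Let yS i : y i.+1 - y i = s^-1 *: \sum_(i * b <= l < i.+1 * b) v l.
Proof.
rewrite /y (big_cat_nat (n := (i * b)%N) (p := (i.+1 * b)%N))//= ?leq_mul2r ?leqnSn ?orbT//.
by rewrite scalerDr addrAC subrr add0r.
Qed.

(** The point at step [i * b + j] is compared with vertex [i] of the polyline through the block
    ends: [1 / m] for the time inside a block, [m * e2] for the drift fluctuation, [e1] for the
    transversal motion inside a block. *)
Lemma walk_upper (K e1 e2 : R) : 0 <= K ->
  (forall a b (p : 'I_a.+1 -> 'rV[R]_(1 + d)) (q : 'I_b.+1 -> 'rV[R]_(1 + d)) (eta : R),
    (forall j, enorm (q j) <= 3) -> 0 <= eta <= 1 -> (forall i, exists j, enorm (p i - q j) <= eta) ->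
    (vol (polytope p) <= vol (polytope q) + (K * eta)%:E)%E) ->
  m%:R * (\sum_(i < m) enorm (s^-1 *: \sum_(i * b <= l < i.+1 * b) v l) ^+ 2) <= 1 ->
  (forall i j, (i < m)%N -> (j <= b)%N -> `|\sum_(i * b <= l < i * b + j) x l| <= e2 * (m * b)%:R) ->
  (forall i j, (i < m)%N -> (j <= b)%N -> enorm (s^-1 *: \sum_(i * b <= l < i * b + j) v l) <= e1) ->
  m%:R^-1 + m%:R * e2 + e1 <= 1 ->
  (vol (polytope (fun l : 'I_(m * b).+1 => walkpt l)) <= lambdaS R d + (K * (m%:R^-1 + m%:R * e2 + e1))%:E)%E.
Proof.
move=> K0 hK hE hx hv eta1.
have mR : 0 < m%:R :> R by rewrite ltr0n.
have bR : 0 < b%:R :> R by rewrite ltr0n.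
have e10 : 0 <= e1 by apply: le_trans (hv 0%N 0%N m0 (leq0n _)); exact: enorm_ge0.
have NR : 0 < (m * b)%:R :> R by rewrite ltr0n muln_gt0 m0.
have e20 : 0 <= e2.
  by rewrite -(pmulr_lge0 _ NR); apply: le_trans (hx 0%N 0%N m0 (leq0n _)).
have eta0 : 0 <= m%:R^-1 + m%:R * e2 + e1.
  by apply: addr_ge0 => //; apply: addr_ge0; [rewrite invr_ge0|exact: mulr_ge0].
have y0 : y 0%N = 0 by rewrite /y mul0n big_geq// scaler0.
have ge : grid_energy m y <= 1 by rewrite /grid_energy; under eq_bigr do rewrite yS.
have yle i : (i <= m)%N -> enorm (y i) <= 1 by move=> im; exact: (grid_energy_enorm m0 y0 ge im).
apply: le_trans (_ : (vol (polytope (polyline m y)) + (K * (m%:R^-1 + m%:R * e2 + e1))%:E <= _)%E); last first.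
  by rewrite leeD2r// vol_polyline_le.
apply: hK => [i| |l]; [|by rewrite eta0|].
  by apply: le_trans (polyline_enorm _ m0 yle) _; lra.
have [i [j [im jb lE]]] : exists i j, [/\ (i < m)%N, (j <= b)%N & l = (i * b + j)%N :> nat].
  have := ltn_ord l; rewrite ltnS leq_eqVlt => /predU1P[->|lm].
    by exists m.-1, b; rewrite prednK// leqnn -mulSnr prednK.
  exists (l %/ b)%N, (l %% b)%N; split; [by rewrite ltn_divLR|by rewrite ltnW// ltn_mod|exact: divn_eq].
have im1 : (i < m.+1)%N by exact: ltnW.
exists (Ordinal im1); rewrite /walkpt /polyline /= lE row_mx_constB.
apply: le_trans (enorm_row_mx_le _ _) _; apply: lerD.
  rewrite -(subrKA ((i * b + j)%:R / (m * b)%:R)) addrC.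
  apply: le_trans (ler_normD _ _) _; apply: lerD; last exact: time_dev im jb hx.
  have -> : (i * b + j)%:R / (m * b)%:R - i%:R / m%:R = j%:R / (m * b)%:R :> R.
    by rewrite natrD !natrM; field; rewrite !gt_eqF.
  rewrite ger0_norm ?divr_ge0// ler_pdivrMr// natrM mulrA mulVf ?gt_eqF// mul1r.
  by rewrite ler_nat.
rewrite /y (big_cat_nat (n := (i * b)%N) (p := (i * b + j)%N))//= ?leq_addr//.
by rewrite scalerDr addrAC subrr add0r; exact: hv.
Qed.

(** Increments are matched up to [e3] except in the first block, where walk and target are only
    known to be small: [e4] for the walk, and [sqrt (1 / m)] for [z 1], because its energy is at
    most 1. Errors add up over the blocks. *)
Lemma walk_lower (K e2 e3 e4 : R) (z : nat -> 'rV[R]_d) : 0 <= K ->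
  (forall a b (p : 'I_a.+1 -> 'rV[R]_(1 + d)) (q : 'I_b.+1 -> 'rV[R]_(1 + d)) (eta : R),
    (forall j, enorm (q j) <= 3) -> 0 <= eta <= 1 -> (forall i, exists j, enorm (p i - q j) <= eta) ->
    (vol (polytope p) <= vol (polytope q) + (K * eta)%:E)%E) ->
  z 0%N = 0 -> grid_energy m z <= 1 ->
  (forall i j, (i < m)%N -> (j <= b)%N -> `|\sum_(i * b <= l < i * b + j) x l| <= e2 * (m * b)%:R) ->
  (forall i, (0 < i < m)%N -> enorm (s^-1 *: \sum_(i * b <= l < i.+1 * b) v l - (z i.+1 - z i)) <= e3) ->
  0 <= e3 -> enorm (s^-1 *: \sum_(0 <= l < b) v l) <= e4 ->
  m%:R * e2 + (e4 + Num.sqrt (1 / m%:R) + m%:R * e3) <= 1 ->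
  (vol (polytope (polyline m z)) <= vol (polytope (fun l : 'I_(m * b).+1 => walkpt l)) +
     (K * (m%:R * e2 + (e4 + Num.sqrt (1 / m%:R) + m%:R * e3)))%:E)%E.
Proof.
move=> K0 hK z0 ge hx hv e30 hv0 eta1.
have mR : 0 < m%:R :> R by rewrite ltr0n.
have e40 : 0 <= e4 by apply: le_trans hv0; exact: enorm_ge0.
have NR : 0 < (m * b)%:R :> R by rewrite ltr0n muln_gt0 m0.
have e20 : 0 <= e2.
  by rewrite -(pmulr_lge0 _ NR); apply: le_trans (hx 0%N 0%N m0 (leq0n _)).
set eta := _ + _ in eta1 *.
have eta0 : 0 <= eta by rewrite /eta !addr_ge0// ?sqrtr_ge0// mulr_ge0.
have zle i : (i <= m)%N -> enorm (z i) <= 1 by move=> im; exact: (grid_energy_enorm m0 z0 ge im).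
have y0 : y 0%N = 0 by rewrite /y mul0n big_geq// scaler0.
have z1 : enorm (z 1%N) <= Num.sqrt (1 / m%:R).
  rewrite -[enorm _]ger0_norm ?enorm_ge0// -sqrtr_sqr ler_wsqrtr// ler_pdivlMr// mulrC.
  apply: le_trans ge; rewrite /grid_energy ler_pM2l// -(prednK m0) big_ord_recl /= z0 subr0 lerDl.
  by apply: sumr_ge0 => i _; rewrite sqr_ge0.
have dev i : (i <= m)%N -> enorm (y i - z i) <= e4 + Num.sqrt (1 / m%:R) + m%:R * e3.
  have H k : (k < m)%N -> enorm (y k.+1 - z k.+1) <= e4 + Num.sqrt (1 / m%:R) + k%:R * e3.
    elim: k => [|k IH] km.
      rewrite mul0r addr0; apply: le_trans (enorm_triangle _ _) _; rewrite enormN; apply: lerD => //.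
      by rewrite /y mul1n.
    have -> : y k.+2 - z k.+2 = (y k.+2 - y k.+1 - (z k.+2 - z k.+1)) + (y k.+1 - z k.+1).
      by rewrite !opprB !addrA; apply/rowP => q; rewrite !mxE; ring.
    apply: le_trans (enorm_triangle _ _) _; rewrite addrC -natr1 mulrDl [1 * e3]mul1r addrA; apply: lerD.
      by apply: IH; exact: ltnW.
    by rewrite yS; exact: hv.
  case: i => [|i] im; first by rewrite y0 z0 subr0 enorm0 !addr_ge0// ?sqrtr_ge0// mulr_ge0.
  apply: le_trans (H i im) _; rewrite lerD2l; apply: ler_wpM2r => //; by rewrite ler_nat ltnW.
have near i : (i <= m)%N -> enorm (row_mx (const_mx (i%:R / m%:R)) (z i) - walkpt (i * b)) <= eta.
  move=> im; rewrite enormC /walkpt row_mx_constB.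
  apply: le_trans (enorm_row_mx_le _ _) _; apply: lerD; last exact: dev.
  case: i im => [_|i im].
    by rewrite mul0n big_geq// addr0 !mul0r subrr normr0 mulr_ge0.
  have := time_dev im (leqnn b) hx; rewrite addnC -mulSn.
  have -> // : (i.+1 * b)%:R / (m * b)%:R = i.+1%:R / m%:R :> R.
  have bR : b%:R != 0 :> R by rewrite pnatr_eq0 -lt0n.
  by rewrite !natrM; field; rewrite bR gt_eqF.
apply: le_trans (_ : (vol (polytope (fun i : 'I_m.+1 => walkpt (i * b))) + (K * eta)%:E <= _)%E); last first.
  rewrite leeD2r//; apply: le_vol; apply: polytope_subfamily => i.
  have ib : (i * b < (m * b).+1)%N by rewrite ltnS leq_mul2r -ltnS ltn_ord orbT.
  by exists (Ordinal ib).
apply: hK => [i| |i]; [|by rewrite eta0|].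
  have im : (i <= m)%N by rewrite -ltnS.
  rewrite -[X in enorm X](subrK (polyline m z i)); apply: le_trans (enorm_triangle _ _) _.
  by have := near i im; rewrite enormC => h; have := polyline_enorm i m0 zle; move: h; rewrite -/(polyline m z i); lra.
by exists i; apply: near; rewrite -ltnS.
Qed.

End WalkPaths.

(** * Moments of linear statistics of a step *)

Section Moments.
Variables (R : realType) (dT : measure_display) (T : measurableType dT) (P : probability T R).
Local Notation "'Ex' f" := (\int[P]_t f t) (at level 10, f at next level).
Local Notation I f := (P.-integrable setT (EFin \o f)).

Lemma Ex_sum (J : Type) (r : seq J) (f : J -> T -> R) : (forall j, I (f j)) ->
  I (fun t => \sum_(j <- r) f j t) /\ Ex (fun t => \sum_(j <- r) f j t) = \sum_(j <- r) Ex (f j).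
Proof.
move=> fi; elim: r => [|j r [IH1 IH2]].
  have -> : (fun t => \sum_(j <- [::]) f j t) = fun=> 0 by apply/funext => t; rewrite big_nil.
  by rewrite big_nil Ex_cst; split => //; exact: integrable_cstR.
have -> : (fun t => \sum_(i <- j :: r) f i t) = fun t => f j t + \sum_(i <- r) f i t.
  by apply/funext => t; rewrite big_cons.
split; first exact: (integrableD measurableT (fi j) IH1).
by rewrite RintegralD// IH2 big_cons.
Qed.

Lemma Ex_scale (a : R) (f : T -> R) : I f -> I (fun t => a * f t) /\ Ex (fun t => a * f t) = a * Ex f.
Proof. by move=> fi; split; [exact: (integrableZl measurableT _ fi)|exact: RintegralZl]. Qed.

Variables (n : nat) (Z : nat -> T -> 'rV[R]_n).
Hypothesis mZ : forall i B, rv_borel B -> measurable (Z i @^-1` B).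
Local Notation mB g := (measurable_fun (setT : set (borelT R n)) g).

Lemma continuous_mB (g : 'rV[R]_n -> R) : continuous g -> mB g.
Proof.
move=> /continuousP cg; apply: (measurability _ (RGenOpens.measurableE R)) => _ [_ [a [b ->] <-]].
by rewrite setTI; apply: open_rv_borel; exact/cg/interval_open.
Qed.

Lemma mB_coordB (mu : 'rV[R]_n) i : mB (fun z => (z - mu) ord0 i).
Proof. by apply: continuous_mB; exact: continuous_coordB. Qed.

Lemma mB_enormB (mu : 'rV[R]_n) : mB (fun z => enorm (z - mu)).
Proof. by apply: continuous_mB; apply: continuous_enorm => i; exact: continuous_coordB. Qed.

Hypothesis fin2 : (\int[P]_t ((enorm (Z 0%N t)) ^+ 2)%:E < +oo)%E.

Lemma integrable_enorm2 (mu : 'rV[R]_n) : I (fun t => enorm (Z 0%N t - mu) ^+ 2).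
Proof.
have m2 (nu : 'rV[R]_n) : measurable_fun setT (fun t => enorm (Z 0%N t - nu) ^+ 2).
  by apply: measurable_funX; exact: (measurable_gZ mZ 0%N (mB_enormB nu)).
have i0 : I (fun t => enorm (Z 0%N t - 0) ^+ 2).
  apply/integrableP; split; first by apply/measurable_EFinP; exact: m2.
  under eq_integral => t _ do rewrite /= ger0_norm ?sqr_ge0// subr0.
  exact: fin2.
apply: (@integrable_le _ _ _ _ _ (fun t => 2 * enorm (Z 0%N t - 0) ^+ 2 + 2 * enorm mu ^+ 2)).
- exact: m2.
- move=> t; rewrite ger0_norm ?sqr_ge0// subr0; have := enorm_triangle (Z 0%N t) (- mu); rewrite enormN.
  have := enorm_ge0 (Z 0%N t - mu); have := sqr_ge0 (enorm (Z 0%N t) - enorm mu); nra.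
- exact: (integrableD measurableT (Ex_scale 2 i0).1 (integrable_cstR P _)).
Qed.

Lemma integrable_coordM (mu : 'rV[R]_n) i j :
  I (fun t => (Z 0%N t - mu) ord0 i * (Z 0%N t - mu) ord0 j).
Proof.
apply: (@integrable_le _ _ _ _ _ (fun t => enorm (Z 0%N t - mu) ^+ 2)).
- by apply: measurable_funM; exact: (measurable_gZ mZ 0%N (mB_coordB mu _)).
- by move=> t; rewrite normrM expr2; apply: ler_pM => //; exact: coord_le_enorm.
exact: integrable_enorm2.
Qed.

Lemma integrable_coord (mu : 'rV[R]_n) i : I (fun t => (Z 0%N t - mu) ord0 i).
Proof.
apply: (@integrable_le _ _ _ _ _ (fun t => 1 + enorm (Z 0%N t - mu) ^+ 2)).
- exact: (measurable_gZ mZ 0%N (mB_coordB mu _)).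
- move=> t; apply: le_trans (coord_le_enorm _ _) _; have := sqr_ge0 (enorm (Z 0%N t - mu) - 1).
  have := enorm_ge0 (Z 0%N t - mu); nra.
exact: (integrableD measurableT (integrable_cstR P 1) (integrable_enorm2 mu)).
Qed.

(** Spelled like [mu] in the theorem, as is [covariance_mx] like [Sigma], so that the results apply
    there by conversion. *)
Definition mean : 'rV[R]_n := \row_j fine (\int[P]_t (Z 0%N t ord0 j)%:E).
Definition covariance_mx : 'M[R]_n := \matrix_(j, k)
  fine (\int[P]_t ((Z 0%N t ord0 j - mean ord0 j) * (Z 0%N t ord0 k - mean ord0 k))%:E).

Lemma Ex_coord i : Ex (fun t => (Z 0%N t - mean) ord0 i) = 0.
Proof.
have e : (fun t => (Z 0%N t - mean) ord0 i) = fun t => (Z 0%N t - 0) ord0 i - mean ord0 i.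
  by apply/funext => t; rewrite subr0 !mxE.
rewrite e RintegralB//; last 2 first.
- exact: integrable_coord.
- exact: integrable_cstR.
rewrite Ex_cst; under eq_Rintegral do rewrite subr0; rewrite /mean mxE /Rintegral; exact: subrr.
Qed.

Variables (p : nat) (M : 'M[R]_(n, p)).

Definition linear_stat (c : 'I_p) (z : 'rV[R]_n) : R := ((z - mean) *m M) ord0 c.
(** One envelope for all coordinates, so that a single truncation event serves them all. *)
Definition stat_bound (z : 'rV[R]_n) : R := (\sum_i \sum_c `|M i c|) * enorm (z - mean).

Let K0 : 0 <= \sum_i \sum_c `|M i c|.
Proof. by apply: sumr_ge0 => i _; exact: sumr_ge0. Qed.

Lemma linear_statE c z : linear_stat c z = \sum_i M i c * (z - mean) ord0 i.
Proof. by rewrite /linear_stat mxE; apply: eq_bigr => i _; rewrite mulrC. Qed.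

Lemma measurable_linear_stat c : mB (linear_stat c).
Proof.
have -> : linear_stat c = fun z => \sum_i M i c * (z - mean) ord0 i by apply/funext => z; exact: linear_statE.
by apply: measurable_sum => i; apply: measurable_funM => //; exact: mB_coordB.
Qed.

Lemma linear_stat_le c z : `|linear_stat c z| <= stat_bound z.
Proof.
rewrite linear_statE /stat_bound mulr_suml; apply: le_trans (ler_norm_sum _ _ _) _; apply: ler_sum => i _.
rewrite normrM; apply: ler_pM => //; last exact: coord_le_enorm.
by rewrite (bigD1 c)//= lerDl sumr_ge0.
Qed.

Lemma stat_bound_ge0 z : 0 <= stat_bound z.
Proof. by rewrite mulr_ge0// enorm_ge0. Qed.

Lemma measurable_stat_bound : mB stat_bound.
Proof. by apply: measurable_funM => //; exact: mB_enormB. Qed.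

Lemma integrable_stat_bound2 : I (fun t => stat_bound (Z 0%N t) ^+ 2).
Proof.
have -> : (fun t => stat_bound (Z 0%N t) ^+ 2) =
    fun t => (\sum_i \sum_c `|M i c|) ^+ 2 * enorm (Z 0%N t - mean) ^+ 2.
  by apply/funext => t; rewrite /stat_bound exprMn.
exact: (Ex_scale _ (integrable_enorm2 _)).1.
Qed.

Lemma Ex_linear_stat c : Ex (fun t => linear_stat c (Z 0%N t)) = 0.
Proof.
have -> : (fun t => linear_stat c (Z 0%N t)) = fun t => \sum_i M i c * (Z 0%N t - mean) ord0 i.
  by apply/funext => t; exact: linear_statE.
have ii i : I (fun t => M i c * (Z 0%N t - mean) ord0 i) by exact: (Ex_scale _ (integrable_coord _ _)).1.
have [_ ->] := Ex_sum (index_enum _) ii; apply: big1 => i _.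
have [_ ->] := Ex_scale (M i c) (integrable_coord mean i).
by rewrite Ex_coord mulr0.
Qed.

Lemma Ex_functional2 (a : 'rV[R]_n) :
  Ex (fun t => (\sum_i a ord0 i * (Z 0%N t - mean) ord0 i) ^+ 2) = (a *m covariance_mx *m a^T) ord0 ord0.
Proof.
have -> : (fun t => (\sum_i a ord0 i * (Z 0%N t - mean) ord0 i) ^+ 2) =
  fun t => \sum_i \sum_j (a ord0 i * a ord0 j) * ((Z 0%N t - mean) ord0 i * (Z 0%N t - mean) ord0 j).
  apply/funext => t; rewrite expr2 big_distrlr /=; apply: eq_bigr => i _; apply: eq_bigr => j _; ring.
have ij i j := Ex_scale (a ord0 i * a ord0 j) (integrable_coordM mean i j).
have ii i := Ex_sum (index_enum _) (fun j => (ij i j).1).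
have [_ ->] := Ex_sum (index_enum _) (fun i => (ii i).1).
rewrite [RHS]mxE; under [RHS]eq_bigr do rewrite mxE mulr_suml.
rewrite [RHS]exchange_big; apply: eq_bigr => i _; have [_ ->] := ii i; apply: eq_bigr => j _.
have [_ ->] := ij i j; rewrite !mxE /Rintegral.
under [in LHS]eq_integral do rewrite !mxE.
by rewrite mulrAC mulrC mulrA; ring.
Qed.

Lemma Ex_linear_stat2 (w : 'I_p -> R) :
  Ex (fun t => (\sum_c w c * linear_stat c (Z 0%N t)) ^+ 2) =
  ((\row_c w c) *m (M^T *m covariance_mx *m M) *m (\row_c w c)^T) ord0 ord0.
Proof.
have -> : (fun t => (\sum_c w c * linear_stat c (Z 0%N t)) ^+ 2) =
    fun t => (\sum_i ((\row_c w c) *m M^T) ord0 i * (Z 0%N t - mean) ord0 i) ^+ 2.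
  apply/funext => t; congr (_ ^+ 2); under eq_bigr do rewrite linear_statE mulr_sumr.
  rewrite exchange_big; apply: eq_bigr => i _; rewrite [X in _ = X * _]mxE mulr_suml.
  by apply: eq_bigr => c _; rewrite [X in _ = X * _ * _]mxE [X in _ = _ * X * _]mxE mulrA.
by rewrite Ex_functional2 trmx_mul trmxK !mulmxA.
Qed.

End Moments.

(** * Upper and lower bounds for the standardized walk *)

Section StandardWalk.
Variables (R : realType) (dT : measure_display) (T : measurableType dT) (P : probability T R).
Variables (n : nat) (Z : nat -> T -> 'rV[R]_n).
Hypothesis mZ : forall i B, rv_borel B -> measurable (Z i @^-1` B).
Hypothesis indZ : forall (F : seq nat) (B : nat -> set 'rV[R]_n), uniq F -> (forall i, rv_borel (B i)) ->
  P (\bigcap_(i in [set` F]) (Z i @^-1` B i)) = \big[*%E/1%E]_(i <- F) P (Z i @^-1` B i).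
Hypothesis idZ : forall i B, rv_borel B -> P (Z i @^-1` B) = P (Z 0%N @^-1` B).
Local Notation mB g := (measurable_fun (setT : set (borelT R n)) g).
Local Notation "'Ex' f" := (\int[P]_t f t) (at level 10, f at next level).

Variable h : 'rV[R]_n -> R.
Hypotheses (mh : mB h) (h0 : forall z, 0 <= h z).
Hypothesis ih2 : P.-integrable setT (EFin \o (fun t => h (Z 0%N t) ^+ 2)).

Lemma block_max_abs b m (xi : 'rV[R]_n -> R) : growing R b -> mB xi -> (forall z, `|xi z| <= h z) ->
  Ex (fun t => xi (Z 0%N t)) = 0 ->
  {ae P, forall t, \forall k \near \oo, forall i j, (i < m)%N -> (j <= b k)%N ->
    `|\sum_(i * b k <= l < i * b k + j) xi (Z l t)| <= (Ex (fun t => xi (Z 0%N t) ^+ 2) + 5) * scale R b k}.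
Proof.
move=> gb mxi xih Exi.
have xih1 z : `|xi z| <= 1 * h z by rewrite mul1r.
have xih2 z : `|- xi z| <= 1 * h z by rewrite normrN mul1r.
have mxi2 : mB (fun z => - xi z) by exact: measurableT_comp.
have ii : P.-integrable setT (EFin \o (fun t => xi (Z 0%N t))).
  apply: (@integrable_le _ _ _ _ _ (fun t => 1 + h (Z 0%N t) ^+ 2)).
  - exact: (measurable_gZ mZ 0%N mxi).
  - move=> t; apply: le_trans (xih _) _; have := sqr_ge0 (h (Z 0%N t) - 1); have := h0 (Z 0%N t); nra.
  - exact: (integrableD measurableT (integrable_cstR P 1) ih2).
have Exi2 : Ex (fun t => - xi (Z 0%N t)) = 0.
  have -> : (fun t => - xi (Z 0%N t)) = (fun t => -1 * xi (Z 0%N t)) by apply/funext => t; rewrite mulN1r.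
  by have [_ ->] := Ex_scale (-1) ii; rewrite Exi mulr0.
have B1 := block_max mZ indZ idZ mh h0 ih2 gb m ltr01 mxi xih1 Exi.
have B2 := block_max mZ indZ idZ mh h0 ih2 gb m ltr01 mxi2 xih2 Exi2.
apply: (ae_and B1 B2) => t h1 h2; apply: filterS2 h1 h2 => k h1 h2 i j im jb.
rewrite ler_norml; apply/andP; split; last exact: h1.
have := h2 i j im jb; rewrite sumrN.
by under eq_Rintegral do rewrite sqrrN; rewrite lerNl.
Qed.

Variables (d : nat) (V : 'I_d -> 'rV[R]_n -> R).
Hypotheses (mV : forall c, mB (V c)) (Vh : forall c z, `|V c z| <= h z).
Hypothesis EV : forall c, Ex (fun t => V c (Z 0%N t)) = 0.
Hypothesis EVV : forall w : 'I_d -> R, Ex (fun t => (\sum_c w c * V c (Z 0%N t)) ^+ 2) = \sum_c w c ^+ 2.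
Variable xi : 'rV[R]_n -> R.
Hypotheses (mxi : mB xi) (xih : forall z, `|xi z| <= h z) (Exi : Ex (fun t => xi (Z 0%N t)) = 0).

Definition spacestep t l : 'rV[R]_d := \row_c V c (Z l t).
Definition timestep t l : R := xi (Z l t).

Lemma Ex_V2 c : Ex (fun t => V c (Z 0%N t) ^+ 2) = 1.
Proof.
have := EVV (fun j => (j == c)%:R); rewrite [RHS](bigD1 c)//= eqxx expr1n big1 ?addr0 => [<-|j /negPf ->]; last first.
  by rewrite expr0n.
apply: eq_Rintegral => t _; rewrite (bigD1 c)//= eqxx mul1r big1 ?addr0// => j /negPf ->.
by rewrite mul0r.
Qed.

Lemma space_coord t s a b c : (s^-1 *: \sum_(a <= l < b) spacestep t l) ord0 c = s^-1 * \sum_(a <= l < b) V c (Z l t).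
Proof. by rewrite mxE summxE; congr (_ * _); apply: eq_bigr => l _; rewrite mxE. Qed.

Lemma block_coord b k m t (a : R) (p : 'I_m * 'I_d) : growing R b -> (0 < m)%N -> 0 < a ->
  ((a * Num.sqrt (2 * m%:R) * scale R b k)^-1 *: \sum_(p.1 * b k <= l < p.1.+1 * b k) spacestep t l) ord0 p.2 =
  blockY Z b V k t p / (a * Num.sqrt m%:R).
Proof.
move=> gb m0 a0; rewrite space_coord /blockY sqrtrM//.
have s0 := scale_gt0 gb k; have r0 : 0 < Num.sqrt 2 :> R by rewrite sqrtr_gt0.
have q0 : 0 < Num.sqrt m%:R :> R by rewrite sqrtr_gt0 ltr0n.
by move: (\sum_(_ <= _ < _) _) => X; field; rewrite !gt_eqF.
Qed.

(* [O(scale)] is negligible against the length [b k] in time, and only a fraction [O(m^(-1/2))] of the space scale. *)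
Lemma block_partial_sums b m (a e : R) : growing R b -> (0 < m)%N -> 0 < a -> 0 < e ->
  {ae P, forall t, \forall k \near \oo,
    (forall i j, (i < m)%N -> (j <= b k)%N ->
       `|\sum_(i * b k <= l < i * b k + j) timestep t l| <= e / m%:R * (m * b k)%:R) /\
    (forall i j, (i < m)%N -> (j <= b k)%N ->
       enorm ((a * Num.sqrt (2 * m%:R) * scale R b k)^-1 *: \sum_(i * b k <= l < i * b k + j) spacestep t l)
       <= 6 * d%:R / a * Num.sqrt (1 / m%:R))}.
Proof.
move=> gb m0 a0 e0; have mR : 0 < m%:R :> R by rewrite ltr0n.
have aeV : {ae P, forall t, forall c, \forall k \near \oo, forall i j, (i < m)%N -> (j <= b k)%N ->
    `|\sum_(i * b k <= l < i * b k + j) V c (Z l t)| <= 6 * scale R b k}.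
  apply: filter_forall => c; have := block_max_abs m gb (mV c) (Vh c) (EV c).
  by rewrite Ex_V2; have -> : 1 + 5 = 6 :> R by ring.
have aex := block_max_abs m gb mxi xih Exi; move: aex; move: (_ + 5) => q aex.
apply: (ae_and aex aeV) => t tx tV.
have {}tV := filter_forall eventually_filter tV.
have bt := tau_large (q / e) gb; apply: filterS3 tx tV bt => k hx hV bt.
have s0 := scale_gt0 gb k; split=> i j im jb.
  apply: le_trans (hx i j im jb) _; rewrite natrM mulrA divfK ?gt_eqF//.
  move: bt; rewrite -scale_tau// ler_pdivlMr// mulrAC ler_pdivrMr// => h1; by rewrite mulrC [e * _]mulrC mulrC.
apply: le_trans (enorm_le_sum _) _.
have S0 : 0 < a * Num.sqrt (2 * m%:R) * scale R b k by rewrite !mulr_gt0// sqrtr_gt0 mulr_gt0.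
apply: le_trans (_ : \sum_(c < d) (6 / a * Num.sqrt (1 / m%:R)) <= _); last first.
  by rewrite sumr_const card_ord -[X in X <= _]mulr_natl le_eqVlt; apply/orP; left; apply/eqP; ring.
apply: ler_sum => c _; rewrite space_coord normrM [X in X * _]gtr0_norm ?invr_gt0// mulrC ler_pdivrMr//.
apply: le_trans (hV c i j im jb) _.
have -> : 6 / a * Num.sqrt (1 / m%:R) * (a * Num.sqrt (2 * m%:R) * scale R b k) =
    6 * scale R b k * (Num.sqrt (1 / m%:R) * Num.sqrt (2 * m%:R)) by field; rewrite gt_eqF.
rewrite -sqrtrM ?divr_ge0// [1 / _ * _]mulrC mulrA mulr1 mulfK ?gt_eqF//.
by rewrite ler_peMr// ?mulr_ge0// ?(ltW s0)// -[X in X <= _]sqrtr1 ler_sqrt//; lra.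
Qed.

Lemma le_mulD1 (K y e : R) : 0 <= K -> 0 <= y -> (K + 1) * y <= e -> y <= e /\ K * y <= e.
Proof. by move=> K0 y0; have := mulr_ge0 K0 y0; lra. Qed.

Lemma enorm_sqrE (x : 'rV[R]_d) : enorm x ^+ 2 = \sum_c x ord0 c ^+ 2.
Proof. by rewrite enorm_sqr /dot; apply: eq_bigr => c _; rewrite expr2. Qed.

(** [m] is taken so large that the O(m^(-1/2)) errors, times the Lipschitz constant, are below
    [eta / 2]. The factor [1 + eta] in the space scale brings the energy from at most [1 + eta] down
    to at most 1. *)
Lemma std_upper b (eta : R) : growing R b -> 0 < eta <= 1 -> exists2 m, (0 < m)%N &
  {ae P, forall t, \forall k \near \oo, (vol (polytope (fun l : 'I_(m * b k).+1 =>
     walkpt (timestep t) (spacestep t) m (b k) ((1 + eta) * Num.sqrt (2 * m%:R) * scale R b k) l))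
     <= lambdaS R d + eta%:E)%E}.
Proof.
move=> gb /andP[eta0 eta1]; have [K K0 hK] := @polytope_perturb R (1 + d) 3.
have K1 : 0 < K + 1 by lra.
have c0 : 0 <= (K + 1) * (6 * d%:R + 1) by apply: mulr_ge0; [exact: ltW|rewrite addr_ge0// mulr_ge0].
have [M hM] := sqrt_div_cvg0 ler01 c0 (divr_gt0 eta0 (ltr0n _ 2)).
exists (maxn M 1); first by rewrite leq_max orbT.
have m0 : (0 < maxn M 1)%N by rewrite leq_max orbT.
have mM := hM _ (leq_maxl M 1); move: (maxn M 1) m0 mM => m m0 mM.
have mR : 0 < m%:R :> R by rewrite ltr0n.
have a0 : 0 < 1 + eta by lra.
pose e := eta / (2 * (K + 1)); have e0 : 0 < e by rewrite divr_gt0// mulr_gt0.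
have eK : (K + 1) * e = eta / 2 by rewrite /e; field; rewrite gt_eqF.
apply: (ae_and (block_partial_sums gb m0 a0 e0) (block_energy_upper mZ indZ idZ mh h0 ih2 gb mV Vh EV EVV m0 eta0 eta1)).
move=> t hb hE; apply: filterS2 hb hE => k [hx hv] hE.
have bk : (0 < b k)%N by case: gb.
set r := Num.sqrt (1 / m%:R) in mM hv; have r0 : 0 <= r by exact: sqrtr_ge0.
have mr : m%:R^-1 <= r.
  have r1 : r <= 1 by rewrite /r -[X in _ <= X]sqrtr1 ler_wsqrtr// ler_pdivrMr// mul1r ler1n.
  have -> : m%:R^-1 = r ^+ 2 by rewrite /r sqr_sqrtr ?divr_ge0// mul1r.
  by rewrite expr2 ler_piMl.
have hv' i j : (i < m)%N -> (j <= b k)%N ->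
    enorm (((1 + eta) * Num.sqrt (2 * m%:R) * scale R b k)^-1 *: \sum_(i * b k <= l < i * b k + j) spacestep t l) <= 6 * d%:R * r.
  move=> im jb; apply: le_trans (hv i j im jb) _; apply: ler_wpM2r => //.
  by rewrite ler_pdivrMr// ler_peMr ?mulr_ge0//; lra.
have me : m%:R * (e / m%:R) = e by rewrite mulrCA divff ?mulr1// gt_eqF.
have tot : (K + 1) * (m%:R^-1 + m%:R * (e / m%:R) + 6 * d%:R * r) <= eta.
  rewrite me; have : (K + 1) * m%:R^-1 <= (K + 1) * r by rewrite ler_pM2l.
  by move: mM; lra.
have tot0 : 0 <= m%:R^-1 + m%:R * (e / m%:R) + 6 * d%:R * r.
  by rewrite me addr_ge0// ?mulr_ge0// addr_ge0 ?invr_ge0// ltW.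
apply: le_trans (walk_upper m0 bk K0 hK _ hx hv' _) _.
- have -> : m%:R * (\sum_(i < m) enorm (((1 + eta) * Num.sqrt (2 * m%:R) * scale R b k)^-1 *:
      \sum_(i * b k <= l < i.+1 * b k) spacestep t l) ^+ 2) = (\sum_(p : 'I_m * 'I_d) blockY Z b V k t p ^+ 2) / (1 + eta) ^+ 2.
    rewrite sum_pairs mulr_sumr mulr_suml; apply: eq_bigr => i _; rewrite enorm_sqrE mulr_sumr mulr_suml.
    apply: eq_bigr => c _; rewrite (block_coord k t (i, c) gb m0 a0) expr_div_n.
    have -> : ((1 + eta) * Num.sqrt m%:R) ^+ 2 = (1 + eta) ^+ 2 * m%:R by rewrite exprMn sqr_sqrtr.
    by field; rewrite !gt_eqF.
  rewrite ler_pdivrMr ?exprn_gt0// mul1r; apply: le_trans hE _; rewrite expr2; have : 0 <= eta * eta by rewrite mulr_ge0// ltW.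
  lra.
- exact: le_trans (le_mulD1 K0 tot0 tot).1 eta1.
by rewrite leeD2l// lee_fin (le_mulD1 K0 tot0 tot).2.
Qed.

(** The target polyline has energy at most 1; shrinking the space scale by [1 + eta] makes the
    vector of prescribed block sums strictly shorter than 1, as [block_hits] requires. *)
Lemma std_lower (c : R) (eta : R) : (c%:E < lambdaS R d)%E -> 0 < eta <= 1 -> exists2 m, (1 < m)%N &
  {ae P, forall t, forall K0, exists2 k, (K0 <= k)%N & (c%:E <= vol (polytope (fun l : 'I_(m * m ^ k).+1 =>
     walkpt (timestep t) (spacestep t) m (m ^ k) ((1 + eta)^-1 * Num.sqrt (2 * m%:R) * scale R (expn m) k) l))
     + eta%:E)%E}.
Proof.
move=> /lambda_grid[M1 hM1] /andP[eta0 eta1]; have [K K0 hK] := @polytope_perturb R (1 + d) 3.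
have K1 : 0 < K + 1 by lra.
have c0 : 0 <= (K + 1) * (4 * d%:R + 1) by apply: mulr_ge0; [exact: ltW|rewrite addr_ge0// mulr_ge0].
have [M2 hM2] := sqrt_div_cvg0 ler01 c0 (divr_gt0 eta0 (ltr0n _ 2)).
pose m := maxn (maxn M1 M2) 2; exists m; first by rewrite leq_max orbT.
have m1 : (1 < m)%N by rewrite leq_max orbT.
have mM : (K + 1) * (4 * d%:R + 1) * Num.sqrt (1 / m%:R) <= eta / 2.
  by apply: hM2; rewrite !leq_max leqnn orbT.
have [z [z0 ge cz]] : exists z : nat -> 'rV[R]_d, [/\ z 0%N = 0, grid_energy m z <= 1 & (c%:E < vol (polytope (polyline m z)))%E].
  by apply: hM1; rewrite !leq_max leqnn.
move: m m1 mM z z0 ge cz => m m1 mM z z0 ge cz.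
have m0 : (0 < m)%N by exact: ltnW.
have mR : 0 < m%:R :> R by rewrite ltr0n.
have mR1 : 1 < m%:R :> R by rewrite ltr1n.
have gb : growing R (expn m).
  suff <- : @geom R m%:R = expn m by exact: geom_growing.
  by apply/funext => k; rewrite /geom -natrX natrK.
pose a := (1 + eta)^-1; have a0 : 0 < a by rewrite invr_gt0; lra.
have a1 : a < 1 by rewrite invf_lt1; lra.
have a2 : a^-1 <= 2 by rewrite invrK; lra.
pose e := eta / (4 * (K + 1)); have e0 : 0 < e by rewrite divr_gt0// mulr_gt0.
have eK : (K + 1) * e = eta / 4 by rewrite /e; field; rewrite gt_eqF.
pose q : R := Num.sqrt m%:R; have q0 : 0 < q by rewrite sqrtr_gt0.
have qq : q ^+ 2 = m%:R by rewrite sqr_sqrtr.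
(* Row 0 is set to 0 because the first block cannot be prescribed; its walk is bounded by
   [block_energy_upper] instead. *)
pose th (p : 'I_m * 'I_d) : R := if (p.1 : nat) == 0%N then 0 else a * q * (z p.1.+1 - z p.1) ord0 p.2.
have th0 (p : 'I_m * 'I_d) : (p.1 : nat) = 0%N -> th p = 0 by rewrite /th => ->.
have th1 : \sum_p th p ^+ 2 < 1.
  apply: le_lt_trans (_ : a ^+ 2 < 1); last by rewrite expr_lt1// ltW.
  apply: le_trans (_ : a ^+ 2 * grid_energy m z <= _); last by rewrite ler_piMr// sqr_ge0.
  rewrite /grid_energy sum_pairs mulrA mulr_sumr; apply: ler_sum => i _; rewrite enorm_sqrE mulr_sumr; apply: ler_sum => j _.
  rewrite /th /=; case: eqP => _; last by rewrite !exprMn qq.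
  by rewrite expr0n mulr_ge0 ?sqr_ge0// mulr_ge0 ?sqr_ge0.
(* Chosen so that the errors of the [d] coordinates, rescaled by [a * q], sum to at most [e / m] per
   block. *)
pose e' := e * a / (q * d.+1%:R); have e'0 : 0 < e' by rewrite divr_gt0// mulr_gt0.
have bS k : expn m k.+1 = (m * expn m k)%N by rewrite expnS.
have aeh := block_hits mZ indZ idZ mh h0 ih2 gb mV Vh EV EVV m0 bS th0 th1 e'0.
have aeu := block_energy_upper mZ indZ idZ mh h0 ih2 gb mV Vh EV EVV m0 ltr01 (lexx _).
have aep := block_partial_sums gb m0 a0 e0.
have aeup : {ae P, forall t, \forall k \near \oo, \sum_(p : 'I_m * 'I_d) blockY Z (expn m) V k t p ^+ 2 <= 1 + 1 /\
    forall i j, (i < m)%N -> (j <= m ^ k)%N ->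
       `|\sum_(i * m ^ k <= l < i * m ^ k + j) timestep t l| <= e / m%:R * (m * m ^ k)%:R}.
  by apply: (ae_and aeu aep) => t h1 h2; apply: filterS2 h1 h2 => k h1 [h2 _].
apply: (ae_and aeh aeup) => t hit [K2 _ hup] K3; have [k kK hk] := hit (maxn K2 K3).
exists k; first by rewrite (leq_trans (leq_maxr _ _) kK).
have [hE hx] := hup k (leq_trans (leq_maxl _ _) kK).
have bk : (0 < m ^ k)%N by rewrite expn_gt0 m0.
set r := Num.sqrt (1 / m%:R) in mM; have r0 : 0 <= r by exact: sqrtr_ge0.
have rq : r = q^-1 by rewrite /r mul1r sqrtrV.
have aq : 0 < a * q by rewrite mulr_gt0.
have hv i : (0 < i < m)%N -> enorm ((a * Num.sqrt (2 * m%:R) * scale R (expn m) k)^-1 *: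
    \sum_(i * m ^ k <= l < i.+1 * m ^ k) spacestep t l - (z i.+1 - z i)) <= e / m%:R.
  move=> /andP[i0 im]; apply: le_trans (enorm_le_sum _) _.
  apply: le_trans (_ : \sum_(j < d) e' / (a * q) <= _); last first.
    rewrite sumr_const card_ord -[X in X <= _]mulr_natl.
    have -> : d%:R * (e' / (a * q)) = e / m%:R * (d%:R / d.+1%:R) by rewrite /e' -qq; field; rewrite !gt_eqF.
    have dd : d%:R / d.+1%:R <= 1 :> R by rewrite ler_pdivrMr// mul1r ler_nat.
    by apply: ler_piMr => //; rewrite divr_ge0// ltW.
  apply: ler_sum => j _; have := hk (Ordinal im, j) i0; rewrite /th /= gtn_eqF//.
  have := block_coord k t (Ordinal im, j) gb m0 a0; rewrite /= -/q => E h1.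
  rewrite mxE E.
  have -> : (- (z i.+1 - z i)) ord0 j = - (a * q * (z i.+1 - z i) ord0 j) / (a * q).
    by rewrite [LHS]mxE; field; rewrite !gt_eqF.
  rewrite -mulrDl normrM [X in _ * X]gtr0_norm ?invr_gt0//; apply: ler_wpM2r; first by rewrite invr_ge0 ltW.
  exact: ltW.
have hv0 : enorm ((a * Num.sqrt (2 * m%:R) * scale R (expn m) k)^-1 *: \sum_(0 <= l < m ^ k) spacestep t l) <= 4 * d%:R * r.
  apply: le_trans (enorm_le_sum _) _; apply: le_trans (_ : \sum_(j < d) 4 * r <= _); last first.
    by rewrite sumr_const card_ord -[X in X <= _]mulr_natl le_eqVlt; apply/orP; left; apply/eqP; ring.
  apply: ler_sum => j _; have := block_coord k t (Ordinal m0, j) gb m0 a0; rewrite /= mul0n mul1n -/q => ->.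
  have b2 : `|blockY Z (expn m) V k t (Ordinal m0, j)| <= 2.
    rewrite -(ler_pXn2r (n := 2))// ?nnegrE// real_normK ?num_real//.
    apply: le_trans (_ : \sum_(p : 'I_m * 'I_d) blockY Z (expn m) V k t p ^+ 2 <= _); last by lra.
    by rewrite (bigD1 (Ordinal m0, j))//= lerDl sumr_ge0// => p _; rewrite sqr_ge0.
  rewrite normrM [X in _ * X]gtr0_norm ?invr_gt0// invfM -rq mulrA; apply: ler_wpM2r => //.
  have : `|blockY Z (expn m) V k t (Ordinal m0, j)| / a <= 2 * 2.
    by apply: ler_pM => //; rewrite invr_ge0 ltW.
  lra.
have me : m%:R * (e / m%:R) = e by rewrite mulrCA divff ?mulr1// gt_eqF.
have e30 : 0 <= e / m%:R by rewrite divr_ge0// ltW.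
have tot : (K + 1) * (m%:R * (e / m%:R) + (4 * d%:R * r + Num.sqrt (1 / m%:R) + m%:R * (e / m%:R))) <= eta.
  by rewrite me -/r; move: mM; lra.
have tot0 : 0 <= m%:R * (e / m%:R) + (4 * d%:R * r + Num.sqrt (1 / m%:R) + m%:R * (e / m%:R)).
  have h4 : 0 <= 4 * d%:R * r by rewrite !mulr_ge0.
  by rewrite me -/r; lra.
apply: le_trans (ltW cz) _.
apply: le_trans (walk_lower m0 bk K0 hK z0 ge hx hv e30 hv0 _) _.
  exact: le_trans (le_mulD1 K0 tot0 tot).1 eta1.
by rewrite leeD2l// lee_fin (le_mulD1 K0 tot0 tot).2.
Qed.

End StandardWalk.

(** * Comparison of the normalizations *)

Section Normalization.
Variable R : realType.

Lemma expn_growing m : (1 < m)%N -> growing R (expn m).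
Proof.
move=> m1; suff <- : @geom R m%:R = expn m by apply: geom_growing; rewrite ltr1n.
by apply/funext => k; rewrite /geom -natrX natrK.
Qed.

Lemma bracket (b : nat -> nat) K N : (b K <= N)%N -> (exists2 k, (K <= k)%N & (N < b k.+1)%N) ->
  exists2 k, (K <= k)%N & (b k <= N < b k.+1)%N.
Proof.
move=> bK [k0 K0 N0]; pose p k := (K <= k)%N && (N < b k.+1)%N.
have ex : exists k, p k by exists k0; rewrite /p K0.
case: (ex_minnP ex) => k /andP[Kk Nk] mk; exists k => //; rewrite Nk andbT leqNgt; apply/negP => h.
move: Kk; rewrite leq_eqVlt => /predU1P[E|Kk]; first by rewrite -E ltnNge bK in h.
have k1 : (0 < k)%N by apply: leq_trans Kk.
have : p k.-1 by rewrite /p prednK// h andbT -ltnS prednK.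
by move=> /mk; rewrite -ltnS prednK// ltnn.
Qed.

(** For large [N] this is [N] times the [d]-th power of the root of [2 * N * ln (ln N)]: one factor
    for the drift direction, [d] for the transversal ones. *)
Definition lil_norm d (N : nat) : R := Num.sqrt (2 ^+ d * N%:R ^+ d.+2 * (ln (ln N%:R)) ^+ d).

Lemma lil_normE d N : 0 <= ln (ln N%:R) :> R ->
  lil_norm d N = N%:R * Num.sqrt (2 * N%:R * ln (ln N%:R)) ^+ d.
Proof.
move=> L0; have x0 : 0 <= N%:R * Num.sqrt (2 * N%:R * ln (ln N%:R)) ^+ d :> R by rewrite mulr_ge0// exprn_ge0// sqrtr_ge0.
rewrite -[RHS]ger0_norm// -sqrtr_sqr /lil_norm; congr Num.sqrt.
rewrite exprMn -exprM [(d * 2)%N]mulnC exprM sqr_sqrtr ?mulr_ge0// !exprMn.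
by rewrite -[d.+2]addn2 exprD; ring.
Qed.

(** In the exponent, 2 comes from replacing [N] by the next scale. Each of the [d] space factors
    costs 3: the explicit [1 + eta], and two more that cover the ratio of scales and of [logk] to
    [ln ln] under the root. *)
Lemma lil_norm_upper d (eta : R) m : 0 < eta -> (0 < m)%N -> \forall k \near \oo, forall N,
  (m * geom (1 + eta)%R k <= N)%N -> 0 < lil_norm d N /\
  (m * geom (1 + eta)%R k.+1)%:R * ((1 + eta) * Num.sqrt (2 * m%:R) * scale R (geom (1 + eta)%R) k.+1) ^+ d <=
  (1 + eta) ^+ (3 * d + 2) * lil_norm d N.
Proof.
move=> eta0 m0; have r1 : 1 < 1 + eta by lra.
have n1 := logk_le_lnln r1 r1; have n2 := pow_large (1 + eta^-1) r1.
apply: filterS2 n1 n2 => k [h1 h2] h3 N hN; set b := geom (1 + eta) in h1 h2 hN *.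
have b0 : 0 < (b k)%:R :> R by rewrite ltr0n geom_gt0.
have mR : 1 <= m%:R :> R by rewrite ler1n.
have bN : (b k)%:R <= N%:R :> R by rewrite ler_nat (leq_trans _ hN)// leq_pmull.
have N0 : 0 < N%:R :> R by exact: lt_le_trans bN.
have lk := logk_gt0 R k.+1.
have LL : 0 < ln (ln (b k)%:R) :> R.
  by rewrite -(pmulr_rgt0 _ (_ : 0 < 1 + eta)); [exact: lt_le_trans h2|lra].
have LN : ln (ln (b k)%:R) <= ln (ln N%:R) :> R.
  have l1 : ln (b k)%:R <= ln N%:R :> R by rewrite ler_ln.
  by rewrite ler_ln// posrE//; exact: lt_le_trans l1.
have LN0 : 0 < ln (ln N%:R) :> R by exact: lt_le_trans LN.
rewrite (lil_normE _ (ltW LN0)).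
set s := Num.sqrt (2 * N%:R * ln (ln N%:R)).
have s0 : 0 < s by rewrite sqrtr_gt0 !mulr_gt0.
split; first by rewrite mulr_gt0// exprn_gt0.
have e0 : 0 < 1 + eta by lra.
have nb : (m * b k.+1)%:R <= (1 + eta) ^+ 2 * N%:R :> R.
  have /andP[g1 _] := geom_bounds k.+1 r1; have /andP[_ g2] := geom_bounds k r1; rewrite -/b in g1 g2.
  have bb : (b k.+1)%:R <= (1 + eta) ^+ 2 * (b k)%:R :> R.
    apply: le_trans g1 _; rewrite exprS expr2 -mulrA ler_pM2l//.
    have : eta * eta^-1 = 1 by rewrite divff// gt_eqF.
    have : eta * (1 + eta^-1) <= eta * ((b k)%:R + 1) by rewrite ler_pM2l//; lra.
    by lra.
  have mN : m%:R * (b k)%:R <= N%:R :> R by rewrite -natrM ler_nat.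
  have q0 : 0 < (1 + eta) ^+ 2 by rewrite exprn_gt0.
  rewrite natrM; apply: le_trans (ler_wpM2l (ler0n _ m) bb) _.
  by rewrite mulrCA ler_pM2l.
have sb : Num.sqrt (2 * m%:R) * scale R b k.+1 <= (1 + eta) ^+ 2 * s.
  rewrite /scale -sqrtrM ?mulr_ge0// -[(1 + eta) ^+ 2]ger0_norm ?sqr_ge0// -sqrtr_sqr -sqrtrM ?sqr_ge0//.
  apply: ler_wsqrtr; have -> : 2 * m%:R * ((b k.+1)%:R * logk R k.+1) = 2 * ((m * b k.+1)%:R * logk R k.+1) by rewrite natrM; ring.
  have : (m * b k.+1)%:R * logk R k.+1 <= ((1 + eta) ^+ 2 * N%:R) * ((1 + eta) * ln (ln N%:R)).
    apply: ler_pM => //; first exact: ltW.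
    by apply: le_trans h2 _; rewrite ler_pM2l.
  have : 0 <= N%:R * ln (ln N%:R) :> R by rewrite mulr_ge0// ltW.
  move=> NL0 h; have : (1 + eta) ^+ 3 * (N%:R * ln (ln N%:R)) <= (1 + eta) ^+ 4 * (N%:R * ln (ln N%:R)).
    by apply: ler_wpM2r => //; rewrite ler_eXn2l.
  rewrite -exprM; lra.
have -> : (1 + eta) ^+ (3 * d + 2) * (N%:R * s ^+ d) = ((1 + eta) ^+ 2 * N%:R) * ((1 + eta) * ((1 + eta) ^+ 2 * s)) ^+ d.
  have -> : (1 + eta) * ((1 + eta) ^+ 2 * s) = (1 + eta) ^+ 3 * s by ring.
  have -> : ((1 + eta) ^+ 3 * s) ^+ d = (1 + eta) ^+ 3 ^+ d * s ^+ d by exact: exprMn.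
  rewrite exprD exprM; move: ((1 + eta) ^+ 3 ^+ d) (s ^+ d) => u w; ring.
have S0 : 0 <= (1 + eta) * Num.sqrt (2 * m%:R) * scale R b k.+1.
  by rewrite !mulr_ge0// ?sqrtr_ge0// ltW.
apply: ler_pM => //; first by rewrite exprn_ge0.
have T0 : 0 <= (1 + eta) * ((1 + eta) ^+ 2 * s).
  by apply: mulr_ge0; [exact: ltW|exact: mulr_ge0 (sqr_ge0 _) (ltW s0)].
by apply: lerXn2r; [rewrite nnegrE|rewrite nnegrE|rewrite -mulrA ler_pM2l].
Qed.

(** Each space factor costs one [1 + eta] to undo the shrinking and one to compare [ln ln] with
    [logk]. *)
Lemma lil_norm_lower d (eta : R) m : 0 < eta -> (1 < m)%N -> \forall k \near \oo,
  0 < lil_norm d (m * m ^ k) /\ lil_norm d (m * m ^ k) <=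
  (1 + eta) ^+ (2 * d) * ((m * m ^ k)%:R * ((1 + eta)^-1 * Num.sqrt (2 * m%:R) * scale R (expn m) k) ^+ d).
Proof.
move=> eta0 m1; have r1 : 1 < 1 + eta by lra.
have m0 : (0 < m)%N by exact: ltnW.
have n1 := lnln_le_logk m1 r1.
have lm : 0 < ln m%:R :> R by rewrite ln_gt0// ltr1n.
have n2 : \forall k \near \oo, 1 < k.+1%:R * ln m%:R :> R.
  exists (Num.trunc (ln (m%:R : R))^-1).+1 => // k /= hk; rewrite -ltr_pdivrMr// mul1r.
  have x0 : 0 <= (ln m%:R)^-1 :> R by rewrite invr_ge0 ltW.
  have /andP[_ h] := truncn_itv x0; apply: lt_le_trans h _; by rewrite ler_nat ltnW.
apply: filterS2 n1 n2 => k h1 h2; rewrite -expnS; set N := (m ^ k.+1)%N in h1 *.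
have N0 : 0 < N%:R :> R by rewrite ltr0n expn_gt0 m0.
have LN0 : 0 < ln (ln N%:R) :> R.
  by rewrite ln_gt0// /N natrX lnXn ?ltr0n// -[ln _ *+ _]mulr_natl.
rewrite (lil_normE _ (ltW LN0)); set s := Num.sqrt (2 * N%:R * _).
have s0 : 0 < s by rewrite sqrtr_gt0 !mulr_gt0.
split; first by rewrite mulr_gt0// exprn_gt0.
have e0 : 0 < 1 + eta by lra.
have lk := logk_gt0 R k.
have sb : s <= (1 + eta) * (Num.sqrt (2 * m%:R) * scale R (expn m) k).
  rewrite /scale -sqrtrM ?mulr_ge0// -{1}[1 + eta]gtr0_norm// -sqrtr_sqr -sqrtrM ?sqr_ge0//.
  apply: ler_wsqrtr; rewrite -mulrA.
  have -> : (1 + eta) ^+ 2 * (2 * m%:R * ((m ^ k)%:R * logk R k)) = 2 * (N%:R * ((1 + eta) * ((1 + eta) * logk R k))).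
    by rewrite /N expnS natrM; ring.
  rewrite ler_pM2l// ler_pM2l//; apply: le_trans h1 _; rewrite ler_peMl// ?mulr_ge0// ?ltW//.
rewrite mulrCA ler_pM2l// exprM -exprMn; apply: lerXn2r; rewrite ?nnegrE ?(ltW s0)//.
  by rewrite !mulr_ge0// ?sqr_ge0// ?invr_ge0 ?sqrtr_ge0// ltW.
have -> // : (1 + eta) ^+ 2 * ((1 + eta)^-1 * Num.sqrt (2 * m%:R) * scale R (expn m) k) =
  (1 + eta) * (Num.sqrt (2 * m%:R) * scale R (expn m) k).
by field; rewrite gt_eqF.
Qed.

End Normalization.

Section LinearImages.
Variable R : realType.

Lemma mximg_polytope n a (M : 'M[R]_n) (p : 'I_a -> 'rV[R]_n) :
  mximg M (polytope p) = polytope (fun i => p i *m M).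
Proof.
have E (w : 'I_a -> R) : (\sum_i w i *: p i) *m M = \sum_i w i *: (p i *m M).
  by rewrite mulmx_suml; apply: eq_bigr => i _; rewrite scalemxAl.
apply/seteqP; split => [_ [_ [w [w0 w1 ->]] <-]|_ [w [w0 w1 ->]]]; first by exists w.
by exists (\sum_i w i *: p i) => //; exists w.
Qed.

Lemma walk_hull_nd n (z : nat -> 'rV[R]_n) k l : (k <= l)%N -> walk_hull z k `<=` walk_hull z l.
Proof. by move=> kl; apply: le_hull => x [j jk ->]; exists j => //; exact: leq_trans kl. Qed.

Lemma vol_walkpt d (M : 'M[R]_(1 + d)) (z : nat -> 'rV[R]_(1 + d)) x v m b s : M \in unitmx ->
  (forall l, partial_sum z l *m M = row_mx (const_mx (l%:R + \sum_(0 <= i < l) x i)) (\sum_(0 <= i < l) v i)) ->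
  (0 < m)%N -> (0 < b)%N -> 0 < s ->
  vol (walk_hull z (m * b)) = ((`|\det M|^-1 * ((m * b)%:R * s ^+ d))%:E *
    vol (polytope (fun l : 'I_(m * b).+1 => walkpt x v m b s l)))%E.
Proof.
move=> uM hM m0 b0 s0; have NR : 0 < (m * b)%:R :> R by rewrite ltr0n muln_gt0 m0.
pose D : 'M[R]_(1 + d) := block_mx ((m * b)%:R^-1)%:M 0 0 (s^-1)%:M.
have dD : \det D = (m * b)%:R^-1 * s^-1 ^+ d by rewrite det_ublock !det_scalar expr1.
have uMD : M *m D \in unitmx.
  by rewrite unitmx_mul uM unitmxE unitfE dD mulf_neq0// ?expf_neq0// invr_neq0// gt_eqF.
have dM : 0 < `|\det M| by rewrite normr_gt0 -unitfE -unitmxE.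
rewrite walk_hull_polytope.
have -> : polytope (fun l : 'I_(m * b).+1 => walkpt x v m b s l) =
    mximg (M *m D) (polytope (fun i : 'I_(m * b).+1 => partial_sum z i)).
  rewrite mximg_polytope; congr polytope; apply/funext => l.
  rewrite mulmxA hM mul_row_block !mulmx0 add0r addr0 !mul_mx_scalar; congr row_mx.
  by apply/rowP => i; rewrite !mxE mulrC.
rewrite vol_mximg// det_mulmx normrM muleA -EFinM dD.
have -> : `|\det M|^-1 * ((m * b)%:R * s ^+ d) * (`|\det M| * `|(m * b)%:R^-1 * s^-1 ^+ d|) = 1.
  have x0 : 0 <= (m * b)%:R^-1 * s^-1 ^+ d by apply: mulr_ge0; rewrite ?exprn_ge0// invr_ge0 ltW.
  rewrite (ger0_norm x0) exprVn.
  have sd : 0 < s ^+ d by rewrite exprn_gt0.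
  have cancel3 (p q y : R) : 0 < p -> 0 < q -> 0 < y -> p^-1 * (q * y) * (p * (q^-1 / y)) = 1.
    by move=> p0 q0 y0; field; rewrite !gt_eqF.
  exact: cancel3.
by rewrite mul1e.
Qed.

End LinearImages.

(** * The linear map that standardizes drift and covariance *)

Section StandardizingMatrix.
Variables (R : realType) (d : nat) (mu : 'rV[R]_d.+1) (Sg Q : 'M[R]_d.+1).
Hypotheses (mu0 : mu != 0) (QQ : Q *m Q^T = 1%:M) (Q0 : row ord0 Q = (enorm mu)^-1 *: mu).

(** An orthonormal basis of the hyperplane orthogonal to [mu], under the hypotheses on [Q]. *)
Definition lower_rows : 'M[R]_(d, d.+1) := \matrix_(i, j) Q (lift ord0 i) j.

Lemma reduced_covE : reduced_cov Q Sg = lower_rows *m Sg *m lower_rows^T.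
Proof.
apply/matrixP => i j; rewrite !mxE; apply: eq_bigr => k _; rewrite !mxE; congr (_ * _).
by apply: eq_bigr => l _; rewrite !mxE.
Qed.

Lemma mean_lower_rows : mu *m lower_rows^T = 0.
Proof.
have n0 : enorm mu != 0 by apply: contraNneq mu0 => /enorm0_eq0 ->.
have : row ord0 Q *m lower_rows^T = 0.
  apply/rowP => j; rewrite mxE [RHS]mxE.
  transitivity ((Q *m Q^T) ord0 (lift ord0 j)); last by rewrite QQ mxE.
  by rewrite [RHS]mxE; apply: eq_bigr => k _; rewrite !mxE.
rewrite Q0 -scalemxAl => /eqP; rewrite scaler_eq0 invr_eq0 (negPf n0) /=; exact/eqP.
Qed.

Lemma lower_rows_orth : lower_rows *m lower_rows^T = 1%:M.
Proof.
apply/matrixP => i j; rewrite mxE.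
have := congr1 (fun A : 'M[R]_d.+1 => A (lift ord0 i) (lift ord0 j)) QQ; rewrite !mxE (inj_eq lift_inj) => <-.
by apply: eq_bigr => k _; rewrite !mxE.
Qed.

Lemma standardizing_mx (W : 'M[R]_d) : W *m reduced_cov Q Sg *m W^T = 1%:M -> exists M : 'M[R]_(1 + d),
  [/\ M \in unitmx, `|\det M|^-1 = enorm mu * Num.sqrt (\det (reduced_cov Q Sg)),
      mu *m M = row_mx (const_mx 1) 0 &
      forall w : 'rV_d, row_mx 0 w *m (M^T *m Sg *m M) *m (row_mx 0 w)^T = w *m w^T].
Proof.
set A := reduced_cov Q Sg => WA.
have n0 : enorm mu != 0 by apply: contraNneq mu0 => /enorm0_eq0 ->.
have np : 0 < enorm mu by rewrite lt0r n0 enorm_ge0.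
have dA : \det W ^+ 2 * \det A = 1.
  by have := congr1 determinant WA; rewrite !det_mulmx det_tr det1 => <-; ring.
have dQ : \det Q ^+ 2 = 1 by have := congr1 determinant QQ; rewrite det_mulmx det_tr det1 expr2.
have dW0 : \det W != 0 by apply/eqP => h; move: dA; rewrite h expr0n mul0r => /eqP; rewrite eq_sym oner_eq0.
have dQ0 : \det Q != 0 by apply/eqP => h; move: dQ; rewrite h expr0n => /eqP; rewrite eq_sym oner_eq0.
have dA0 : 0 <= \det A.
  by rewrite -(pmulr_rge0 _ (_ : 0 < \det W ^+ 2)) ?dA// lt0r sqr_ge0 sqrf_eq0 dW0.
pose B : 'M[R]_(1 + d) := block_mx (enorm mu)^-1%:M 0 0 W^T.
pose M : 'M[R]_(1 + d) := (Q^T : 'M[R]_(1 + d)) *m B; exists M.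
have QE : (Q^T : 'M[R]_(d.+1, 1 + d)) = row_mx (row ord0 Q)^T lower_rows^T.
  apply/matrixP => i j; rewrite mxE; case: (split_ordP j) => k ->; rewrite !mxE ?(unsplitK (inl _)) ?(unsplitK (inr _)) /=.
    by rewrite !mxE ord1; congr (Q _ _); apply: val_inj.
  by rewrite !mxE; congr (Q _ _); apply: val_inj.
have ME : (M : 'M[R]_(d.+1, 1 + d)) = row_mx ((enorm mu)^-1 *: (row ord0 Q)^T) (lower_rows^T *m W^T).
  by rewrite /M QE mul_row_block !mulmx0 addr0 add0r mul_mx_scalar.
have dM : \det M = \det Q * ((enorm mu)^-1 * \det W).
  by rewrite det_mulmx det_tr det_ublock det_scalar1 det_tr.
split.
- by rewrite unitmxE unitfE dM !mulf_neq0// invr_eq0.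
- have x0 : 0 <= enorm mu * Num.sqrt (\det A) by rewrite mulr_ge0 ?enorm_ge0 ?sqrtr_ge0.
  apply/eqP; rewrite -(eqrXn2 (n := 2))// ?invr_ge0// exprVn real_normK ?num_real//.
  have -> : (enorm mu * Num.sqrt (\det A)) ^+ 2 = enorm mu ^+ 2 * \det A by rewrite exprMn [Num.sqrt (\det A) ^+ 2]sqr_sqrtr.
  have -> : \det M ^+ 2 = \det Q ^+ 2 * ((enorm mu)^-1 * \det W) ^+ 2 by rewrite dM; ring.
  rewrite dQ mul1r; apply/eqP; have : \det A = (\det W ^+ 2)^-1 by rewrite -[RHS]mulr1 -dA mulKf// sqrf_eq0.
  by move=> ->; field; rewrite ?n0 ?dW0.
- rewrite ME mul_mx_row mulmxA mean_lower_rows mul0mx; congr row_mx.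
  rewrite Q0 [X in _ *: X]linearZ /= scalerA -scalemxAr; apply/rowP => i; rewrite !ord1 mxE.
  have -> : (mu *m mu^T) 0 0 = enorm mu ^+ 2.
    by rewrite mxE enorm_sqr; apply: eq_bigr => k _; rewrite mxE.
  by rewrite mxE; field.
move=> w; have wM : row_mx 0 w *m M^T = w *m W *m lower_rows.
  by rewrite [M]ME tr_row_mx mul_row_col mul0mx add0r trmx_mul !trmxK mulmxA.
have Mw : M *m (row_mx 0 w)^T = (w *m W *m lower_rows)^T by rewrite -wM trmx_mul trmxK.
transitivity ((row_mx 0 w *m M^T) *m Sg *m (M *m (row_mx 0 w)^T)); first by rewrite !mulmxA.
rewrite wM Mw; transitivity (w *m (W *m A *m W^T) *m w^T); last by rewrite WA mulmx1.
by rewrite /A reduced_covE !trmx_mul !mulmxA.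
Qed.

Lemma lower_rows_neq0 (w : 'rV_d) : w != 0 -> w *m lower_rows != 0.
Proof.
by apply: contraNneq => h; rewrite -[w]mulmx1 -lower_rows_orth mulmxA h mul0mx.
Qed.

End StandardizingMatrix.

(** * Law of large numbers and the degenerate case *)

Section LimsupVolume.
Variables (R : realType) (dT : measure_display) (T : measurableType dT) (P : probability T R).

Section UniformLLN.
Variables (n : nat) (Z : nat -> T -> 'rV[R]_n).
Hypothesis mZ : forall i B, rv_borel B -> measurable (Z i @^-1` B).
Hypothesis indZ : forall (F : seq nat) (B : nat -> set 'rV[R]_n), uniq F -> (forall i, rv_borel (B i)) ->
  P (\bigcap_(i in [set` F]) (Z i @^-1` B i)) = \big[*%E/1%E]_(i <- F) P (Z i @^-1` B i).
Hypothesis idZ : forall i B, rv_borel B -> P (Z i @^-1` B) = P (Z 0%N @^-1` B).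
Hypothesis fin2 : (\int[P]_t ((enorm (Z 0%N t)) ^+ 2)%:E < +oo)%E.
Local Notation mu := (mean P Z).

(** [block_max_abs] with a single block of length [2 ^ k]: fluctuations are O([scale]), which is
    [b k / tau] and hence negligible against [N]. *)
Lemma uniform_lln : {ae P, forall t, forall e, 0 < e -> \forall N \near \oo, forall j, (j <= N)%N ->
  enorm (partial_sum (fun i => Z i t) j - j%:R *: mu) <= e * N%:R}.
Proof.
have gb : growing R (expn 2) by exact: expn_growing.
pose V := linear_stat P Z (1%:M : 'M[R]_n).
pose q c := \int[P]_t (fun t => V c (Z 0%N t) ^+ 2) t + 5.
have aec : {ae P, forall t, forall c, \forall k \near \oo, forall i j, (i < 1)%N -> (j <= 2 ^ k)%N ->
    `|\sum_(i * 2 ^ k <= l < i * 2 ^ k + j) V c (Z l t)| <= q c * scale R (expn 2) k}.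
  apply: filter_forall => c.
  exact: (block_max_abs mZ indZ idZ (measurable_stat_bound _ _ _) (stat_bound_ge0 _ _ _)
    (integrable_stat_bound2 mZ fin2 (1%:M : 'M[R]_n)) 1 gb (measurable_linear_stat _ _ _ c)
    (linear_stat_le _ _ _ c) (Ex_linear_stat mZ fin2 _ c)).
apply: filterS aec => t ht e e0; have {}ht := filter_forall eventually_filter ht.
pose S := \sum_c q c.
have q0 c : 0 <= q c by rewrite /q addr_ge0// Rintegral_ge0// => u _; rewrite sqr_ge0.
have S0 : 0 <= S by exact: sumr_ge0.
have tl := tau_large (2 * S / e) gb.
have [K _ hK] : \forall k \near \oo, (forall c i j, (i < 1)%N -> (j <= 2 ^ k)%N ->
    `|\sum_(i * 2 ^ k <= l < i * 2 ^ k + j) V c (Z l t)| <= q c * scale R (expn 2) k) /\ 2 * S / e <= tau R (expn 2) k.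
  by apply: filterI.
exists (2 ^ K)%N => // N /= KN j jN.
have [k Kk /andP[kN Nk]] : exists2 k, (K <= k)%N & (2 ^ k <= N < 2 ^ k.+1)%N.
  apply: (bracket (b := expn 2)) => //; exists (maxn K N); first exact: leq_maxl.
  by apply: leq_trans (ltn_expl _ (ltnSn 1)) _; rewrite leq_exp2l// ltnW// ltnS leq_maxr.
have [hk tk] := hK k.+1 (leq_trans Kk (leqnSn _)).
apply: le_trans (enorm_le_sum _) _.
apply: le_trans (_ : \sum_c q c * scale R (expn 2) k.+1 <= _).
  apply: ler_sum => c _; have := hk c 0%N j isT (leq_trans jN (ltnW Nk)).
  have -> // : \sum_(0 * 2 ^ k.+1 <= l < 0 * 2 ^ k.+1 + j) V c (Z l t) = (partial_sum (fun i => Z i t) j - j%:R *: mu) ord0 c.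
  rewrite mul0n add0n big_mkord /partial_sum [RHS]mxE summxE mxE mxE mulr_natl.
  under eq_bigr do rewrite /V /linear_stat mulmx1 !mxE.
  by rewrite sumrB sumr_const card_ord mxE.
have s0 := scale_gt0 gb k.+1.
rewrite -mulr_suml -/S; move: tk; rewrite -scale_tau// ler_pdivrMr// mulrAC ler_pdivlMr// => tk.
have : (2 ^ k)%:R <= N%:R :> R by rewrite ler_nat.
move: tk; rewrite expnS natrM => tk kNR.
have : e * (2 ^ k)%:R <= e * N%:R by rewrite ler_pM2l.
lra.
Qed.

End UniformLLN.

Variables (d : nat) (Z : nat -> T -> 'rV[R]_d.+1).
Hypothesis mZ : forall i B, rv_borel B -> measurable (Z i @^-1` B).
Hypothesis indZ : forall (F : seq nat) (B : nat -> set 'rV[R]_d.+1), uniq F -> (forall i, rv_borel (B i)) ->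
  P (\bigcap_(i in [set` F]) (Z i @^-1` B i)) = \big[*%E/1%E]_(i <- F) P (Z i @^-1` B i).
Hypothesis idZ : forall i B, rv_borel B -> P (Z i @^-1` B) = P (Z 0%N @^-1` B).
Hypothesis fin2 : (\int[P]_t ((enorm (Z 0%N t)) ^+ 2)%:E < +oo)%E.
Local Notation mu := (mean P Z).
Local Notation Sg := (covariance_mx P Z).
Lemma limsup_ivol1 : mu != 0 ->
  {ae P, forall t, limn_esup (fun N => (ivol 1 (walk_hull (fun i => Z i t) N) / N%:R)%:E) = (enorm mu)%:E}.
Proof.
move=> mu0; apply: filterS (uniform_lln mZ indZ idZ fin2) => t ht.
have /cvgrPdist_le cv := ivol1_cvg mu0 ht.
apply: limn_esup_eq => e e0.
  have := cv e e0; apply: filterS => N; rewrite ler_distlC => /andP[_ h].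
  by rewrite lee_fin.
move=> K; have [M _ hM] := cv e e0; exists (maxn K M); first exact: leq_maxl.
have := hM (maxn K M) (leq_maxr _ _); rewrite /= ler_distlC => /andP[h _].
by rewrite lee_fin.
Qed.

Variable Q : 'M[R]_d.+1.
Hypotheses (mu0 : mu != 0) (QQ : Q *m Q^T = 1%:M) (Q0 : row ord0 Q = (enorm mu)^-1 *: mu).
Local Notation A := (reduced_cov Q Sg).

Lemma covariance_sym : Sg^T = Sg.
Proof. by apply/matrixP => i j; rewrite [LHS]mxE [LHS]mxE [RHS]mxE; congr fine; apply: eq_integral => t _; congr EFin; exact: mulrC. Qed.

Lemma covariance_psd (a : 'rV[R]_d.+1) : 0 <= (a *m Sg *m a^T) ord0 ord0.
Proof. by rewrite -(Ex_functional2 mZ fin2) Rintegral_ge0// => t _; rewrite sqr_ge0. Qed.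

Lemma reduced_cov_sym : A^T = A.
Proof. by rewrite reduced_covE !trmx_mul trmxK covariance_sym mulmxA. Qed.

Lemma reduced_cov_form (w : 'rV[R]_d) : w *m A *m w^T = (w *m lower_rows Q) *m Sg *m (w *m lower_rows Q)^T.
Proof. by rewrite reduced_covE trmx_mul !mulmxA. Qed.

(** The direction [a] is orthogonal to [mu] and has variance 0, so almost surely every step lies in
    the hyperplane orthogonal to [a]. *)
Lemma degenerate_vol (w : 'rV[R]_d) : w != 0 -> (w *m A *m w^T) ord0 ord0 = 0 ->
  {ae P, forall t, forall N, vol (walk_hull (fun i => Z i t) N) = 0%E}.
Proof.
move=> w0 wA; pose a := w *m lower_rows Q; have a0 : a != 0 by exact: lower_rows_neq0.
have amu : mu *m a^T = 0 by rewrite /a trmx_mul mulmxA (mean_lower_rows mu0 QQ Q0) mul0mx.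
pose f (z : 'rV[R]_d.+1) := \sum_i a ord0 i * (z - mu) ord0 i.
have mf : measurable_fun (setT : set (borelT R d.+1)) f.
  by apply: measurable_sum => i; apply: measurable_funM => //; exact: mB_coordB.
have f2 : (\int[P]_t ((f (Z 0%N t)) ^+ 2)%:E = 0)%E.
  have := Ex_functional2 mZ fin2 a; rewrite -reduced_cov_form wA /Rintegral => E.
  have fn : (\int[P]_t ((f (Z 0%N t)) ^+ 2)%:E)%E \is a fin_num.
    rewrite ge0_fin_numE; last by apply: integral_ge0 => t _; rewrite lee_fin sqr_ge0.
    have /integrableP[_] := (Ex_scale ((\sum_i `|a ord0 i|) ^+ 2) (integrable_enorm2 mZ fin2 mu)).1.
    apply: le_lt_trans; apply: ge0_le_integral => //.
    - by move=> t _; rewrite lee_fin sqr_ge0.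
    - by apply/measurable_EFinP; apply: measurable_funX; exact: (measurable_gZ mZ 0%N mf).
    - apply/measurable_EFinP; apply: measurableT_comp => //; apply: measurable_funM => //.
      by apply: measurable_funX; exact: (measurable_gZ mZ 0%N (mB_enormB mu)).
    move=> t _; rewrite /= lee_fin; apply: le_trans (ler_norm _).
    rewrite -exprMn -[f _ ^+ 2]real_normK ?num_real// lerXn2r ?nnegrE ?mulr_ge0 ?enorm_ge0 ?sumr_ge0//.
    apply: le_trans (ler_norm_sum _ _ _) _; rewrite mulr_suml; apply: ler_sum => i _.
    by rewrite normrM ler_wpM2l// coord_le_enorm.
  by rewrite -[LHS](fineK fn); congr EFin; exact: E.
have ae0 : {ae P, forall t, forall i, f (Z i t) = 0}.
  apply/ae_foralln => i.
  have fi : (\int[P]_t ((f (Z i t)) ^+ 2)%:E = 0)%E.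
    rewrite -f2; apply: (@law_eq _ _ _ _ _ _ mZ idZ i (fun z => ((f z) ^+ 2)%:E)).
      by apply/measurable_EFinP; exact: measurable_funX.
    by move=> z; rewrite lee_fin sqr_ge0.
  have mfi : measurable_fun setT (fun t => ((f (Z i t)) ^+ 2)%:E).
    by apply/measurable_EFinP; apply: measurable_funX; exact: (measurable_gZ mZ i mf).
  have := (ae_eq_integral_abs P measurableT mfi).1.
  under eq_integral => t _ do rewrite gee0_abs ?lee_fin ?sqr_ge0//.
  move=> /(_ fi); apply: filterS => t /(_ I) /= [/eqP]; by rewrite sqrf_eq0 => /eqP.
apply: filterS ae0 => t ht N; apply/eqP; rewrite eq_le vol_ge0 andbT -(vol_hyperplane a0).
have aZ i : Z i t *m a^T = 0.
  rewrite -[Z i t](subrK mu) mulmxDl amu addr0; apply/rowP => j; rewrite ord1 mxE [RHS]mxE -[RHS](ht i).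
  by apply: eq_bigr => k _; rewrite mulrC [a^T _ _]mxE.
apply: le_vol => _ [k [p [x [_ _ hx ->]]]] /=; rewrite mulmx_suml big1// => i _.
have [j _ ->] := hx i; by rewrite -scalemxAl /partial_sum mulmx_suml big1 ?scaler0.
Qed.

End LimsupVolume.

(** * The two bounds for the normalized volume *)

Section LimsupVolumeMain.
Variables (R : realType) (dT : measure_display) (T : measurableType dT) (P : probability T R).
Variables (d : nat) (Z : nat -> T -> 'rV[R]_d.+1).
Hypothesis mZ : forall i B, rv_borel B -> measurable (Z i @^-1` B).
Hypothesis indZ : forall (F : seq nat) (B : nat -> set 'rV[R]_d.+1), uniq F -> (forall i, rv_borel (B i)) ->
  P (\bigcap_(i in [set` F]) (Z i @^-1` B i)) = \big[*%E/1%E]_(i <- F) P (Z i @^-1` B i).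
Hypothesis idZ : forall i B, rv_borel B -> P (Z i @^-1` B) = P (Z 0%N @^-1` B).
Hypothesis fin2 : (\int[P]_t ((enorm (Z 0%N t)) ^+ 2)%:E < +oo)%E.
Local Notation mu := (mean P Z).
Local Notation Sg := (covariance_mx P Z).
Variable Q : 'M[R]_d.+1.
Hypotheses (mu0 : mu != 0) (QQ : Q *m Q^T = 1%:M) (Q0 : row ord0 Q = (enorm mu)^-1 *: mu).
Local Notation A := (reduced_cov Q Sg).

Lemma limsup_vol_degenerate (w : 'rV[R]_d) : w != 0 -> (w *m A *m w^T) ord0 ord0 = 0 ->
  {ae P, forall t, limn_esup (fun N => (vol (walk_hull (fun i => Z i t) N) * (lil_norm R d N)^-1%:E)%E)
     = (lambdaS R d * (enorm mu * Num.sqrt (\det A))%:E)%E}.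
Proof.
move=> w0 wA; have := degenerate_vol mZ idZ fin2 mu0 QQ Q0 w0 wA; apply: filterS => t ht.
have dA : \det A = 0.
  apply/eqP/det0P; exists w => //; apply: psd_isotropic wA; first exact: reduced_cov_sym.
  by move=> u; rewrite reduced_cov_form; exact: covariance_psd.
rewrite dA sqrtr0 mulr0 mule0.
by apply: limn_esup_eq => e e0; [apply: nearW => N|move=> K; exists K => //]; rewrite ht mul0e lee_fin; lra.
Qed.

Variable M : 'M[R]_(1 + d).
Hypotheses (uM : M \in unitmx) (muM : mu *m M = row_mx (const_mx 1) 0)
  (sM : forall w : 'rV_d, row_mx 0 w *m (M^T *m Sg *m M) *m (row_mx 0 w)^T = w *m w^T).

Let V (c : 'I_d) : 'rV[R]_d.+1 -> R := linear_stat P Z (M : 'M[R]_(d.+1, 1 + d)) (rshift 1 c).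
Let xi : 'rV[R]_d.+1 -> R := linear_stat P Z (M : 'M[R]_(d.+1, 1 + d)) (lshift d ord0).
Let h := stat_bound P Z (M : 'M[R]_(d.+1, 1 + d)).
Let mh := measurable_stat_bound P Z (M : 'M[R]_(d.+1, 1 + d)).
Let h0 := stat_bound_ge0 P Z (M : 'M[R]_(d.+1, 1 + d)).
Let ih2 := integrable_stat_bound2 mZ fin2 (M : 'M[R]_(d.+1, 1 + d)).

Lemma Ex_standard2 (w : 'I_d -> R) : \int[P]_t (fun t => (\sum_c w c * V c (Z 0%N t)) ^+ 2) t = \sum_c w c ^+ 2.
Proof.
pose w' (j : 'I_(1 + d)) : R := if fintype.split j is inr c then w c else 0.
have w'l : w' (lshift d ord0) = 0 by rewrite /w' (unsplitK (inl _)).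
have w'r c : w' (rshift 1 c) = w c by rewrite /w' (unsplitK (inr _)).
have := Ex_linear_stat2 mZ fin2 (M : 'M[R]_(d.+1, 1 + d)) w'.
have -> : \row_c w' c = row_mx 0 (\row_c w c).
  apply/rowP => j; rewrite mxE; case: (split_ordP j) => c ->; first by rewrite ord1 w'l row_mxEl mxE.
  by rewrite w'r row_mxEr mxE.
rewrite sM => E; transitivity (\int[P]_t (fun t => (\sum_c w' c * linear_stat P Z (M : 'M[R]_(d.+1, 1 + d)) c (Z 0%N t)) ^+ 2) t).
  apply: eq_Rintegral => t _; congr (_ ^+ 2); rewrite [RHS]big_split_ord /= big_ord1 w'l mul0r add0r.
  by apply: eq_bigr => c _; rewrite w'r.
by rewrite E mxE; apply: eq_bigr => c _; rewrite !mxE expr2.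
Qed.

Lemma standardized_walk t l : partial_sum (fun i => Z i t) l *m M =
  row_mx (const_mx (l%:R + \sum_(0 <= i < l) timestep Z xi t i)) (\sum_(0 <= i < l) spacestep Z V t i).
Proof.
have stepE (z : 'rV[R]_d.+1) : z *m M = row_mx (const_mx (1 + xi z)) (\row_c V c z).
  have E0 : (z - mu) *m M = row_mx (const_mx (xi z)) (\row_c V c z).
    apply/rowP => j; case: (split_ordP j) => c ->; last by rewrite row_mxEr [RHS]mxE.
    by rewrite row_mxEl [RHS]mxE ord1.
  rewrite -[z in LHS](subrK mu) mulmxDl muM E0 add_row_mx addr0; congr row_mx.
  by apply/rowP => j; rewrite !mxE addrC.
elim: l => [|l IH]; first last.
  rewrite /partial_sum big_ord_recr /= -/(partial_sum _ _) mulmxDl IH stepE add_row_mx !big_nat_recr//=.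
  by congr row_mx; apply/rowP => j; rewrite !mxE -natr1 /timestep; ring.
rewrite /partial_sum !big_ord0 !big_geq// mul0mx addr0; apply/rowP => j; rewrite !mxE.
by case: fintype.split => c; rewrite mxE.
Qed.

Let kappa0 : 0 <= `|\det M|^-1 :> R.
Proof. by rewrite invr_ge0. Qed.

Let kappa_le (k e : R) : 0 <= k -> 0 <= e -> k * (e / (k + 1)) <= e.
Proof.
move=> k0 e0; have k1 : 0 < k + 1 by lra.
by rewrite mulrCA; apply: ler_piMr => //; rewrite ler_pdivrMr// mul1r; lra.
Qed.

(** Hulls increase with time, so the volume at [N] is at most the volume at the next scale
    [m * b k.+1]; [eta] is chosen so that all factors close to 1 cost at most [e]. *)
Lemma limsup_vol_upper (e : R) : 0 < e -> {ae P, forall t, \forall N \near \oo,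
  (vol (walk_hull (fun i => Z i t) N) * (lil_norm R d N)^-1%:E <= (`|\det M|^-1 * fine (lambdaS R d) + e)%:E)%E}.
Proof.
move=> e0; set L := fine _; have LE : lambdaS R d = L%:E.
  by rewrite fineK// ge0_fin_numE ?lambda_lty// ltW// lambda_gt0.
have L0 : 0 <= L by rewrite -lee_fin -LE ltW// lambda_gt0.
have e1 : 0 < e / (`|\det M|^-1 + 1) by rewrite divr_gt0//; lra.
have [eta eta01 hpow] := pow_near1 (3 * d + 2) L0 e1; have /andP[eta0 eta1] := eta01.
have r1 : 1 < 1 + eta by lra.
have gb := geom_growing r1; set b := geom (1 + eta) in gb.
have [m m0] := std_upper mZ indZ idZ mh h0 ih2 (fun c => measurable_linear_stat P Z _ (rshift 1 c))
  (fun c => linear_stat_le P Z _ (rshift 1 c)) (fun c => Ex_linear_stat mZ fin2 _ (rshift 1 c)) Ex_standard2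
  (measurable_linear_stat P Z _ (lshift d ord0)) (linear_stat_le P Z _ (lshift d ord0))
  (Ex_linear_stat mZ fin2 _ (lshift d ord0)) gb eta01.
apply: filterS => t ht.
have [K _ hK] : \forall k \near \oo, _ /\ _ := filterI ht (lil_norm_upper d eta0 m0).
exists (m * b K)%N => // N /= KN.
have [k Kk /andP[kN Nk]] : exists2 k, (K <= k)%N & (m * b k <= N < m * b k.+1)%N.
  apply: (bracket (b := fun k => (m * b k)%N)) => //.
  have [K2 _ hK2] := pow_large (N%:R + 1) r1; exists (maxn K K2); first exact: leq_maxl.
  apply: leq_trans (leq_pmull _ m0); rewrite -(ltr_nat R).
  have /andP[_ g2] := geom_bounds (maxn K K2).+1 r1.
  have := hK2 (maxn K K2).+1 (leq_trans (leq_maxr _ _) (leqnSn _)); rewrite /b; lra.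
have [_ /(_ N kN)[a0 anorm]] := hK k Kk; have [vk _] := hK k.+1 (leq_trans Kk (leqnSn _)).
have bk : (0 < b k.+1)%N by exact: geom_gt0.
have s0 : 0 < (1 + eta) * Num.sqrt (2 * m%:R) * scale R b k.+1.
  apply: mulr_gt0; last exact: scale_gt0.
  by rewrite mulr_gt0 ?sqrtr_gt0 ?mulr_gt0 ?ltr0n//; lra.
have volN : (vol (walk_hull (fun i => Z i t) N) <= vol (walk_hull (fun i => Z i t) (m * b k.+1)))%E.
  by apply: le_vol; exact: walk_hull_nd (ltnW Nk).
rewrite lee_pdivrMr//; apply: le_trans volN _.
rewrite (vol_walkpt uM (standardized_walk t) m0 bk s0).
move: vk; rewrite LE -EFinD => vk.
set X := vol _ in vk *; apply: le_trans (_ : ((`|\det M|^-1 * ((1 + eta) ^+ (3 * d + 2) * lil_norm R d N))%:E * (L + eta)%:E <= _)%E).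
  apply: lee_pmul vk; [|exact: vol_ge0|].
    by rewrite lee_fin; apply: mulr_ge0 => //; apply: mulr_ge0 => //; rewrite exprn_ge0// ltW.
  by rewrite lee_fin; apply: ler_wpM2l.
rewrite -!EFinM lee_fin.
have -> : `|\det M|^-1 * ((1 + eta) ^+ (3 * d + 2) * lil_norm R d N) * (L + eta) =
  `|\det M|^-1 * ((1 + eta) ^+ (3 * d + 2) * (L + eta)) * lil_norm R d N by ring.
rewrite ler_pM2r//; apply: le_trans (ler_wpM2l kappa0 hpow) _; rewrite mulrDr lerD2l.
exact: kappa_le (ltW e0).
Qed.

Lemma limsup_vol_lower (e : R) : 0 < e -> {ae P, forall t, forall K, exists2 N, (K <= N)%N &
  ((`|\det M|^-1 * fine (lambdaS R d) - e)%:E <= vol (walk_hull (fun i => Z i t) N) * (lil_norm R d N)^-1%:E)%E}.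
Proof.
move=> e0; set L := fine _; have LE : lambdaS R d = L%:E.
  by rewrite fineK// ge0_fin_numE ?lambda_lty// ltW// lambda_gt0.
pose e1 := e / (`|\det M|^-1 + 1); have e10 : 0 < e1 by rewrite divr_gt0//; lra.
have low : `|\det M|^-1 * L - e <= `|\det M|^-1 * (L - e1).
  by rewrite mulrBr lerD2l lerN2; exact: kappa_le (ltW e0).
(* If [L - e1] is negative the claim is trivial; the other case multiplies inequalities by
   [L - e1]. *)
have [Ln|L0] := ltP (L - e1) 0.
  apply/nearW => t K; exists K => //; apply: (@le_trans _ _ 0%E).
    by rewrite lee_fin; apply: le_trans low _; rewrite mulr_ge0_le0// ltW.
  by apply: mule_ge0; [exact: vol_ge0|rewrite lee_fin invr_ge0 sqrtr_ge0].
have e3 : 0 < e1 / 3 by rewrite divr_gt0.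
have [eta eta01 hpow] := pow_near1 (2 * d) L0 e3; have /andP[eta0 eta1] := eta01.
have cL : ((L - e1 / 2)%:E < lambdaS R d)%E by rewrite LE lte_fin; lra.
have [m m1] := std_lower mZ indZ idZ mh h0 ih2 (fun c => measurable_linear_stat P Z _ (rshift 1 c))
  (fun c => linear_stat_le P Z _ (rshift 1 c)) (fun c => Ex_linear_stat mZ fin2 _ (rshift 1 c)) Ex_standard2
  (measurable_linear_stat P Z _ (lshift d ord0)) (linear_stat_le P Z _ (lshift d ord0))
  (Ex_linear_stat mZ fin2 _ (lshift d ord0)) cL eta01.
apply: filterS => t ht K; have [K1 _ hK1] := lil_norm_lower d eta0 m1.
have [k kK vk] := ht (maxn K K1); have [a0 anorm] := hK1 k (leq_trans (leq_maxr _ _) kK).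
have m0 : (0 < m)%N by exact: ltnW.
exists (m * m ^ k)%N.
  rewrite -expnS ltnW// (leq_ltn_trans (leq_trans (leq_maxl _ _) kK))//.
  by rewrite (leq_trans _ (ltn_expl _ m1)).
have bk : (0 < m ^ k)%N by rewrite expn_gt0 m0.
have s0 : 0 < (1 + eta)^-1 * Num.sqrt (2 * m%:R) * scale R (expn m) k.
  apply: mulr_gt0; last by apply: scale_gt0; exact: expn_growing.
  by rewrite mulr_gt0 ?sqrtr_gt0 ?mulr_gt0 ?ltr0n ?invr_gt0//; lra.
rewrite lee_pdivlMr// (vol_walkpt uM (standardized_walk t) m0 bk s0).
set X := vol _ in vk *.
have e2 : 0 < (1 + eta) ^+ (2 * d) by rewrite exprn_gt0//; lra.
have vk2 : (((1 + eta) ^+ (2 * d) * (L - e1))%:E <= X)%E.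
  apply: le_trans (_ : ((L - e1 / 2 - eta)%:E <= _)%E); last by rewrite EFinB leeBlDr.
  rewrite lee_fin; move: hpow; rewrite mulrDr.
  have : eta <= (1 + eta) ^+ (2 * d) * eta by rewrite ler_peMl ?(ltW eta0)// exprn_ege1//; lra.
  lra.
apply: le_trans (_ : ((`|\det M|^-1 * ((m * m ^ k)%:R * ((1 + eta)^-1 * Num.sqrt (2 * m%:R) * scale R (expn m) k) ^+ d))%:E *
   ((1 + eta) ^+ (2 * d) * (L - e1))%:E <= _)%E); last first.
  by apply: lee_wpmul2l => //; rewrite lee_fin mulr_ge0// mulr_ge0// exprn_ge0// ltW.
rewrite -!EFinM lee_fin; apply: le_trans (_ : `|\det M|^-1 * (L - e1) * lil_norm R d (m * m ^ k) <= _).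
  by rewrite ler_pM2r.
set Y := (m * m ^ k)%:R * _ in anorm *.
have -> : `|\det M|^-1 * Y * ((1 + eta) ^+ (2 * d) * (L - e1)) = `|\det M|^-1 * (L - e1) * ((1 + eta) ^+ (2 * d) * Y) by ring.
by apply: ler_wpM2l => //; exact: mulr_ge0.
Qed.

End LimsupVolumeMain.

Section LimsupVol.
Variables (R : realType) (dT : measure_display) (T : measurableType dT) (P : probability T R).
Variables (d : nat) (Z : nat -> T -> 'rV[R]_d.+1).
Hypothesis mZ : forall i B, rv_borel B -> measurable (Z i @^-1` B).
Hypothesis indZ : forall (F : seq nat) (B : nat -> set 'rV[R]_d.+1), uniq F -> (forall i, rv_borel (B i)) ->
  P (\bigcap_(i in [set` F]) (Z i @^-1` B i)) = \big[*%E/1%E]_(i <- F) P (Z i @^-1` B i).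
Hypothesis idZ : forall i B, rv_borel B -> P (Z i @^-1` B) = P (Z 0%N @^-1` B).
Hypothesis fin2 : (\int[P]_t ((enorm (Z 0%N t)) ^+ 2)%:E < +oo)%E.
Local Notation mu := (mean P Z).
Local Notation Sg := (covariance_mx P Z).

(** Either some direction orthogonal to the drift has variance 0, and both sides vanish, or the
    reduced covariance is positive definite and can be whitened. *)
Lemma limsup_vol (Q : 'M[R]_d.+1) : mu != 0 -> Q *m Q^T = 1%:M -> row ord0 Q = (enorm mu)^-1 *: mu ->
  {ae P, forall t, limn_esup (fun N => (vol (walk_hull (fun i => Z i t) N) * (lil_norm R d N)^-1%:E)%E)
     = (lambdaS R d * (enorm mu * Num.sqrt (\det (reduced_cov Q Sg)))%:E)%E}.
Proof.
move=> mu0 QQ Q0; set A := reduced_cov Q Sg.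
have [[w [w0 wA]]|nd] := pselect (exists w : 'rV[R]_d, w != 0 /\ (w *m A *m w^T) ord0 ord0 = 0).
  exact: limsup_vol_degenerate w0 wA.
have pA (w : 'rV[R]_d) : w != 0 -> 0 < (w *m A *m w^T) 0 0.
  move=> w0; rewrite lt0r; apply/andP; split.
    by apply/negP => /eqP wA; apply: nd; exists w.
  by rewrite reduced_cov_form; exact: covariance_psd.
have [W WA] := whitening (reduced_cov_sym P Z Q) pA.
have [M [uM dM muM sM]] := standardizing_mx mu0 QQ Q0 WA.
have LE : lambdaS R d = (fine (lambdaS R d))%:E.
  by rewrite fineK// ge0_fin_numE ?lambda_lty// ltW// lambda_gt0.
have inv_gt0 (j : nat) : 0 < j.+1%:R^-1 :> R by [].
have small (e : R) : 0 < e -> exists j : nat, j.+1%:R^-1 <= e.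
  move=> e0; exists (Num.trunc e^-1); have x0 : 0 <= e^-1 by rewrite invr_ge0 ltW.
  have /andP[_ /ltW h] := truncn_itv x0; by rewrite -[X in _ <= X]invrK lef_pV2 ?posrE ?invr_gt0.
(* The margins [1 / j.+1] make the exceptional sets countably many. *)
have up : {ae P, forall t, forall j : nat, \forall N \near \oo,
  (vol (walk_hull (fun i => Z i t) N) * (lil_norm R d N)^-1%:E <= (`|\det M|^-1 * fine (lambdaS R d) + j.+1%:R^-1)%:E)%E}.
  by apply/ae_foralln => j; exact: (limsup_vol_upper mZ indZ idZ fin2 uM muM sM (inv_gt0 j)).
have lo : {ae P, forall t, forall j : nat, forall K, exists2 N, (K <= N)%N &
  ((`|\det M|^-1 * fine (lambdaS R d) - j.+1%:R^-1)%:E <= vol (walk_hull (fun i => Z i t) N) * (lil_norm R d N)^-1%:E)%E}.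
  by apply/ae_foralln => j; exact: (limsup_vol_lower mZ indZ idZ fin2 uM muM sM (inv_gt0 j)).
rewrite LE -EFinM mulrC -dM; apply: (ae_and up lo) => t hu hl.
apply: limn_esup_eq => e e0; have [j je] := small e e0.
  by apply: filterS (hu j) => N h; apply: le_trans h _; rewrite lee_fin lerD2l.
move=> K; have [N KN h] := hl j K; exists N => //; apply: le_trans h.
by rewrite lee_fin lerD2l lerN2.
Qed.

End LimsupVol.

(* Ambient dimension is d.+1 (so paper's d = d.+1 >= 1). *)
Theorem theorem1p3 (R : realType) (dT : measure_display) (T : measurableType dT)
  (P : probability T R) (d : nat) (Z : nat -> T -> 'rV[R]_d.+1) :
  (forall i B, rv_borel B -> measurable (Z i @^-1` B)) ->
  (forall (F : seq nat) (B : nat -> set 'rV[R]_d.+1), uniq F ->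
     (forall i, rv_borel (B i)) ->
     P (\bigcap_(i in [set` F]) (Z i @^-1` B i)) =
     \big[*%E/1%E]_(i <- F) P (Z i @^-1` B i)) ->
  (forall i B, rv_borel B -> P (Z i @^-1` B) = P (Z 0%N @^-1` B)) ->
  (\int[P]_t ((enorm (Z 0%N t)) ^+ 2)%:E < +oo)%E ->
  let mu : 'rV[R]_d.+1 := \row_j fine (\int[P]_t (Z 0%N t ord0 j)%:E) in
  let Sigma : 'M[R]_d.+1 := \matrix_(j, k)
      fine (\int[P]_t ((Z 0%N t ord0 j - mu ord0 j) * (Z 0%N t ord0 k - mu ord0 k))%:E) in
  mu != 0 ->
  [/\ (1 <= d)%N ->
        (0 < lambdaS R d < +oo)%E /\
        (forall Q : 'M[R]_d.+1, Q *m Q^T = 1%:M -> row ord0 Q = (enorm mu)^-1 *: mu ->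
          {ae P, forall t,
            limn_esup (fun n : nat =>
              (vol (walk_hull (fun i => Z i t) n) *
               ((Num.sqrt (2 ^+ d * n%:R ^+ d.+2 * (ln (ln n%:R)) ^+ d))^-1)%:E)%E)
            = (lambdaS R d * (enorm mu * Num.sqrt (\det (reduced_cov Q Sigma)))%:E)%E}),
      lambdaS R 1 = (Num.sqrt 3 / 6)%:E &
      {ae P, forall t,
         limn_esup (fun n : nat =>
           (ivol 1 (walk_hull (fun i => Z i t) n) / n%:R)%:E) = (enorm mu)%:E}].
Proof.
move=> mZ indZ idZ fin2 mu Sigma mu0; split.
- move=> _; split; first by rewrite lambda_gt0 lambda_lty.
  by move=> Q QQ Q0; exact: (limsup_vol mZ indZ idZ fin2).
- exact: lambdaS1.
- exact: (limsup_ivol1 mZ indZ idZ fin2).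
Qed.
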